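(* Assume the setting and hypotheses described in the context. Then $$\big|\langle\mathbf v,G(z)\mathbf w\rangle-\langle\mathbf v,\mathbf w\rangle m(z)\big|\prec\sqrt{\frac{\operatorname{Im}m(z)}{N\eta}}+\frac1{N\eta}$$ uniformly in $z\in\mathbf S_W$ and in all deterministic unit vectors $\mathbf v,\mathbf w\in\mathbb C^N$.
   Context: Let $H=H^*$ be a random $N\times N$ Hermitian matrix whose entries $H_{ij}$, $i\le j$, are independent complex random variables with $\mathbb E H_{ij}=0$, whose variances $S_{ij}=\mathbb E|H_{ij}|^2$ satisfy $C^{-1}\le NS_{ij}\le C$ and $\sum_jS_{ij}=1$ for all $i$ (for a constant $C>0$), and such that for every $p\in\mathbb N$ there is a constant $C_p$ with $\mathbb E|\sqrt N H_{ij}|^p\le C_p$ for all $N,i,j$. Let $m(z)=\frac{-z+\sqrt{z^2-4}}2$ be the Stieltjes transform of the semicircle law $\varrho(\mathrm dx)=\frac1{2\pi}\sqrt{(4-x^2)_+}\,\mathrm dx$ (branch chosen so that $m$ is holomorphic in the upper half-plane and $m(z)\to0$ as $z\to\infty$). For $z=E+\mathrm i\eta$, $\eta>0$, let $G(z)=(H-z)^{-1}$. Fix $\omega\in(0,1)$ and let $\mathbf S_W=\{z=E+\mathrm i\eta:|E|\le\omega^{-1},\ N^{-1+\omega}\le\eta\le\omega^{-1}\}$. Stochastic domination: for families of nonnegative random variables $\xi=(\xi^{(N)}(u))$, $\zeta=(\zeta^{(N)}(u))$, we write $\xi\prec\zeta$ (uniformly in $u$) if for every $\varepsilon>0$, $D>0$,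 $\sup_u\mathbb P[\xi^{(N)}(u)>N^\varepsilon\zeta^{(N)}(u)]\le N^{-D}$ for $N\ge N_0(\varepsilon,D)$, with $N_0$ depending only on the constants in the hypotheses. *)

(* Defs.v *)
From mathcomp Require Import all_boot all_order all_algebra.
From mathcomp Require Import all_classical all_reals all_analysis.
Import Order.TTheory GRing.Theory Num.Theory.
From mathcomp Require Export complex.

Set Implicit Arguments.
Unset Strict Implicit.
Unset Printing Implicit Defensive.

Local Open Scope ring_scope.
Local Open Scope classical_set_scope.

Section IsotropicLaw.
Context {R : realType}.

Definition cabs (x : R[i]) : R := Normc.normc x.

Definition sc_density (x : R) : R :=
  (2 * pi)^-1 * Num.sqrt (Num.max (4 - x ^+ 2) 0).

(* Stieltjes transform of the semicircle law,
   m(z) = \int rho(dx) / (x - z), written via its real and imaginary parts: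
   1/(x - z) = ((x - E) + i eta) / ((x - E)^2 + eta^2), z = E + i eta. *)
Definition msc (z : R[i]) : R[i] :=
  let E := complex.Re z in
  let eta := complex.Im z in
  Complex
    (Rintegral (@lebesgue_measure R) setT
       (fun x => sc_density x * (x - E) / ((x - E) ^+ 2 + eta ^+ 2)))
    (Rintegral (@lebesgue_measure R) setT
       (fun x => sc_density x * eta / ((x - E) ^+ 2 + eta ^+ 2))).

Definition green (N : nat) (H : 'M[R[i]]_N) (z : R[i]) : 'M[R[i]]_N :=
  invmx (H - z%:M).

Definition cdot (N : nat) (v w : 'cV[R[i]]_N) : R[i] :=
  \sum_(i < N) (v i 0)^*%C * w i 0.

Definition unit_vector (N : nat) (v : 'cV[R[i]]_N) : Prop :=
  \sum_(i < N) cabs (v i 0) ^+ 2 = 1.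

Definition in_SW (omega : R) (N : nat) (z : R[i]) : Prop :=
  `|complex.Re z| <= omega^-1 /\
  (N%:R `^ (-1 + omega) <= complex.Im z) /\ complex.Im z <= omega^-1.

Definition Psi (N : nat) (z : R[i]) : R :=
  Num.sqrt (complex.Im (msc z) / (N%:R * complex.Im z)) + (N%:R * complex.Im z)^-1.

Definition entry2 (N : nat) {d} {T : measurableType d}
  (H : T -> 'M[R[i]]_N) (i j : 'I_N) : T -> R * R :=
  fun w => (complex.Re (H w i j), complex.Im (H w i j)).

Definition wigner_type (C : R) (Cp : nat -> R) (N : nat) {d}
  {T : measurableType d} (P : probability T R) (H : T -> 'M[R[i]]_N) : Prop :=
      (forall w i j, H w j i = (H w i j)^*%C) /\
      (forall i j, measurable_fun setT (fun w => complex.Re (H w i j)) /\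
                   measurable_fun setT (fun w => complex.Im (H w i j))) /\
      (forall (S : {set 'I_N * 'I_N}) (B : 'I_N -> 'I_N -> set (R * R)),
          (forall i j, measurable (B i j)) ->
          (forall ij, ij \in S -> (ij.1 <= ij.2)%N) ->
          P (\bigcap_(ij in [set ij | ij \in S])
               (entry2 H ij.1 ij.2 @^-1` B ij.1 ij.2))
          = (\prod_(ij in S) P (entry2 H ij.1 ij.2 @^-1` B ij.1 ij.2))%E) /\
      (forall i j, (\int[P]_w (complex.Re (H w i j))%:E = 0)%E /\
                   (\int[P]_w (complex.Im (H w i j))%:E = 0)%E) /\
      ((forall i j, (C^-1)%:E <= (N%:R)%:E * \int[P]_w ((cabs (H w i j)) ^+ 2)%:E
                   <= C%:E)%E) /\
      (forall i, (\sum_(j < N) \int[P]_w ((cabs (H w i j)) ^+ 2)%:E = 1)%E) /\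
      (forall (p : nat) i j,
          (\int[P]_w ((Num.sqrt N%:R * cabs (H w i j)) ^+ p)%:E <= (Cp p)%:E)%E).

End IsotropicLaw.

(* Main.v *)
From HB Require Import structures.
Require Import Defs.
From mathcomp Require Import all_boot all_order all_algebra.
From mathcomp Require Import all_classical all_reals all_analysis.
From mathcomp Require Import measurable_realfun.
From mathcomp Require Import ring lra.
From mathcomp Require Import complex.
Import Order.TTheory GRing.Theory Num.Theory.
Set Implicit Arguments.
Unset Strict Implicit.
Unset Printing Implicit Defensive.
Local Open Scope ring_scope.
Local Open Scope classical_set_scope.

(* For a quantity Q = sum_ij c_ij H_ij + q with c_ij and q functions of H, expanding the cofactor
   of one entry H_ij in E |Q|^(2p) to second order around H_ij = 0 replaces H_ij by its (co)variances
   times derivatives, which cancel q up to small errors. Young's inequality then bounds Q by any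
   deterministic control of these errors, with very high probability. Let G = (H - z)^-1,
   u = tr G / N and rho = 1 / (N Im z). The method is applied to 1 + z G_aa + (SG)_a G_aa, with
   (SG)_a = sum_k S_ak G_kk, to 1 + z u + u^2, where the fluctuations average, and to
   G_vw - m <v,w>; the Ward identity makes the errors small in terms of Im G / (N Im z).
   The spectral gap of S, which comes from the lower bound on its entries, turns the first estimate
   into G_aa = u up to small errors; since m^2 + z m + 1 = 0, the second one becomes
   |u - m| |u - m + 2 m + z| <= delta, and the small factor is identified by following the vertical
   segment from z to Im z of order one.
   A weak law is propagated to smaller Im z using the monotonicity of Im z * Im G_vv. Then an
   error sqrt(Im m rho) + r in the law for G_vw improves to sqrt(Im m rho) + sqrt(r rho),
   and the iteration from r = 1 converges to r = rho. *)

(** * Resolvents of Hermitian matrices *)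

(** The expansion involves only the variances [Sv] and the pseudo-variances [Tv]; third order is an
    error of size N^(-3/2) per entry. Summed over N^2 entries this is too large by itself, and Ward
    sums supply the missing factors. For general v and w, summing the covariances against v creates
    new test vectors, so each bound on G is needed for a family of vectors growing with N; a union
    bound supplies it. These bounds hold only with high probability: off that event polynomial
    bounds such as |G| <= N and the fourth moments of the entries suffice.

    Near the spectral edges 2 m + z is small and the equation for u loses stability. The
    compensation is that the derivative of 1 + z u + u^2 carries the factor z + 2 u, so delta is
    proportional to |2 m + z| + r, and dividing by |2 m + z| loses nothing: |u - m| is at most
    sqrt(r rho) up to small powers of N, also where both roots are close.

    Constants are rarely tracked: [K] is a small power of N that exceeds them, and every loss is a
    fixed power of [K]. *)

Section ComplexModulus.
Context {R : realType}.
Implicit Types (x y z : R[i]) (a b : R).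

Lemma cabs_ge0 x : 0 <= cabs x.
Proof. by case: x => a b; rewrite /cabs /= sqrtr_ge0. Qed.

Lemma cabs0 : cabs (0 : R[i]) = 0.
Proof. exact: Normc.normc0. Qed.

Lemma cabs1 : cabs (1 : R[i]) = 1.
Proof. exact: Normc.normc1. Qed.

Lemma cabsM x y : cabs (x * y) = cabs x * cabs y.
Proof. exact: Normc.normcM. Qed.

Lemma cabsN x : cabs (- x) = cabs x.
Proof. exact: normcN. Qed.

Lemma ler_cabsD x y : cabs (x + y) <= cabs x + cabs y.
Proof. exact: le_normcD. Qed.

Lemma ler_cabsB x y : cabs (x - y) <= cabs x + cabs y.
Proof. by rewrite -(cabsN y); exact: ler_cabsD. Qed.

Lemma cabsBC x y : cabs (x - y) = cabs (y - x).
Proof. by rewrite -cabsN opprB. Qed.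

Lemma cabs_eq0 x : cabs x = 0 -> x = 0.
Proof. exact: Normc.eq0_normc. Qed.

Lemma cabs_gt0 x : x != 0 -> 0 < cabs x.
Proof.
move=> x0; rewrite lt_def cabs_ge0 andbT.
by apply: contra x0 => /eqP/cabs_eq0 ->.
Qed.

Lemma cabsX x n : cabs (x ^+ n) = cabs x ^+ n.
Proof. by elim: n => [|n IH]; rewrite ?expr0 ?cabs1 // !exprS cabsM IH. Qed.

Lemma cabsJ x : cabs (x^*)%C = cabs x.
Proof. by case: x => a b; rewrite /cabs /= sqrrN. Qed.

Lemma cabs_sqr x : cabs x ^+ 2 = complex.Re x ^+ 2 + complex.Im x ^+ 2.
Proof. by case: x => a b; rewrite /cabs /= sqr_sqrtr // addr_ge0 ?sqr_ge0. Qed.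

Lemma cabs_real a : cabs (a%:C)%C = `|a|.
Proof. by rewrite /cabs /= expr0n /= addr0 sqrtr_sqr. Qed.

Lemma cabs_nat n : cabs (n%:R : R[i]) = n%:R.
Proof.
have -> : (n%:R : R[i]) = (n%:R)%:C%C by rewrite rmorph_nat.
by rewrite cabs_real ger0_norm.
Qed.

Lemma Re_le_cabs x : `|complex.Re x| <= cabs x.
Proof.
rewrite -(@ler_pXn2r _ 2) ?nnegrE ?cabs_ge0 // cabs_sqr real_normK ?num_real //.
by rewrite lerDl sqr_ge0.
Qed.

Lemma Im_le_cabs x : `|complex.Im x| <= cabs x.
Proof.
rewrite -(@ler_pXn2r _ 2) ?nnegrE ?cabs_ge0 // cabs_sqr real_normK ?num_real //.
by rewrite lerDr sqr_ge0.
Qed.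

Lemma cabs_le_ReIm x : cabs x <= `|complex.Re x| + `|complex.Im x|.
Proof.
rewrite -(@ler_pXn2r _ 2) ?nnegrE ?cabs_ge0 ?addr_ge0 // cabs_sqr.
rewrite sqrrD !real_normK ?num_real //.
by have := mulr_ge0 (normr_ge0 (complex.Re x)) (normr_ge0 (complex.Im x)); lra.
Qed.

Lemma cabs_sum (I : Type) (r : seq I) (P : pred I) (F : I -> R[i]) :
  cabs (\sum_(i <- r | P i) F i) <= \sum_(i <- r | P i) cabs (F i).
Proof.
elim/big_ind2 : _ => [|x1 x2 y1 y2 h1 h2|//]; first by rewrite cabs0.
by apply: (le_trans (ler_cabsD _ _)); exact: lerD.
Qed.

Lemma cabs_conjM x : (x^*)%C * x = (cabs x ^+ 2)%:C%C.
Proof.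
rewrite cabs_sqr; case: x => a b; apply/eqP; rewrite eq_complex /=.
by apply/andP; split; apply/eqP; ring.
Qed.

Lemma cReD x y : complex.Re (x + y) = complex.Re x + complex.Re y.
Proof. by case: x => a b; case: y. Qed.
Lemma cImD x y : complex.Im (x + y) = complex.Im x + complex.Im y.
Proof. by case: x => a b; case: y. Qed.
Lemma cReN x : complex.Re (- x) = - complex.Re x.
Proof. by case: x. Qed.
Lemma cImN x : complex.Im (- x) = - complex.Im x.
Proof. by case: x. Qed.
Lemma cReM x y : complex.Re (x * y) =
  complex.Re x * complex.Re y - complex.Im x * complex.Im y.
Proof. by case: x => a b; case: y. Qed.
Lemma cImM x y : complex.Im (x * y) =
  complex.Re x * complex.Im y + complex.Im x * complex.Re y.
Proof. by case: x => a b; case: y. Qed.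
Lemma cReJ x : complex.Re (x^*)%C = complex.Re x.
Proof. by case: x. Qed.
Lemma cImJ x : complex.Im (x^*)%C = - complex.Im x.
Proof. by case: x. Qed.

Lemma conjc_sum (I : Type) (r : seq I) (P : pred I) (F : I -> R[i]) :
  ((\sum_(i <- r | P i) F i)^*)%C = \sum_(i <- r | P i) ((F i)^*)%C.
Proof. exact: (rmorph_sum conjc). Qed.

Lemma conjcM x y : ((x * y)^*)%C = (x^*)%C * (y^*)%C.
Proof. exact: (rmorphM conjc). Qed.
Lemma conjcD x y : ((x + y)^*)%C = (x^*)%C + (y^*)%C.
Proof. exact: (rmorphD conjc). Qed.
Lemma conjcN x : ((- x)^*)%C = - (x^*)%C.
Proof. exact: (rmorphN conjc). Qed.
Lemma complex_eq x y : complex.Re x = complex.Re y ->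
  complex.Im x = complex.Im y -> x = y.
Proof. by case: x => a b; case: y => c d /= -> ->. Qed.

End ComplexModulus.

#[global] Arguments cabs {R} x : simpl never.

Section RealSums.
Context {R : realType}.

Lemma cauchy_schwarz_sum (I : finType) (a b : I -> R) :
  (\sum_i a i * b i) ^+ 2 <= (\sum_i a i ^+ 2) * (\sum_i b i ^+ 2).
Proof.
set A := \sum_i a i ^+ 2; set B := \sum_i b i ^+ 2; set D := \sum_i _ * _.
have B0 : 0 <= B by apply: sumr_ge0 => i _; exact: sqr_ge0.
have A0 : 0 <= A by apply: sumr_ge0 => i _; exact: sqr_ge0.
have key t : 0 <= A - 2 * t * D + t ^+ 2 * B.
  have -> : A - 2 * t * D + t ^+ 2 * B = \sum_i (a i - t * b i) ^+ 2.
    rewrite /A /B /D !mulr_sumr -sumrB -big_split /=.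
    by apply: eq_bigr => i _; ring.
  by apply: sumr_ge0 => i _; exact: sqr_ge0.
have [B00|Bn0] := eqVneq B 0.
  have D0 : D = 0.
    rewrite /D big1 // => i _; have : b i ^+ 2 = 0.
      exact: (psumr_eq0P (fun i _ => sqr_ge0 (b i)) B00).
    by move/eqP; rewrite sqrf_eq0 => /eqP ->; rewrite mulr0.
  by rewrite D0 expr0n /= mulr_ge0.
have Bp : 0 < B by rewrite lt_def Bn0.
have := key (D / B).
have -> : A - 2 * (D / B) * D + (D / B) ^+ 2 * B = (A * B - D ^+ 2) / B by field.
by rewrite pmulr_lge0 ?invr_gt0 // subr_ge0.
Qed.

Lemma cauchy_schwarz (I : finType) (a b : I -> R) (A B : R) :
  0 <= A -> 0 <= B ->
  \sum_i a i ^+ 2 <= A ^+ 2 -> \sum_i b i ^+ 2 <= B ^+ 2 ->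
  \sum_i a i * b i <= A * B.
Proof.
move=> A0 B0 hA hB; apply: (le_trans (ler_norm _)).
rewrite -(@ler_pXn2r _ 2) ?nnegrE ?mulr_ge0 // real_normK ?num_real // exprMn.
apply: (le_trans (cauchy_schwarz_sum _ _)); apply: ler_pM => //.
- by apply: sumr_ge0 => i _; exact: sqr_ge0.
- by apply: sumr_ge0 => i _; exact: sqr_ge0.
Qed.

Lemma sum_le_card (I : finType) (F : I -> R) (B : R) :
  (forall i, F i <= B) -> \sum_i F i <= #|I|%:R * B.
Proof.
move=> h; apply: (le_trans (ler_sum _ (fun i _ => h i))).
have -> : \sum_(i : I) B = B *+ #|I|.
  by rewrite -sumr_const; apply: eq_bigl => i; rewrite inE.
by rewrite mulr_natl.
Qed.

Lemma le_sum_term (I : finType) (F : I -> R) (i : I) :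
  (forall j, 0 <= F j) -> F i <= \sum_j F j.
Proof. by move=> h; rewrite (bigD1 i) //= lerDl sumr_ge0. Qed.

End RealSums.

Section Resolvent.
Context {R : realType} {N : nat}.
Local Notation C := R[i].
Implicit Types (X : 'M[C]_N) (z : C) (u v w : 'cV[C]_N).

Definition hermx X := forall i j, X j i = ((X i j)^*)%C.

Definition nsq v : R := \sum_i cabs (v i 0) ^+ 2.

Definition ev (i : 'I_N) : 'cV[C]_N := delta_mx i 0.

(** The lock keeps unification and simplification from unfolding the form into matrix sums; [GqE]
    opens it on demand. *)
Fact Gq_key : unit. Proof. by []. Qed.
Definition Gq X z v w : C := locked_with Gq_key (cdot v (green X z *m w)).

Lemma GqE X z v w : Gq X z v w = cdot v (green X z *m w).
Proof. by rewrite /Gq unlock. Qed.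

Lemma nsq_ge0 v : 0 <= nsq v.
Proof. by apply: sumr_ge0 => i _; exact: sqr_ge0. Qed.

Lemma nsq_ev i : nsq (ev i) = 1.
Proof.
rewrite /nsq (bigD1 i) //= big1 => [|j ji]; last first.
  by rewrite mxE (negbTE ji) cabs0 expr0n.
by rewrite mxE !eqxx cabs1 addr0 expr1n.
Qed.

Lemma nsq0 v : nsq v = 0 -> v = 0.
Proof.
move=> h; apply/matrixP => i j; rewrite ord1 mxE.
have := psumr_eq0P (fun i _ => sqr_ge0 (cabs (v i 0))) h.
by move=> /(_ i isT)/eqP; rewrite sqrf_eq0 => /eqP/cabs_eq0.
Qed.

Lemma cdotDr u v w : cdot u (v + w) = cdot u v + cdot u w.
Proof. by rewrite /cdot -big_split; apply: eq_bigr => i _; rewrite mxE mulrDr. Qed.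
Lemma cdotZr u a w : cdot u (a *: w) = a * cdot u w.
Proof. by rewrite /cdot mulr_sumr; apply: eq_bigr => i _; rewrite mxE mulrCA. Qed.
Lemma cdotBr u v w : cdot u (v - w) = cdot u v - cdot u w.
Proof. by rewrite cdotDr -scaleN1r cdotZr mulN1r. Qed.
Lemma cdotC v w : cdot v w = ((cdot w v)^*)%C.
Proof.
rewrite /cdot conjc_sum; apply: eq_bigr => i _.
by rewrite conjcM conjcK mulrC.
Qed.
Lemma cdotDl u v w : cdot (u + v) w = cdot u w + cdot v w.
Proof. by rewrite cdotC cdotDr conjcD -!cdotC. Qed.
Lemma cdotZl a u w : cdot (a *: u) w = (a^*)%C * cdot u w.
Proof. by rewrite cdotC cdotZr conjcM -cdotC. Qed.
Lemma cdot0r u : cdot u 0 = 0.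
Proof. by rewrite /cdot big1 // => i _; rewrite mxE mulr0. Qed.

Lemma cdot_sumr (I : finType) u (F : I -> 'cV[C]_N) :
  cdot u (\sum_i F i) = \sum_i cdot u (F i).
Proof.
elim/big_rec2 : _ => [|i y1 y2 _ <-]; first exact: cdot0r.
by rewrite cdotDr.
Qed.

Lemma cdot_evl i w : cdot (ev i) w = w i 0.
Proof.
rewrite /cdot (bigD1 i) //= big1 => [|j ji]; last first.
  by rewrite mxE (negbTE ji) conjc0 mul0r.
by rewrite mxE !eqxx conjc1 mul1r addr0.
Qed.

Lemma cdot_nsq v : cdot v v = (nsq v)%:C%C.
Proof.
rewrite /cdot /nsq (rmorph_sum (real_complex R)); apply: eq_bigr => i _.
exact: cabs_conjM.
Qed.

Lemma vec_sum_ev v : v = \sum_i v i 0 *: ev i.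
Proof.
apply/matrixP => k l; rewrite ord1 summxE (bigD1 k) //= big1 => [|j jk].
  by rewrite !mxE !eqxx mulr1 addr0.
by rewrite !mxE eq_sym (negbTE jk) mulr0.
Qed.

Lemma nsq_sqrt v : Num.sqrt (nsq v) ^+ 2 = nsq v.
Proof. by rewrite sqr_sqrtr ?nsq_ge0. Qed.

Lemma cdot_le v w : cabs (cdot v w) <= Num.sqrt (nsq v) * Num.sqrt (nsq w).
Proof.
apply: (le_trans (cabs_sum _ _ _)).
under eq_bigr => i _ do rewrite cabsM cabsJ.
by apply: cauchy_schwarz; rewrite ?sqrtr_ge0 // nsq_sqrt.
Qed.

Lemma nsqZ a v : nsq (a *: v) = cabs a ^+ 2 * nsq v.
Proof.
by rewrite /nsq mulr_sumr; apply: eq_bigr => i _; rewrite mxE cabsM exprMn.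
Qed.

Lemma sqrt_nsqD v w :
  Num.sqrt (nsq (v + w)) <= Num.sqrt (nsq v) + Num.sqrt (nsq w).
Proof.
rewrite -(@ler_pXn2r _ 2) ?nnegrE ?addr_ge0 ?sqrtr_ge0 // nsq_sqrt sqrrD !nsq_sqrt.
have -> : nsq (v + w) = nsq v + 2 * complex.Re (cdot v w) + nsq w.
  apply: complexI; rewrite -cdot_nsq cdotDl !cdotDr !cdot_nsq (cdotC w v).
  by apply: complex_eq; rewrite !(cReD,cImD,cReJ,cImJ) /=; lra.
have h := le_trans (ler_norm _) (le_trans (Re_le_cabs (cdot v w)) (cdot_le v w)).
by rewrite lerD2r lerD2l mulr2n; lra.
Qed.

Lemma cdot_herm X u w : hermx X -> cdot u (X *m w) = cdot (X *m u) w.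
Proof.
move=> hX; rewrite /cdot.
under eq_bigr => i _ do rewrite mxE mulr_sumr.
under [RHS]eq_bigr => i _ do rewrite mxE conjc_sum mulr_suml.
rewrite exchange_big; apply: eq_bigr => i _; apply: eq_bigr => j _.
by rewrite conjcM -hX mulrA (mulrC _ (X j i)).
Qed.

(** A kernel vector satisfies X w = z w; since [cdot w (X *m w)] is real, the imaginary part of z
    |w|^2 vanishes. *)
Lemma herm_shift_inj X z w : hermx X -> complex.Im z != 0 ->
  (X - z%:M) *m w = 0 -> w = 0.
Proof.
move=> hX z0; rewrite mulmxBl mul_scalar_mx => /eqP; rewrite subr_eq0 => /eqP h.
have h1 : cdot w (X *m w) = ((cdot w (X *m w))^*)%C.
  by rewrite -cdotC cdot_herm.
rewrite h cdotZr cdot_nsq in h1; apply: nsq0.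
have h2 : complex.Im z * nsq w = 0.
  by move: h1 => /(congr1 (@complex.Im R)); rewrite cImJ cImM /=; lra.
by move/eqP: h2; rewrite mulf_eq0 (negbTE z0) => /eqP.
Qed.

Lemma herm_shift_unit X z : hermx X -> complex.Im z != 0 ->
  (X - z%:M) \in unitmx.
Proof.
move=> hX z0; rewrite -unitmx_tr unitmxE unitfE; apply/negP => /det0P [v v0 hv].
move: v0; apply/negP; rewrite negbK -trmx_eq0; apply/eqP.
apply: (herm_shift_inj hX z0).
by rewrite -[RHS]trmx0 -hv trmx_mul trmxK.
Qed.

Lemma green_mulr X z : hermx X -> complex.Im z != 0 ->
  (X - z%:M) *m green X z = 1%:M.
Proof. by move=> hX z0; rewrite mulmxV // herm_shift_unit. Qed.

Lemma green_mull X z : hermx X -> complex.Im z != 0 ->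
  green X z *m (X - z%:M) = 1%:M.
Proof. by move=> hX z0; rewrite mulVmx // herm_shift_unit. Qed.

#[global] Opaque green.

Lemma Im_conj_neq0 z : complex.Im z != 0 -> complex.Im (z^*)%C != 0.
Proof. by rewrite cImJ oppr_eq0. Qed.

Lemma hermx_shift_cdot X z u w : hermx X ->
  cdot u ((X - z%:M) *m w) = cdot ((X - ((z^*)%C)%:M) *m u) w.
Proof.
move=> hX; rewrite !mulmxBl !mul_scalar_mx cdotBr cdotZr cdot_herm //.
by rewrite cdotDl -[- (_ *: u)]scaleNr cdotZl conjcN conjcK mulNr.
Qed.

Lemma green_adj X z u w : hermx X -> complex.Im z != 0 ->
  cdot u (green X z *m w) = cdot (green X (z^*)%C *m u) w.
Proof.
move=> hX z0; have z0' := Im_conj_neq0 z0.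
rewrite -{1}(mul1mx u) -(green_mulr hX z0') -mulmxA.
by rewrite -hermx_shift_cdot // mulmxA green_mulr // mul1mx.
Qed.

Lemma GqJ X z v w : hermx X -> complex.Im z != 0 ->
  ((Gq X z v w)^*)%C = Gq X (z^*)%C w v.
Proof.
move=> hX z0; rewrite !GqE -cdotC [RHS]green_adj ?conjcK //.
exact: Im_conj_neq0.
Qed.

(** Write w = (X - z) y with y = G w. The form of X at y is real, so only the shift by z contributes
    to the imaginary part. *)
Lemma Im_Gq X z w : hermx X -> complex.Im z != 0 ->
  complex.Im (Gq X z w w) = complex.Im z * nsq (green X z *m w).
Proof.
move=> hX z0; rewrite !GqE; set y := green X z *m w.
have -> : w = (X - z%:M) *m y by rewrite mulmxA green_mulr // mul1mx.
rewrite cdotC hermx_shift_cdot // mulmxBl mul_scalar_mx cdotDl -scaleNr cdotZl.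
have h : complex.Im (cdot (X *m y) y) = 0.
  have : cdot (X *m y) y = ((cdot (X *m y) y)^*)%C by rewrite -cdotC cdot_herm.
  by move=> /(congr1 (@complex.Im R)); rewrite cImJ; lra.
rewrite cImJ cImD h cdot_nsq conjcN conjcK cImM cImN /=; ring.
Qed.

(** The Ward identity: the left side is the squared norm of G w, which [Im_Gq] evaluates. It trades
    a sum of N squares for one diagonal value and is the main source of smallness below. *)
Lemma ward_r X z w : hermx X -> complex.Im z != 0 ->
  \sum_j cabs (Gq X z (ev j) w) ^+ 2 = complex.Im (Gq X z w w) / complex.Im z.
Proof.
move=> hX z0; rewrite Im_Gq // mulrAC divff // mul1r.
by apply: eq_bigr => j _; rewrite !GqE cdot_evl.
Qed.

Lemma ward_l X z w : hermx X -> complex.Im z != 0 ->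
  \sum_j cabs (Gq X z w (ev j)) ^+ 2 = complex.Im (Gq X z w w) / complex.Im z.
Proof.
move=> hX z0.
have h : complex.Im (Gq X (z^*)%C w w) / complex.Im (z^*)%C =
   complex.Im (Gq X z w w) / complex.Im z.
  by rewrite -GqJ // !cImJ invrN mulrNN.
rewrite -h -ward_r ?Im_conj_neq0 //; apply: eq_bigr => j _.
by rewrite -GqJ // cabsJ.
Qed.

(** Cauchy-Schwarz in [Im_Gq] gives Im z |y|^2 <= |w| |y| for y = G w, and one factor |y|
    cancels. *)
Lemma sqrt_nsq_green X z w : hermx X -> 0 < complex.Im z ->
  Num.sqrt (nsq (green X z *m w)) <= Num.sqrt (nsq w) / complex.Im z.
Proof.
move=> hX z0; have zn0 : complex.Im z != 0 by rewrite gt_eqF.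
set y := green X z *m w.
have h1 : complex.Im z * nsq y <= Num.sqrt (nsq w) * Num.sqrt (nsq y).
  rewrite -Im_Gq //; apply: le_trans (cdot_le _ _).
  by rewrite -GqE; apply: le_trans (Im_le_cabs _); exact: ler_norm.
have [y0|yn0] := eqVneq (Num.sqrt (nsq y)) 0.
  by rewrite y0 divr_ge0 ?sqrtr_ge0 // ltW.
have yp : 0 < Num.sqrt (nsq y) by rewrite lt_def yn0 sqrtr_ge0.
rewrite ler_pdivlMr // -(ler_pM2r yp).
apply: le_trans h1; rewrite -[X in _ <= _ * X]nsq_sqrt expr2.
by rewrite mulrA [_ * complex.Im z]mulrC.
Qed.

Lemma Gq_le_eta X z v w : hermx X -> 0 < complex.Im z ->
  cabs (Gq X z v w) <= Num.sqrt (nsq v) * Num.sqrt (nsq w) / complex.Im z.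
Proof.
move=> hX z0; rewrite GqE; apply: (le_trans (cdot_le _ _)).
by rewrite -mulrA ler_wpM2l ?sqrtr_ge0 // sqrt_nsq_green.
Qed.

Lemma green_diff X z z' : hermx X -> complex.Im z != 0 -> complex.Im z' != 0 ->
  green X z - green X z' = (z - z') *: (green X z *m green X z').
Proof.
move=> hX z0 z0'.
have -> : (z - z') *: (green X z *m green X z') =
    green X z *m ((X - z'%:M) - (X - z%:M)) *m green X z'.
  have -> : (X - z'%:M) - (X - z%:M) = (z - z')%:M.
    by rewrite opprB addrC addrA subrK raddfB.
  by rewrite mul_mx_scalar scalemxAl.
by rewrite mulmxBr mulmxBl green_mull // mul1mx -mulmxA green_mulr // mulmx1.
Qed.

Lemma Gq_diff X z z' v w : hermx X -> complex.Im z != 0 -> complex.Im z' != 0 ->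
  Gq X z v w - Gq X z' v w =
  (z - z') * cdot (green X (z^*)%C *m v) (green X z' *m w).
Proof.
move=> hX z0 z0'; rewrite !GqE -cdotBr -mulmxBl green_diff // -scalemxAl cdotZr.
by congr (_ * _); rewrite -mulmxA; exact: green_adj.
Qed.

Lemma nsq_green_conj X z w : hermx X -> complex.Im z != 0 ->
  nsq (green X (z^*)%C *m w) = nsq (green X z *m w).
Proof.
move=> hX z0; have h1 := ward_r w hX z0; have h2 := ward_l w hX z0.
transitivity (\sum_j cabs (Gq X z (ev j) w) ^+ 2).
  rewrite h1 -h2; apply: eq_bigr => j _; rewrite -(cdot_evl j) -GqE.
  by rewrite -GqJ // cabsJ.
by apply: eq_bigr => j _; rewrite -(cdot_evl j) -GqE.
Qed.

(** After the resolvent identity both factors are norms of resolvent vectors, so only Im G_vv and Im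
    G_ww enter. This is how off-diagonal entries are carried to a smaller spectral scale. *)
Lemma Gq_diff_le X z z' v w : hermx X -> 0 < complex.Im z -> 0 < complex.Im z' ->
  cabs (Gq X z v w - Gq X z' v w) <=
  cabs (z - z') * (Num.sqrt (complex.Im (Gq X z v v) / complex.Im z) *
                   Num.sqrt (complex.Im (Gq X z' w w) / complex.Im z')).
Proof.
move=> hX z0 z0'; have zn : complex.Im z != 0 by rewrite gt_eqF.
have zn' : complex.Im z' != 0 by rewrite gt_eqF.
rewrite Gq_diff // cabsM ler_wpM2l ?cabs_ge0 //.
apply: (le_trans (cdot_le _ _)); rewrite nsq_green_conj // !Im_Gq //.
by rewrite ![_ * nsq _]mulrC !mulfK.
Qed.

(** By the resolvent identity G(z) w = G(z') w + (z - z') G(z) G(z') w, where |z - z'| = b - a and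
    the norm of G(z) is at most 1/a. The total factor is 1 + (b - a)/a = b/a. *)
Lemma sqrt_nsq_green_mono X (E a b : R) w : hermx X -> 0 < a -> a <= b ->
  a * Num.sqrt (nsq (green X (E +i* a)%C *m w)) <=
  b * Num.sqrt (nsq (green X (E +i* b)%C *m w)).
Proof.
move=> hX a0 ab; have b0 := lt_le_trans a0 ab.
set z := (E +i* a)%C; set z' := (E +i* b)%C.
have zn : complex.Im z != 0 by rewrite gt_eqF.
have zn' : complex.Im z' != 0 by rewrite gt_eqF.
have -> : green X z *m w = green X z' *m w + (z - z') *: (green X z *m (green X z' *m w)).
  by rewrite mulmxA scalemxAl -green_diff // mulmxBl addrC subrK.
have dz : cabs (z - z') = b - a.
  have -> : z - z' = (0 +i* (a - b))%C by apply: complex_eq => //=; rewrite subrr.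
  by rewrite /cabs /= expr0n add0r sqrtr_sqr distrC ger0_norm // subr_ge0.
have h : Num.sqrt (nsq (green X z' *m w + (z - z') *: (green X z *m (green X z' *m w))))
   <= Num.sqrt (nsq (green X z' *m w)) * (1 + (b - a) / a).
  apply: (le_trans (sqrt_nsqD _ _)); rewrite mulrDr mulr1 lerD2l nsqZ.
  rewrite sqrtrM ?sqr_ge0 // sqrtr_sqr ger0_norm ?cabs_ge0 // dz.
    rewrite [leRHS]mulrCA ler_wpM2l ?subr_ge0 //.
  exact: (@sqrt_nsq_green X z).
have -> : b * Num.sqrt (nsq (green X z' *m w)) =
   a * (Num.sqrt (nsq (green X z' *m w)) * (1 + (b - a) / a)) by field; rewrite gt_eqF.
by rewrite ler_wpM2l // ltW.
Qed.

(** By [Im_Gq], eta Im G_ww is the square of eta |G w|, so the previous monotonicity passes to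
    squares. *)
Lemma Im_Gq_mono X (E a b : R) w : hermx X -> 0 < a -> a <= b ->
  a * complex.Im (Gq X (E +i* a)%C w w) <= b * complex.Im (Gq X (E +i* b)%C w w).
Proof.
move=> hX a0 ab; have b0 := lt_le_trans a0 ab.
have aux (p q : R) : 0 <= p -> a * p <= b * q -> a * (a * p ^+ 2) <= b * (b * q ^+ 2).
  move=> p00 h; have p0 : 0 <= a * p by rewrite mulr_ge0 // ltW.
  have -> : a * (a * p ^+ 2) = (a * p) ^+ 2 by ring.
  have -> : b * (b * q ^+ 2) = (b * q) ^+ 2 by ring.
  by rewrite ler_pXn2r // nnegrE // (le_trans p0 h).
have e c : 0 < c -> c * complex.Im (Gq X (E +i* c)%C w w) =
    c * (c * Num.sqrt (nsq (green X (E +i* c)%C *m w)) ^+ 2).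
  by move=> c0; rewrite Im_Gq ?gt_eqF // nsq_sqrt.
have h2 := aux _ _ (sqrtr_ge0 _) (sqrt_nsq_green_mono E w hX a0 ab).
have trans (x1 x2 y1 y2 : R) : x1 = y1 -> x2 = y2 -> y1 <= y2 -> x1 <= x2.
  by move=> -> ->.
exact: (trans _ _ _ _ (e a a0) (e b b0) h2).
Qed.

End Resolvent.

(** * Measurability of functions of the matrix *)

Section ComplexMeasurability.
Context {R : realType} {d : measure_display} {T : measurableType d}.
Implicit Types (f g : T -> R[i]).

Definition cmeas f := measurable_fun setT (fun w => complex.Re (f w)) /\
  measurable_fun setT (fun w => complex.Im (f w)).

Lemma eq_cmeas f g : f =1 g -> cmeas f -> cmeas g.
Proof. by move=> /funext ->. Qed.

Lemma cmeas_cst c : cmeas (fun=> c).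
Proof. by split; exact: measurable_cst. Qed.

Lemma cmeasD f g : cmeas f -> cmeas g -> cmeas (fun w => f w + g w).
Proof.
move=> [f1 f2] [g1 g2]; split.
  by under eq_fun do rewrite cReD; exact: measurable_funD.
by under eq_fun do rewrite cImD; exact: measurable_funD.
Qed.

Lemma cmeasM f g : cmeas f -> cmeas g -> cmeas (fun w => f w * g w).
Proof.
move=> [f1 f2] [g1 g2]; split.
  under eq_fun do rewrite cReM.
  by apply: measurable_funB; exact: measurable_funM.
under eq_fun do rewrite cImM.
by apply: measurable_funD; exact: measurable_funM.
Qed.

Lemma cmeasN f : cmeas f -> cmeas (fun w => - f w).
Proof.
move=> hf; apply: eq_cmeas (cmeasM (cmeas_cst (-1)) hf) => w.
by rewrite mulN1r.
Qed.

Lemma cmeasB f g : cmeas f -> cmeas g -> cmeas (fun w => f w - g w).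
Proof. by move=> hf hg; apply: cmeasD => //; exact: cmeasN. Qed.

Lemma cmeasJ f : cmeas f -> cmeas (fun w => ((f w)^*)%C).
Proof.
move=> [f1 f2]; split; first by under eq_fun do rewrite cReJ.
by under eq_fun do rewrite cImJ; exact: measurable_funN.
Qed.

Lemma cmeas_sum (I : Type) (r : seq I) (p : pred I) (F : I -> T -> R[i]) :
  (forall i, cmeas (F i)) -> cmeas (fun w => \sum_(i <- r | p i) F i w).
Proof.
move=> h; elim: r => [|i r IH].
  by under eq_fun do rewrite big_nil; exact: cmeas_cst.
under eq_fun do rewrite big_cons.
by case: (p i) => //; exact: cmeasD.
Qed.

Lemma cmeas_prod (I : Type) (r : seq I) (p : pred I) (F : I -> T -> R[i]) :
  (forall i, cmeas (F i)) -> cmeas (fun w => \prod_(i <- r | p i) F i w).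
Proof.
move=> h; elim: r => [|i r IH].
  by under eq_fun do rewrite big_nil; exact: cmeas_cst.
under eq_fun do rewrite big_cons.
by case: (p i) => //; exact: cmeasM.
Qed.

Lemma cmeasX f n : cmeas f -> cmeas (fun w => f w ^+ n).
Proof.
move=> h; elim: n => [|n IH]; first by under eq_fun do rewrite expr0; exact: cmeas_cst.
by under eq_fun do rewrite exprS; exact: cmeasM.
Qed.

Lemma measurable_cabs_sqr f : cmeas f -> measurable_fun setT (fun w => cabs (f w) ^+ 2).
Proof.
move=> [f1 f2]; under eq_fun do rewrite cabs_sqr.
by apply: measurable_funD; exact: measurable_funX.
Qed.

Lemma measurable_cabs f : cmeas f -> measurable_fun setT (fun w => cabs (f w)).
Proof.
move=> h; have h2 := measurable_cabs_sqr h.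
have e w : cabs (f w) = (cabs (f w) ^+ 2) `^ (2^-1).
  rewrite -powR_mulrn ?cabs_ge0 // -powRrM mulfV ?pnatr_eq0 //.
  by rewrite powRr1 ?cabs_ge0.
under eq_fun do rewrite e.
exact: (measurableT_comp (measurable_powR _) h2).
Qed.

Lemma invcE (x : R[i]) : x^-1 = ((cabs x ^+ 2)^-1)%:C%C * (x^*)%C.
Proof.
have [->|x0] := eqVneq x 0; first by rewrite invr0 conjc0 mulr0.
have c0 : cabs x ^+ 2 != 0 by rewrite expf_neq0 // gt_eqF // cabs_gt0.
apply: (mulIf x0); rewrite mulVf // -mulrA cabs_conjM -rmorphM /= mulVf //.
Qed.

Lemma cmeas_real (g : T -> R) : measurable_fun setT g ->
  cmeas (fun w => (g w)%:C%C).
Proof. by move=> h; split => //; exact: measurable_cst. Qed.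

Lemma cmeasV f : cmeas f -> cmeas (fun w => (f w)^-1).
Proof.
move=> h; under eq_fun do rewrite invcE.
apply: cmeasM; last exact: cmeasJ.
apply: cmeas_real; have h2 := measurable_cabs_sqr h.
have e w : (cabs (f w) ^+ 2)^-1 = (cabs (f w) ^+ 2) `^ (-1).
  by rewrite powR_inv1 // sqr_ge0.
under eq_fun do rewrite e.
exact: (measurableT_comp (measurable_powR _) h2).
Qed.

End ComplexMeasurability.

Section MatrixMeasurability.
Context {R : realType} {N : nat}.
Local Notation C := R[i].
Implicit Types (phi psi : 'M[C]_N -> C).

(** The measurable space is quantified inside: the same function is later used over the given
    sigma-algebra and over the one generated by all entries but one. Only Hermitian-valued maps are
    asked for, since there the shifted matrix is known to be invertible. *)
Definition mxmeas phi := forall (d : measure_display) (T : measurableType d)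
  (X : T -> 'M[C]_N), (forall i j, cmeas (fun w => X w i j)) ->
  (forall w, hermx (X w)) -> cmeas (fun w => phi (X w)).

Lemma mxmeas_cst c : mxmeas (fun=> c).
Proof. by move=> *; exact: cmeas_cst. Qed.
Lemma mxmeas_entry i j : mxmeas (fun X => X i j).
Proof. by move=> d T X hX _; exact: hX. Qed.
Lemma mxmeasD phi psi : mxmeas phi -> mxmeas psi -> mxmeas (fun X => phi X + psi X).
Proof. by move=> h1 h2 d T X hX hX'; apply: cmeasD; [exact: h1|exact: h2]. Qed.
Lemma mxmeasM phi psi : mxmeas phi -> mxmeas psi -> mxmeas (fun X => phi X * psi X).
Proof. by move=> h1 h2 d T X hX hX'; apply: cmeasM; [exact: h1|exact: h2]. Qed.
Lemma mxmeasN phi : mxmeas phi -> mxmeas (fun X => - phi X).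
Proof. by move=> h1 d T X hX hX'; apply: cmeasN; exact: h1. Qed.
Lemma mxmeasB phi psi : mxmeas phi -> mxmeas psi -> mxmeas (fun X => phi X - psi X).
Proof. by move=> h1 h2; apply: mxmeasD => //; exact: mxmeasN. Qed.
Lemma mxmeasJ phi : mxmeas phi -> mxmeas (fun X => ((phi X)^*)%C).
Proof. by move=> h1 d T X hX hX'; apply: cmeasJ; exact: h1. Qed.
Lemma mxmeasX phi n : mxmeas phi -> mxmeas (fun X => phi X ^+ n).
Proof. by move=> h1 d T X hX hX'; apply: cmeasX; exact: h1. Qed.
Lemma mxmeas_sum (I : Type) (r : seq I) (p : pred I) (F : I -> 'M[C]_N -> C) :
  (forall i, mxmeas (F i)) -> mxmeas (fun X => \sum_(i <- r | p i) F i X).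
Proof.
by move=> h d T X hX hX'; apply: cmeas_sum => i; exact: (h i _ _ X).
Qed.

Lemma cmeas_det n (d : measure_display) (T : measurableType d) (A : T -> 'M[C]_n) :
  (forall i j, cmeas (fun w => A w i j)) -> cmeas (fun w => \det (A w)).
Proof.
move=> h; rewrite /determinant; apply: cmeas_sum => s.
apply: cmeasM; first exact: cmeas_cst.
by apply: cmeas_prod => i; exact: h.
Qed.

Lemma mxmeas_green z i j : complex.Im z != 0 ->
  mxmeas (fun X => green X z i j).
Proof.
move=> z0 d T X hX hX'.
have hA i' j' : cmeas (fun w => (X w - z%:M) i' j').
  under eq_fun do rewrite !mxE.
  by apply: cmeasB; [exact: hX|exact: cmeas_cst].
(* Cramer's rule: cofactor and determinant are polynomials in the entries. *)
have e w : green (X w) z i j =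
  (\det (X w - z%:M))^-1 * (\adj (X w - z%:M)) i j.
  have hu := herm_shift_unit (hX' w) z0.
  have h1 := green_mull (hX' w) z0.
  have h2 : invmx (X w - z%:M) = green (X w) z.
    by rewrite -[LHS]mul1mx -h1 -mulmxA mulmxV // mulmx1.
  by rewrite -h2 /invmx hu mxE.
under eq_fun do rewrite e.
apply: cmeasM; first by apply: cmeasV; exact: cmeas_det.
under eq_fun do rewrite mxE /cofactor.
apply: cmeasM; first exact: cmeas_cst.
apply: cmeas_det => i' j'; under eq_fun do rewrite [row' _ _ _ _]mxE [col' _ _ _ _]mxE.
exact: hA.
Qed.

Lemma mxmeas_Gq z v w : complex.Im z != 0 -> mxmeas (fun X => Gq X z v w).
Proof.
move=> z0 d T X hX hX'; under eq_fun do rewrite GqE /cdot.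
apply: cmeas_sum => i.
apply: cmeasM; first exact: cmeas_cst.
under eq_fun do rewrite mxE.
apply: cmeas_sum => j; apply: cmeasM; last exact: cmeas_cst.
exact: (mxmeas_green i j z0 hX hX').
Qed.

(** The mirror position is removed too, so that [kill p X] stays Hermitian and, for the random
    matrix, no longer depends on the entry p at all. *)
Definition killed (p q : 'I_N * 'I_N) := (q == p) || (q == (p.2, p.1)).

Definition kill p (X : 'M[C]_N) : 'M[C]_N :=
  \matrix_(i, j) if killed p (i, j) then 0 else X i j.

Lemma killed_sym p i j : killed p (j, i) = killed p (i, j).
Proof.
case: p => a b; rewrite /killed !xpair_eqE /= orbC andbC; congr (_ || _).
by rewrite andbC.
Qed.

Lemma herm_kill p X : hermx X -> hermx (kill p X).
Proof.
by move=> h i j; rewrite !mxE killed_sym; case: ifP => _; rewrite ?conjc0 // h.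
Qed.

Lemma mxmeas_kill p phi : mxmeas phi -> mxmeas (fun X => phi (kill p X)).
Proof.
move=> h d T X hX hX'; apply: (h _ _ (fun w => kill p (X w))) => [i j|w].
  under eq_fun do rewrite mxE.
  by case: (killed p (i, j)); [exact: cmeas_cst|exact: hX].
exact: herm_kill.
Qed.

End MatrixMeasurability.

(** * Random matrices with independent entries *)

Section Independence.
Context {R : realType} {d : measure_display} {T : measurableType d} (P : probability T R).

Lemma bounded_integrable (f : T -> R) (b : R) : measurable_fun setT f ->
  (forall w, `|f w| <= b) -> P.-integrable setT (EFin \o f).
Proof.
move=> mf hb; apply: (@le_integrable _ _ _ P setT measurableT _ (EFin \o (cst b))).
- exact/measurable_EFinP.
- by move=> w _ /=; rewrite lee_fin; exact: (le_trans (hb w) (ler_norm _)).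
- exact: finite_measure_integrable_cst.
Qed.

(** Independence identifies the joint law of (X, Y) with the product of the two laws, by uniqueness
    of product measures on rectangles; Fubini then factorises the integral of x y. Boundedness of Y
    makes x y integrable. *)
Lemma indep_Rintegral (X Y : T -> R) (b : R) :
  measurable_fun setT X -> measurable_fun setT Y ->
  P.-integrable setT (EFin \o X) -> (forall w, `|Y w| <= b) ->
  (forall A B : set R, measurable A -> measurable B ->
    P ((X @^-1` A) `&` (Y @^-1` B)) = (P (X @^-1` A) * P (Y @^-1` B))%E) ->
  Rintegral P setT (fun w => X w * Y w) = Rintegral P setT X * Rintegral P setT Y.
Proof.
move=> mX mY iX hb ind.
pose X' : {mfun T >-> R} := HB.pack X (isMeasurableFun.Build _ _ _ _ X mX).
pose Y' : {mfun T >-> R} := HB.pack Y (isMeasurableFun.Build _ _ _ _ Y mY).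
have mXY : measurable_fun setT (fun w => (X w, Y w)) by exact: measurable_fun_pair.
pose XY : {mfun T >-> (R * R)%type} :=
  HB.pack (fun w => (X w, Y w)) (isMeasurableFun.Build _ _ _ _ _ mXY).
have eqm A : measurable A -> (distribution P X' \x distribution P Y')%E A = distribution P XY A.
  apply: product_measure_unique => A1 B1 mA mB.
  by rewrite /distribution /pushforward /= -ind //.
pose f (xy : R * R) : R := xy.1 * xy.2.
have mf : measurable_fun setT f.
  by apply: measurable_funM; [exact: measurable_fst|exact: measurable_snd].
have iXY : P.-integrable setT ((EFin \o f) \o XY).
  apply: (@le_integrable _ _ _ P setT measurableT _ (EFin \o (fun w => b * X w))).
  - by apply/measurable_EFinP; exact: measurable_funM.
  - move=> w _ /=; rewrite lee_fin !normrM mulrC ler_wpM2r //.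
    exact: (le_trans (hb w) (ler_norm _)).
  - exact: (@integrableZl _ _ _ P _ measurableT b _ iX).
have mEf : measurable_fun setT (EFin \o f) by exact/measurable_EFinP.
have e1 : (\int[P]_w (X w * Y w)%:E = \int[distribution P X' \x distribution P Y']_z (EFin \o f) z)%E.
  rewrite (eq_measure_integral (distribution P XY)) => [|A mA _]; last exact: eqm.
  by rewrite (integral_distribution mEf iXY).
have ifprod : (distribution P X' \x distribution P Y')%E.-integrable setT (EFin \o f).
  apply/integrableP; split => //.
  rewrite (eq_measure_integral (distribution P XY)) => [|A mA _]; last exact: eqm.
  rewrite ge0_integral_distribution //; last exact: measurableT_comp.
  by have /integrableP[] := iXY.
have e2 := integral12_prod_meas1 ifprod.
rewrite /Rintegral e1 -e2.
have iY : P.-integrable setT (EFin \o Y) by exact: (bounded_integrable mY hb).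
have mid : measurable_fun setT (EFin \o (@idfun R)).
  by apply/measurable_EFinP; exact: measurable_id.
have iYd : (distribution P Y').-integrable setT (EFin \o idfun).
  apply/integrableP; split => //.
  rewrite ge0_integral_distribution //; last exact: measurableT_comp.
  by have /integrableP[] := iY.
have EY : (\int[distribution P Y']_y (EFin \o idfun) y = (Rintegral P setT Y)%:E)%E.
  rewrite (integral_distribution (X := Y') mid iY) /Rintegral fineK //.
  exact: (integrable_fin_num measurableT iY).
have -> : fubini_F (distribution P Y') (EFin \o f) =
    fun x => ((Rintegral P setT Y)%:E * (EFin \o idfun) x)%E.
  apply/funext => x; rewrite /fubini_F /f /=.
  have := integralZl measurableT iYd x; rewrite EY => e.
  by rewrite muleC -e.
have iXd : (distribution P X').-integrable setT (EFin \o idfun).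
  apply/integrableP; split => //.
  rewrite ge0_integral_distribution //; last exact: measurableT_comp.
  by have /integrableP[] := iX.
rewrite (integralZl measurableT iXd) (integral_distribution (X := X') mid iX).
rewrite fineM //; first by rewrite mulrC.
exact: (integrable_fin_num measurableT iX).
Qed.

(** As functions of the second set, both sides are finite measures, [mrestr P mA] and a multiple of
    P. They agree on the intersection-stable system G, hence on the sigma-algebra it generates. *)
Lemma indep_sigma (G : set (set T)) (A E : set T) :
  (forall F, G F -> measurable F) -> setI_closed G -> G setT -> measurable A ->
  (forall F, G F -> P (A `&` F) = (P A * P F)%E) ->
  <<s G >> E -> P (A `&` E) = (P A * P E)%E.
Proof.
move=> mG GI GT mA h sE.
have PA : (P A \is a fin_num) by exact: fin_num_measure.
pose r : {nonneg R} := NngNum (fine_ge0 (measure_ge0 P A)).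
have hr : (r%:num%:E = P A)%E by rewrite /= fineK.
have : mrestr P mA E = mscale r P E.
  apply: (@g_sigma_algebra_measure_unique d R T G mG (fun=> setT)) => //.
  - by rewrite bigcup_const.
  - by move=> F GF; rewrite /= /mrestr /mscale hr setIC h.
  - by move=> _; rewrite /= /mrestr setTI -ge0_fin_numE.
by rewrite /mrestr /mscale hr setIC.
Qed.

End Independence.

Section ComplexExpectation.
Context {R : realType} {d : measure_display} {T : measurableType d} (P : probability T R).
Local Notation C := R[i].
Implicit Types (f g : T -> C).

Definition Ex f : C := Complex (Rintegral P setT (fun w => complex.Re (f w)))
  (Rintegral P setT (fun w => complex.Im (f w))).

Definition Cint f := P.-integrable setT (EFin \o (fun w => complex.Re (f w))) /\
  P.-integrable setT (EFin \o (fun w => complex.Im (f w))).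

Lemma eq_Ex f g : f =1 g -> Ex f = Ex g.
Proof. by move=> /funext ->. Qed.

Lemma Cint_le f (g : T -> R) : cmeas f -> P.-integrable setT (EFin \o g) ->
  (forall w, cabs (f w) <= g w) -> Cint f.
Proof.
move=> [mf1 mf2] ig h; split.
- apply: (le_integrable measurableT _ _ ig); first exact/measurable_EFinP.
  by move=> w _ /=; rewrite lee_fin (le_trans (Re_le_cabs _)) // (le_trans (h w)) // ler_norm.
- apply: (le_integrable measurableT _ _ ig); first exact/measurable_EFinP.
  by move=> w _ /=; rewrite lee_fin (le_trans (Im_le_cabs _)) // (le_trans (h w)) // ler_norm.
Qed.

Lemma Cint_bounded f b : cmeas f -> (forall w, cabs (f w) <= b) -> Cint f.
Proof.
move=> mf h; apply: (@Cint_le _ (fun=> b)) => //.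
exact: finite_measure_integrable_cst.
Qed.

Lemma CintD f g : Cint f -> Cint g -> Cint (fun w => f w + g w).
Proof.
move=> [f1 f2] [g1 g2]; split.
- rewrite (_ : EFin \o _ = (EFin \o (fun w => complex.Re (f w))) \+
    (EFin \o (fun w => complex.Re (g w))))%E; first exact: integrableD.
  by apply/funext => w /=; rewrite cReD.
- rewrite (_ : EFin \o _ = (EFin \o (fun w => complex.Im (f w))) \+
    (EFin \o (fun w => complex.Im (g w))))%E; first exact: integrableD.
  by apply/funext => w /=; rewrite cImD.
Qed.

Lemma ExD f g : Cint f -> Cint g -> Ex (fun w => f w + g w) = Ex f + Ex g.
Proof.
move=> [f1 f2] [g1 g2]; apply: complex_eq; rewrite !(cReD, cImD) /=.
- under eq_Rintegral do rewrite cReD; exact: RintegralD.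
- under eq_Rintegral do rewrite cImD; exact: RintegralD.
Qed.

Lemma CintZ a f : Cint f -> Cint (fun w => a * f w).
Proof.
move=> [f1 f2]; split.
- have h := integrableB measurableT (integrableZl measurableT (complex.Re a) f1)
    (integrableZl measurableT (complex.Im a) f2).
  by congr (P.-integrable setT _): h; apply/funext => w /=; rewrite cReM.
- have h := integrableD measurableT (integrableZl measurableT (complex.Re a) f2)
    (integrableZl measurableT (complex.Im a) f1).
  by congr (P.-integrable setT _): h; apply/funext => w /=; rewrite cImM.
Qed.

Lemma ExZ a f : Cint f -> Ex (fun w => a * f w) = a * Ex f.
Proof.
move=> [f1 f2]; apply: complex_eq; rewrite !(cReM, cImM) /=.
- under eq_Rintegral do rewrite cReM.
  rewrite RintegralB //; last 2 first.
    exact: (integrableZl measurableT (complex.Re a) f1).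
    exact: (integrableZl measurableT (complex.Im a) f2).
  by rewrite !RintegralZl.
- under eq_Rintegral do rewrite cImM.
  rewrite RintegralD //; last 2 first.
    exact: (integrableZl measurableT (complex.Re a) f2).
    exact: (integrableZl measurableT (complex.Im a) f1).
  by rewrite !RintegralZl.
Qed.

Lemma Cint_sum (I : Type) (r : seq I) (F : I -> T -> C) :
  (forall i, Cint (F i)) -> Cint (fun w => \sum_(i <- r) F i w).
Proof.
move=> h; elim: r => [|i r IH].
  under eq_fun do rewrite big_nil.
  by apply: (@Cint_bounded _ 0) => [|w]; [exact: cmeas_cst|rewrite cabs0].
by under eq_fun do rewrite big_cons; exact: CintD.
Qed.

Lemma Ex_cst c : Ex (fun=> c) = c.
Proof.
have e (r : R) : Rintegral P setT (fun=> r) = r.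
  have h : fine (P setT) = 1 :> R by rewrite probability_setT.
  by apply: (eq_trans (Rintegral_cst P measurableT r)); rewrite h mulr1.
by apply: complex_eq; rewrite /Ex /= e.
Qed.

Lemma Ex_sum (I : Type) (r : seq I) (F : I -> T -> C) :
  (forall i, Cint (F i)) -> Ex (fun w => \sum_(i <- r) F i w) = \sum_(i <- r) Ex (F i).
Proof.
move=> h; elim: r => [|i r IH].
  rewrite big_nil; under eq_Ex do rewrite big_nil; exact: Ex_cst.
rewrite big_cons -IH -ExD //; last exact: Cint_sum.
by apply: eq_Ex => w; rewrite big_cons.
Qed.

Lemma Re_Ex_le f (g : T -> R) : Cint f -> P.-integrable setT (EFin \o g) ->
  (forall w, complex.Re (f w) <= g w) -> complex.Re (Ex f) <= Rintegral P setT g.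
Proof. by move=> [f1 f2] ig h; apply: le_Rintegral. Qed.

End ComplexExpectation.

(** * Independence of one entry from the matrix without it *)

Section WignerEntries.
Context {R : realType} {N : nat} {d : measure_display} {T : measurableType d}
  (P : probability T R) (H : T -> 'M[R[i]]_N) (C : R) (Cp : nat -> R).
Local Notation CC := R[i].
Hypothesis W : wigner_type C Cp P H.

Lemma wigner_herm w : hermx (H w).
Proof. by case: W => h _ i j; exact: h. Qed.

Lemma cmeas_entry i j : cmeas (fun w => H w i j).
Proof. by case: W => _ [h _]; case: (h i j). Qed.

Lemma mxmeasH (phi : 'M[CC]_N -> CC) : mxmeas phi -> cmeas (fun w => phi (H w)).
Proof.
move=> h; apply: h => [i j|w]; [exact: cmeas_entry|exact: wigner_herm].
Qed.

Lemma measurable_entry2 i j : measurable_fun setT (entry2 H i j).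
Proof. by have [h1 h2] := cmeas_entry i j; exact: measurable_fun_pair. Qed.

Lemma kill_swap (i j : 'I_N) (X : 'M[CC]_N) : kill (j, i) X = kill (i, j) X.
Proof. by apply/matrixP => a b; rewrite !mxE /killed orbC. Qed.

(** An intersection-stable system generating the information in the entries on and above the
    diagonal other than p. Each [B i j] may be the whole space, which yields events about any
    subfamily. *)
Definition others (p : 'I_N * 'I_N) : set (set T) :=
  [set E | exists B : 'I_N -> 'I_N -> set (R * R),
    (forall i j, measurable (B i j)) /\
    E = \bigcap_(q in [set q : 'I_N * 'I_N | (q.1 <= q.2)%N && (q != p)])
          (entry2 H q.1 q.2 @^-1` B q.1 q.2)].

Lemma others_setI p : setI_closed (others p).
Proof.
move=> E F [B [mB ->]] [B' [mB' ->]]; exists (fun i j => B i j `&` B' i j); split.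
  by move=> i j; exact: measurableI.
apply/seteqP; split => w /=.
  by move=> [h1 h2] q hq; split; [exact: h1|exact: h2].
by move=> h; split => q hq; have [] := h q hq.
Qed.

Lemma others_setT p : others p setT.
Proof.
exists (fun _ _ => setT); split=> [i j|]; first exact: measurableT.
by apply/seteqP; split.
Qed.

Lemma others_measurable p E : others p E -> measurable E.
Proof.
move=> [B [mB ->]]; apply: fin_bigcap_measurable => [|q _]; first exact: finite_finset.
by rewrite -[X in measurable X]setTI; exact: measurable_entry2.
Qed.

Lemma others_entry (p q : 'I_N * 'I_N) : (q.1 <= q.2)%N -> q != p ->
  forall B, measurable B -> others p (entry2 H q.1 q.2 @^-1` B).
Proof.
move=> qle qp B mB; exists (fun i j => if (i, j) == q then B else setT); split.
  by move=> i j; case: ifP.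
apply/seteqP; split => w /=.
  move=> h q' _; case: ifP => //.
  by rewrite -surjective_pairing => /eqP ->.
move=> /(_ q) /=; rewrite qle qp -surjective_pairing eqxx; exact.
Qed.

Lemma others_indep (p : 'I_N * 'I_N) (A : set (R * R)) E : (p.1 <= p.2)%N ->
  measurable A -> others p E ->
  P ((entry2 H p.1 p.2 @^-1` A) `&` E) = (P (entry2 H p.1 p.2 @^-1` A) * P E)%E.
Proof.
move=> pp mA [B [mB eE]].
pose S : {set 'I_N * 'I_N} := [set q : 'I_N * 'I_N | (q.1 <= q.2)%N]%SET.
(* The product formula of the hypothesis is applied to all positions on and above the diagonal, with
   A' at p. The choice [A' = setT] afterwards identifies the remaining product with P E. *)
have key A' : measurable A' ->
    P ((entry2 H p.1 p.2 @^-1` A') `&` E) =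
    (P (entry2 H p.1 p.2 @^-1` A') *
      \prod_(q in S | q != p) P (entry2 H q.1 q.2 @^-1` B q.1 q.2))%E.
  move=> mA'.
  have [_ [_ [ind _]]] := W.
  have := ind S (fun i j => if (i, j) == p then A' else B i j).
  have -> : \bigcap_(ij in [set ij | ij \in S])
      (entry2 H ij.1 ij.2 @^-1` (if (ij.1, ij.2) == p then A' else B ij.1 ij.2)) =
      (entry2 H p.1 p.2 @^-1` A') `&` E.
    rewrite eE; apply/seteqP; split => w /=.
      move=> h; split.
        have := h p; rewrite /= -surjective_pairing eqxx; apply.
        by rewrite finset.inE.
      move=> q /andP[q1 q2]; have := h q; rewrite /= -surjective_pairing (negbTE q2).
      by apply; rewrite finset.inE.
    move=> [h1 h2] q; rewrite /= finset.inE => q1; rewrite -surjective_pairing.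
    by case: eqP => [->//|/eqP qp]; apply: h2; rewrite /= q1.
  move=> ->; last 2 first.
    by move=> i j; case: ifP.
    by move=> q; rewrite finset.inE.
  rewrite (bigD1 p) /=; last by rewrite finset.inE.
  rewrite -surjective_pairing eqxx; congr (_ * _)%E.
  by apply: eq_bigr => q /andP[_ qp]; rewrite -surjective_pairing (negbTE qp).
have := key setT measurableT; rewrite preimage_setT setTI probability_setT mul1e => ->.
exact: key.
Qed.

(** At p and its mirror image the killed matrix is constant. An entry below the diagonal is the
    conjugate of its mirror image, which is among the generating entries. *)
Lemma cmeas_kill_others (p : 'I_N * 'I_N) (phi : 'M[CC]_N -> CC) : (p.1 <= p.2)%N ->
  mxmeas phi -> @cmeas R _ (g_sigma_algebraType (others p))
    (fun w => phi (kill p (H w))).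
Proof.
move=> pp h; apply: h => [i j|w]; last exact/herm_kill/wigner_herm.
have can (q : 'I_N * 'I_N) : (q.1 <= q.2)%N -> ~~ killed p q ->
    @cmeas R _ (g_sigma_algebraType (others p)) (fun w => H w q.1 q.2).
  move=> qle; rewrite /killed negb_or => /andP[qp _].
  have m2 : @measurable_fun _ _ (g_sigma_algebraType (others p)) _ setT
      (entry2 H q.1 q.2).
    move=> _ B mB; rewrite setTI; apply: sub_sigma_algebra.
    exact: others_entry.
  split.
  - exact: (measurableT_comp measurable_fst m2).
  - exact: (measurableT_comp measurable_snd m2).
under eq_fun do rewrite mxE.
case: (boolP (killed p (i, j))) => k; first exact: cmeas_cst.
have [ij|ji] := leqP i j; first exact: (can (i, j)).
under eq_fun do rewrite wigner_herm.
have h := can (j, i) (ltnW ji); rewrite killed_sym in h; exact: (cmeasJ (h k)).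
Qed.

Lemma indep_entry_real (p : 'I_N * 'I_N) (f : R * R -> R) (g : T -> R) (b : R) :
  (p.1 <= p.2)%N -> measurable_fun setT f ->
  @measurable_fun _ _ (g_sigma_algebraType (others p)) _ setT g ->
  measurable_fun setT g ->
  (forall w, `|g w| <= b) -> P.-integrable setT (EFin \o (f \o entry2 H p.1 p.2)) ->
  Rintegral P setT (fun w => f (entry2 H p.1 p.2 w) * g w) =
  Rintegral P setT (f \o entry2 H p.1 p.2) * Rintegral P setT g.
Proof.
move=> pp mf mg mg' hb fi.
apply: (indep_Rintegral _ mg' fi hb).
  exact: measurableT_comp (measurable_entry2 _ _).
move=> A B mA mB; rewrite comp_preimage.
have mfA : measurable (f @^-1` A) by rewrite -[X in measurable X]setTI; exact: mf.
apply: (@indep_sigma _ _ _ P (others p)).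
- exact: others_measurable.
- exact: others_setI.
- exact: others_setT.
- by rewrite -[X in measurable X]setTI; exact: measurable_entry2.
- by move=> F hF; exact: others_indep.
- by have := mg measurableT B mB; rewrite setTI.
Qed.

Lemma indep_entry_le (p : 'I_N * 'I_N) (f : CC -> CC) phi (b : R) :
  (p.1 <= p.2)%N ->
  cmeas (fun ab : R * R => f (ab.1 +i* ab.2)%C) -> mxmeas phi ->
  (forall X, hermx X -> cabs (phi X) <= b) -> Cint P (fun w => f (H w p.1 p.2)) ->
  Ex P (fun w => f (H w p.1 p.2) * phi (kill p (H w))) =
  Ex P (fun w => f (H w p.1 p.2)) * Ex P (fun w => phi (kill p (H w))).
Proof.
move=> pp [mf1 mf2] mphi hb [i1 i2].
have hb' w := hb _ (herm_kill p (wigner_herm w)).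
have [g1 g2] := cmeas_kill_others pp mphi.
have [g1' g2'] := mxmeasH (mxmeas_kill p mphi).
have hH w : H w p.1 p.2 = ((entry2 H p.1 p.2 w).1 +i* (entry2 H p.1 p.2 w).2)%C.
  by rewrite /entry2; case: (H w _ _).
have b1 w : `|complex.Re (phi (kill p (H w)))| <= b by rewrite (le_trans (Re_le_cabs _)).
have b2 w : `|complex.Im (phi (kill p (H w)))| <= b by rewrite (le_trans (Im_le_cabs _)).
pose f1 (ab : R * R) := complex.Re (f (ab.1 +i* ab.2)%C).
pose f2 (ab : R * R) := complex.Im (f (ab.1 +i* ab.2)%C).
have e1 : (fun w => complex.Re (f (H w p.1 p.2))) = f1 \o entry2 H p.1 p.2.
  by apply/funext => w; rewrite hH.
have e2 : (fun w => complex.Im (f (H w p.1 p.2))) = f2 \o entry2 H p.1 p.2.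
  by apply/funext => w; rewrite hH.
rewrite e1 in i1; rewrite e2 in i2.
have prod_int (X Y : T -> R) : P.-integrable setT (EFin \o X) -> measurable_fun setT Y ->
    (forall w, `|Y w| <= b) -> P.-integrable setT (EFin \o (fun w => X w * Y w)).
  move=> iX mY hY.
  have mX : measurable_fun setT X by have /integrableP[/measurable_EFinP] := iX.
  apply: (@le_integrable _ _ _ P setT measurableT _ (EFin \o (fun w => b * X w))).
  - by apply/measurable_EFinP; exact: measurable_funM.
  - move=> w _ /=; rewrite lee_fin !normrM mulrC ler_wpM2r //.
    exact: (le_trans (hY w) (ler_norm _)).
  - exact: (@integrableZl _ _ _ P _ measurableT b _ iX).
apply: complex_eq; rewrite !(cReM, cImM) /= e1 e2.
- rewrite -(indep_entry_real pp mf1 g1 g1' b1 i1) -(indep_entry_real pp mf2 g2 g2' b2 i2).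
  rewrite -RintegralB //; last 2 first.
    exact: (prod_int (f1 \o entry2 H p.1 p.2)).
    exact: (prod_int (f2 \o entry2 H p.1 p.2)).
  by apply: eq_Rintegral => w _; rewrite cReM hH.
- rewrite -(indep_entry_real pp mf1 g2 g2' b2 i1) -(indep_entry_real pp mf2 g1 g1' b1 i2).
  rewrite -RintegralD //; last 2 first.
    exact: (prod_int (f1 \o entry2 H p.1 p.2)).
    exact: (prod_int (f2 \o entry2 H p.1 p.2)).
  by apply: eq_Rintegral => w _; rewrite cImM hH.
Qed.

Lemma indep_entry (p : 'I_N * 'I_N) (f : CC -> CC) phi (b : R) :
  (forall (d' : measure_display) (T' : measurableType d') (g : T' -> CC),
     cmeas g -> cmeas (fun w => f (g w))) -> mxmeas phi ->
  (forall X, hermx X -> cabs (phi X) <= b) -> Cint P (fun w => f (H w p.1 p.2)) ->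
  Ex P (fun w => f (H w p.1 p.2) * phi (kill p (H w))) =
  Ex P (fun w => f (H w p.1 p.2)) * Ex P (fun w => phi (kill p (H w))).
Proof.
move=> mf mphi hb hi.
have mpair : cmeas (fun ab : R * R => (ab.1 +i* ab.2)%C).
  by split; [exact: measurable_fst|exact: measurable_snd].
have [pp|pp] := leqP p.1 p.2.
  by apply: (indep_entry_le pp _ mphi hb hi); exact: mf.
(* Below the diagonal the entry is the conjugate of its mirror image, so f is composed with
   conjugation. *)
have e w : f (H w p.1 p.2) = (fun x => f (x^*)%C) (H w p.2 p.1).
  by rewrite /= -wigner_herm.
have ek w : kill p (H w) = kill (p.2, p.1) (H w).
  by case: p {pp hi e} => i j; rewrite kill_swap.
rewrite (eq_Ex _ e).
under eq_Ex do rewrite e ek; under [X in _ = _ * X]eq_Ex do rewrite ek.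
apply: (@indep_entry_le (p.2, p.1) (fun x => f (x^*)%C) phi b) => //.
- exact: ltnW.
- by apply: (mf _ _ (fun ab : R * R => ((ab.1 +i* ab.2)^*)%C)); exact: cmeasJ.
- by move: hi; congr (Cint P _); apply/funext => w; rewrite e.
Qed.

End WignerEntries.

(** * Expansion in one entry *)

Section Jets.
Context {R : realType}.
Local Notation CC := R[i].

(* [s] encodes the monomial that is the product of a factor x for each [true]
   and a factor conj(x) for each [false]; [mon1] and [mon2] are its Wirtinger
   derivatives. *)
Fixpoint mon (s : seq bool) (x : CC) : CC :=
  if s is b :: s' then (if b then x else (x^*)%C) * mon s' x else 1.
Fixpoint mon1 (s : seq bool) (x : CC) : CC :=
  if s is b :: s' then
    (if b then mon s' x + x * mon1 s' x else (x^*)%C * mon1 s' x) else 0.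
Fixpoint mon2 (s : seq bool) (x : CC) : CC :=
  if s is b :: s' then
    (if b then x * mon2 s' x else mon s' x + (x^*)%C * mon2 s' x) else 0.
(** One constant for all estimates on monomials. The recursion comes from the product rule:
    [mon12_diff] needs 3 K and [mon_diff] needs K + 1. *)
Fixpoint monK (s : seq bool) : R := if s is _ :: s' then 3 * monK s' + 1 else 1.

Lemma monK_ge1 s : 1 <= monK s.
Proof. by elim: s => [|b s IH] //=; lra. Qed.

Section Bounds.
Variables (Y : R).
Hypothesis Y0 : 0 < Y.
Local Notation k s := (size s).

Lemma mon_le s x : cabs x <= Y -> cabs (mon s x) <= Y ^+ k s.
Proof.
move=> hx; elim: s => [|b s IH] /=; first by rewrite expr0 cabs1.
rewrite cabsM exprS; apply: ler_pM; rewrite ?cabs_ge0 //.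
by case: b; rewrite ?cabsJ.
Qed.

(** Degrees are lowered by dividing by Y rather than in the exponent, so degrees 0 and 1 need no
    separate treatment. *)
Lemma mon12_le s x : cabs x <= Y ->
  cabs (mon1 s x) <= monK s * (Y ^+ k s / Y) /\
  cabs (mon2 s x) <= monK s * (Y ^+ k s / Y).
Proof.
move=> hx; elim: s => [|b s [IH1 IH2]] /=.
  by rewrite cabs0 expr0 mul1r mul1r invr_ge0 (ltW Y0).
have e : Y ^+ (k s).+1 / Y = Y ^+ k s by rewrite exprS; field; rewrite gt_eqF.
have hm := mon_le s hx; have K1 := monK_ge1 s.
have P0 : 0 <= Y ^+ k s by rewrite exprn_ge0 // ltW.
have aux u : cabs u <= monK s * (Y ^+ k s / Y) ->
    cabs x * cabs u <= monK s * Y ^+ k s.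
  move=> hu; have -> : monK s * Y ^+ k s = Y * (monK s * (Y ^+ k s / Y)).
    by field; rewrite gt_eqF.
  by apply: ler_pM; rewrite ?cabs_ge0.
have a1 := aux _ IH1; have a2 := aux _ IH2.
have KP : 0 <= monK s * Y ^+ k s by rewrite mulr_ge0 // (le_trans ler01).
rewrite e mulrDl mul1r -mulrA.
case: b; split.
- by apply: (le_trans (ler_cabsD _ _)); rewrite cabsM; lra.
- by rewrite cabsM; lra.
- by rewrite cabsM cabsJ; lra.
- by apply: (le_trans (ler_cabsD _ _)); rewrite cabsM cabsJ; lra.
Qed.

Lemma mon_diff s x y : cabs x <= Y -> cabs y <= Y ->
  cabs (mon s x - mon s y) <= monK s * (cabs (x - y) * (Y ^+ k s / Y)).
Proof.
move=> hx hy; elim: s => [|b s IH] /=.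
  rewrite subrr cabs0 !mul1r mulr_ge0 ?cabs_ge0 // invr_ge0 ltW //.
have e : Y ^+ (k s).+1 / Y = Y ^+ k s by rewrite exprS; field; rewrite gt_eqF.
have hm := mon_le s hx; have K1 := monK_ge1 s.
have P0 : 0 <= Y ^+ k s by rewrite exprn_ge0 // ltW.
have B0 := cabs_ge0 (x - y).
rewrite e mulrDl mul1r -mulrA.
set t := if b then x else _; set t' := if b then y else _.
have ht : cabs (t - t') = cabs (x - y).
  by rewrite /t /t'; case: (b) => //; rewrite -(rmorphB conjc) cabsJ.
have ht' : cabs t' <= Y by rewrite /t'; case: (b); rewrite ?cabsJ.
have -> : t * mon s x - t' * mon s y = (t - t') * mon s x + t' * (mon s x - mon s y) by ring.
apply: (le_trans (ler_cabsD _ _)); rewrite !cabsM ht.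
have h1 : cabs (x - y) * cabs (mon s x) <= cabs (x - y) * Y ^+ k s by rewrite ler_wpM2l.
have h2 : cabs t' * cabs (mon s x - mon s y) <= monK s * (cabs (x - y) * Y ^+ k s).
  have -> : monK s * (cabs (x - y) * Y ^+ k s) =
      Y * (monK s * (cabs (x - y) * (Y ^+ k s / Y))) by field; rewrite gt_eqF.
  by apply: ler_pM; rewrite ?cabs_ge0.
have BP : 0 <= monK s * (cabs (x - y) * Y ^+ k s).
  by rewrite !mulr_ge0 // (le_trans ler01).
lra.
Qed.

Lemma mon12_diff s x y : cabs x <= Y -> cabs y <= Y ->
  cabs (mon1 s x - mon1 s y) <= monK s * (cabs (x - y) * (Y ^+ k s / Y ^+ 2)) /\
  cabs (mon2 s x - mon2 s y) <= monK s * (cabs (x - y) * (Y ^+ k s / Y ^+ 2)).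
Proof.
move=> hx hy; elim: s => [|b s [IH1 IH2]] /=.
  rewrite subrr cabs0 !mul1r mulr_ge0 ?cabs_ge0 // ?invr_ge0 ?exprn_ge0 ?(ltW Y0) //.
have e : Y ^+ (k s).+1 / Y ^+ 2 = Y ^+ k s / Y by rewrite exprS; field; rewrite gt_eqF.
have hm := mon_diff s hx hy; have K1 := monK_ge1 s.
have [l1 l2] := mon12_le s hx.
have P0 : 0 <= Y ^+ k s / Y by rewrite divr_ge0 ?exprn_ge0 // ltW.
have B0 := cabs_ge0 (x - y).
have BP : 0 <= cabs (x - y) * (Y ^+ k s / Y) by rewrite mulr_ge0.
have KBP : 0 <= monK s * (cabs (x - y) * (Y ^+ k s / Y)).
  by rewrite mulr_ge0 // (le_trans ler01).
have aux t t' u u' : cabs (t - t') = cabs (x - y) -> cabs t' <= Y ->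
    cabs u <= monK s * (Y ^+ k s / Y) ->
    cabs (u - u') <= monK s * (cabs (x - y) * (Y ^+ k s / Y ^+ 2)) ->
    cabs (t * u - t' * u') <= 2 * (monK s * (cabs (x - y) * (Y ^+ k s / Y))).
  move=> ht ht' hu hu'.
  have -> : t * u - t' * u' = (t - t') * u + t' * (u - u') by ring.
  apply: (le_trans (ler_cabsD _ _)); rewrite !cabsM ht.
  have h1 : cabs (x - y) * cabs u <= monK s * (cabs (x - y) * (Y ^+ k s / Y)).
    by rewrite mulrCA ler_wpM2l.
  have h2 : cabs t' * cabs (u - u') <= monK s * (cabs (x - y) * (Y ^+ k s / Y)).
    have -> : monK s * (cabs (x - y) * (Y ^+ k s / Y)) =
      Y * (monK s * (cabs (x - y) * (Y ^+ k s / Y ^+ 2))) by field; rewrite gt_eqF.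
    by apply: ler_pM; rewrite ?cabs_ge0.
  lra.
have cj : cabs ((x^*)%C - (y^*)%C) = cabs (x - y) by rewrite -(rmorphB conjc) cabsJ.
have cy : cabs (y^*)%C <= Y by rewrite cabsJ.
rewrite e mulrDl mul1r -mulrA.
case: b; split.
- have -> : mon s x + x * mon1 s x - (mon s y + y * mon1 s y) =
    (mon s x - mon s y) + (x * mon1 s x - y * mon1 s y) by ring.
  apply: (le_trans (ler_cabsD _ _)); have := aux x y _ _ erefl hy l1 IH1; lra.
- by have := aux x y _ _ erefl hy l2 IH2; lra.
- by have := aux _ _ _ _ cj cy l1 IH1; lra.
- have -> : mon s x + (x^*)%C * mon2 s x - (mon s y + (y^*)%C * mon2 s y) =
    (mon s x - mon s y) + ((x^*)%C * mon2 s x - (y^*)%C * mon2 s y) by ring.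
  apply: (le_trans (ler_cabsD _ _)); have := aux _ _ _ _ cj cy l2 IH2; lra.
Qed.

(** Induction with the product rule: the remainder of t F is (t - t') (F(x) - F(y)) plus t' times
    the remainder of F, because the new factor t is itself x or its conjugate. *)
Lemma mon_taylor s x y : cabs x <= Y -> cabs y <= Y ->
  cabs (mon s x - mon s y - mon1 s y * (x - y) - mon2 s y * ((x - y)^*)%C) <=
  monK s * (cabs (x - y) ^+ 2 * (Y ^+ k s / Y ^+ 2)).
Proof.
move=> hx hy; elim: s => [|b s IH] /=.
  rewrite !mul0r !subr0 subrr cabs0 !mul1r mulr_ge0 ?exprn_ge0 ?cabs_ge0 //.
  by rewrite invr_ge0 exprn_ge0 // ltW.
have e : Y ^+ (k s).+1 / Y ^+ 2 = Y ^+ k s / Y by rewrite exprS; field; rewrite gt_eqF.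
have hm := mon_diff s hx hy; have K1 := monK_ge1 s.
have P0 : 0 <= Y ^+ k s / Y by rewrite divr_ge0 ?exprn_ge0 // ltW.
have B0 := cabs_ge0 (x - y).
have BP : 0 <= cabs (x - y) ^+ 2 * (Y ^+ k s / Y) by rewrite mulr_ge0 ?exprn_ge0.
have KBP : 0 <= monK s * (cabs (x - y) ^+ 2 * (Y ^+ k s / Y)).
  by rewrite mulr_ge0 // (le_trans ler01).
set t := if b then x else _; set t' := if b then y else _.
have ht : cabs (t - t') = cabs (x - y).
  by rewrite /t /t'; case: (b) => //; rewrite -(rmorphB conjc) cabsJ.
have ht' : cabs t' <= Y by rewrite /t'; case: (b); rewrite ?cabsJ.
have -> : t * mon s x - t' * mon s y -
   (if b then mon s y + y * mon1 s y else (y^*)%C * mon1 s y) * (x - y) -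
   (if b then y * mon2 s y else mon s y + (y^*)%C * mon2 s y) * ((x - y)^*)%C =
   (t - t') * (mon s x - mon s y) +
   t' * (mon s x - mon s y - mon1 s y * (x - y) - mon2 s y * ((x - y)^*)%C).
  by rewrite /t /t'; case: (b); rewrite ?(rmorphB conjc) /=; ring.
apply: (le_trans (ler_cabsD _ _)); rewrite !cabsM ht e mulrDl mul1r -mulrA.
have h1 : cabs (x - y) * cabs (mon s x - mon s y) <=
    monK s * (cabs (x - y) ^+ 2 * (Y ^+ k s / Y)).
  have -> : monK s * (cabs (x - y) ^+ 2 * (Y ^+ k s / Y)) =
    cabs (x - y) * (monK s * (cabs (x - y) * (Y ^+ k s / Y))) by ring.
  by rewrite ler_wpM2l.
have h2 : cabs t' * cabs (mon s x - mon s y - mon1 s y * (x - y) - mon2 s y * ((x - y)^*)%C) <=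
    monK s * (cabs (x - y) ^+ 2 * (Y ^+ k s / Y)).
  have -> : monK s * (cabs (x - y) ^+ 2 * (Y ^+ k s / Y)) =
    Y * (monK s * (cabs (x - y) ^+ 2 * (Y ^+ k s / Y ^+ 2))) by field; rewrite gt_eqF.
  by apply: ler_pM; rewrite ?cabs_ge0.
lra.
Qed.

End Bounds.

Lemma mxmeas_mon N (phi : 'M[CC]_N -> CC) s : mxmeas phi -> mxmeas (fun X => mon s (phi X)).
Proof.
move=> h; elim: s => [|b s IH] /=; first exact: mxmeas_cst.
by case: b; apply: mxmeasM => //; exact: mxmeasJ.
Qed.

Lemma mxmeas_mon12 N (phi : 'M[CC]_N -> CC) s : mxmeas phi ->
  mxmeas (fun X => mon1 s (phi X)) /\ mxmeas (fun X => mon2 s (phi X)).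
Proof.
move=> h; elim: s => [|b s [IH1 IH2]] /=; first by split; exact: mxmeas_cst.
have hj := mxmeasJ h; have hm := mxmeas_mon s h.
case: b; split.
- by apply: mxmeasD => //; exact: mxmeasM.
- exact: mxmeasM.
- exact: mxmeasM.
- by apply: mxmeasD => //; exact: mxmeasM.
Qed.

(** [mon (alt n) x] is conj(x) |x|^(2n), the cofactor of Q in the moment |Q|^(2n+2). *)
Fixpoint alt (n : nat) : seq bool :=
  if n is n'.+1 then true :: false :: alt n' else [:: false].

Lemma size_alt n : size (alt n) = (2 * n).+1.
Proof. by elim: n => // n IH /=; rewrite IH mulnS. Qed.

Lemma mon_alt n x : x * mon (alt n) x = (cabs x ^+ (2 * n).+2)%:C%C.
Proof.
elim: n => [|n IH] /=; first by rewrite mulr1 mulrC cabs_conjM.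
have -> : x * (x * ((x^*)%C * mon (alt n) x)) = ((x^*)%C * x) * (x * mon (alt n) x) by ring.
by rewrite IH cabs_conjM -rmorphM /= -exprD mulnS.
Qed.

End Jets.

(** * Error of the second-order expansion in one entry *)

Section EntryError.
Context {R : realType}.
Local Notation CC := R[i].

Lemma le_cabsD (a b : CC) A B : cabs a <= A -> cabs b <= B -> cabs (a + b) <= A + B.
Proof. by move=> h1 h2; apply: (le_trans (ler_cabsD _ _)); exact: lerD. Qed.
Lemma le_cabsB (a b : CC) A B : cabs a <= A -> cabs b <= B -> cabs (a - b) <= A + B.
Proof. by move=> h1 h2; apply: le_cabsD; rewrite ?cabsN. Qed.
Lemma le_cabsM (a b : CC) A B : cabs a <= A -> cabs b <= B -> cabs (a * b) <= A * B.
Proof. by move=> h1 h2; rewrite cabsM; apply: ler_pM; rewrite ?cabs_ge0. Qed.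
Lemma le_cabsJ (a : CC) A : cabs a <= A -> cabs (a^*)%C <= A.
Proof. by rewrite cabsJ. Qed.

(** Chain rule for [c * mon sq Q]. The derivative of conj(Q) in h is the conjugate of the derivative
    of Q in conj(h), whence the conjugated [Q2] in [jet1] and [Q1] in [jet2]. *)
Definition jet1 (sq : seq bool) (c c1 Q Q1 Q2 : CC) : CC :=
  c1 * mon sq Q + c * (mon1 sq Q * Q1 + mon2 sq Q * (Q2^*)%C).
Definition jet2 (sq : seq bool) (c c2 Q Q1 Q2 : CC) : CC :=
  c2 * mon sq Q + c * (mon1 sq Q * Q2 + mon2 sq Q * (Q1^*)%C).

Lemma jet1_diff sq (c ch c1 c1h Q Qh Q1 Q1h Q2 Q2h : CC) (Y : R) : 0 < Y ->
  cabs Q <= Y -> cabs Qh <= Y ->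
  let P := Y ^+ size sq in let K := monK sq in
  is_true (cabs (jet1 sq ch c1h Qh Q1h Q2h - jet1 sq c c1 Q Q1 Q2) <=
  cabs (c1h - c1) * P + cabs c1 * (K * (cabs (Q - Qh) * (P / Y))) +
  (cabs ch * (K * (P / Y)) * (cabs (Q1h - Q1) + cabs (Q2h - Q2)) +
   cabs (ch - c) * (K * (P / Y)) * (cabs Q1 + cabs Q2)) +
  cabs c * (K * (cabs (Q - Qh) * (P / Y ^+ 2))) * (cabs Q1 + cabs Q2)).
Proof.
move=> Y0 hQ hQh P K.
have mP := mon_le sq hQh.
have [d1 d2] := mon12_le Y0 sq hQh.
have md : cabs (mon sq Qh - mon sq Q) <= K * (cabs (Q - Qh) * (P / Y)).
  by rewrite cabsBC; exact: mon_diff.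
have [md1 md2] : cabs (mon1 sq Qh - mon1 sq Q) <= K * (cabs (Q - Qh) * (P / Y ^+ 2)) /\
   cabs (mon2 sq Qh - mon2 sq Q) <= K * (cabs (Q - Qh) * (P / Y ^+ 2)).
  by rewrite (cabsBC (mon1 _ _)) (cabsBC (mon2 _ _)); exact: mon12_diff.
rewrite /jet1.
have -> : c1h * mon sq Qh + ch * (mon1 sq Qh * Q1h + mon2 sq Qh * (Q2h^*)%C) -
   (c1 * mon sq Q + c * (mon1 sq Q * Q1 + mon2 sq Q * (Q2^*)%C)) =
   (c1h - c1) * mon sq Qh + c1 * (mon sq Qh - mon sq Q) +
   ((ch * mon1 sq Qh * (Q1h - Q1) + ch * mon2 sq Qh * ((Q2h - Q2)^*)%C) +
    ((ch - c) * mon1 sq Qh * Q1 + (ch - c) * mon2 sq Qh * (Q2^*)%C)) +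
   (c * (mon1 sq Qh - mon1 sq Q) * Q1 + c * (mon2 sq Qh - mon2 sq Q) * (Q2^*)%C).
  by rewrite (rmorphB conjc) /=; ring.
rewrite !(@mulrDr R).
apply: le_cabsD; first (apply: le_cabsD; first apply: le_cabsD).
- by apply: le_cabsM.
- by apply: le_cabsM.
- by apply: le_cabsD; apply: le_cabsD; apply: le_cabsM; rewrite ?cabsJ //; apply: le_cabsM.
- by apply: le_cabsD; apply: le_cabsM; rewrite ?cabsJ //; apply: le_cabsM.
Qed.

Lemma jet_taylor sq (h c ch c1h c2h Q Qh Q1h Q2h : CC) (Y : R) : 0 < Y ->
  cabs Q <= Y -> cabs Qh <= Y ->
  let P := Y ^+ size sq in let K := monK sq in
  let b := Q - Qh in
  let rc := c - ch - h * c1h - (h^*)%C * c2h in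
  let rQ := b - h * Q1h - (h^*)%C * Q2h in
  is_true (cabs (c * mon sq Q - ch * mon sq Qh - h * jet1 sq ch c1h Qh Q1h Q2h
     - (h^*)%C * jet2 sq ch c2h Qh Q1h Q2h) <=
  cabs rc * P + cabs (c - ch) * (K * (cabs b * (P / Y))) +
  cabs ch * (K * (cabs b ^+ 2 * (P / Y ^+ 2))) +
  cabs ch * (K * (P / Y) * cabs rQ + K * (P / Y) * cabs rQ)).
Proof.
move=> Y0 hQ hQh P K b rc rQ.
have mP := mon_le sq hQh.
have [d1 d2] := mon12_le Y0 sq hQh.
have md := mon_diff Y0 sq hQ hQh.
have mt := mon_taylor Y0 sq hQ hQh.
rewrite /jet2 /jet1.
set F := mon sq Q in mt md *; set Fh := mon sq Qh in mt mP md *.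
have -> : c * F - ch * Fh -
  h * (c1h * Fh + ch * (mon1 sq Qh * Q1h + mon2 sq Qh * (Q2h^*)%C)) -
  (h^*)%C * (c2h * Fh + ch * (mon1 sq Qh * Q2h + mon2 sq Qh * (Q1h^*)%C)) =
  rc * Fh + (c - ch) * (F - Fh) +
  ch * (F - Fh - mon1 sq Qh * b - mon2 sq Qh * (b^*)%C) +
  ch * (mon1 sq Qh * rQ + mon2 sq Qh * (rQ^*)%C).
  rewrite /rQ /rc /b !(rmorphB conjc, rmorphM conjc) /= conjcK; ring.
apply: le_cabsD; first (apply: le_cabsD; first apply: le_cabsD).
- by apply: le_cabsM.
- by apply: le_cabsM.
- by apply: le_cabsM.
- by apply: le_cabsM => //; apply: le_cabsD; apply: le_cabsM; rewrite ?cabsJ.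
Qed.

(** Here h is the entry, t1 and t2 stand for its second moments, and a suffix h marks values at the
    matrix without the entry. The groups are sorted by the number of powers of Y that have been
    differentiated away; they become [E1term], [E2term] and [E3term]. *)
Lemma entry_error sq (h c ch c1 c2 c1h c2h Q Qh Q1 Q2 Q1h Q2h t1 t2 : CC) (s Y : R) :
  0 < Y -> cabs Q <= Y -> cabs Qh <= Y -> cabs t1 <= s -> cabs t2 <= s ->
  let P := Y ^+ size sq in let K := monK sq in
  let b := cabs (Q - Qh) in
  let rc := cabs (c - ch - h * c1h - (h^*)%C * c2h) in
  let rQ := cabs (Q - Qh - h * Q1h - (h^*)%C * Q2h) in
  is_true (cabs (h * (c * mon sq Q - ch * mon sq Qh - h * jet1 sq ch c1h Qh Q1h Q2h
     - (h^*)%C * jet2 sq ch c2h Qh Q1h Q2h) +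
     t1 * (jet1 sq ch c1h Qh Q1h Q2h - jet1 sq c c1 Q Q1 Q2) +
     t2 * (jet2 sq ch c2h Qh Q1h Q2h - jet2 sq c c2 Q Q1 Q2)) <=
  2 * K * ((cabs h * rc + s * (cabs (c1h - c1) + cabs (c2h - c2))) * P +
   (cabs h * cabs (c - ch) * b + cabs h * cabs ch * rQ +
    s * (cabs (ch - c) * (cabs Q1 + cabs Q2) +
         cabs ch * (cabs (Q1h - Q1) + cabs (Q2h - Q2))) +
    s * (cabs c1 + cabs c2) * b) * (P / Y) +
   (cabs h * cabs ch * b ^+ 2 + s * cabs c * (cabs Q1 + cabs Q2) * b) * (P / Y ^+ 2))).
Proof.
move=> Y0 hQ hQh ht1 ht2 P K b rc rQ.
have K1 : 1 <= K := monK_ge1 sq.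
have s0 : 0 <= s := le_trans (cabs_ge0 _) ht1.
have j1 := jet1_diff sq c ch c1 c1h Q1 Q1h Q2 Q2h Y0 hQ hQh.
have j2 := jet1_diff sq c ch c2 c2h Q2 Q2h Q1 Q1h Y0 hQ hQh.
have jt := jet_taylor sq h c ch c1h c2h Q1h Q2h Y0 hQ hQh.
have B := le_cabsD (le_cabsD (le_cabsM (lexx (cabs h)) jt) (le_cabsM ht1 j1)) (le_cabsM ht2 j2).
apply: (le_trans B) => {B jt j1 j2}.
rewrite -/P -/K -/b -/rc -/rQ.
have P0 : 0 <= P by rewrite exprn_ge0 // ltW.
have u0 : 0 <= P / Y by rewrite divr_ge0 // ltW.
have v0 : 0 <= P / Y ^+ 2 by rewrite divr_ge0 // exprn_ge0 // ltW.
move: (P / Y) (P / Y ^+ 2) u0 v0 P0 => u v u0 v0 P0; move: P P0 => {}P P0.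
have b0 : 0 <= b by exact: cabs_ge0.
have rc0 : 0 <= rc by exact: cabs_ge0.
have rQ0 : 0 <= rQ by exact: cabs_ge0.
rewrite (cabsBC ch c) [cabs (Q2h - Q2) + _]addrC [cabs Q2 + _]addrC.
clearbody b rc rQ.
have := cabs_ge0 h; move: (cabs h) => a a0.
have := cabs_ge0 (c - ch); move: (cabs (c - ch)) => dc dc0.
have := cabs_ge0 ch; move: (cabs ch) => lch lch0.
have d0 := addr_ge0 (cabs_ge0 (Q1h - Q1)) (cabs_ge0 (Q2h - Q2)).
move: (_ + _) d0 => dQ dQ0.
have d0 := addr_ge0 (cabs_ge0 Q1) (cabs_ge0 Q2).
move: (cabs Q1 + _) d0 => lQ lQ0.
have := cabs_ge0 (c1h - c1); move: (cabs (c1h - c1)) => e1 e10.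
have := cabs_ge0 (c2h - c2); move: (cabs (c2h - c2)) => e2 e20.
have := cabs_ge0 c1; move: (cabs c1) => l1 l10.
have := cabs_ge0 c2; move: (cabs c2) => l2 l20.
have := cabs_ge0 c; move: (cabs c) => lc lc0.
(* The three nonnegative terms [n1], [n2], [n3] add up exactly to the right side minus the left
   side, which [ring] confirms. *)
have n1 : 0 <= (2 * K - 1) * ((a * rc + s * (e1 + e2)) * P).
  have k0 : 0 <= 2 * K - 1 by lra.
  by apply: mulr_ge0 => //; rewrite !(mulr_ge0, addr_ge0).
have n2 : 0 <= K * (a * dc * b + s * (l1 + l2) * b) * u.
  by rewrite !(mulr_ge0, addr_ge0) // (le_trans ler01).
have n3 : 0 <= K * (a * lch * b ^+ 2) * v.
  by rewrite !(mulr_ge0, addr_ge0, sqr_ge0) // (le_trans ler01).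
rewrite -subr_ge0; apply: le_trans (addr_ge0 (addr_ge0 n1 n2) n3) _.
by rewrite le_eqVlt; apply/orP; left; apply/eqP; ring.
Qed.

End EntryError.

(** * Second moments of an entry and the expansion of an expectation *)

Section Moments.
Context {R : realType} {N : nat} {d : measure_display} {T : measurableType d}
  (P : probability T R) (H : T -> 'M[R[i]]_N) (C : R) (Cp : nat -> R).
Local Notation CC := R[i].
Hypothesis W : wigner_type C Cp P H.

Definition Sv (p : 'I_N * 'I_N) : R := Rintegral P setT (fun w => cabs (H w p.1 p.2) ^+ 2).
(** For complex entries this second moment is not determined by the variance and need not vanish;
    what is used about it is [Tv_le]. *)
Definition Tv (p : 'I_N * 'I_N) : CC := Ex P (fun w => H w p.1 p.2 ^+ 2).

Lemma scaled_entry_moment k (i j : 'I_N) :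
  P.-integrable setT (EFin \o (fun w => (Num.sqrt N%:R * cabs (H w i j)) ^+ k)) /\
  Rintegral P setT (fun w => (Num.sqrt N%:R * cabs (H w i j)) ^+ k) <= Cp k.
Proof.
have [_ [_ [_ [_ [_ [_ h]]]]]] := W; have hk := h k i j.
have mf : measurable_fun setT (fun w => (Num.sqrt N%:R * cabs (H w i j)) ^+ k).
  apply: measurable_funX; apply: measurable_funM; first exact: measurable_cst.
  exact: measurable_cabs (cmeas_entry W i j).
have f0 w : 0 <= (Num.sqrt N%:R * cabs (H w i j)) ^+ k.
  by rewrite exprn_ge0 // mulr_ge0 ?sqrtr_ge0 ?cabs_ge0.
have ip : P.-integrable setT (EFin \o (fun w => (Num.sqrt N%:R * cabs (H w i j)) ^+ k)).
  apply/integrableP; split; first exact/measurable_EFinP.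
  under eq_integral => w _ do rewrite /= ger0_norm //.
  exact: (le_lt_trans hk (ltry _)).
split=> //; rewrite -lee_fin /Rintegral fineK //.
exact: (integrable_fin_num measurableT ip).
Qed.

Lemma N_ge1 (i : 'I_N) : 1 <= N%:R :> R.
Proof. by rewrite ler1n (leq_ltn_trans (leq0n i)). Qed.

Lemma entry_moment k (i j : 'I_N) :
  P.-integrable setT (EFin \o (fun w => cabs (H w i j) ^+ k)) /\
  Rintegral P setT (fun w => cabs (H w i j) ^+ k) <= Cp k.
Proof.
have [i1 i2] := scaled_entry_moment k i j.
have hle w : cabs (H w i j) ^+ k <= (Num.sqrt N%:R * cabs (H w i j)) ^+ k.
  apply: lerXn2r; rewrite ?nnegrE ?mulr_ge0 ?sqrtr_ge0 ?cabs_ge0 //.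
  by rewrite ler_peMl ?cabs_ge0 // -{1}sqrtr1 ler_wsqrtr // (N_ge1 i).
have ip : P.-integrable setT (EFin \o (fun w => cabs (H w i j) ^+ k)).
  apply: (le_integrable measurableT _ _ i1).
    apply/measurable_EFinP; apply: measurable_funX.
    exact: measurable_cabs (cmeas_entry W i j).
  move=> w _ /=; rewrite lee_fin !ger0_norm ?hle //.
    by rewrite exprn_ge0 // mulr_ge0 ?sqrtr_ge0 ?cabs_ge0.
  by rewrite exprn_ge0 ?cabs_ge0.
split=> //; apply: le_trans i2; exact: le_Rintegral.
Qed.

Lemma Cint_entry_prod k (i j : 'I_N) (x y : T -> CC) (b : R) :
  cmeas x -> cmeas y -> (forall w, cabs (x w) <= cabs (H w i j) ^+ k) ->
  (forall w, cabs (y w) <= b) -> Cint P (fun w => x w * y w).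
Proof.
move=> mx my hx hy; have [ik _] := entry_moment k i j.
apply: (@Cint_le _ _ _ P _ (fun w => b * cabs (H w i j) ^+ k)).
- exact: cmeasM.
- exact: (@integrableZl _ _ _ P _ measurableT b _ ik).
- move=> w; rewrite cabsM mulrC; apply: ler_pM; rewrite ?cabs_ge0 //.
Qed.

Lemma Cint_entryX k (i j : 'I_N) : Cint P (fun w => H w i j ^+ k).
Proof.
have [ik _] := entry_moment k i j.
apply: (Cint_le _ ik) => [|w]; last by rewrite cabsX.
exact/cmeasX/(cmeas_entry W).
Qed.

Lemma Cint_entry_normsq (i j : 'I_N) : Cint P (fun w => H w i j * ((H w i j)^*)%C).
Proof.
have [ik _] := entry_moment 2 i j; have m := cmeas_entry W i j.
apply: (Cint_le _ ik) => [|w]; last by rewrite cabsM cabsJ expr2.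
by apply: cmeasM => //; exact: cmeasJ.
Qed.

Lemma Ex_entry (i j : 'I_N) : Ex P (fun w => H w i j) = 0.
Proof.
have [_ [_ [_ [h _]]]] := W; have [h1 h2] := h i j.
by rewrite /Ex /Rintegral h1 h2 /=.
Qed.

Lemma Ex_entry_normsq p : Ex P (fun w => H w p.1 p.2 * ((H w p.1 p.2)^*)%C) = (Sv p)%:C%C.
Proof.
apply: complex_eq; rewrite /Ex /=.
  apply: eq_Rintegral => w _; rewrite mulrC cabs_conjM //.
transitivity (Rintegral P setT (fun=> 0 : R)); last first.
  by rewrite (Rintegral_cst P measurableT 0) mul0r.
apply: eq_Rintegral => w _; rewrite mulrC cabs_conjM //.
Qed.

Lemma Sv_ge0 p : 0 <= Sv p.
Proof. by apply: Rintegral_ge0 => w _; exact: sqr_ge0. Qed.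

Lemma Sv_E p : (\int[P]_w (cabs (H w p.1 p.2) ^+ 2)%:E = (Sv p)%:E)%E.
Proof.
have [i2 _] := entry_moment 2 p.1 p.2.
by rewrite /Sv /Rintegral fineK //; exact: (integrable_fin_num measurableT i2).
Qed.

Lemma Sv_bounds p : C^-1 <= N%:R * Sv p <= C.
Proof.
have [_ [_ [_ [_ [h _]]]]] := W; have := h p.1 p.2.
by rewrite Sv_E -EFinM !lee_fin.
Qed.

Lemma Sv_row i : \sum_j Sv (i, j) = 1.
Proof.
have [_ [_ [_ [_ [_ [h _]]]]]] := W; have := h i.
under eq_bigr => j _ do rewrite (Sv_E (i, j)).
by rewrite sumEFin => -[].
Qed.

Lemma Sv_sym i j : Sv (i, j) = Sv (j, i).
Proof. by apply: eq_Rintegral => w _ /=; rewrite (wigner_herm W) cabsJ. Qed.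

(** Rotating f by the conjugate of its expectation e turns |e|^2 into the real part of an
    expectation, which is at most |e| times the integral of g. *)
Lemma Re_Ex_le_abs (f : T -> CC) (g : T -> R) : cmeas f -> P.-integrable setT (EFin \o g) ->
  (forall w, cabs (f w) <= g w) -> cabs (Ex P f) <= Rintegral P setT g.
Proof.
move=> mf ig h; set e := Ex P f.
have [e0|e0] := eqVneq (cabs e) 0.
  rewrite e0; apply: Rintegral_ge0 => w _; exact: le_trans (cabs_ge0 _) (h w).
have ep : 0 < cabs e by rewrite lt_def e0 cabs_ge0.
have ci : Cint P f := Cint_le mf ig h.
have hh w : cabs ((e^*)%C * f w) <= cabs e * g w by rewrite cabsM cabsJ ler_pM2l.
have := @Re_Ex_le _ _ _ P (fun w => (e^*)%C * f w) (fun w => cabs e * g w) _ _ _.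
rewrite ExZ // cabs_conjM RintegralZl //= expr2 ler_pM2l //; apply.
- exact: CintZ.
- exact: (@integrableZl _ _ _ P _ measurableT _ _ ig).
- move=> w; apply: le_trans (ler_norm _) (le_trans (Re_le_cabs _) _).
  exact: hh.
Qed.

Lemma Tv_le p : cabs (Tv p) <= Sv p.
Proof.
have [i2 _] := entry_moment 2 p.1 p.2.
apply: Re_Ex_le_abs => // [|w]; last by rewrite cabsX.
exact/cmeasX/(cmeas_entry W).
Qed.

(** Two kinds of error: the entry times the Taylor remainder of f around the matrix without the
    entry, and the change when the derivatives are moved from that matrix back to X. *)
Definition remainder (f f1 f2 : 'M[CC]_N -> CC) (p : 'I_N * 'I_N) (X : 'M[CC]_N) : CC :=
  let h := X p.1 p.2 in let Xk := kill p X in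
  h * (f X - f Xk - h * f1 Xk - (h^*)%C * f2 Xk) +
  Tv p * (f1 Xk - f1 X) + (Sv p)%:C%C * (f2 Xk - f2 X).

(** Independence of h and the killed matrix gives E h f = 0, E h^2 f1 = Tv E f1 and E |h|^2 f2 = Sv
    E f2, with f, f1, f2 taken at the killed matrix. Everything else is collected in [remainder]. *)
Lemma Ex_expand f f1 f2 p b :
  mxmeas f -> mxmeas f1 -> mxmeas f2 ->
  (forall X, hermx X -> cabs (f X) <= b) -> (forall X, hermx X -> cabs (f1 X) <= b) ->
  (forall X, hermx X -> cabs (f2 X) <= b) ->
  Ex P (fun w => H w p.1 p.2 * f (H w)) =
  Ex P (fun w => remainder f f1 f2 p (H w) +
    (Tv p * f1 (H w) + (Sv p)%:C%C * f2 (H w))).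
Proof.
move=> mf mf1 mf2 bf bf1 bf2.
have hH := wigner_herm W; have hK w := herm_kill p (hH w).
have mh := cmeas_entry W p.1 p.2.
have mk g := fun mg => mxmeasH W (@mxmeas_kill R N p g mg).
have e0 : Ex P (fun w => H w p.1 p.2 * f (kill p (H w))) = 0.
  rewrite (@indep_entry _ _ _ _ _ _ _ _ W p id f b) ?Ex_entry ?mul0r //.
  by have := Cint_entryX 1 p.1 p.2.
have e1 : Ex P (fun w => H w p.1 p.2 ^+ 2 * f1 (kill p (H w))) =
    Tv p * Ex P (fun w => f1 (kill p (H w))).
  rewrite (@indep_entry _ _ _ _ _ _ _ _ W p (fun x => x ^+ 2) f1 b) //.
    by move=> *; exact: cmeasX.
  exact: Cint_entryX.
have e2 : Ex P (fun w => H w p.1 p.2 * ((H w p.1 p.2)^*)%C * f2 (kill p (H w))) =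
    (Sv p)%:C%C * Ex P (fun w => f2 (kill p (H w))).
  rewrite (@indep_entry _ _ _ _ _ _ _ _ W p (fun x => x * (x^*)%C) f2 b) //.
  - by rewrite Ex_entry_normsq.
  - by move=> *; apply: cmeasM => //; exact: cmeasJ.
  - exact: Cint_entry_normsq.
have i0 : Cint P (fun w => H w p.1 p.2 * f (kill p (H w))).
  apply: (@Cint_entry_prod 1 p.1 p.2 _ _ b) => //; first exact: mk.
  by move=> w; exact: bf.
have i1 : Cint P (fun w => H w p.1 p.2 ^+ 2 * f1 (kill p (H w))).
  apply: (@Cint_entry_prod 2 p.1 p.2 _ _ b) => //; first exact: cmeasX.
  - exact: mk.
  - by move=> w; rewrite cabsX.
  - by move=> w; exact: bf1.
have i2 : Cint P (fun w => H w p.1 p.2 * ((H w p.1 p.2)^*)%C * f2 (kill p (H w))).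
  apply: (@Cint_entry_prod 2 p.1 p.2 _ _ b) => //.
  - by apply: cmeasM => //; exact: cmeasJ.
  - exact: mk.
  - by move=> w; rewrite cabsM cabsJ expr2.
  - by move=> w; exact: bf2.
have k1 : Cint P (fun w => f1 (kill p (H w))).
  by apply: (@Cint_bounded _ _ _ P _ b) => [|w]; [exact: mk|exact: bf1].
have k2 : Cint P (fun w => f2 (kill p (H w))).
  by apply: (@Cint_bounded _ _ _ P _ b) => [|w]; [exact: mk|exact: bf2].
(* g has mean zero, and subtracting it turns the left integrand into the right one pointwise. *)
pose g w := H w p.1 p.2 * f (kill p (H w)) +
  ((H w p.1 p.2 ^+ 2 * f1 (kill p (H w)) + - Tv p * f1 (kill p (H w))) +
   (H w p.1 p.2 * ((H w p.1 p.2)^*)%C * f2 (kill p (H w)) +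
    - (Sv p)%:C%C * f2 (kill p (H w)))).
have ig1 : Cint P (fun w => H w p.1 p.2 ^+ 2 * f1 (kill p (H w)) + - Tv p * f1 (kill p (H w))).
  by apply: CintD => //; exact: CintZ.
have ig2 : Cint P (fun w => H w p.1 p.2 * ((H w p.1 p.2)^*)%C * f2 (kill p (H w)) +
    - (Sv p)%:C%C * f2 (kill p (H w))).
  by apply: CintD => //; exact: CintZ.
have ig : Cint P g by apply: CintD => //; exact: CintD.
have Eg : Ex P g = 0.
  rewrite /g ExD //; last exact: CintD.
  rewrite (ExD ig1 ig2) (ExD i1) ?(ExD i2); try exact: CintZ.
  by rewrite e0 e1 e2 !ExZ // !mulNr !subrr !addr0.
have iL : Cint P (fun w => H w p.1 p.2 * f (H w)).
  apply: (@Cint_entry_prod 1 p.1 p.2 _ _ b) => //; first exact: (mxmeasH W mf).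
  by move=> w; exact: bf.
have iN : Cint P (fun w => -1 * g w) by exact: CintZ.
rewrite -[LHS]addr0 -[0 in LHS]oppr0 -{1}Eg -mulN1r -ExZ // -ExD //.
apply: eq_Ex => w; rewrite /remainder /g; ring.
Qed.

End Moments.

(** * High moments *)

Record mmdata {R : realType} (N : nat) := MMData {
  mQ : 'M[R[i]]_N -> R[i];
  mq : 'M[R[i]]_N -> R[i];
  mc : 'I_N * 'I_N -> 'M[R[i]]_N -> R[i];
  mc1 : 'I_N * 'I_N -> 'M[R[i]]_N -> R[i];
  mc2 : 'I_N * 'I_N -> 'M[R[i]]_N -> R[i];
  mQ1 : 'I_N * 'I_N -> 'M[R[i]]_N -> R[i];
  mQ2 : 'I_N * 'I_N -> 'M[R[i]]_N -> R[i] }.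

Section MomentBound.
Context {R : realType} {N : nat}.
Local Notation CC := R[i].
Implicit Types (X : 'M[CC]_N) (D : @mmdata R N).

(* [mQ] is a linear form in the entries with coefficients [mc], plus [mq];
   the suffixes 1 and 2 denote the derivatives in X_p and conj(X_p). *)
Record admissible (D : @mmdata R N) (b : R) : Prop := Admissible {
  ad_mQ : mxmeas (mQ D); ad_mq : mxmeas (mq D);
  ad_mc : forall p, mxmeas (mc D p);
  ad_mc1 : forall p, mxmeas (mc1 D p); ad_mc2 : forall p, mxmeas (mc2 D p);
  ad_mQ1 : forall p, mxmeas (mQ1 D p); ad_mQ2 : forall p, mxmeas (mQ2 D p);
  ad_b1 : 1 <= b;
  ad_Q : forall X, hermx X -> cabs (mQ D X) <= b;
  ad_q : forall X, hermx X -> cabs (mq D X) <= b;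
  ad_c : forall p X, hermx X -> cabs (mc D p X) <= b;
  ad_c1 : forall p X, hermx X -> cabs (mc1 D p X) <= b;
  ad_c2 : forall p X, hermx X -> cabs (mc2 D p X) <= b;
  ad_Q1 : forall p X, hermx X -> cabs (mQ1 D p X) <= b;
  ad_Q2 : forall p X, hermx X -> cabs (mQ2 D p X) <= b;
  ad_eq : forall X, hermx X -> mQ D X = \sum_p X p.1 p.2 * mc D p X + mq D X }.

Definition cerr D p X := cabs (mc D p X - mc D p (kill p X) -
  X p.1 p.2 * mc1 D p (kill p X) - ((X p.1 p.2)^*)%C * mc2 D p (kill p X)).
Definition Qdiff D p X := cabs (mQ D X - mQ D (kill p X)).
Definition Qerr D p X := cabs (mQ D X - mQ D (kill p X) -
  X p.1 p.2 * mQ1 D p (kill p X) - ((X p.1 p.2)^*)%C * mQ2 D p (kill p X)).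

(** The groups of [entry_error]: they multiply the bound Y^(2n+1) of the cofactor with 0, 1 or 2
    powers of Y removed. *)
Definition E1term (s : R) D p X :=
  cabs (X p.1 p.2) * cerr D p X +
  s * (cabs (mc1 D p (kill p X) - mc1 D p X) + cabs (mc2 D p (kill p X) - mc2 D p X)).
Definition E2term (s : R) D p X :=
  cabs (X p.1 p.2) * cabs (mc D p X - mc D p (kill p X)) * Qdiff D p X +
  cabs (X p.1 p.2) * cabs (mc D p (kill p X)) * Qerr D p X +
  s * (cabs (mc D p (kill p X) - mc D p X) * (cabs (mQ1 D p X) + cabs (mQ2 D p X)) +
       cabs (mc D p (kill p X)) *
         (cabs (mQ1 D p (kill p X) - mQ1 D p X) + cabs (mQ2 D p (kill p X) - mQ2 D p X))) +
  s * (cabs (mc1 D p X) + cabs (mc2 D p X)) * Qdiff D p X.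
Definition E3term (s : R) D p X :=
  cabs (X p.1 p.2) * cabs (mc D p (kill p X)) * Qdiff D p X ^+ 2 +
  s * cabs (mc D p X) * (cabs (mQ1 D p X) + cabs (mQ2 D p X)) * Qdiff D p X.

(** M0 multiplies the undifferentiated cofactor, and there the cancellation against [mq] takes
    place; M1 and M2 multiply its two derivatives. Each lost power of Q is paid by one more power of
    A, so every term is at most A (|Q| + A)^(2n+1) up to constants. *)
Record good (S : 'I_N * 'I_N -> R) (T : 'I_N * 'I_N -> CC) (s A : R) D X : Prop := Good {
  good_M0 : cabs (mq D X + \sum_p (T p * mc1 D p X + (S p)%:C%C * mc2 D p X)) <= A;
  good_M1 : cabs (\sum_p (T p * (mc D p X * mQ1 D p X) + (S p)%:C%C * (mc D p X * mQ2 D p X)))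
     <= A ^+ 2;
  good_M2 : cabs (\sum_p (T p * (mc D p X * ((mQ2 D p X)^*)%C) +
     (S p)%:C%C * (mc D p X * ((mQ1 D p X)^*)%C))) <= A ^+ 2;
  good_b : forall p, Qdiff D p X <= A;
  good_E1 : \sum_p E1term s D p X <= A;
  good_E2 : \sum_p E2term s D p X <= A ^+ 2;
  good_E3 : \sum_p E3term s D p X <= A ^+ 3 }.

Context {d : measure_display} {T : measurableType d} (P : probability T R)
  (H : T -> 'M[R[i]]_N) (C : R) (Cp : nat -> R).
Hypothesis W : wigner_type C Cp P H.
Variables (D : @mmdata R N) (b0 : R) (n : nat).
Hypothesis aD : admissible D b0.

Local Notation sq := (alt n).
Local Notation K := (@monK R (alt n)).
Let F X := mon sq (mQ D X).
Let f p X := mc D p X * F X.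
Let f1 p X := jet1 sq (mc D p X) (mc1 D p X) (mQ D X) (mQ1 D p X) (mQ2 D p X).
Let f2 p X := jet2 sq (mc D p X) (mc2 D p X) (mQ D X) (mQ1 D p X) (mQ2 D p X).

(** The integrand after expansion of every entry of the linear form: its expectation is E
    |Q|^(2n+2), as shown inside [moment_bound]. *)
Definition Zint X : CC :=
  \sum_p (remainder P H (f p) (f1 p) (f2 p) p X +
    (Tv P H p * f1 p X + (Sv P H p)%:C%C * f2 p X)) + mq D X * F X.

Lemma mxmeas_f p : mxmeas (f p).
Proof.
by apply: mxmeasM; [exact: ad_mc aD p|apply: mxmeas_mon; exact: ad_mQ aD].
Qed.

Lemma mxmeas_f12 p : mxmeas (f1 p) /\ mxmeas (f2 p).
Proof.
have mF := mxmeas_mon sq (ad_mQ aD); have [m1 m2] := mxmeas_mon12 sq (ad_mQ aD).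
have [hc hc1 hc2 hQ1 hQ2] := And5 (ad_mc aD p) (ad_mc1 aD p) (ad_mc2 aD p) (ad_mQ1 aD p) (ad_mQ2 aD p).
split; apply: mxmeasD; apply: mxmeasM => //; apply: mxmeasD; apply: mxmeasM => //;
  exact: mxmeasJ.
Qed.

Let b2 := (1 + 2 * K) * (b0 * b0 ^+ size sq).

Lemma b2_ge1 : 1 <= b2.
Proof.
have b1 := ad_b1 aD; have K1 := @monK_ge1 R sq.
have h : 1 <= b0 * b0 ^+ size sq by rewrite -exprS exprn_ege1.
by rewrite -[1]mulr1; apply: ler_pM => //; lra.
Qed.

Lemma f_bounds p X : hermx X ->
  [/\ cabs (f p X) <= b2, cabs (f1 p X) <= b2, cabs (f2 p X) <= b2 & cabs (mq D X * F X) <= b2].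
Proof.
move=> hX; have b1 := ad_b1 aD; have K1 := @monK_ge1 R sq.
have b0p : 0 < b0 := lt_le_trans ltr01 b1.
have hQ := ad_Q aD hX; have hF := mon_le sq hQ.
have [h1 h2] := mon12_le b0p sq hQ.
have B0 : 0 <= b0 * b0 ^+ size sq by rewrite mulr_ge0 ?exprn_ge0 ?(ltW b0p).
have KB : 0 <= K * (b0 * b0 ^+ size sq) by rewrite mulr_ge0 // (le_trans ler01).
have aux c c' Q1 Q2 : cabs c <= b0 -> cabs c' <= b0 -> cabs Q1 <= b0 -> cabs Q2 <= b0 ->
    cabs (jet1 sq c c' (mQ D X) Q1 Q2) <= b2.
  move=> hc hc' hQ1 hQ2.
  have := le_cabsD (le_cabsM hc' hF) (le_cabsM hc (le_cabsD (le_cabsM h1 hQ1)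
    (le_cabsM h2 (le_cabsJ hQ2)))).
  rewrite /jet1 => /le_trans; apply; rewrite /b2.
  rewrite le_eqVlt; apply/orP; left; apply/eqP; field; by rewrite gt_eqF.
have aux0 c : cabs c <= b0 -> cabs (c * F X) <= b2.
  move=> hc; have := le_cabsM hc hF; move/le_trans; apply; rewrite /b2; lra.
have [hc hc1 hc2 hQ1 hQ2] := And5 (ad_c aD p hX) (ad_c1 aD p hX) (ad_c2 aD p hX)
  (ad_Q1 aD p hX) (ad_Q2 aD p hX).
split; [exact: aux0|exact: aux|exact: aux|apply: aux0; exact: (ad_q aD hX)].
Qed.

Lemma mxmeas_remainder p : mxmeas (fun X => remainder P H (f p) (f1 p) (f2 p) p X +
    (Tv P H p * f1 p X + (Sv P H p)%:C%C * f2 p X)).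
Proof.
have [m1 m2] := mxmeas_f12 p; have m0 := mxmeas_f p.
have me := @mxmeas_entry R N p.1 p.2; have mk g := fun mg => @mxmeas_kill R N p g mg.
have mZ a (g : 'M[CC]_N -> CC) : mxmeas g -> mxmeas (fun X => a * g X).
  by move=> mg; apply: mxmeasM => //; exact: mxmeas_cst.
apply: mxmeasD; last by apply: mxmeasD; exact: mZ.
rewrite /remainder /=; apply: mxmeasD; first apply: mxmeasD.
- apply: mxmeasM => //; apply: mxmeasB; last by apply: mxmeasM; [exact: mxmeasJ|exact: mk].
  apply: mxmeasB; last by apply: mxmeasM => //; exact: mk.
  by apply: mxmeasB => //; exact: mk.
- apply: mZ; apply: mxmeasB => //; exact: mk.
- apply: mZ; apply: mxmeasB => //; exact: mk.
Qed.

Lemma mxmeas_Zint : mxmeas Zint.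
Proof.
apply: mxmeasD; last first.
  by apply: mxmeasM; [exact: ad_mq aD|apply: mxmeas_mon; exact: ad_mQ aD].
move=> d' T' X hX hX'; apply: cmeas_sum => p.
exact: (mxmeas_remainder p hX hX').
Qed.

Lemma Sv_le1 p : Sv P H p <= 1.
Proof.
rewrite -(Sv_row W p.1) {1}(surjective_pairing p).
apply: (@le_sum_term _ _ (fun j => Sv P H (p.1, j))) => j; exact: Sv_ge0.
Qed.

Definition Zterm_bound p X : hermx X ->
  cabs (remainder P H (f p) (f1 p) (f2 p) p X +
    (Tv P H p * f1 p X + (Sv P H p)%:C%C * f2 p X)) <=
  b2 * (3 * cabs (X p.1 p.2) ^+ 2 + 7).
Proof.
move=> hX; have hK := herm_kill p hX.
have [h0 h1 h2 _] := f_bounds p hX; have [k0 k1 k2 _] := f_bounds p hK.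
have t1 : cabs (Tv P H p) <= 1 := le_trans (Tv_le W p) (Sv_le1 p).
have s1 : cabs ((Sv P H p)%:C%C) <= 1 by rewrite cabs_real ger0_norm ?Sv_ge0 ?Sv_le1.
have e := lexx (cabs (X p.1 p.2)).
have := le_cabsD (le_cabsD (le_cabsD (le_cabsM e
   (le_cabsB (le_cabsB (le_cabsB h0 k0) (le_cabsM e k1)) (le_cabsM (le_cabsJ e) k2)))
   (le_cabsM t1 (le_cabsB k1 h1))) (le_cabsM s1 (le_cabsB k2 h2)))
   (le_cabsD (le_cabsM t1 h1) (le_cabsM s1 h2)).
rewrite /remainder /=; move/le_trans; apply.
have B := le_trans ler01 b2_ge1; move: (cabs _) => x; move: b2 B => b B.
rewrite -subr_ge0.
have -> : b * (3 * x ^+ 2 + 7) - (x * (b + b + x * b + x * b) + 1 * (b + b) + 1 * (b + b) +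
  (1 * b + 1 * b)) = b * (x - 1) ^+ 2 by ring.
by rewrite mulr_ge0 ?sqr_ge0.
Qed.

Definition Venv X : R := 1 + \sum_(p : 'I_N * 'I_N) cabs (X p.1 p.2) ^+ 2.

(** For use on the exceptional event: valid at every Hermitian matrix, and quadratic growth in the
    entries is affordable because their fourth moments are bounded. *)
Lemma Zint_bound X : hermx X -> cabs (Zint X) <=
  8 * (N%:R ^+ 2 + 1) * b2 * Venv X.
Proof.
move=> hX; rewrite /Zint.
have B1 := b2_ge1; have B : 0 <= b2 by exact: le_trans ler01 B1.
have hq : cabs (mq D X * F X) <= b2.
  have hF := mon_le sq (ad_Q aD hX).
  have := le_cabsM (ad_q aD hX) hF; move/le_trans; apply; rewrite /b2.
  rewrite ler_peMl ?mulr_ge0 ?exprn_ge0 ?(le_trans ler01 (ad_b1 aD)) //.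
  by have := @monK_ge1 R sq; lra.
apply: (le_trans (le_cabsD (le_trans (cabs_sum _ _ _)
   (ler_sum _ (fun p _ => Zterm_bound p hX))) hq)).
rewrite -mulr_sumr big_split /= -mulr_sumr /Venv.
set V := \sum_(_ : _ * _) _.
have V0 : 0 <= V by apply: sumr_ge0 => p _; exact: sqr_ge0.
have -> : \sum_(p : 'I_N * 'I_N) 7 = 7 * N%:R ^+ 2 :> R.
  rewrite big_const iter_addr_0 card_prod card_ord -[7 *+ _]mulr_natr natrM expr2 //.
have n0 : 0 <= N%:R ^+ 2 :> R by rewrite sqr_ge0.
have nV := mulr_ge0 n0 V0; move: (N%:R ^+ 2) n0 nV => n' n0 nV.
rewrite -subr_ge0; have -> : 8 * (n' + 1) * b2 * (1 + V) - (b2 * (3 * V + 7 * n') + b2) =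
  b2 * (n' + 8 * (n' * V) + 7 + 5 * V) by ring.
by apply: mulr_ge0 => //; lra.
Qed.

(** Y = |Q| + A dominates Q before and after the removal of any entry, and A <= Y pays for each
    division by Y. The constant is 2 K for each of the three error groups plus K for each of the
    three main terms. *)
Lemma Zint_good X (s A : R) : hermx X -> 0 < A -> (forall p, Sv P H p <= s) ->
  good (Sv P H) (Tv P H) s A D X ->
  cabs (Zint X) <= 9 * K * (A * (cabs (mQ D X) + A) ^+ size sq).
Proof.
move=> hX A0 hs [M0 M1 M2 gb g1 g2 g3].
set Y := cabs (mQ D X) + A.
have Y0 : 0 < Y by rewrite ltr_wpDl ?cabs_ge0.
have hQ : cabs (mQ D X) <= Y by rewrite lerDl ltW.
have hQk p : cabs (mQ D (kill p X)) <= Y.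
  have -> : mQ D (kill p X) = mQ D X - (mQ D X - mQ D (kill p X)) by ring.
  by apply: (le_trans (ler_cabsB _ _)); rewrite lerD2l; exact: gb.
have K1 := @monK_ge1 R sq.
set Pw := Y ^+ size sq.
have hrem p : cabs (remainder P H (f p) (f1 p) (f2 p) p X) <=
  2 * K * (E1term s D p X * Pw + E2term s D p X * (Pw / Y) + E3term s D p X * (Pw / Y ^+ 2)).
  apply: entry_error => //.
  - exact: le_trans (Tv_le W p) (hs p).
  - by rewrite cabs_real ger0_norm ?Sv_ge0.
have -> : Zint X = \sum_p remainder P H (f p) (f1 p) (f2 p) p X +
  (F X * (mq D X + \sum_p (Tv P H p * mc1 D p X + (Sv P H p)%:C%C * mc2 D p X)) +
  mon1 sq (mQ D X) * (\sum_p (Tv P H p * (mc D p X * mQ1 D p X) +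
     (Sv P H p)%:C%C * (mc D p X * mQ2 D p X))) +
  mon2 sq (mQ D X) * (\sum_p (Tv P H p * (mc D p X * ((mQ2 D p X)^*)%C) +
     (Sv P H p)%:C%C * (mc D p X * ((mQ1 D p X)^*)%C)))).
  rewrite /Zint big_split /= -addrA; congr (_ + _).
  rewrite mulrDr !mulr_sumr [RHS]addrAC -!addrA [RHS]addrC.
  rewrite [F X * mq D X]mulrC; congr (_ + _).
  rewrite -!big_split /=; apply: eq_bigr => p _.
  by rewrite /f1 /f2 /jet1 /jet2 -/(F X); ring.
have [d1 d2] := mon12_le Y0 sq hQ; have dF := mon_le sq hQ.
have hsum := le_trans (cabs_sum _ _ _) (ler_sum _ (fun p _ => hrem p)).
apply: (le_trans (le_cabsD (hsum _ _) (le_cabsD (le_cabsD (le_cabsM dF M0) (le_cabsM d1 M1))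
  (le_cabsM d2 M2)))).
rewrite -mulr_sumr !big_split /= -!mulr_suml -/Pw.
have P0 : 0 <= Pw by rewrite exprn_ge0 // ltW.
have AY : A <= Y by rewrite lerDr cabs_ge0.
have u0 : 0 <= Pw / Y by rewrite divr_ge0 // ltW.
have v0 : 0 <= Pw / Y ^+ 2 by rewrite divr_ge0 // exprn_ge0 // ltW.
have hA2 : A ^+ 2 * (Pw / Y) <= A * Pw.
  have -> : A * Pw = A * Y * (Pw / Y) by field; rewrite gt_eqF.
  by rewrite ler_wpM2r // expr2 ler_pM2l.
have hA3 : A ^+ 3 * (Pw / Y ^+ 2) <= A * Pw.
  have -> : A * Pw = A * Y ^+ 2 * (Pw / Y ^+ 2) by field; rewrite gt_eqF.
  rewrite ler_wpM2r // exprS ler_pM2l //.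
  by rewrite lerXn2r // nnegrE ltW.
have h1 := ler_wpM2r P0 g1; have h2 := ler_wpM2r u0 g2; have h3 := ler_wpM2r v0 g3.
have K0 : 0 <= K by exact: le_trans ler01 K1.
have H1 : 2 * K * ((\sum_p E1term s D p X) * Pw + (\sum_p E2term s D p X) * (Pw / Y) +
   (\sum_p E3term s D p X) * (Pw / Y ^+ 2)) <= 2 * K * (3 * (A * Pw)).
  rewrite ler_wpM2l ?mulr_ge0 //; lra.
have H2 : K * (Pw / Y) * A ^+ 2 <= K * (A * Pw).
  by rewrite -mulrA ler_wpM2l // mulrC.
have H3 : Pw * A <= K * (A * Pw).
  by rewrite mulrC ler_peMl // mulr_ge0 // ltW.
by move: H1 H2 H3; lra.
Qed.

(** With L = c 2^(k+1): if q > A L, then (q + A)^k <= (2 q)^k and A < q / L, which leaves half of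
    q^(k+1); otherwise q + A <= (L + 1) A. *)
Lemma young_power (c A q : R) (k : nat) : 1 <= c -> 0 < A -> 0 <= q ->
  c * (A * (q + A) ^+ k) <=
  2^-1 * q ^+ k.+1 + c * (c * 2 ^+ k.+1 + 1) ^+ k * A ^+ k.+1.
Proof.
move=> c1 A0 q0; set L := c * 2 ^+ k.+1.
have L1 : 1 <= L by rewrite -[1]mulr1; apply: ler_pM => //; rewrite exprn_ege1 // ler1n.
have c0 : 0 <= c by exact: le_trans c1.
have [qA|qA] := leP q (A * L).
  apply: (@le_trans _ _ (c * (L + 1) ^+ k * A ^+ k.+1)); last first.
    by rewrite lerDr mulr_ge0 ?exprn_ge0 // invr_ge0.
  have -> : c * (L + 1) ^+ k * A ^+ k.+1 = c * (A * ((A * (L + 1)) ^+ k)).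
    by rewrite exprMn exprS; ring.
  rewrite ler_wpM2l // ler_wpM2l ?(ltW A0) //; apply: lerXn2r.
  - by rewrite nnegrE addr_ge0 // ltW.
  - by rewrite nnegrE mulr_ge0 ?(ltW A0) //; lra.
  - by rewrite mulrDr mulr1 lerD2r.
apply: (@le_trans _ _ (2^-1 * q ^+ k.+1)); last first.
  rewrite lerDl !mulr_ge0 ?exprn_ge0 ?(ltW A0) //; lra.
have qA' : A <= q.
  by apply: le_trans (ltW qA); rewrite ler_peMr // ltW.
have h1 : (q + A) ^+ k <= (2 * q) ^+ k.
  apply: lerXn2r; rewrite ?nnegrE ?addr_ge0 ?mulr_ge0 // ?(ltW A0) //; lra.
apply: (@le_trans _ _ (c * (A * (2 * q) ^+ k))).
  by rewrite ler_wpM2l // ler_wpM2l // ltW.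
have -> : c * (A * (2 * q) ^+ k) = 2^-1 * ((A * L) * q ^+ k).
  by rewrite /L exprMn exprS; field.
apply: ler_wpM2l; first by rewrite invr_ge0.
by rewrite exprS ler_wpM2r ?exprn_ge0 // ltW.
Qed.

Definition ycst : R := 9 * K * (9 * K * 2 ^+ (size sq).+1 + 1) ^+ size sq.

Lemma ycst_ge1 : 1 <= ycst.
Proof.
have K1 := @monK_ge1 R sq; have K9 : 1 <= 9 * K by lra.
apply: mulr_ege1 => //; apply: exprn_ege1; rewrite lerDr mulr_ge0 ?exprn_ge0 //.
exact: le_trans ler01 K9.
Qed.

Lemma Rint_sum (I : finType) (F' : I -> T -> R) :
  (forall i, P.-integrable setT (EFin \o F' i)) ->
  P.-integrable setT (EFin \o (fun w => \sum_i F' i w)) /\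
  Rintegral P setT (fun w => \sum_i F' i w) = \sum_i Rintegral P setT (F' i).
Proof.
move=> h; elim: (index_enum I) => [|i r [IH1 IH2]].
  split.
    under eq_fun do rewrite big_nil; exact: finite_measure_integrable_cst.
  rewrite big_nil; under eq_Rintegral do rewrite big_nil.
  by rewrite (Rintegral_cst P measurableT) mul0r.
split.
  under eq_fun do rewrite big_cons.
  exact: (@integrableD _ _ _ P _ measurableT _ _ (h i) IH1).
under eq_Rintegral do rewrite big_cons.
by rewrite RintegralD // IH2 big_cons.
Qed.

Lemma Rint_indic (B : set T) : measurable B ->
  P.-integrable setT (EFin \o (\1_B : T -> R)) /\
  Rintegral P setT (\1_B : T -> R) = fine (P B).
Proof.
move=> mB; split; last by rewrite /Rintegral integral_indic // setIT.
apply: (@bounded_integrable _ _ _ P _ 1); first exact: measurable_indic.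
by move=> w; rewrite indicE ger0_norm //; case: (_ \in _).
Qed.

(** On the good event half of the moment is absorbed by the left side. On B the crude bound is
    combined with |h|^2 <= lam + |h|^4 / lam, so the probability of B is multiplied by lam while the
    fourth moments are divided by it. *)
Lemma moment_bound (s A lam : R) (B : set T) : 0 < A -> 0 < lam -> measurable B ->
  (forall p, Sv P H p <= s) ->
  (forall w, ~ B w -> good (Sv P H) (Tv P H) s A D (H w)) ->
  Rintegral P setT (fun w => cabs (mQ D (H w)) ^+ (size sq).+1) <=
  2 * (ycst * A ^+ (size sq).+1 + 8 * (N%:R ^+ 2 + 1) * b2 *
    ((1 + N%:R ^+ 2 * lam) * fine (P B) + N%:R ^+ 2 * Cp 4 / lam)).
Proof.
move=> A0 l0 mB hs hgood; have hH := wigner_herm W.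
pose QQ w := cabs (mQ D (H w)) ^+ (size sq).+1.
pose b3 := 8 * (N%:R ^+ 2 + 1) * b2.
have b3ge : 0 <= b3.
  apply: mulr_ge0; last exact: le_trans ler01 b2_ge1.
  by rewrite mulr_ge0 // addr_ge0 // sqr_ge0.
have mQQ : measurable_fun setT QQ.
  by apply: measurable_funX; apply: measurable_cabs; apply: (mxmeasH W); exact: (ad_mQ aD).
have iQQ : P.-integrable setT (EFin \o QQ).
  apply: (@bounded_integrable _ _ _ P _ (b0 ^+ (size sq).+1)) => // w.
  rewrite ger0_norm ?exprn_ge0 ?cabs_ge0 //.
  apply: lerXn2r; rewrite ?nnegrE ?cabs_ge0 ?(le_trans ler01 (ad_b1 aD)) //.
  exact: (ad_Q aD (hH w)).
have [iB eB] := Rint_indic mB.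
pose U w : R := \sum_(p : 'I_N * 'I_N) cabs (H w p.1 p.2) ^+ 4.
have i4 (p : 'I_N * 'I_N) := (entry_moment W 4 p.1 p.2).1.
have [iU EsU] := Rint_sum i4.
have EU : Rintegral P setT U <= N%:R ^+ 2 * Cp 4.
  rewrite EsU.
  apply: le_trans (sum_le_card (fun p => (entry_moment W 4 p.1 p.2).2)) _.
  by rewrite card_prod card_ord natrM expr2.
pose g w := (2^-1 * QQ w + ycst * A ^+ (size sq).+1) +
  (b3 * (1 + N%:R ^+ 2 * lam) * (\1_B w : R) + b3 / lam * U w).
have ig1 : P.-integrable setT (EFin \o (fun w => 2^-1 * QQ w)).
  exact: (@integrableZl _ _ _ P _ measurableT _ _ iQQ).
have ig2 : P.-integrable setT (EFin \o (fun w : T => ycst * A ^+ (size sq).+1)).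
  exact: finite_measure_integrable_cst.
have ig3 : P.-integrable setT (EFin \o (fun w => b3 * (1 + N%:R ^+ 2 * lam) * (\1_B w : R))).
  exact: (@integrableZl _ _ _ P _ measurableT _ _ iB).
have ig4 : P.-integrable setT (EFin \o (fun w => b3 / lam * U w)).
  exact: (@integrableZl _ _ _ P _ measurableT _ _ iU).
have ig12 : P.-integrable setT (EFin \o (fun w => 2^-1 * QQ w + ycst * A ^+ (size sq).+1)).
  exact: (@integrableD _ _ _ P _ measurableT _ _ ig1 ig2).
have ig34 : P.-integrable setT (EFin \o (fun w =>
   b3 * (1 + N%:R ^+ 2 * lam) * (\1_B w : R) + b3 / lam * U w)).
  exact: (@integrableD _ _ _ P _ measurableT _ _ ig3 ig4).
have ig : P.-integrable setT (EFin \o g).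
  exact: (@integrableD _ _ _ P _ measurableT _ _ ig12 ig34).
have Eg : Rintegral P setT g = 2^-1 * Rintegral P setT QQ + ycst * A ^+ (size sq).+1 +
   (b3 * (1 + N%:R ^+ 2 * lam) * fine (P B) + b3 / lam * Rintegral P setT U).
  rewrite RintegralD // (RintegralD measurableT ig1 ig2) (RintegralD measurableT ig3 ig4).
  rewrite (RintegralZl _ measurableT iQQ) (RintegralZl _ measurableT iB) (RintegralZl _ measurableT iU).
  rewrite eB; congr (_ + _ + _).
  have h1 : fine (P setT) = 1 :> R by rewrite probability_setT.
  by apply: (eq_trans (Rintegral_cst P measurableT _)); rewrite h1 mulr1.
have hZ w : cabs (Zint (H w)) <= g w.
  have hq0 := cabs_ge0 (mQ D (H w)).
  have U0 : 0 <= U w by apply: sumr_ge0 => p _; rewrite exprn_ge0 ?cabs_ge0.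
  have y0 : 0 <= ycst * A ^+ (size sq).+1.
    by rewrite mulr_ge0 ?(le_trans ler01 ycst_ge1) // exprn_ge0 // ltW.
  have Q0 : 0 <= 2^-1 * QQ w by rewrite mulr_ge0 ?invr_ge0 ?exprn_ge0.
  have b30 : 0 <= b3 / lam by rewrite divr_ge0 // ltW.
  have [wB|wB] := pselect (B w); last first.
    apply: (@le_trans _ _ (2^-1 * QQ w + ycst * A ^+ (size sq).+1)).
      apply: le_trans (Zint_good (hH w) A0 hs (hgood w wB)) _.
      apply: young_power => //; have := @monK_ge1 R sq; lra.
    rewrite lerDl addr_ge0 ?(mulr_ge0 b30) // indicE memNset //= mulr0 //.
  have hV : Venv (H w) <= (1 + N%:R ^+ 2 * lam) + U w / lam.
    rewrite /Venv -addrA lerD2l /U mulr_suml.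
    have -> : N%:R ^+ 2 * lam = \sum_(p : 'I_N * 'I_N) lam.
      rewrite big_const iter_addr_0 card_prod card_ord -[RHS]mulr_natl natrM expr2 //.
    rewrite -big_split /=; apply: ler_sum => p _; set x := cabs _ ^+ 2.
    have -> : cabs (H w p.1 p.2) ^+ 4 = x ^+ 2 by rewrite /x -exprM.
    have x0 : 0 <= x by exact: sqr_ge0.
    rewrite -(ler_pM2r l0) mulrDl divfK ?gt_eqF //.
    by have := sqr_ge0 (x - lam); nra.
  apply: le_trans (Zint_bound (hH w)) _; apply: le_trans (ler_wpM2l b3ge hV) _.
  have -> : b3 * (1 + N%:R ^+ 2 * lam + U w / lam) =
     b3 * (1 + N%:R ^+ 2 * lam) * 1 + b3 / lam * U w by ring.
  by rewrite /g indicE mem_set //= lerDr addr_ge0.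
have iZ : Cint P (fun w => Zint (H w)).
  by apply: (Cint_le _ ig) => //; apply: (mxmeasH W); exact: mxmeas_Zint.
(* [mon_alt] writes |Q|^(2n+2) as Q times its cofactor, and [ad_eq] splits this Q into the linear
   form and [mq]. *)
have EZ : Rintegral P setT QQ = complex.Re (Ex P (fun w => Zint (H w))).
  transitivity (complex.Re (Ex P (fun w => mQ D (H w) * F (H w)))).
    by apply: eq_Rintegral => w _; rewrite /F mon_alt /QQ size_alt.
  congr complex.Re.
  have bF X : hermx X -> cabs (F X) <= b0 ^+ size sq.
    by move=> hX; apply: mon_le; exact: (ad_Q aD hX).
  have mF : mxmeas F by apply: mxmeas_mon; exact: (ad_mQ aD).
  have iHf p : Cint P (fun w => H w p.1 p.2 * f p (H w)).
    apply: (@Cint_entry_prod _ _ _ _ _ _ _ _ W 1 p.1 p.2 _ _ b2) => //.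
    - exact: (cmeas_entry W).
    - apply: (mxmeasH W); exact: mxmeas_f.
    - by move=> w; have [] := f_bounds p (hH w).
  have mqF : mxmeas (fun X => mq D X * F X) by apply: mxmeasM => //; exact: (ad_mq aD).
  have iqF : Cint P (fun w => mq D (H w) * F (H w)).
    apply: (@Cint_bounded _ _ _ P _ (b0 * b0 ^+ size sq)).
      exact: (mxmeasH W mqF).
    by move=> w; apply: le_cabsM; [exact: (ad_q aD (hH w))|exact: bF].
  have expand p : Ex P (fun w => H w p.1 p.2 * f p (H w)) = Ex P (fun w =>
     remainder P H (f p) (f1 p) (f2 p) p (H w) +
     (Tv P H p * f1 p (H w) + (Sv P H p)%:C%C * f2 p (H w))).
    have [mf1 mf2] := mxmeas_f12 p.
    have h0 X (hX : hermx X) : cabs (f p X) <= b2 by have [] := f_bounds p hX.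
    have h1 X (hX : hermx X) : cabs (f1 p X) <= b2 by have [] := f_bounds p hX.
    have h2 X (hX : hermx X) : cabs (f2 p X) <= b2 by have [] := f_bounds p hX.
    exact: (@Ex_expand _ _ _ _ _ _ _ _ W (f p) (f1 p) (f2 p) p b2 (mxmeas_f p) mf1 mf2 h0 h1 h2).
  have iR p : Cint P (fun w => remainder P H (f p) (f1 p) (f2 p) p (H w) +
     (Tv P H p * f1 p (H w) + (Sv P H p)%:C%C * f2 p (H w))).
    have i2 := (entry_moment W 2 p.1 p.2).1.
    apply: (@Cint_le _ _ _ P _ (fun w => b2 * (3 * cabs (H w p.1 p.2) ^+ 2 + 7))).
    - have mm := mxmeas_remainder p; exact: (mxmeasH W mm).
    - apply: (@integrableZl _ _ _ P _ measurableT _ (EFin \o (fun w => 3 * cabs (H w p.1 p.2) ^+ 2 + 7))).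
      apply: (@integrableD _ _ _ P _ measurableT (EFin \o (fun w => 3 * cabs (H w p.1 p.2) ^+ 2)) (EFin \o (fun=> 7))).
        exact: (@integrableZl _ _ _ P _ measurableT _ _ i2).
      exact: finite_measure_integrable_cst.
    - by move=> w; exact: Zterm_bound.
  rewrite (eq_Ex P (g := fun w => \sum_p H w p.1 p.2 * f p (H w) + mq D (H w) * F (H w))).
    rewrite ExD //; last exact: Cint_sum.
    rewrite Ex_sum // /Zint ExD //; last exact: Cint_sum.
    rewrite [in RHS]Ex_sum //; congr (_ + _); apply: eq_bigr => p _; exact: expand.
  move=> w; rewrite (ad_eq aD (hH w)) mulrDl mulr_suml; congr (_ + _).
  by apply: eq_bigr => p _; rewrite /f mulrA.
have := Re_Ex_le iZ ig (fun w => le_trans (ler_norm _) (le_trans (Re_le_cabs _) (hZ w))).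
rewrite -EZ Eg -/QQ -/b3.
have : b3 / lam * Rintegral P setT U <= b3 / lam * (N%:R ^+ 2 * Cp 4).
  by rewrite ler_wpM2l // divr_ge0 // ltW.
have -> : b3 * ((1 + N%:R ^+ 2 * lam) * fine (P B) + N%:R ^+ 2 * Cp 4 / lam) =
  b3 * (1 + N%:R ^+ 2 * lam) * fine (P B) + b3 / lam * (N%:R ^+ 2 * Cp 4) by ring.
have aux (I x y z t : R) : x <= y -> I <= 2^-1 * I + t + (z + x) -> I <= 2 * (t + (z + y)).
  by move=> h1 h2; lra.
exact: aux.
Qed.

End MomentBound.

Section PowerGrowth.
Context {R : realType}.

Lemma exists_nat_ge (x : R) : exists n : nat, x <= n%:R.
Proof.
exists (Num.truncn `|x|).+1; apply: le_trans (ler_norm _) _.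
by apply: ltW; have /andP[_] := Num.Theory.truncn_itv (normr_ge0 x).
Qed.

Lemma powR_natX (N : nat) (t : R) (k : nat) : (N%:R `^ t) ^+ k = N%:R `^ (t * k%:R).
Proof. by rewrite -powR_mulrn ?powR_ge0 // -powRrM. Qed.

Lemma powR_nat_ge (N : nat) (t : R) : (1 <= N)%N -> 0 <= t -> 1 <= N%:R `^ t.
Proof.
move=> N1 t0; have h : N%:R `^ 0 <= N%:R `^ t by rewrite ler_powR // ler1n.
by rewrite powRr0 in h.
Qed.

Lemma powR_ge_const (c t : R) : 0 < t -> exists N0 : nat, forall N, (N0 <= N)%N ->
  c <= N%:R `^ t.
Proof.
move=> t0; have [n hn] := exists_nat_ge (Num.max c 1 `^ t^-1).
exists n => N nN; have c1 : c <= Num.max c 1 by rewrite le_max lexx.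
have m0 : 0 <= Num.max c 1 by rewrite le_max ler01 orbT.
apply: (le_trans c1).
have -> : Num.max c 1 = (Num.max c 1 `^ t^-1) `^ t.
  by rewrite -powRrM mulVf ?gt_eqF // powRr1.
apply: ge0_ler_powR; [exact: ltW|by rewrite nnegrE powR_ge0|by rewrite nnegrE|].
by apply: le_trans hn _; rewrite ler_nat.
Qed.

End PowerGrowth.

(** * Events of very high probability, uniformly over all models *)

Section HighProbability.
Context {R : realType} {C : R} {Cp : nat -> R}.

(** Bundling the probability space with the matrix lets [whp] ask for one N0 that serves all of
    them. *)
Record model (N : nat) := Model {
  mdisp : measure_display;
  msp : measurableType mdisp;
  mP : probability msp R;
  mH : msp -> 'M[R[i]]_N;
  mW : wigner_type C Cp mP mH }.

(** The failure is only asked to lie in a small measurable set, so Phi itself may be any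
    predicate. *)
Definition hp N (M : model N) (k : nat) (Phi : msp M -> Prop) : Prop :=
  exists B : set (msp M), [/\ measurable B, fine (mP M B) <= N%:R ^- k &
    forall w, ~ B w -> Phi w].

(** The index i stands for z, v, w and the like: the probability bound is uniform in i, but the
    exceptional set may depend on i. This matches the supremum outside the probability in stochastic
    domination. *)
Definition whp (I : nat -> Type) (Phi : forall N (M : model N), I N -> msp M -> Prop) :=
  forall k : nat, exists N0 : nat, forall N, (N0 <= N)%N ->
  forall (M : model N) (i : I N), hp k (Phi N M i).

Lemma hp_all N (M : model N) (k l : nat) (J : finType) (Phi : J -> msp M -> Prop) :
  (0 < N)%N -> #|J|%:R <= N%:R ^+ l :> R -> (forall j, hp (k + l) (Phi j)) ->
  hp k (fun w => forall j, Phi j w).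
Proof.
move=> N0 hJ /choice[B hB]; exists (\big[setU/set0]_j B j).
have mB j : measurable (B j) by have [] := hB j.
have N0' : 0 < N%:R :> R by rewrite ltr0n.
have mb (r : seq J) : measurable (\big[setU/set0]_(j <- r) B j).
  by elim/big_ind : _ => // *; exact: measurableU.
split=> //.
- have fin A : measurable A -> mP M A \is a fin_num by move=> mA; exact: fin_num_measure.
  have h : fine (mP M (\big[setU/set0]_j B j)) <= \sum_j fine (mP M (B j)).
    elim: (index_enum J) => [|j r IH]; first by rewrite !big_nil measure0.
    rewrite !big_cons; apply: le_trans (lerD (lexx _) IH).
    rewrite -fineD ?fin // fine_le ?fin //; last exact: measureU2.
    - by apply: measurableU.
    - by rewrite fin_numD !fin.
  apply: (le_trans h); apply: le_trans (sum_le_card (fun j => let: And3 _ h _ := hB j in h)) _.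
  rewrite exprD invfM mulrCA -[leRHS]mulr1 ler_wpM2l ?invr_ge0 ?exprn_ge0 ?(ltW N0') //.
  by rewrite ler_pdivrMr ?exprn_gt0 // mul1r.
- move=> w hw j; have [_ _] := hB j; apply => wB; apply: hw.
  by rewrite -bigcup_seq; exists j => //=; rewrite mem_index_enum.
Qed.

Lemma whp_mono (I : nat -> Type) (Phi Psi : forall N (M : model N), I N -> msp M -> Prop)
  (N1 : nat) :
  (forall N, (N1 <= N)%N -> forall M i w, Phi N M i w -> Psi N M i w) ->
  whp Phi -> whp Psi.
Proof.
move=> h hP k; have [N0 hN] := hP k; exists (maxn N0 N1) => N.
rewrite geq_max => /andP[n0 n1] M i; have [B [b1 b2 b3]] := hN N n0 M i.
by exists B; split=> // w wB; apply: h => //; exact: b3.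
Qed.

Lemma whp_sub (I I' : nat -> Type) (Phi : forall N (M : model N), I N -> msp M -> Prop)
  (g : forall N, model N -> I' N -> I N) :
  whp Phi -> whp (fun N M i => Phi N M (g N M i)).
Proof. by move=> h k; have [N0 hN] := h k; exists N0 => N n0 M i; exact: hN. Qed.

(** Union bound: N^l indices are paid for by starting from the exponent k + l. *)
Lemma whp_all (I : nat -> Type) (J : nat -> finType)
  (Phi : forall N (M : model N), (I N * J N)%type -> msp M -> Prop) (l N1 : nat) :
  (forall N, (N1 <= N)%N -> #|J N|%:R <= N%:R ^+ l :> R) ->
  whp Phi -> whp (fun N M i w => forall j, Phi N M (i, j) w).
Proof.
move=> hJ h k; have [N0 hN] := h (k + l)%N; exists (maxn N0 (maxn N1 1)) => N.
rewrite !geq_max => /andP[n0 /andP[n1 n2]] M i.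
by apply: (hp_all n2 (hJ N n1)) => j; exact: hN.
Qed.

Lemma whp_and (I : nat -> Type) (Phi Psi : forall N (M : model N), I N -> msp M -> Prop) :
  whp Phi -> whp Psi -> whp (fun N M i w => Phi N M i w /\ Psi N M i w).
Proof.
move=> h1 h2; pose Th N (M : model N) (ij : I N * bool) w :=
  if ij.2 then Phi N M ij.1 w else Psi N M ij.1 w.
have : whp Th.
  move=> k; have [N1 hN1] := h1 k; have [N2 hN2] := h2 k; exists (maxn N1 N2) => N.
  rewrite geq_max => /andP[n1 n2] M [i []]; [exact: hN1|exact: hN2].
move/(@whp_all I (fun=> bool) Th 1 2).
have hc N : (2 <= N)%N -> #|(bool : finType)|%:R <= N%:R ^+ 1 :> R.
  by move=> n2; rewrite card_bool expr1 ler_nat.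
move/(_ hc); apply: (whp_mono (N1 := 0)) => N _ M i w h.
by split; [exact: (h true)|exact: (h false)].
Qed.

Lemma whp_det (I : nat -> Type) (Phi : forall N (M : model N), I N -> msp M -> Prop) (N1 : nat) :
  (forall N, (N1 <= N)%N -> forall M i w, Phi N M i w) -> whp Phi.
Proof.
move=> h k; exists N1 => N n1 M i; exists set0; split.
- exact: measurable0.
- by rewrite measure0 /= invr_ge0 exprn_ge0.
- by move=> w _; exact: h.
Qed.

Lemma markov_set (N : nat) (M : model N) (f : msp M -> R) (t : R) (k : nat) :
  0 < t -> measurable_fun setT f -> (forall w, 0 <= f w) ->
  (mP M).-integrable setT (EFin \o (fun w => f w ^+ k)) ->
  measurable [set w | t < f w] /\
  fine (mP M [set w | t < f w]) <= Rintegral (mP M) setT (fun w => f w ^+ k) / t ^+ k.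
Proof.
move=> t0 mf f0 ifk.
have mB : measurable [set w | t < f w].
  have := mf measurableT `]t, +oo[%classic (measurable_itv _).
  rewrite setTI; congr measurable; apply/seteqP; split => w /=; rewrite in_itv /= andbT //.
split=> //; have [iB eB] := Rint_indic (mP M) mB.
rewrite ler_pdivlMr ?exprn_gt0 // mulrC -eB -RintegralZl //.
apply: le_Rintegral => //; first exact: (@integrableZl _ _ _ (mP M) _ measurableT _ _ iB).
move=> w _ /=; rewrite ?indicE; have [h|h] := boolP (w \in _).
  rewrite mulr1; apply: lerXn2r; rewrite ?nnegrE ?f0 ?(ltW t0) //.
  by move: h; rewrite inE /=; exact: ltW.
by rewrite mulr0 exprn_ge0.
Qed.

Lemma whp_entry (t : R) : 0 < t ->
  whp (I := fun N => ('I_N * 'I_N)%type) (fun N M p w =>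
    cabs (mH w p.1 p.2) <= N%:R `^ t * (Num.sqrt N%:R)^-1).
Proof.
(* Markov's inequality with the power n, where n t >= k + 1: the spare power of N absorbs the
   constant [Cp n]. *)
move=> t0 k; have [n hn] := exists_nat_ge ((k%:R + 1) / t).
have [N0 hN0] := powR_ge_const (Num.max (Cp n) 0) (@ltr01 R).
exists (maxn N0 1) => N; rewrite geq_max => /andP[n0 n1] M p.
have Np : 0 < N%:R :> R by rewrite ltr0n.
have sp : 0 < Num.sqrt N%:R :> R by rewrite sqrtr_gt0.
have [i1 i2] := scaled_entry_moment (mW M) n p.1 p.2.
pose f w := Num.sqrt N%:R * cabs (mH (m := M) w p.1 p.2).
have tp : 0 < N%:R `^ t by rewrite powR_gt0.
have [mB hB] := @markov_set N M f (N%:R `^ t) n tp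
  (measurable_funM (measurable_cst _) (measurable_cabs (cmeas_entry (mW M) p.1 p.2)))
  (fun w => mulr_ge0 (ltW sp) (cabs_ge0 _)) i1.
exists [set w | N%:R `^ t < f w]; split=> //.
- apply: (le_trans hB); rewrite ler_pdivrMr ?exprn_gt0 //.
  apply: (le_trans i2); apply: (@le_trans _ _ (N%:R)).
    have := hN0 N n0; rewrite powRr1 ?ler0n //; apply: le_trans.
    by rewrite le_max lexx.
  rewrite powR_natX [leRHS]mulrC ler_pdivlMr ?exprn_gt0 // -exprS.
  rewrite -powR_mulrn ?ler0n // ler_powR ?ler1n // -natr1.
  by rewrite mulrC -ler_pdivrMr.
- move=> w /= /negP; rewrite -leNgt /f => h.
  by rewrite ler_pdivlMr // mulrC.
Qed.

(** The hypothesis is used with t / 2, so that Markov's inequality for the moment of order m gains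
    N^(t m / 2). The lower bound N^(-a) on A is what makes the contribution of the exceptional set
    smaller than A^m. *)
Theorem moment_method (I : nat -> Type) (V : forall N, model N -> I N -> Prop)
  (D : forall N (M : model N), I N -> @mmdata R N)
  (A : forall N (M : model N), I N -> R) (a b N1 : nat) :
  (forall N, (N1 <= N)%N -> forall M i, V N M i ->
     admissible (D N M i) (N%:R ^+ b) /\ N%:R ^- a <= A N M i) ->
  (forall t : R, 0 < t -> whp (fun N M i w => V N M i ->
     good (Sv (mP M) (mH (m := M))) (Tv (mP M) (mH (m := M))) (C / N%:R)
        (N%:R `^ t * A N M i) (D N M i) (mH w))) ->
  forall t : R, 0 < t -> whp (fun N M i w => V N M i ->
     cabs (mQ (D N M i) (mH w)) <= N%:R `^ t * A N M i).
Proof.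
move=> hadm hgood t t0 k.
have t2 : 0 < t / 2 by rewrite divr_gt0.
have [n hn] := exists_nat_ge ((k%:R + 1) / (t / 2)).
pose m := (size (alt n)).+1.
have hnm : (n <= m)%N by rewrite /m size_alt mul2n -addnn; apply: leqW; apply: leqW; exact: leq_addr.
(* The cut is lam = N^l and the exceptional set has probability N^(-2l). The summands of l beat the
   crude bound N^(b m), the factor N^4 and the target N^(-a m), and one spare power of N absorbs
   [c1]. *)
pose l := (b * m + 4 + a * m + 1)%N.
have [N2 hN2] := hgood (t / 2) t2 (2 * l)%N.
pose Y := @ycst R n; pose K := @monK R (alt n).
have K1 : 1 <= K := monK_ge1 _.
pose c1 := 16 * (1 + 2 * K) * (2 + Num.max (Cp 4) 0).
have [N3 hN3] := exists_nat_ge (Num.max c1 (2 * (Y + 1))).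
exists (maxn (maxn N1 1) (maxn N2 N3)) => N.
rewrite !geq_max => /andP[/andP[n1 n0] /andP[n2 n3]] M i.
have [hV|hV] := pselect (V N M i); last first.
  by exists set0; split; [exact: measurable0|rewrite measure0 /= invr_ge0 exprn_ge0|].
have [ad hA] := hadm N n1 M i hV.
have Np : 0 < N%:R :> R by rewrite ltr0n.
have N1' : 1 <= N%:R :> R by rewrite ler1n.
have [B [mB PB gB]] := hN2 N n2 M i.
pose A' := N%:R `^ (t / 2) * A N M i.
have A0 : 0 < A N M i by apply: lt_le_trans hA; rewrite invr_gt0 exprn_gt0.
have A'0 : 0 < A' by rewrite mulr_gt0 // powR_gt0.
have hA' : N%:R ^- a <= A'.
  apply: (le_trans hA); rewrite ler_peMl ?(ltW A0) //.
  by rewrite powR_nat_ge // ltW.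
have l0 : 0 < N%:R ^+ l :> R by rewrite exprn_gt0.
have hs p : Sv (mP M) (mH (m := M)) p <= C / N%:R.
  by rewrite ler_pdivlMr // mulrC; have /andP[] := Sv_bounds (mW M) p.
have mb := moment_bound (mW M) n ad A'0 l0 mB hs (fun w wB => gB w wB hV).
have cN : c1 <= N%:R.
  apply: (@le_trans _ _ N3%:R); last by rewrite ler_nat.
  by apply: le_trans hN3; rewrite le_max lexx.
have yN : 2 * (Y + 1) <= N%:R.
  apply: (@le_trans _ _ N3%:R); last by rewrite ler_nat.
  by apply: le_trans hN3; rewrite le_max lexx orbT.
have tail : 8 * (N%:R ^+ 2 + 1) * ((1 + 2 * monK (alt n)) * (N%:R ^+ b * (N%:R ^+ b) ^+ size (alt n))) *
   ((1 + N%:R ^+ 2 * N%:R ^+ l) * fine (mP M B) + N%:R ^+ 2 * Cp 4 / N%:R ^+ l) <= A' ^+ m.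
  apply: (@le_trans _ _ ((N%:R ^- a) ^+ m)); last first.
    by apply: lerXn2r hA'; rewrite nnegrE ?invr_ge0 ?exprn_ge0 ?(ltW Np) ?(ltW A'0).
  rewrite -exprS -exprM -/m.
  set x : R := N%:R in Np N1' hA hA' PB mb cN yN l0 *.
  have xl : x ^+ l = x ^+ (b * m) * x ^+ 4 * x ^+ (a * m) * x by rewrite /l !exprD expr1.
  have x2 : 1 <= x ^+ 2 by rewrite exprn_ege1.
  have h1 : 8 * (x ^+ 2 + 1) <= 16 * x ^+ 2 by lra.
  have x4 : 1 + x ^+ 2 * x ^+ l <= 2 * (x ^+ 2 * x ^+ l).
    have : 1 <= x ^+ 2 * x ^+ l by rewrite -exprD exprn_ege1.
    lra.
  have PB0 : 0 <= fine (mP M B) by rewrite fine_ge0.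
  have h2 : (1 + x ^+ 2 * x ^+ l) * fine (mP M B) <= 2 * x ^+ 2 / x ^+ l.
    apply: (@le_trans _ _ (2 * (x ^+ 2 * x ^+ l) * x ^- (2 * l))).
      by apply: ler_pM => //; rewrite addr_ge0 // mulr_ge0 ?exprn_ge0 // ltW.
    rewrite mul2n -addnn exprD le_eqVlt; apply/orP; left; apply/eqP.
    by field; rewrite ?expf_neq0 // ?gt_eqF.
  have h3 : x ^+ 2 * Cp 4 / x ^+ l <= x ^+ 2 * Num.max (Cp 4) 0 / x ^+ l.
    by rewrite ler_pM2r ?invr_gt0 // ler_pM2l ?exprn_gt0 // le_max lexx.
  have h4 : (1 + x ^+ 2 * x ^+ l) * fine (mP M B) + x ^+ 2 * Cp 4 / x ^+ l <=
     (2 + Num.max (Cp 4) 0) * x ^+ 2 / x ^+ l.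
    apply: le_trans (lerD h2 h3) _; rewrite le_eqVlt; apply/orP; left; apply/eqP; ring.
  have mx0 : 0 <= Num.max (Cp 4) 0 by rewrite le_max lexx orbT.
  have h5 : 8 * (x ^+ 2 + 1) * ((1 + 2 * K) * x ^+ (b * m)) <=
     16 * x ^+ 2 * ((1 + 2 * K) * x ^+ (b * m)).
    by rewrite ler_wpM2r // mulr_ge0 ?exprn_ge0 // ?(ltW Np) //; lra.
  apply: (@le_trans _ _ (16 * x ^+ 2 * ((1 + 2 * K) * x ^+ (b * m)) *
     ((2 + Num.max (Cp 4) 0) * x ^+ 2 / x ^+ l))).
    apply: (@le_trans _ _ (8 * (x ^+ 2 + 1) * ((1 + 2 * K) * x ^+ (b * m)) *
     ((2 + Num.max (Cp 4) 0) * x ^+ 2 / x ^+ l))).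
      apply: ler_wpM2l => //.
      rewrite -/K; apply: mulr_ge0; first lra.
      by apply: mulr_ge0; [lra|rewrite exprn_ge0 // ltW].
    apply: ler_wpM2r => //.
    by rewrite divr_ge0 ?mulr_ge0 ?exprn_ge0 ?addr_ge0 ?(ltW Np) //.
  rewrite exprVn -exprM xl.
  have -> : 16 * x ^+ 2 * ((1 + 2 * K) * x ^+ (b * m)) * ((2 + Num.max (Cp 4) 0) * x ^+ 2 /
     (x ^+ (b * m) * x ^+ 4 * x ^+ (a * m) * x)) = c1 / x * x ^- (a * m).
    rewrite /c1; move: (expf_neq0 (b * m) (lt0r_neq0 Np)) (expf_neq0 (a * m) (lt0r_neq0 Np)).
    move: (x ^+ (b * m)) (x ^+ (a * m)) (Num.max _ _) => y1 y2 y3 y10 y20; field.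
    by rewrite ?y10 ?y20 gt_eqF.
  rewrite ler_piMl ?invr_ge0 ?exprn_ge0 ?(ltW Np) //.
  by rewrite ler_pdivrMr // mul1r.
pose f w := cabs (mQ (D N M i) (mH (m := M) w)).
have mf : measurable_fun setT f.
  by apply: measurable_cabs; apply: (mxmeasH (mW M)); exact: (ad_mQ ad).
have ifm : (mP M).-integrable setT (EFin \o (fun w => f w ^+ m)).
  apply: (@bounded_integrable _ _ _ (mP M) _ ((N%:R ^+ b) ^+ m)).
    exact: measurable_funX.
  move=> w; rewrite ger0_norm ?exprn_ge0 ?cabs_ge0 //.
  apply: lerXn2r; rewrite ?nnegrE ?cabs_ge0 ?exprn_ge0 //.
  exact: (ad_Q ad (wigner_herm (mW M) w)).
have tp : 0 < N%:R `^ t * A N M i by rewrite mulr_gt0 // powR_gt0.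
have [mB' hB'] := @markov_set N M f (N%:R `^ t * A N M i) m tp mf (fun w => cabs_ge0 _) ifm.
exists [set w | N%:R `^ t * A N M i < f w]; split=> //; last first.
  by move=> w /= /negP; rewrite -leNgt.
apply: (le_trans hB'); rewrite ler_pdivrMr ?exprn_gt0 //.
have mb2 : Rintegral (mP M) setT (fun w => f w ^+ m) <= N%:R * A' ^+ m.
  apply: (le_trans mb).
  have h := ler_wpM2r (exprn_ge0 m (ltW A'0)) yN.
  apply: (le_trans _ h); rewrite -[leRHS]mulrA; apply: ler_wpM2l => //.
  by rewrite [leRHS]mulrDl mul1r; apply: lerD.
apply: (le_trans mb2).
have -> : N%:R `^ t * A N M i = N%:R `^ (t / 2) * A'.
  rewrite /A' mulrA -powRD; first by congr (_ `^ _ * _); lra.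
  by rewrite (gt_eqF Np) implybT.
rewrite [(_ * A') ^+ m]exprMn [leRHS]mulrA; apply: ler_wpM2r; first by rewrite exprn_ge0 // ltW.
rewrite mulrC ler_pdivlMr ?exprn_gt0 // -exprS powR_natX.
rewrite -powR_mulrn ?ler0n // ler_powR // -natr1.
apply: (@le_trans _ _ (t / 2 * n%:R)).
  by rewrite mulrC -ler_pdivrMr.
by rewrite ler_wpM2l ?(ltW t2) // ler_nat.
Qed.

End HighProbability.

(** * Removing one entry *)

Section KillCalculus.
Context {R : realType} {N : nat}.
Local Notation CC := R[i].
Variables (X : 'M[CC]_N) (z : CC) (p : 'I_N * 'I_N).
Hypotheses (hX : hermx X) (z0 : complex.Im z != 0).
Local Notation i := p.1.
Local Notation j := p.2.
Local Notation h := (X p.1 p.2).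
Local Notation G := (Gq X z).
Local Notation Gk := (Gq (kill p X) z).

(** On the diagonal h is real and a single position is removed. Dropping the h-term there leaves the
    conj(h)-term to carry the whole change, so one formula covers both cases. *)
Definition offd (q : 'I_N * 'I_N) : CC := (q.1 != q.2)%:R.

Lemma cabs_offd q : cabs (offd q) <= 1.
Proof. by rewrite /offd; case: (q.1 != q.2); rewrite ?cabs1 ?cabs0. Qed.

Lemma kill_diff : X - kill p X =
  (offd p * h) *: delta_mx i j + ((h^*)%C) *: delta_mx j i.
Proof.
have hsym : ((X p.1 p.2)^*)%C = X p.2 p.1 by rewrite -hX.
apply/matrixP => a b; rewrite !mxE /killed hsym /offd.
case: p hsym => i' j' /= hsym; rewrite !xpair_eqE.
have [/andP[/eqP-> /eqP->]|ab1] := boolP ((a == i') && (b == j')).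
  rewrite /= subr0; have [<-|ij] := eqVneq i' j'.
    by rewrite /= mul0r mul0r add0r mulr1.
  by rewrite /= mul1r mulr1 mulr0 addr0.
have [/andP[/eqP-> /eqP->]|ab2] /= := boolP ((a == j') && (b == i')).
  by rewrite subr0 mulr0 add0r mulr1.
by rewrite !mulr0 subrr addr0.
Qed.

Lemma delta_mulmx (a b : 'I_N) (y : 'cV[CC]_N) : delta_mx a b *m y = cdot (ev b) y *: ev a.
Proof.
apply/matrixP => k l; rewrite ord1 mxE (bigD1 b) //= big1 => [|c cb].
  by rewrite cdot_evl !mxE eqxx !andbT addr0 mulrC.
by rewrite mxE (negbTE cb) andbF mul0r.
Qed.

Lemma cdot_green_scale (Y : 'M[CC]_N) v a w : cdot v (green Y z *m (a *: w)) = a * Gq Y z v w.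
Proof. by rewrite -scalemxAr cdotZr GqE. Qed.

Lemma kill_greenl : green (kill p X) z - green X z =
  green X z *m (X - kill p X) *m green (kill p X) z.
Proof.
have hK := herm_kill p hX.
have -> : X - kill p X = (X - z%:M) - (kill p X - z%:M) by rewrite opprB addrA subrK.
by rewrite mulmxBr green_mull // mulmxBl mul1mx -mulmxA green_mulr // mulmx1.
Qed.

Lemma kill_greenr : green (kill p X) z - green X z =
  green (kill p X) z *m (X - kill p X) *m green X z.
Proof.
have hK := herm_kill p hX.
have -> : X - kill p X = (X - z%:M) - (kill p X - z%:M) by rewrite opprB addrA subrK.
by rewrite mulmxBr mulmxBl green_mull // mul1mx -mulmxA green_mulr // mulmx1.
Qed.

(** The exact resolvent identity with the killed resolvent as right factor; in [kill_expandr] it is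
    the left factor. The first closes on rows, the second on columns. *)
Lemma kill_expandl v w :
  Gk v w = G v w + offd p * h * G v (ev i) * Gk (ev j) w + (h^*)%C * G v (ev j) * Gk (ev i) w.
Proof.
have e : Gk v w - G v w = cdot v ((green (kill p X) z - green X z) *m w).
  by rewrite mulmxBl cdotBr !GqE.
rewrite -[LHS](subrK (G v w)) e kill_greenl kill_diff -!mulmxA mulmxDl.
rewrite -!scalemxAl !delta_mulmx mulmxDr cdotDr.
rewrite !scalerA !cdot_green_scale !GqE.
have aux (a b c d f x y : CC) : x * d * a + y * f * b + c = c + x * a * d + y * b * f.
  by ring.
exact: aux.
Qed.

Lemma kill_expandr v w :
  Gk v w = G v w + offd p * h * Gk v (ev i) * G (ev j) w + (h^*)%C * Gk v (ev j) * G (ev i) w.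
Proof.
have e : Gk v w - G v w = cdot v ((green (kill p X) z - green X z) *m w).
  by rewrite mulmxBl cdotBr !GqE.
rewrite -[LHS](subrK (G v w)) e kill_greenr kill_diff -!mulmxA mulmxDl.
rewrite -!scalemxAl !delta_mulmx mulmxDr cdotDr.
rewrite !scalerA !cdot_green_scale !GqE.
have aux (a b c d f x y : CC) : x * d * a + y * f * b + c = c + x * a * d + y * b * f.
  by ring.
exact: aux.
Qed.

#[local] Opaque kill cabs.

Variables (K e : R).
Hypotheses (K4 : 4 <= K) (e0 : 0 <= e) (Ke : 4 * K ^+ 2 * e <= 1).
Hypothesis he : cabs h <= K * e.
Hypothesis hii : cabs (G (ev i) (ev i)) <= K.
Hypothesis hij : cabs (G (ev i) (ev j)) <= K.
Hypothesis hji : cabs (G (ev j) (ev i)) <= K.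
Hypothesis hjj : cabs (G (ev j) (ev j)) <= K.

Definition pL v := cabs (G v (ev i)) + cabs (G v (ev j)).
Definition pR w := cabs (G (ev i) w) + cabs (G (ev j) w).
(** Throughout, K stands for a small power of N and e for N^(-1/2). Per unit of e, the first-order
    change of G_vw consists of the two products that pair opposite indices; the last term, with
    arbitrary pairing, comes from the next order and is smaller by e. *)
Definition pbeta v w := cabs (G v (ev i)) * cabs (G (ev j) w) +
  cabs (G v (ev j)) * cabs (G (ev i) w) + e * pL v * pR w.

Lemma pL_ge0 v : 0 <= pL v. Proof. by rewrite addr_ge0 ?cabs_ge0. Qed.
Lemma pR_ge0 w : 0 <= pR w. Proof. by rewrite addr_ge0 ?cabs_ge0. Qed.
Lemma pbeta_ge0 v w : 0 <= pbeta v w.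
Proof. by rewrite !(addr_ge0, mulr_ge0, cabs_ge0, pL_ge0, pR_ge0). Qed.

Lemma cabs_dh : cabs (offd p * h) <= K * e.
Proof.
rewrite cabsM; apply: le_trans he; rewrite -[leRHS]mul1r ler_wpM2r ?cabs_ge0 //.
exact: cabs_offd.
Qed.

Lemma cabs_hJ : cabs (h^*)%C <= K * e.
Proof. by rewrite cabsJ. Qed.

(** The perturbed values stand on both sides; for k <= 1/4 they contribute at most half of their own
    sum to the error, which is absorbed. *)
Lemma two_by_two (a b a' b' k : R) : 0 <= a' -> 0 <= b' -> k <= 4^-1 ->
  `|a' - a| <= k * (a' + b') -> `|b' - b| <= k * (a' + b') -> a' + b' <= 2 * (a + b).
Proof.
move=> a0 b0 k4 /ler_normlP[h1 h2] /ler_normlP[h3 h4].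
have : k * (a' + b') <= 4^-1 * (a' + b') by rewrite ler_wpM2r // addr_ge0.
lra.
Qed.

Lemma K2e : K ^+ 2 * e <= 4^-1.
Proof. by move: Ke; lra. Qed.

Lemma dist_cabs (x y : CC) : `|cabs x - cabs y| <= cabs (x - y).
Proof.
apply/ler_normlP; split.
  rewrite opprB lerBlDr cabsBC; apply: le_trans (ler_cabsD _ _); by rewrite subrK.
by rewrite lerBlDr; apply: le_trans (ler_cabsD _ _); rewrite subrK.
Qed.

Lemma Gk_expandl_le v w a b : cabs (G v (ev i)) <= a -> cabs (G v (ev j)) <= b ->
  cabs (Gk v w - G v w) <= K * e * (a * cabs (Gk (ev j) w) + b * cabs (Gk (ev i) w)).
Proof.
move=> ha hb.
have aux (g a1 b1 c d f x y : CC) : g = c + x * a1 * d + y * b1 * f ->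
    g - c = x * (a1 * d) + y * (b1 * f) by move=> ->; ring.
rewrite (aux _ _ _ _ _ _ _ _ (kill_expandl v w)).
rewrite mulrDr; apply: le_cabsD; apply: le_cabsM; rewrite ?cabs_dh ?cabs_hJ //.
all: by apply: le_cabsM.
Qed.

Lemma Gk_expandr_le v w a b : cabs (G (ev j) w) <= a -> cabs (G (ev i) w) <= b ->
  cabs (Gk v w - G v w) <= K * e * (cabs (Gk v (ev i)) * a + cabs (Gk v (ev j)) * b).
Proof.
move=> ha hb.
have aux (g a1 b1 c d f x y : CC) : g = c + x * a1 * d + y * b1 * f ->
    g - c = x * (a1 * d) + y * (b1 * f) by move=> ->; ring.
rewrite (aux _ _ _ _ _ _ _ _ (kill_expandr v w)).
rewrite mulrDr; apply: le_cabsD; apply: le_cabsM; rewrite ?cabs_dh ?cabs_hJ //.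
all: by apply: le_cabsM.
Qed.

(** Only the original resolvent is known to be bounded. The identities for the rows i and j form a
    linear system for the killed rows with small parameter K^2 e <= 1/4, which [two_by_two]
    inverts. *)
Lemma kill_pR w : cabs (Gk (ev i) w) + cabs (Gk (ev j) w) <= 2 * pR w.
Proof.
apply: (@two_by_two _ _ _ _ (K ^+ 2 * e)); rewrite ?cabs_ge0 ?K2e //.
all: apply: le_trans (dist_cabs _ _) _.
- apply: le_trans (Gk_expandl_le w hii hij) _; move: (cabs _) (cabs _) => a b.
  by rewrite le_eqVlt; apply/orP; left; apply/eqP; ring.
- apply: le_trans (Gk_expandl_le w hji hjj) _; move: (cabs _) (cabs _) => a b.
  by rewrite le_eqVlt; apply/orP; left; apply/eqP; ring.
Qed.

Lemma kill_pL v : cabs (Gk v (ev i)) + cabs (Gk v (ev j)) <= 2 * pL v.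
Proof.
apply: (@two_by_two _ _ _ _ (K ^+ 2 * e)); rewrite ?cabs_ge0 ?K2e //.
all: apply: le_trans (dist_cabs _ _) _.
- apply: le_trans (Gk_expandr_le v hji hii) _; move: (cabs _) (cabs _) => a b.
  by rewrite le_eqVlt; apply/orP; left; apply/eqP; ring.
- apply: le_trans (Gk_expandr_le v hjj hij) _; move: (cabs _) (cabs _) => a b.
  by rewrite le_eqVlt; apply/orP; left; apply/eqP; ring.
Qed.

Let K0 : 0 <= K. Proof. by apply: le_trans K4. Qed.
Let Ke0 : 0 <= K ^+ 2 * e. Proof. by rewrite mulr_ge0 ?exprn_ge0. Qed.

Lemma kill_rowi w : cabs (Gk (ev i) w - G (ev i) w) <= K ^+ 3 * e * pR w.
Proof.
apply: le_trans (Gk_expandl_le w hii hij) _.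
have aux (a b : R) : K * e * (K * a + K * b) = (K ^+ 2 * e) * (b + a) by ring.
rewrite aux.
apply: le_trans (ler_wpM2l Ke0 (kill_pR w)) _.
rewrite mulrA ler_wpM2r ?pR_ge0 // -subr_ge0.
have -> : K ^+ 3 * e - K ^+ 2 * e * 2 = (K ^+ 2 * e) * (K - 2) by ring.
by rewrite mulr_ge0 //; move: K4; lra.
Qed.

Lemma kill_rowj w : cabs (Gk (ev j) w - G (ev j) w) <= K ^+ 3 * e * pR w.
Proof.
apply: le_trans (Gk_expandl_le w hji hjj) _.
have aux (a b : R) : K * e * (K * a + K * b) = (K ^+ 2 * e) * (b + a) by ring.
rewrite aux.
apply: le_trans (ler_wpM2l Ke0 (kill_pR w)) _.
rewrite mulrA ler_wpM2r ?pR_ge0 // -subr_ge0.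
have -> : K ^+ 3 * e - K ^+ 2 * e * 2 = (K ^+ 2 * e) * (K - 2) by ring.
by rewrite mulr_ge0 //; move: K4; lra.
Qed.

Lemma kill_coli v : cabs (Gk v (ev i) - G v (ev i)) <= K ^+ 3 * e * pL v.
Proof.
apply: le_trans (Gk_expandr_le v hji hii) _.
have aux (a b : R) : K * e * (a * K + b * K) = (K ^+ 2 * e) * (a + b) by ring.
rewrite aux.
apply: le_trans (ler_wpM2l Ke0 (kill_pL v)) _.
rewrite mulrA ler_wpM2r ?pL_ge0 // -subr_ge0.
have -> : K ^+ 3 * e - K ^+ 2 * e * 2 = (K ^+ 2 * e) * (K - 2) by ring.
by rewrite mulr_ge0 //; move: K4; lra.
Qed.

Lemma kill_colj v : cabs (Gk v (ev j) - G v (ev j)) <= K ^+ 3 * e * pL v.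
Proof.
apply: le_trans (Gk_expandr_le v hjj hij) _.
have aux (a b : R) : K * e * (a * K + b * K) = (K ^+ 2 * e) * (a + b) by ring.
rewrite aux.
apply: le_trans (ler_wpM2l Ke0 (kill_pL v)) _.
rewrite mulrA ler_wpM2r ?pL_ge0 // -subr_ge0.
have -> : K ^+ 3 * e - K ^+ 2 * e * 2 = (K ^+ 2 * e) * (K - 2) by ring.
by rewrite mulr_ge0 //; move: K4; lra.
Qed.

Lemma kill_rowi_le w : cabs (Gk (ev i) w) <= 2 * pR w.
Proof. by apply: le_trans (kill_pR w); rewrite lerDl cabs_ge0. Qed.
Lemma kill_rowj_le w : cabs (Gk (ev j) w) <= 2 * pR w.
Proof. by apply: le_trans (kill_pR w); rewrite lerDr cabs_ge0. Qed.
Lemma kill_coli_le v : cabs (Gk v (ev i)) <= 2 * pL v.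
Proof. by apply: le_trans (kill_pL v); rewrite lerDl cabs_ge0. Qed.
Lemma kill_colj_le v : cabs (Gk v (ev j)) <= 2 * pL v.
Proof. by apply: le_trans (kill_pL v); rewrite lerDr cabs_ge0. Qed.

Lemma kill_beta_real (a b c d x y : R) : 0 <= a -> 0 <= b -> 0 <= c -> 0 <= d ->
  x <= d + K ^+ 3 * e * (c + d) -> y <= c + K ^+ 3 * e * (c + d) ->
  K * e * (a * x + b * y) <= K ^+ 4 * e * (a * d + b * c + e * (a + b) * (c + d)).
Proof.
move=> a0 b0 c0 d0 hx hy.
have h1 := ler_wpM2l a0 hx; have h2 := ler_wpM2l b0 hy.
have KK : 0 <= K * e by rewrite mulr_ge0.
apply: le_trans (ler_wpM2l KK (lerD h1 h2)) _.
have K3 : 0 <= (K ^+ 3 - 1) * (K * e * (a * d + b * c)).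
  have K1 : 0 <= K ^+ 3 - 1 by rewrite subr_ge0 exprn_ege1 //; move: K4; lra.
  by apply: mulr_ge0 => //; rewrite !(mulr_ge0, addr_ge0).
by rewrite -subr_ge0; apply: le_trans K3 _; rewrite le_eqVlt; apply/orP; left; apply/eqP; ring.
Qed.

Lemma kill_beta v w : cabs (Gk v w - G v w) <= K ^+ 4 * e * pbeta v w.
Proof.
apply: le_trans (Gk_expandl_le w (lexx _) (lexx _)) _.
have tri (x y : CC) (B : R) : cabs (x - y) <= B -> cabs x <= cabs y + B.
  by move=> hB; rewrite -[x in leLHS](subrK y) addrC; apply: le_cabsD.
by apply: kill_beta_real; rewrite ?cabs_ge0 // tri // ?kill_rowi ?kill_rowj.
Qed.

(** In the exact identity one factor belongs to the original matrix. Replacing it by the killed one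
    yields the derivative at the killed matrix and costs another factor e, by [kill_rowi] and
    [kill_rowj]. *)
Lemma kill_taylor v w :
  cabs (G v w - Gk v w - h * (- offd p * Gk v (ev i) * Gk (ev j) w) -
    (h^*)%C * (- Gk v (ev j) * Gk (ev i) w)) <= K ^+ 5 * e ^+ 2 * (pL v * pR w).
Proof.
have aux (g gk a b d f d' f' o x y : CC) : gk = g + o * x * a * d + y * b * f ->
    g - gk - x * (- o * a * d') - y * (- b * f') = o * x * (a * (d' - d)) + y * (b * (f' - f)).
  by move=> ->; ring.
rewrite (aux _ _ _ _ _ _ _ _ _ _ _ (kill_expandr v w)).
have b1 := le_cabsM cabs_dh (le_cabsM (lexx (cabs (Gk v (ev i)))) (kill_rowj w)).
have b2 := le_cabsM cabs_hJ (le_cabsM (lexx (cabs (Gk v (ev j)))) (kill_rowi w)).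
apply: le_trans (le_cabsD b1 b2) _.
have aux2 (a b r : R) : K * e * (a * (K ^+ 3 * e * r)) + K * e * (b * (K ^+ 3 * e * r)) =
   (K ^+ 4 * e ^+ 2 * r) * (a + b) by ring.
rewrite aux2.
have H0 : 0 <= K ^+ 4 * e ^+ 2 * pR w by rewrite !mulr_ge0 ?exprn_ge0 ?pR_ge0.
apply: le_trans (ler_wpM2l H0 (kill_pL v)) _.
have H1 : 0 <= (K - 2) * (K ^+ 4 * e ^+ 2 * pR w * pL v).
  by rewrite mulr_ge0 ?(mulr_ge0 H0) ?pL_ge0 //; move: K4; lra.
by rewrite -subr_ge0; apply: le_trans H1 _; rewrite le_eqVlt; apply/orP; left; apply/eqP; ring.
Qed.

End KillCalculus.

#[global] Opaque kill cabs.

(** * Sums over pairs of indices under square-sum bounds *)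

Section PairSums.
Context {R : realType}.

Lemma sum_pairM (I : finType) (f g : I -> R) :
  \sum_(p : I * I) f p.1 * g p.2 = (\sum_i f i) * (\sum_i g i).
Proof.
rewrite -(pair_bigA _ (fun i j => f i * g j)) /= mulr_suml.
by apply: eq_bigr => i _; rewrite mulr_sumr.
Qed.

Lemma sum_pairM_le (I : finType) (f g : I -> R) F G :
  (forall i, 0 <= f i) -> (forall i, 0 <= g i) ->
  \sum_i f i <= F -> \sum_i g i <= G -> \sum_(p : I * I) f p.1 * g p.2 <= F * G.
Proof.
move=> f0 g0 hf hg; rewrite sum_pairM; apply: ler_pM => //; exact: sumr_ge0.
Qed.

Variables (K e psi sN : R).
Hypotheses (K4 : 4 <= K) (sN1 : 1 <= sN) (eN : e * sN = 1) (epsi : e <= psi).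

Lemma e_gt0 : 0 < e.
Proof.
have sN0 : 0 < sN by exact: lt_le_trans ltr01 sN1.
by rewrite -(pmulr_lgt0 _ sN0) eN.
Qed.

Lemma e_le1 : e <= 1.
Proof. by rewrite -eN ler_peMr // ltW // e_gt0. Qed.

(** Every monomial on the right separates into a function of i times a function of j and keeps two
    factors x or y, the others being bounded by K, so that the Ward bound can be applied twice. *)
Lemma iso_point2 (a xi xj yi yj : R) : 0 <= a -> 0 <= xi <= K -> 0 <= xj <= K ->
  0 <= yi <= K -> 0 <= yj <= K ->
  a * (xi + xj) * (yi * xj + yj * xi + e * (yi + yj) * (xi + xj)) +
  a * (xj + e * (xi + xj)) * ((yi + yj) * (xi + xj)) <=
  16 * K * (a * xi * xj + a * xj ^+ 2 + a * xi * yj + e * a * xi ^+ 2).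
Proof.
move=> a0 /andP[xi0 xiK] /andP[xj0 xjK] /andP[yi0 yiK] /andP[yj0 yjK].
have e0 := ltW e_gt0; have e1 := e_le1.
have K0 : 0 <= K by move: K4; lra.
have a1 : 0 <= a * xi * xj by rewrite !mulr_ge0.
have a2 : 0 <= a * xj ^+ 2 by rewrite !mulr_ge0 ?exprn_ge0.
have a3 : 0 <= a * xi * yj by rewrite !mulr_ge0.
have a4 : 0 <= e * a * xi ^+ 2 by rewrite !mulr_ge0 ?exprn_ge0.
have a5 : 0 <= e * a * (xi + xj) ^+ 2 by rewrite !mulr_ge0 ?exprn_ge0 ?addr_ge0.
have d (u v : R) : u <= v -> 0 <= v - u by rewrite subr_ge0.
have h1 := mulr_ge0 a1 (d _ _ yiK); have h2 := mulr_ge0 a3 (d _ _ xiK).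
have h3 := mulr_ge0 a2 (d _ _ yiK); have h4 := mulr_ge0 a1 (d _ _ yjK).
have h4' := mulr_ge0 a2 (d _ _ yjK).
have h5 := mulr_ge0 a5 (d _ _ (lerD yiK yjK)).
have h6 := mulr_ge0 (mulr_ge0 (mulr_ge0 K0 e0) a0) (sqr_ge0 (xi - xj)).
have h7 := mulr_ge0 (mulr_ge0 K0 a2) (d _ _ e1).
have k1 := mulr_ge0 K0 a1; have k2 := mulr_ge0 K0 a2; have k3 := mulr_ge0 K0 a3.
have k4 := mulr_ge0 K0 a4.
lra.
Qed.

(** As in [iso_point2], now with three factors x or y, or with two such factors and extra powers of
    e. *)
Lemma iso_point3 (a xi xj yi yj : R) : 0 <= a -> 0 <= xi <= K -> 0 <= xj <= K ->
  0 <= yi <= K -> 0 <= yj <= K ->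
  a * (xj + e * (xi + xj)) * (yi * xj + yj * xi + e * (yi + yj) * (xi + xj)) ^+ 2 <=
  100 * K ^+ 3 * (a * yi * xj ^+ 2 + a * xi * (xj * yj) + e ^+ 2 * a * xi ^+ 2 * xj
    + e ^+ 2 * a * xj ^+ 2 + a * xi * yj ^+ 2 + e ^+ 3 * a * xi ^+ 2).
Proof.
move=> a0 /andP[xi0 xiK] /andP[xj0 xjK] /andP[yi0 yiK] /andP[yj0 yjK].
have e0 := ltW e_gt0; have e1 := e_le1.
have K0 : 0 <= K by move: K4; lra.
have K1 : 1 <= K by move: K4; lra.
set L := yi + yj; set Rr := xi + xj.
have L0 : 0 <= L by rewrite addr_ge0.
have R0 : 0 <= Rr by rewrite addr_ge0.
have LK : L <= 2 * K by rewrite /L; lra.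
have RK : Rr <= 2 * K by rewrite /Rr; lra.
set t := xj + e * Rr.
have eR : e * Rr <= 2 * K by apply: le_trans RK; rewrite ler_piMl.
have eR0 : 0 <= e * Rr by rewrite mulr_ge0.
have t0 : 0 <= t by rewrite addr_ge0.
have tK : t <= 3 * K by rewrite /t; lra.
have sq3 (u v s : R) : (u + v + s) ^+ 2 <= 3 * (u ^+ 2 + v ^+ 2 + s ^+ 2).
  by have := sqr_ge0 (u - v); have := sqr_ge0 (u - s); have := sqr_ge0 (v - s); lra.
have at0 : 0 <= a * t by rewrite mulr_ge0.
apply: le_trans (ler_wpM2l at0 (sq3 _ _ _)) _.
have p1 : a * t * (yi * xj) ^+ 2 <= 3 * K ^+ 2 * (a * yi * xj ^+ 2).
  have -> : a * t * (yi * xj) ^+ 2 = (t * yi) * (a * yi * xj ^+ 2) by ring.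
  apply: ler_wpM2r; first by rewrite !mulr_ge0 ?exprn_ge0.
  by rewrite expr2 mulrA; apply: ler_pM.
have p2 : a * t * (yj * xi) ^+ 2 <= K ^+ 2 * (a * xi * (xj * yj)) + 2 * K ^+ 2 * (a * xi * yj ^+ 2).
  have -> : a * t * (yj * xi) ^+ 2 = (xi * yj) * (a * xi * (xj * yj)) +
    (e * Rr * xi) * (a * xi * yj ^+ 2) by rewrite /t; ring.
  apply: lerD; apply: ler_wpM2r; rewrite ?mulr_ge0 ?exprn_ge0 //.
  - by rewrite expr2; apply: ler_pM.
  - by rewrite expr2 mulrA; apply: ler_pM.
have RR : Rr ^+ 2 <= 2 * xi ^+ 2 + 2 * xj ^+ 2.
  by rewrite /Rr; have := sqr_ge0 (xi - xj); lra.
have LL : L ^+ 2 <= 4 * K ^+ 2.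
  have -> : 4 * K ^+ 2 = (2 * K) ^+ 2 by ring.
  by apply: lerXn2r; rewrite ?nnegrE ?mulr_ge0.
have p3 : a * t * (e * L * Rr) ^+ 2 <= 4 * K ^+ 2 * (a * t * e ^+ 2 * (2 * xi ^+ 2 + 2 * xj ^+ 2)).
  have -> : a * t * (e * L * Rr) ^+ 2 = L ^+ 2 * (a * t * e ^+ 2 * Rr ^+ 2) by ring.
  apply: ler_pM => //; rewrite ?exprn_ge0 // ?mulr_ge0 ?exprn_ge0 //.
  by apply: ler_wpM2l => //; rewrite !mulr_ge0 ?exprn_ge0.
have p4 : a * t * e ^+ 2 * (2 * xi ^+ 2 + 2 * xj ^+ 2) <=
   2 * (e ^+ 2 * a * xi ^+ 2 * xj) + 4 * K * (e ^+ 3 * a * xi ^+ 2) + 6 * K * (e ^+ 2 * a * xj ^+ 2).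
  have q1 : 0 <= (2 * K - Rr) * (2 * (e ^+ 3 * a * xi ^+ 2)).
    by rewrite !mulr_ge0 ?exprn_ge0 // subr_ge0.
  have q2 : 0 <= (3 * K - t) * (2 * (e ^+ 2 * a * xj ^+ 2)).
    by rewrite !mulr_ge0 ?exprn_ge0 // subr_ge0.
  rewrite -subr_ge0; apply: le_trans (addr_ge0 q1 q2) _.
  by rewrite /t le_eqVlt; apply/orP; left; apply/eqP; ring.
have K2 : 0 <= 4 * K ^+ 2 by rewrite mulr_ge0 ?exprn_ge0.
have p5 := le_trans p3 (ler_wpM2l K2 p4).
set u1 := a * yi * xj ^+ 2 in p1 *; set u2 := a * xi * (xj * yj) in p2 *.
set u3 := e ^+ 2 * a * xi ^+ 2 * xj in p5 *; set u4 := e ^+ 2 * a * xj ^+ 2 in p5 *.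
set u5 := a * xi * yj ^+ 2 in p2 *; set u6 := e ^+ 3 * a * xi ^+ 2 in p5 *.
have n1 : 0 <= u1 by rewrite !mulr_ge0 ?exprn_ge0.
have n2 : 0 <= u2 by rewrite !mulr_ge0 ?exprn_ge0.
have n3 : 0 <= u3 by rewrite !mulr_ge0 ?exprn_ge0.
have n4 : 0 <= u4 by rewrite !mulr_ge0 ?exprn_ge0.
have n5 : 0 <= u5 by rewrite !mulr_ge0 ?exprn_ge0.
have n6 : 0 <= u6 by rewrite !mulr_ge0 ?exprn_ge0.
have K23 : K ^+ 2 <= K ^+ 3 by rewrite ler_weXn2l.
have K20 : 0 <= K ^+ 2 by rewrite exprn_ge0.
have w (u : R) : 0 <= u -> K ^+ 2 * u <= K ^+ 3 * u by move=> ?; rewrite ler_wpM2r.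
have g1 := w _ n1; have g2 := w _ n2; have g3 := w _ n3; have g5 := w _ n5.
have z (u : R) : 0 <= u -> 0 <= K ^+ 3 * u by move=> ?; rewrite mulr_ge0 ?exprn_ge0.
have z1 := z _ n1; have z2 := z _ n2; have z3 := z _ n3; have z4 := z _ n4.
have z5 := z _ n5; have z6 := z _ n6.
have aux (q1 q2 q3 v1 v2 v3 v5 w1 w2 w3 w4 w5 w6 : R) : q1 <= 3 * v1 -> q2 <= v2 + 2 * v5 ->
   q3 <= 8 * v3 + 16 * w6 + 24 * w4 -> v1 <= w1 -> v2 <= w2 -> v3 <= w3 -> v5 <= w5 ->
   0 <= w1 -> 0 <= w2 -> 0 <= w3 -> 0 <= w4 -> 0 <= w5 -> 0 <= w6 ->
   3 * q1 + 3 * q2 + 3 * q3 <= 100 * w1 + 100 * w2 + 100 * w3 + 100 * w4 + 100 * w5 + 100 * w6.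
  by lra.
have eL (q1 q2 q3 : R) : a * t * (3 * (q1 + q2 + q3)) =
   3 * (a * t * q1) + 3 * (a * t * q2) + 3 * (a * t * q3) by ring.
have eR' (c : R) : 100 * c * (u1 + u2 + u3 + u4 + u5 + u6) = 100 * (c * u1) + 100 * (c * u2)
   + 100 * (c * u3) + 100 * (c * u4) + 100 * (c * u5) + 100 * (c * u6) by ring.
rewrite eL eR'; apply: aux g1 g2 g3 g5 z1 z2 z3 z4 z5 z6.
- by rewrite [leRHS]mulrA.
- by rewrite [2 * _]mulrA.
- apply: le_trans p5 _; rewrite le_eqVlt; apply/orP; left; apply/eqP.
  clear; by clearbody u3 u4 u6; ring.
Qed.

Variables (I : finType) (a x y : I -> R).
Hypothesis cardI : #|I|%:R = sN ^+ 2.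
Hypotheses (a01 : forall i, 0 <= a i <= 1) (x0K : forall i, 0 <= x i <= K)
  (y0K : forall i, 0 <= y i <= K).
Hypotheses (ha : \sum_i a i ^+ 2 <= 1) (hx : \sum_i x i ^+ 2 <= (sN * psi) ^+ 2)
  (hy : \sum_i y i ^+ 2 <= (sN * psi) ^+ 2).

Let sN0 : 0 <= sN. Proof. exact: le_trans ler01 sN1. Qed.
Let psi0 : 0 <= psi. Proof. exact: le_trans (ltW e_gt0) epsi. Qed.
Let sp0 : 0 <= sN * psi. Proof. exact: mulr_ge0. Qed.
Let a0 i : 0 <= a i. Proof. by have /andP[] := a01 i. Qed.
Let x0 i : 0 <= x i. Proof. by have /andP[] := x0K i. Qed.
Let y0 i : 0 <= y i. Proof. by have /andP[] := y0K i. Qed.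

Lemma sum_sq1 : \sum_(i : I) 1 ^+ 2 <= sN ^+ 2.
Proof.
apply: le_trans (sum_le_card (B := 1) _) _; first by move=> i; rewrite expr1n.
by rewrite mulr1 cardI.
Qed.

Lemma sum_a : \sum_i a i <= sN.
Proof.
have h := cauchy_schwarz (a := a) (b := fun=> 1) ler01 sN0 _ sum_sq1.
by move: h; rewrite expr1n mul1r => /(_ ha); under eq_bigr do rewrite mulr1.
Qed.

Lemma sum_l1 (f : I -> R) : \sum_i f i ^+ 2 <= (sN * psi) ^+ 2 -> \sum_i f i <= sN ^+ 2 * psi.
Proof.
move=> hf; have h := cauchy_schwarz (b := fun=> 1) sp0 sN0 hf sum_sq1.
move: h; under eq_bigr do rewrite mulr1.
by move/le_trans; apply; rewrite le_eqVlt; apply/orP; left; apply/eqP; ring.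
Qed.

Lemma sum_af (f : I -> R) : \sum_i f i ^+ 2 <= (sN * psi) ^+ 2 -> \sum_i a i * f i <= sN * psi.
Proof.
move=> hf; rewrite -[sN * psi]mul1r; apply: cauchy_schwarz => //; by rewrite expr1n.
Qed.

Lemma sum_af2 (f : I -> R) : \sum_i f i ^+ 2 <= (sN * psi) ^+ 2 ->
  \sum_i a i * f i ^+ 2 <= (sN * psi) ^+ 2.
Proof.
move=> hf; apply: le_trans hf; apply: ler_sum => i _.
by rewrite ler_piMl ?sqr_ge0 //; have /andP[] := a01 i.
Qed.

Lemma sum_xy : \sum_i x i * y i <= (sN * psi) ^+ 2.
Proof. by rewrite expr2; apply: cauchy_schwarz. Qed.

Lemma sum_1 : \sum_(i : I) 1 <= sN ^+ 2.
Proof. by apply: le_trans sum_sq1; under [leRHS]eq_bigr do rewrite expr1n. Qed.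

Lemma e3sN : e ^+ 3 * sN ^+ 3 = 1.
Proof. by rewrite -exprMn eN expr1n. Qed.

(** Both products are of size N^(3/2) psi: the weight a contributes N^(1/2), a free index
    contributes N, and e^3 cancels exactly these. *)
Lemma iso_sum1 : \sum_(p : I * I) e ^+ 3 * (a p.1 * (x p.1 + x p.2)) <= 2 * psi.
Proof.
rewrite -mulr_sumr; under eq_bigr do rewrite mulrDr.
have e0 : 0 <= e ^+ 3 by rewrite exprn_ge0 // ltW // e_gt0.
rewrite big_split /=.
have h1 : \sum_(p : I * I) a p.1 * x p.1 <= sN * psi * sN ^+ 2.
  have := sum_pairM_le (f := fun i => a i * x i) (g := fun=> 1)
    (fun i => mulr_ge0 (a0 i) (x0 i)) (fun=> ler01) (sum_af hx) sum_1.
  by under eq_bigr do rewrite mulr1.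
have h2 := sum_pairM_le a0 x0 sum_a (sum_l1 hx).
apply: le_trans (ler_wpM2l e0 (lerD h1 h2)) _.
rewrite le_eqVlt; apply/orP; left; apply/eqP.
transitivity (e ^+ 3 * sN ^+ 3 * (2 * psi)); first ring.
by rewrite e3sN mul1r.
Qed.

Let bet i j := y i * x j + y j * x i + e * (y i + y j) * (x i + x j).

Lemma iso_sum2 : \sum_(p : I * I) e ^+ 3 * (a p.1 * (x p.1 + x p.2) * bet p.1 p.2 +
   a p.1 * (x p.2 + e * (x p.1 + x p.2)) * ((y p.1 + y p.2) * (x p.1 + x p.2))) <=
  K ^+ 4 * psi ^+ 2.
Proof.
have e0 : 0 <= e by rewrite ltW // e_gt0.
have K0 : 0 <= K by move: K4; lra.
have h (p : I * I) := iso_point2 (a0 p.1) (x0K p.1) (x0K p.2) (y0K p.1) (y0K p.2).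
apply: le_trans (ler_sum _ (fun p _ => ler_wpM2l (exprn_ge0 3 e0) (h p))) _.
rewrite -mulr_sumr -mulr_sumr !big_split /=.
have h1 : \sum_(p : I * I) a p.1 * x p.1 * x p.2 <= sN * psi * (sN ^+ 2 * psi).
  exact: (sum_pairM_le (f := fun i => a i * x i) (fun i => mulr_ge0 (a0 i) (x0 i)) x0
    (sum_af hx) (sum_l1 hx)).
have h2 : \sum_(p : I * I) a p.1 * x p.2 ^+ 2 <= sN * (sN * psi) ^+ 2.
  exact: (sum_pairM_le (g := fun i => x i ^+ 2) a0 (fun i => sqr_ge0 (x i)) sum_a hx).
have h3 : \sum_(p : I * I) a p.1 * x p.1 * y p.2 <= sN * psi * (sN ^+ 2 * psi).
  exact: (sum_pairM_le (f := fun i => a i * x i) (fun i => mulr_ge0 (a0 i) (x0 i)) y0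
    (sum_af hx) (sum_l1 hy)).
have h4 : \sum_(p : I * I) e * a p.1 * x p.1 ^+ 2 <= e * ((sN * psi) ^+ 2 * sN ^+ 2).
  under eq_bigr do rewrite -mulrA; rewrite -mulr_sumr ler_wpM2l //.
  have := sum_pairM_le (f := fun i => a i * x i ^+ 2) (g := fun=> 1)
    (fun i => mulr_ge0 (a0 i) (sqr_ge0 _)) (fun=> ler01) (sum_af2 hx) sum_1.
  by under eq_bigr do rewrite mulr1.
have E0 : 0 <= 16 * K by rewrite !mulr_ge0.
apply: le_trans (ler_wpM2l (exprn_ge0 3 e0) (ler_wpM2l E0 (lerD (lerD (lerD h1 h2) h3) h4))) _.
have -> : e ^+ 3 * (16 * K * (sN * psi * (sN ^+ 2 * psi) + sN * (sN * psi) ^+ 2 +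
   sN * psi * (sN ^+ 2 * psi) + e * ((sN * psi) ^+ 2 * sN ^+ 2))) =
   16 * K * psi ^+ 2 * (3 * (e * sN) ^+ 3 + (e * sN) ^+ 4) by ring.
rewrite eN !expr1n.
have k3 : 64 <= K ^+ 3.
  have -> : 64 = 4 ^+ 3 :> R by rewrite -natrX.
  by apply: lerXn2r; rewrite ?nnegrE.
have := mulr_ge0 (mulr_ge0 K0 (sqr_ge0 psi)) (_ : 0 <= K ^+ 3 - 64).
by rewrite subr_ge0 => /(_ k3); rewrite [K ^+ 4]exprS; lra.
Qed.

Lemma iso_sum3 : \sum_(p : I * I) e ^+ 3 * (a p.1 * (x p.2 + e * (x p.1 + x p.2)) *
   bet p.1 p.2 ^+ 2) <= K ^+ 8 * psi ^+ 3.
Proof.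
have e0 : 0 <= e by rewrite ltW // e_gt0.
have K0 : 0 <= K by move: K4; lra.
have h (p : I * I) := iso_point3 (a0 p.1) (x0K p.1) (x0K p.2) (y0K p.1) (y0K p.2).
apply: le_trans (ler_sum _ (fun p _ => ler_wpM2l (exprn_ge0 3 e0) (h p))) _.
rewrite -mulr_sumr -mulr_sumr !big_split /=.
set B := sN ^+ 3 * psi ^+ 3.
(* From psi >= e one gets N psi >= 1, so monomials with only two factors psi stay below the common
   bound [B]. *)
have sp1 : 1 <= sN ^+ 2 * psi.
  have : sN ^+ 2 * e <= sN ^+ 2 * psi by rewrite ler_wpM2l ?exprn_ge0.
  have -> : sN ^+ 2 * e = sN * (e * sN) by ring.
  by rewrite eN mulr1; exact: le_trans.
have B4 : sN * psi ^+ 2 <= B.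
  have -> : B = sN * psi ^+ 2 * (sN ^+ 2 * psi) by rewrite /B; ring.
  by rewrite ler_peMr // mulr_ge0 ?exprn_ge0.
have h1 : \sum_(p : I * I) a p.1 * y p.1 * x p.2 ^+ 2 <= B.
  have -> : B = sN * psi * (sN * psi) ^+ 2 by rewrite /B; ring.
  exact: (sum_pairM_le (f := fun i => a i * y i) (g := fun i => x i ^+ 2)
   (fun i => mulr_ge0 (a0 i) (y0 i)) (fun i => sqr_ge0 (x i)) (sum_af hy) hx).
have h2 : \sum_(p : I * I) a p.1 * x p.1 * (x p.2 * y p.2) <= B.
  have -> : B = sN * psi * (sN * psi) ^+ 2 by rewrite /B; ring.
  exact: (sum_pairM_le (f := fun i => a i * x i) (g := fun i => x i * y i)
   (fun i => mulr_ge0 (a0 i) (x0 i)) (fun i => mulr_ge0 (x0 i) (y0 i)) (sum_af hx) sum_xy).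
have h3 : \sum_(p : I * I) e ^+ 2 * a p.1 * x p.1 ^+ 2 * x p.2 <= B.
  have -> : \sum_(p : I * I) e ^+ 2 * a p.1 * x p.1 ^+ 2 * x p.2 =
     e ^+ 2 * \sum_(p : I * I) (a p.1 * x p.1 ^+ 2) * x p.2.
    by rewrite mulr_sumr; apply: eq_bigr => p _; ring.
  have hh := sum_pairM_le (f := fun i => a i * x i ^+ 2)
   (fun i => mulr_ge0 (a0 i) (sqr_ge0 (x i))) x0 (sum_af2 hx) (sum_l1 hx).
  apply: le_trans (ler_wpM2l (exprn_ge0 2 e0) hh) _.
  have -> : e ^+ 2 * ((sN * psi) ^+ 2 * (sN ^+ 2 * psi)) = (e * sN) ^+ 2 * (sN ^+ 2 * psi ^+ 3) by ring.
  by rewrite eN expr1n mul1r /B ler_wpM2r ?exprn_ge0 // ler_weXn2l.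
have h4 : \sum_(p : I * I) e ^+ 2 * a p.1 * x p.2 ^+ 2 <= B.
  have -> : \sum_(p : I * I) e ^+ 2 * a p.1 * x p.2 ^+ 2 =
     e ^+ 2 * \sum_(p : I * I) a p.1 * x p.2 ^+ 2.
    by rewrite mulr_sumr; apply: eq_bigr => p _; ring.
  have hh := sum_pairM_le (g := fun i => x i ^+ 2) a0 (fun i => sqr_ge0 (x i)) sum_a hx.
  apply: le_trans (ler_wpM2l (exprn_ge0 2 e0) hh) _.
  have -> : e ^+ 2 * (sN * (sN * psi) ^+ 2) = (e * sN) ^+ 2 * (sN * psi ^+ 2) by ring.
  by rewrite eN expr1n mul1r.
have h5 : \sum_(p : I * I) a p.1 * x p.1 * y p.2 ^+ 2 <= B.
  have -> : B = sN * psi * (sN * psi) ^+ 2 by rewrite /B; ring.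
  exact: (sum_pairM_le (f := fun i => a i * x i) (g := fun i => y i ^+ 2)
   (fun i => mulr_ge0 (a0 i) (x0 i)) (fun i => sqr_ge0 (y i)) (sum_af hx) hy).
have h6 : \sum_(p : I * I) e ^+ 3 * a p.1 * x p.1 ^+ 2 <= B.
  have -> : \sum_(p : I * I) e ^+ 3 * a p.1 * x p.1 ^+ 2 =
     e ^+ 3 * \sum_(p : I * I) (a p.1 * x p.1 ^+ 2) * 1.
    by rewrite mulr_sumr; apply: eq_bigr => p _; ring.
  have hh := sum_pairM_le (f := fun i => a i * x i ^+ 2) (g := fun=> 1)
    (fun i => mulr_ge0 (a0 i) (sqr_ge0 _)) (fun=> ler01) (sum_af2 hx) sum_1.
  apply: le_trans (ler_wpM2l (exprn_ge0 3 e0) hh) _.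
  have -> : e ^+ 3 * ((sN * psi) ^+ 2 * sN ^+ 2) = (e * sN) ^+ 3 * (sN * psi ^+ 2) by ring.
  by rewrite eN expr1n mul1r.
have E0 : 0 <= 100 * K ^+ 3 by rewrite !mulr_ge0 ?exprn_ge0.
apply: le_trans (ler_wpM2l (exprn_ge0 3 e0) (ler_wpM2l E0
  (lerD (lerD (lerD (lerD (lerD h1 h2) h3) h4) h5) h6))) _.
have -> : e ^+ 3 * (100 * K ^+ 3 * (B + B + B + B + B + B)) =
   600 * (K ^+ 3 * psi ^+ 3) * (e ^+ 3 * sN ^+ 3) by rewrite /B; ring.
rewrite e3sN mulr1.
have -> : K ^+ 8 * psi ^+ 3 = K ^+ 5 * (K ^+ 3 * psi ^+ 3) by ring.
apply: ler_wpM2r; first by rewrite mulr_ge0 ?exprn_ge0.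
apply: (@le_trans _ _ (4 ^+ 5)).
  by rewrite -natrX ler_nat.
by apply: lerXn2r; rewrite ?nnegrE.
Qed.

End PairSums.

(** * The isotropic equation *)

(** Linear arithmetic isolated from its context, so that [lra] meets variables in place of long
    products. *)
Lemma absorb_six {R : realType} (x y : R) : x <= 4^-1 * y -> 0 <= x -> 6 * x <= 2 * y.
Proof. by lra. Qed.

Lemma absorb_ten {R : realType} (q x y u : R) : q <= 8 * x -> x <= 4^-1 * y -> y <= 4^-1 * u -> 0 <= x -> q + 2 * x <= u.
Proof. by lra. Qed.

Lemma absorb_sum {R : realType} (x y u : R) : y <= x -> x <= 4^-1 * u -> 0 <= x -> x + y <= u.
Proof. by lra. Qed.

Section IsotropicData.
Context {R : realType} {N : nat}.
Local Notation CC := R[i].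
Variables (z m : CC) (v w : 'cV[CC]_N).
Local Notation vb p := ((v p.1 0)^*)%C.
Implicit Types (X : 'M[CC]_N) (u : 'cV[CC]_N).

(** Since X G = 1 + z G and m^2 + z m + 1 = 0, the deviation equals -m <v, X G w> - m^2 G_vw, whose
    first part is a linear form with coefficients [mc]. The variances turn -m X G into m^2 G up to
    the error G_jj - m, and this cancels [mq]. *)
Definition iso_data : @mmdata R N := {|
  mQ := fun X => Gq X z v w - m * cdot v w;
  mq := fun X => - m ^+ 2 * Gq X z v w;
  mc := fun p X => - m * vb p * Gq X z (ev p.2) w;
  mc1 := fun p X => m * vb p * (offd p * Gq X z (ev p.2) (ev p.1) * Gq X z (ev p.2) w);
  mc2 := fun p X => m * vb p * (Gq X z (ev p.2) (ev p.2) * Gq X z (ev p.1) w);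
  mQ1 := fun p X => - offd p * Gq X z v (ev p.1) * Gq X z (ev p.2) w;
  mQ2 := fun p X => - Gq X z v (ev p.2) * Gq X z (ev p.1) w |}.

Lemma nsq_entry (u : 'cV[CC]_N) i : nsq u <= 1 -> cabs (u i 0) <= 1.
Proof.
move=> h; rewrite -(@ler_pXn2r _ 2) ?nnegrE ?cabs_ge0 // expr1n.
apply: le_trans h; apply: (@le_sum_term _ _ (fun i => cabs (u i 0) ^+ 2)) => j.
exact: sqr_ge0.
Qed.

Lemma sqrt_nsq_le1 (u : 'cV[CC]_N) : nsq u <= 1 -> Num.sqrt (nsq u) <= 1.
Proof. by move=> h; rewrite -sqrtr1 ler_wsqrtr. Qed.

Lemma Gq_le_N X u u' (n : R) : hermx X -> 0 < complex.Im z -> 1 <= n * complex.Im z ->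
  nsq u <= 1 -> nsq u' <= 1 -> cabs (Gq X z u u') <= n.
Proof.
move=> hX z0 nz hu hu'; apply: le_trans (Gq_le_eta _ _ hX z0) _.
rewrite ler_pdivrMr //; apply: le_trans nz.
rewrite -[1]mulr1; apply: ler_pM; rewrite ?sqrtr_ge0 // sqrt_nsq_le1 //.
Qed.

Lemma cdot_mulmx X (y : 'cV[CC]_N) :
  cdot v (X *m y) = \sum_(p : 'I_N * 'I_N) vb p * X p.1 p.2 * y p.2 0.
Proof.
rewrite -(pair_bigA _ (fun i j => ((v i 0)^*)%C * X i j * y j 0)) /=.
apply: eq_bigr => i _; rewrite mxE mulr_sumr.
by apply: eq_bigr => j _; rewrite mulrA.
Qed.

Lemma green_eq (X : 'M[CC]_N) u : hermx X -> complex.Im z != 0 ->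
  X *m (green X z *m u) = u + z *: (green X z *m u).
Proof.
move=> hX z0; have := green_mulr hX z0; move/(congr1 (fun A => A *m u)).
rewrite mul1mx -mulmxA mulmxBl mul_scalar_mx => h.
by rewrite -[X in _ = X + _]h subrK.
Qed.

Lemma Gq_evl X j u : Gq X z (ev j) u = (green X z *m u) j 0.
Proof. by rewrite ?GqE cdot_evl. Qed.

Lemma iso_eq X : hermx X -> complex.Im z != 0 -> m ^+ 2 + z * m + 1 = 0 ->
  mQ iso_data X = \sum_p X p.1 p.2 * mc iso_data p X + mq iso_data X.
Proof.
move=> hX z0 hm /=.
have -> : \sum_(p : 'I_N * 'I_N) X p.1 p.2 * (- m * vb p * Gq X z (ev p.2) w) =
  - m * cdot v (X *m (green X z *m w)).
  rewrite cdot_mulmx mulr_sumr; apply: eq_bigr => p _.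
  by rewrite Gq_evl; ring.
rewrite green_eq // cdotDr cdotZr.
have -> : cdot v (green X z *m w) = Gq X z v w by rewrite ?GqE.
have -> : - m * (cdot v w + z * Gq X z v w) + - m ^+ 2 * Gq X z v w =
  - m * cdot v w + Gq X z v w - (m ^+ 2 + z * m + 1) * Gq X z v w by ring.
by rewrite hm mul0r subr0 addrC mulNr.
Qed.

Lemma iso_admissible (n : R) : 2 <= n -> 0 < complex.Im z -> 1 <= n * complex.Im z ->
  m ^+ 2 + z * m + 1 = 0 -> cabs m <= 1 -> nsq v <= 1 -> nsq w <= 1 ->
  admissible iso_data (n ^+ 3).
Proof.
move=> n2 z0 nz hm m1 hv hw.
have zn : complex.Im z != 0 by rewrite gt_eqF.
have n1 : 1 <= n by move: n2; lra.
have n0 : 0 <= n by move: n2; lra.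
have G X u u' : hermx X -> nsq u <= 1 -> nsq u' <= 1 -> cabs (Gq X z u u') <= n.
  by move=> *; exact: Gq_le_N.
have e1 i : nsq (@ev R N i) <= 1 by rewrite nsq_ev.
have vb1 p : cabs (vb p) <= 1 by rewrite cabsJ nsq_entry.
have mvb p : cabs (m * vb p) <= 1.
  by rewrite -[1]mulr1; exact: le_cabsM.
have mvbN p : cabs (- m * vb p) <= 1.
  by rewrite -[1]mulr1; apply: le_cabsM => //; rewrite cabsN.
have o1 p : cabs (- @offd R N p) <= 1 by rewrite cabsN cabs_offd.
have nX k : (k <= 3)%N -> n ^+ k <= n ^+ 3 by move=> k3; rewrite ler_weXn2l.
have mG u u' : mxmeas (fun X : 'M[CC]_N => Gq X z u u') by exact: mxmeas_Gq.
have mZ a (g : 'M[CC]_N -> CC) : mxmeas g -> mxmeas (fun X => a * g X).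
  by move=> mg; apply: mxmeasM => //; exact: mxmeas_cst.
split=> /=.
- by apply: mxmeasB => //; exact: mxmeas_cst.
- exact: mZ.
- by move=> p; exact: mZ.
- by move=> p; apply: (mZ); apply: mxmeasM => //; exact: mZ.
- by move=> p; apply: mZ; exact: mxmeasM.
- by move=> p; apply: mxmeasM => //; exact: mZ.
- by move=> p; apply: mxmeasM => //; exact: mxmeasN.
- exact: exprn_ege1.
- move=> X hX; apply: (@le_trans _ _ (n + 1 * 1)).
    apply: le_cabsB; first exact: G.
    apply: le_cabsM => //; apply: le_trans (cdot_le _ _) _.
    by rewrite -[1]mulr1; apply: ler_pM; rewrite ?sqrtr_ge0 // sqrt_nsq_le1.
  apply: (@le_trans _ _ (n ^+ 2)); last exact: nX.
  have := mulr_ge0 (n0) (_ : 0 <= n - 2); rewrite subr_ge0 => /(_ n2).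
  by move: n2; rewrite expr2; lra.
- move=> X hX; apply: (@le_trans _ _ (1 * n)); last by rewrite mul1r -[leLHS]expr1 nX.
  apply: le_cabsM; last exact: G.
  by rewrite cabsN cabsX exprn_ile1 // cabs_ge0.
- move=> p X hX; apply: (@le_trans _ _ (1 * n)); last by rewrite mul1r -[leLHS]expr1 nX.
  by apply: le_cabsM => //; exact: G.
- move=> p X hX; apply: (@le_trans _ _ (1 * (1 * n * n))).
    apply: le_cabsM => //; apply: le_cabsM; last exact: G.
    by apply: le_cabsM; [exact: cabs_offd|exact: G].
  by rewrite !mul1r -expr2 nX.
- move=> p X hX; apply: (@le_trans _ _ (1 * (n * n))).
    by apply: le_cabsM => //; apply: le_cabsM; exact: G.
  by rewrite mul1r -expr2 nX.
- move=> p X hX; apply: (@le_trans _ _ (1 * n * n)).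
    apply: le_cabsM; last exact: G.
    by apply: le_cabsM => //; exact: G.
  by rewrite mul1r -expr2 nX.
- move=> p X hX; apply: (@le_trans _ _ (n * n)).
    by apply: le_cabsM; rewrite ?cabsN; exact: G.
  by rewrite -expr2 nX.
- by move=> X hX; exact: iso_eq.
Qed.

End IsotropicData.

(** In [iso_E2] the variables are the products K^n M1 (letter c) and K^n M2 (letter d), with n in
    the name and t for ten. *)
Lemma iso_E2_aux (R : realType) (c4 c5 c6 c7 c8 c9 ct d8 d9 dt : R) :
  c4 <= 4^-1 * c5 -> c5 <= 4^-1 * c6 -> c6 <= 4^-1 * c7 -> c7 <= 4^-1 * c8 ->
  c8 <= 4^-1 * c9 -> c9 <= 4^-1 * ct -> d8 <= 4^-1 * d9 -> d9 <= 4^-1 * dt ->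
  0 <= c5 -> 0 <= c6 -> 0 <= c7 -> 0 <= c8 -> 0 <= c9 -> 0 <= ct -> 0 <= d9 -> 0 <= dt ->
  c8 + d9 + c4 + 2 * d8 + 2 * c6 <= ct + dt.
Proof. by lra. Qed.

Lemma pbeta_le_aux (R : realType) (K e xi xj yi yj : R) : 4 <= K -> 0 <= e <= 1 ->
  0 <= xi <= K -> 0 <= xj <= K -> 0 <= yi <= K -> 0 <= yj <= K ->
  yi * xj + yj * xi + e * (yi + yj) * (xi + xj) <= K ^+ 4.
Proof.
move=> K4 /andP[e0 e1] /andP[xi0 xiK] /andP[xj0 xjK] /andP[yi0 yiK] /andP[yj0 yjK].
have K0 : 0 <= K by exact: le_trans K4.
have h1 := ler_pM yi0 xj0 yiK xjK; have h2 := ler_pM yj0 xi0 yjK xiK.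
have h3 := ler_pM (mulr_ge0 e0 (addr_ge0 yi0 yj0)) (addr_ge0 xi0 xj0)
      (ler_pM e0 (addr_ge0 yi0 yj0) e1 (lerD yiK yjK)) (lerD xiK xjK).
have k2 : 6 * (K * K) <= K ^+ 4.
  have -> : K ^+ 4 = K ^+ 2 * (K * K) by ring.
  rewrite ler_wpM2r ?mulr_ge0 //; apply: (@le_trans _ _ (4 ^+ 2)); first by rewrite -natrX ler_nat.
  by apply: lerXn2r; rewrite ?nnegrE.
move: h1 h2 h3 k2; lra.
Qed.

(** * Error terms of the isotropic equation *)

Section IsotropicGood.
Context {R : realType} {N : nat}.
Local Notation CC := R[i].
Variables (z m : CC) (v w : 'cV[CC]_N) (X : 'M[CC]_N) (hX : hermx X).
Variables (S : 'I_N * 'I_N -> R) (T : 'I_N * 'I_N -> CC) (C : R).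
Hypotheses (z0 : 0 < complex.Im z) (C0 : 0 < C).
Hypotheses (S0 : forall p, 0 <= S p) (SC : forall p, S p <= C / N%:R)
  (TS : forall p, cabs (T p) <= S p) (Srow : forall i, \sum_j S (i, j) = 1).

(* The test vectors, of norm at most one, that arise from partially summing
   the covariances against [v]. *)
Definition vS j : 'cV[CC]_N := \col_i ((N%:R / C * S (i, j))%:C%C * v i 0).
Definition vT j : 'cV[CC]_N := \col_i ((N%:R / C)%:C%C * T (i, j) * ((v i 0)^*)%C).
Definition vTo j : 'cV[CC]_N := \col_i ((N%:R / C)%:C%C * (offd (i, j) * T (i, j)) * ((v i 0)^*)%C).

(** All vectors whose resolvent entries are needed. Their number is linear in N, so a union bound
    over them is affordable. *)
Inductive fam : 'cV[CC]_N -> Prop :=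
| fam_ev j : fam (ev j) | fam_v : fam v | fam_w : fam w
| fam_S j : fam (vS j) | fam_T j : fam (vT j) | fam_To j : fam (vTo j).

Variables (K e psi phi sN : R).
Hypotheses (K4 : 4 <= K) (CK : C <= K) (sN1 : 1 <= sN) (eN : e * sN = 1) (Nsq : N%:R = sN ^+ 2)
  (epsi : e <= psi) (psiK : psi <= K) (Ke : 4 * K ^+ 2 * e <= 1) (phi0 : 0 <= phi).
Hypothesis hent : forall p, cabs (X p.1 p.2) <= K * e.
Hypothesis hG : forall x y, fam x -> fam y -> cabs (Gq X z x y) <= K.
Hypothesis hIm : forall x, fam x -> complex.Im (Gq X z x x) <= complex.Im z * (sN * psi) ^+ 2.
Hypotheses (m1 : cabs m <= 1) (hv : nsq v <= 1)
  (hphi : forall j, cabs (Gq X z (ev j) (ev j) - m) <= phi).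

Local Notation G := (Gq X z).
Let D := iso_data z m v w.

Let zn : complex.Im z != 0. Proof. by rewrite gt_eqF. Qed.
Let K0 : 0 <= K. Proof. exact: le_trans K4. Qed.
Let K1 : 1 <= K. Proof. by move: K4; lra. Qed.
Let e0 : 0 <= e. Proof. exact: ltW (e_gt0 sN1 eN). Qed.
Let psi0 : 0 <= psi. Proof. exact: le_trans e0 epsi. Qed.
Let sN0 : 0 <= sN. Proof. exact: le_trans ler01 sN1. Qed.
Let Np : 0 < N%:R :> R.
Proof. by rewrite Nsq exprn_gt0 // (lt_le_trans ltr01). Qed.
Let cN0 : 0 <= C / N%:R. Proof. by rewrite divr_ge0 ?ltW. Qed.

Let x i := cabs (G (ev i) w).
Let y i := cabs (G v (ev i)).
Let a i := cabs (v i 0).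

Lemma row_sq u : fam u -> \sum_i cabs (G (ev i) u) ^+ 2 <= (sN * psi) ^+ 2.
Proof. by move=> fu; rewrite ward_r // ler_pdivrMr // mulrC hIm. Qed.

Lemma col_sq u : fam u -> \sum_i cabs (G u (ev i)) ^+ 2 <= (sN * psi) ^+ 2.
Proof. by move=> fu; rewrite ward_l // ler_pdivrMr // mulrC hIm. Qed.

Let hx : \sum_i x i ^+ 2 <= (sN * psi) ^+ 2. Proof. exact: row_sq fam_w. Qed.
Let hy : \sum_i y i ^+ 2 <= (sN * psi) ^+ 2. Proof. exact: col_sq fam_v. Qed.
Let cardI : #|'I_N|%:R = sN ^+ 2. Proof. by rewrite card_ord. Qed.
Let x0K i : 0 <= x i <= K.
Proof. by rewrite cabs_ge0 hG //; [exact: fam_ev|exact: fam_w]. Qed.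
Let y0K i : 0 <= y i <= K.
Proof. by rewrite cabs_ge0 hG //; [exact: fam_v|exact: fam_ev]. Qed.
Let a01 i : 0 <= a i <= 1.
Proof. by rewrite cabs_ge0 nsq_entry. Qed.

(** A weighted sum of N resolvent entries becomes C/N times one entry at a test vector. The triangle
    inequality would lose a factor N^(1/2) against this. *)
Lemma sum_vS j u : \sum_i (S (i, j))%:C%C * ((v i 0)^*)%C * G (ev i) u =
  (C / N%:R)%:C%C * G (vS j) u.
Proof.
have -> : G (vS j) u = \sum_i ((N%:R / C * S (i, j))%:C%C * ((v i 0)^*)%C) * G (ev i) u.
  rewrite GqE {1}/cdot; apply: eq_bigr => i _.
  by rewrite Gq_evl mxE conjcM conjc_real.
rewrite mulr_sumr; apply: eq_bigr => i _.
rewrite !mulrA -!rmorphM /= !mulrA divfK ?gt_eqF // divff ?mul1r // gt_eqF //.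
Qed.

Lemma sum_Svr j u : \sum_i (S (i, j))%:C%C * v i 0 * G u (ev i) =
  (C / N%:R)%:C%C * G u (vS j).
Proof.
have -> : G u (vS j) = \sum_i ((N%:R / C * S (i, j))%:C%C * v i 0) * G u (ev i).
  rewrite {1}(vec_sum_ev (vS j)).
  rewrite GqE mulmx_sumr cdot_sumr; apply: eq_bigr => i _.
  by rewrite GqE -scalemxAr cdotZr mxE.
rewrite mulr_sumr; apply: eq_bigr => i _.
rewrite !mulrA -!rmorphM /= !mulrA divfK ?gt_eqF // divff ?mul1r // gt_eqF //.
Qed.

Lemma sum_Tvr (T' : 'I_N * 'I_N -> CC) j u :
  \sum_i T' (i, j) * ((v i 0)^*)%C * G u (ev i) =
  (C / N%:R)%:C%C * G u (\col_i ((N%:R / C)%:C%C * T' (i, j) * ((v i 0)^*)%C)).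
Proof.
set uu := \col_i _.
have -> : G u uu = \sum_i ((N%:R / C)%:C%C * T' (i, j) * ((v i 0)^*)%C) * G u (ev i).
  rewrite {1}(vec_sum_ev uu).
  rewrite GqE mulmx_sumr cdot_sumr; apply: eq_bigr => i _.
  by rewrite GqE -scalemxAr cdotZr mxE.
rewrite mulr_sumr; apply: eq_bigr => i _.
rewrite !mulrA -!rmorphM /= !mulrA divfK ?gt_eqF // divff ?mul1r // gt_eqF //.
Qed.

Lemma sum_Tvl (T' : 'I_N * 'I_N -> CC) j u :
  \sum_i ((T' (i, j))^*)%C * v i 0 * G (ev i) u =
  (C / N%:R)%:C%C * G (\col_i ((N%:R / C)%:C%C * T' (i, j) * ((v i 0)^*)%C)) u.
Proof.
set uu := \col_i _.
have -> : G uu u = \sum_i ((N%:R / C)%:C%C * ((T' (i, j))^*)%C * v i 0) * G (ev i) u.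
  rewrite GqE {1}/cdot; apply: eq_bigr => i _.
  by rewrite Gq_evl mxE !conjcM conjc_real conjcK.
rewrite mulr_sumr; apply: eq_bigr => i _.
rewrite !mulrA -!rmorphM /= !mulrA divfK ?gt_eqF // divff ?mul1r // gt_eqF //.
Qed.

Lemma cC_le (u : CC) : cabs u <= K -> cabs ((C / N%:R)%:C%C * u) <= K ^+ 2 / N%:R.
Proof.
move=> hu; rewrite cabsM cabs_real ger0_norm //.
have -> : K ^+ 2 / N%:R = (K / N%:R) * K by rewrite expr2; ring.
apply: ler_pM; rewrite ?cabs_ge0 //; by rewrite ler_pM2r ?invr_gt0.
Qed.

Let sumxle : \sum_i x i <= sN ^+ 2 * psi.
Proof. exact: (sum_l1 sN1 eN epsi cardI hx). Qed.

Lemma sum_cC (F : 'I_N -> CC) (g : 'I_N -> R) (B : R) :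
  (forall j, cabs (F j) <= g j * (K ^+ 2 / N%:R)) -> \sum_j g j <= sN ^+ 2 * B ->
  cabs (\sum_j F j) <= K ^+ 2 * B.
Proof.
move=> hF hg; apply: le_trans (cabs_sum _ _ _) _.
apply: le_trans (ler_sum _ (fun j _ => hF j)) _; rewrite -mulr_suml.
have c0 : 0 <= K ^+ 2 / N%:R by rewrite divr_ge0 ?exprn_ge0 // ltW.
apply: le_trans (ler_wpM2r c0 hg) _; rewrite -Nsq.
by rewrite le_eqVlt; apply/orP; left; apply/eqP; field; rewrite gt_eqF.
Qed.

Lemma sum_pairE (F : 'I_N * 'I_N -> CC) : \sum_p F p = \sum_j \sum_i F (i, j).
Proof. by rewrite exchange_big pair_bigA /=; apply: eq_bigr => -[]. Qed.

(** The row sums of S recombine the test vectors into G_vw, so [mq] cancels what G_jj contributes at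
    the value m. The rest carries either G_jj - m, hence phi, or an entry G_jw from the
    pseudo-variances, whose average over j is at most psi. *)
Lemma iso_M0 : cabs (mq D X + \sum_p (T p * mc1 D p X + (S p)%:C%C * mc2 D p X)) <=
  K ^+ 2 * (psi + phi).
Proof.
have hvw : G v w = \sum_i ((v i 0)^*)%C * G (ev i) w.
  by rewrite GqE {1}/cdot; apply: eq_bigr => i _; rewrite Gq_evl.
have h1 : \sum_j (C / N%:R)%:C%C * G (vS j) w = G v w.
  under eq_bigr => j _ do rewrite -sum_vS.
  rewrite exchange_big hvw; apply: eq_bigr => i _ /=.
  rewrite -!mulr_suml -(rmorph_sum (real_complex R)) /= Srow.
  by rewrite (rmorph1 (real_complex R)) mul1r.
have -> : mq D X + \sum_p (T p * mc1 D p X + (S p)%:C%C * mc2 D p X) =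
  \sum_j m * (G (ev j) (ev j) - m) * ((C / N%:R)%:C%C * G (vS j) w) +
  \sum_j m * G (ev j) w * ((C / N%:R)%:C%C * G (ev j) (vTo j)).
  rewrite /= -h1 mulr_sumr sum_pairE -!big_split /=; apply: eq_bigr => j _.
  rewrite -(sum_Tvr (fun p => offd p * T p)) -sum_vS !mulr_sumr -!big_split /=.
  by apply: eq_bigr => i _; ring.
rewrite mulrDr [leRHS]addrC; apply: le_cabsD.
- apply: (sum_cC (g := fun=> phi)) => [j|].
    apply: le_cabsM; last by apply: cC_le; apply: hG; [exact: fam_S|exact: fam_w].
    by rewrite -[phi]mul1r; exact: le_cabsM.
  by apply: le_trans (sum_le_card (fun=> lexx phi)) _; rewrite cardI.
- apply: (sum_cC (g := x)) => [j|] //.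
  apply: le_cabsM; last by apply: cC_le; apply: hG; [exact: fam_ev|exact: fam_To].
  by rewrite -[x j]mul1r; exact: le_cabsM.
Qed.

Let sumx2 : \sum_i x i ^+ 2 <= sN ^+ 2 * psi ^+ 2. Proof. by rewrite -exprMn. Qed.
Let sumxy : \sum_i x i * y i <= sN ^+ 2 * psi ^+ 2.
Proof. by rewrite -exprMn expr2; apply: cauchy_schwarz; rewrite ?mulr_ge0. Qed.

Lemma iso_M1 : cabs (\sum_p (T p * (mc D p X * mQ1 D p X) + (S p)%:C%C * (mc D p X * mQ2 D p X)))
  <= K ^+ 2 * (2 * psi ^+ 2).
Proof.
have -> : \sum_p (T p * (mc D p X * mQ1 D p X) + (S p)%:C%C * (mc D p X * mQ2 D p X)) =
  \sum_j m * (G (ev j) w) ^+ 2 * ((C / N%:R)%:C%C * G v (vTo j)) +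
  \sum_j m * (G (ev j) w * G v (ev j)) * ((C / N%:R)%:C%C * G (vS j) w).
  rewrite /= sum_pairE -!big_split /=; apply: eq_bigr => j _.
  rewrite -(sum_Tvr (fun p => offd p * T p)) -sum_vS !mulr_sumr -!big_split /=.
  by apply: eq_bigr => i _; ring.
have -> : K ^+ 2 * (2 * psi ^+ 2) = K ^+ 2 * psi ^+ 2 + K ^+ 2 * psi ^+ 2 by ring.
apply: le_cabsD.
- apply: (sum_cC (g := fun j => x j ^+ 2)) => [j|] //.
  apply: le_cabsM; last by apply: cC_le; apply: hG; [exact: fam_v|exact: fam_To].
  by rewrite -[leRHS]mul1r; apply: le_cabsM => //; rewrite cabsX.
- apply: (sum_cC (g := fun j => x j * y j)) => [j|] //.
  apply: le_cabsM; last by apply: cC_le; apply: hG; [exact: fam_S|exact: fam_w].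
  by rewrite -[_ * y j]mul1r; apply: le_cabsM => //; exact: le_cabsM.
Qed.

Lemma sum_offd (f : 'I_N -> CC) j : \sum_i offd (i, j) * f i = \sum_i f i - f j.
Proof.
rewrite (bigD1 j) //= [in RHS](bigD1 j) //= {1}/offd /= eqxx mul0r add0r addrAC subrr add0r.
by apply: eq_bigr => i ij; rewrite /offd /= ij mul1r.
Qed.

(** The factor [offd] in the conjugated derivative does not fit a test vector [vS]: the full sum is
    taken and its diagonal term subtracted, which is the third sum below. *)
Lemma iso_M2 : cabs (\sum_p (T p * (mc D p X * ((mQ2 D p X)^*)%C) +
     (S p)%:C%C * (mc D p X * ((mQ1 D p X)^*)%C))) <= K ^+ 2 * (3 * psi ^+ 2).
Proof.
pose gg j := G (ev j) w * ((G (ev j) w)^*)%C.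
have -> : \sum_p (T p * (mc D p X * ((mQ2 D p X)^*)%C) +
     (S p)%:C%C * (mc D p X * ((mQ1 D p X)^*)%C)) =
  \sum_j m * (G (ev j) w * ((G v (ev j))^*)%C) * (((C / N%:R)%:C%C * G (vT j) w)^*)%C +
  (\sum_j m * gg j * (((C / N%:R)%:C%C * G v (vS j))^*)%C +
   \sum_j m * gg j * (- ((S (j, j))%:C%C * (((v j 0)^*)%C * ((G v (ev j))^*)%C)))).
  rewrite sum_pairE -!big_split /=; apply: eq_bigr => j _.
  have h1 : (((C / N%:R)%:C%C * G (vT j) w)^*)%C =
      \sum_i T (i, j) * (((v i 0)^*)%C * ((G (ev i) w)^*)%C).
    rewrite -(sum_Tvl T) conjc_sum; apply: eq_bigr => i _.
    by rewrite !conjcM conjcK mulrA.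
  have h2 : (((C / N%:R)%:C%C * G v (vS j))^*)%C - (S (j, j))%:C%C * (((v j 0)^*)%C * ((G v (ev j))^*)%C) =
      \sum_i offd (i, j) * ((S (i, j))%:C%C * (((v i 0)^*)%C * ((G v (ev i))^*)%C)).
    rewrite sum_offd; congr (_ - _).
    rewrite -sum_Svr conjc_sum; apply: eq_bigr => i _.
    by rewrite !conjcM conjc_real mulrA.
  rewrite -mulrDr h1 h2 !mulr_sumr -big_split /=; apply: eq_bigr => i _.
  have ho : ((@offd R N (i, j))^*)%C = offd (i, j) by rewrite /offd; case: (_ != _); rewrite ?conjc1 ?conjc0.
  by rewrite !conjcM !conjcN ho /gg; ring.
have -> : K ^+ 2 * (3 * psi ^+ 2) = K ^+ 2 * psi ^+ 2 + (K ^+ 2 * psi ^+ 2 + K ^+ 2 * psi ^+ 2).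
  by ring.
have hgg j : cabs (m * gg j) <= x j ^+ 2.
  rewrite -[_ ^+ 2]mul1r expr2; apply: le_cabsM => //; apply: le_cabsM => //.
  by rewrite cabsJ.
apply: le_cabsD; last apply: le_cabsD.
- apply: (sum_cC (g := fun j => x j * y j)) => [j|] //.
  apply: le_cabsM; last by rewrite cabsJ; apply: cC_le; apply: hG; [exact: fam_T|exact: fam_w].
  rewrite -[_ * y j]mul1r; apply: le_cabsM => //; apply: le_cabsM => //.
  by rewrite cabsJ.
- apply: (sum_cC (g := fun j => x j ^+ 2)) => [j|] //.
  apply: le_cabsM => //; rewrite cabsJ; apply: cC_le; apply: hG; [exact: fam_v|exact: fam_S].
- apply: (sum_cC (g := fun j => x j ^+ 2)) => [j|] //.
  apply: le_cabsM => //; rewrite cabsN.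
  have -> : K ^+ 2 / N%:R = (K / N%:R) * (1 * K) by rewrite expr2; ring.
  apply: le_cabsM; first rewrite cabs_real ger0_norm //.
    by apply: le_trans (SC _) _; rewrite ler_pM2r ?invr_gt0.
  by apply: le_cabsM; rewrite cabsJ ?nsq_entry //; apply: hG; [exact: fam_v|exact: fam_ev].
Qed.

Section Pair.
Variable p : 'I_N * 'I_N.
Local Notation i := p.1.
Local Notation j := p.2.
Local Notation h := (X p.1 p.2).
Local Notation Xk := (kill p X).
Local Notation L u := (pL X z p u).
Local Notation Rr u := (pR X z p u).
Let bt := pbeta X z p e v w.

Let hii : cabs (G (ev i) (ev i)) <= K. Proof. by apply: hG; exact: fam_ev. Qed.
Let hij : cabs (G (ev i) (ev j)) <= K. Proof. by apply: hG; exact: fam_ev. Qed.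
Let hji : cabs (G (ev j) (ev i)) <= K. Proof. by apply: hG; exact: fam_ev. Qed.
Let hjj : cabs (G (ev j) (ev j)) <= K. Proof. by apply: hG; exact: fam_ev. Qed.
Let L0 u : 0 <= L u. Proof. exact: pL_ge0. Qed.
Let R0 u : 0 <= Rr u. Proof. exact: pR_ge0. Qed.
Let a0 : 0 <= a i. Proof. exact: cabs_ge0. Qed.
Let bt0 : 0 <= bt. Proof. exact: pbeta_ge0. Qed.
Let mv1 : cabs (- m * ((v i 0)^*)%C) <= a i.
Proof. by rewrite -[a i]mul1r; apply: le_cabsM; rewrite ?cabsN ?cabsJ. Qed.
Let mv2 : cabs (m * ((v i 0)^*)%C) <= a i.
Proof. by rewrite -[a i]mul1r; apply: le_cabsM; rewrite ?cabsN ?cabsJ. Qed.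

Lemma Kpow n (M : R) : 0 <= M -> K ^+ n * M <= 4^-1 * (K ^+ n.+1 * M).
Proof.
move=> M0; have M1 : 0 <= K ^+ n * M by rewrite mulr_ge0 ?exprn_ge0.
have := mulr_ge0 M1 (_ : 0 <= K - 4); rewrite subr_ge0 => /(_ K4).
by rewrite exprS; move: (K ^+ n) => q; lra.
Qed.

Let Lj : L (ev j) <= 2 * K.
Proof. by apply: le_trans (lerD hji hjj) _; rewrite mulr2n mulrDl mul1r. Qed.
Let xjR : x j <= Rr w. Proof. by rewrite lerDr cabs_ge0. Qed.
Let xiR : x i <= Rr w. Proof. by rewrite lerDl cabs_ge0. Qed.

Lemma prod_diff (u u' s s' : CC) A1 B1 A2 B2 : cabs (u - s) <= A1 -> cabs u' <= B1 ->
  cabs s <= A2 -> cabs (u' - s') <= B2 -> cabs (u * u' - s * s') <= A1 * B1 + A2 * B2.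
Proof.
move=> h1 h2 h3 h4; have -> : u * u' - s * s' = (u - s) * u' + s * (u' - s') by ring.
by apply: le_cabsD; exact: le_cabsM.
Qed.

Lemma iso_c : cabs (mc D p X) <= a i * x j.
Proof. by rewrite /=; apply: le_cabsM. Qed.

Lemma iso_dc : cabs (mc D p X - mc D p Xk) <= K ^+ 3 * (e * (a i * Rr w)).
Proof.
rewrite /= -mulrBr.
have -> : K ^+ 3 * (e * (a i * Rr w)) = a i * (K ^+ 3 * e * Rr w) by ring.
apply: le_cabsM => //; rewrite cabsBC; exact: kill_rowj.
Qed.

Lemma iso_ck : cabs (mc D p Xk) <= K ^+ 3 * (a i * (x j + e * (x i + x j))).
Proof.
rewrite -[mc D p Xk](subKr (mc D p X)).
apply: le_trans (le_cabsB iso_c iso_dc) _.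
have -> : K ^+ 3 * (a i * (x j + e * (x i + x j))) =
  K ^+ 3 * (a i * x j) + K ^+ 3 * (e * (a i * (x i + x j))) by ring.
by rewrite lerD2r ler_peMl ?exprn_ege1 // mulr_ge0 ?cabs_ge0.
Qed.

Lemma iso_cerr : cerr D p X <= K ^+ 7 * (e ^+ 2 * (a i * Rr w)).
Proof.
rewrite /cerr /=.
have aux (n' v' x' y' h' k' o' a' b' c' d' : CC) :
   - n' * v' * x' - - n' * v' * y' - h' * (n' * v' * (o' * a' * b')) - k' * (n' * v' * (c' * d')) =
   - n' * v' * (x' - y' - h' * (- o' * a' * b') - k' * (- c' * d')) by ring.
rewrite aux.
have B := le_cabsM mv1 (kill_taylor hX zn K4 e0 Ke (hent p) hii hij hji hjj (ev j) w).
apply: (le_trans B).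
have -> : a i * (K ^+ 5 * e ^+ 2 * (L (ev j) * Rr w)) =
  L (ev j) * (K ^+ 5 * (e ^+ 2 * (a i * Rr w))) by ring.
have M0 : 0 <= e ^+ 2 * (a i * Rr w) by rewrite !mulr_ge0 ?exprn_ge0.
have M5 : 0 <= K ^+ 5 * (e ^+ 2 * (a i * Rr w)) by rewrite mulr_ge0 ?exprn_ge0.
have h1 := ler_wpM2r M5 Lj; have h2 := Kpow 6 M0; have M6 := mulr_ge0 K0 M5.
move: h1 h2 M6; rewrite [K ^+ 6]exprS -[2 * K * _]mulrA -[K * K ^+ 5 * _]mulrA; lra.
Qed.

Lemma iso_c12 : cabs (mc1 D p X) + cabs (mc2 D p X) <= 2 * (K * (a i * Rr w)).
Proof.
have h1 : cabs (mc1 D p X) <= a i * (1 * K * Rr w).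
  apply: le_cabsM => //; apply: le_cabsM; last exact: xjR.
  by apply: le_cabsM; [exact: cabs_offd|].
have h2 : cabs (mc2 D p X) <= a i * (K * Rr w).
  by apply: le_cabsM => //; apply: le_cabsM.
by apply: le_trans (lerD h1 h2) _; rewrite le_eqVlt; apply/orP; left; apply/eqP; ring.
Qed.

Lemma iso_dc12 : cabs (mc1 D p Xk - mc1 D p X) + cabs (mc2 D p Xk - mc2 D p X) <=
  K ^+ 6 * (e * (a i * Rr w)).
Proof.
have k1 : cabs (Gq Xk z (ev j) (ev i) - G (ev j) (ev i)) <= K ^+ 3 * e * L (ev j) by exact: kill_coli.
have k2 : cabs (Gq Xk z (ev j) (ev j) - G (ev j) (ev j)) <= K ^+ 3 * e * L (ev j) by exact: kill_colj.
have r1 : cabs (Gq Xk z (ev i) w - G (ev i) w) <= K ^+ 3 * e * Rr w by exact: kill_rowi.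
have r2 : cabs (Gq Xk z (ev j) w - G (ev j) w) <= K ^+ 3 * e * Rr w by exact: kill_rowj.
have q1 : cabs (Gq Xk z (ev i) w) <= 2 * Rr w.
  by apply: (@kill_rowi_le _ _ X z p hX zn K e) => //.
have q2 : cabs (Gq Xk z (ev j) w) <= 2 * Rr w.
  by apply: (@kill_rowj_le _ _ X z p hX zn K e) => //.
have p1 := le_cabsM mv2 (le_cabsM (@cabs_offd R N p) (prod_diff k1 q2 hji r2)).
have p2 := le_cabsM mv2 (prod_diff k2 q1 hjj r1).
have aux (n' o' a' b' c' d' : CC) : n' * (o' * a' * b') - n' * (o' * c' * d') = n' * (o' * (a' * b' - c' * d')) by ring.
have aux' (n' a' b' c' d' : CC) : n' * (a' * b') - n' * (c' * d') = n' * (a' * b' - c' * d') by ring.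
rewrite /= aux aux'.
apply: le_trans (lerD p1 p2) _.
have M0 : 0 <= e * (a i * Rr w) by rewrite !mulr_ge0.
have M3 : 0 <= 4 * (K ^+ 3 * (e * (a i * Rr w))) by rewrite !mulr_ge0 ?exprn_ge0.
have h1 := ler_wpM2r M3 Lj; have h4 := Kpow 4 M0; have h5 := Kpow 5 M0.
have M4 : 0 <= K ^+ 4 * (e * (a i * Rr w)) by rewrite !mulr_ge0 ?exprn_ge0.
have -> : a i * (1 * (K ^+ 3 * e * L (ev j) * (2 * Rr w) + K * (K ^+ 3 * e * Rr w))) +
  a i * (K ^+ 3 * e * L (ev j) * (2 * Rr w) + K * (K ^+ 3 * e * Rr w)) =
  L (ev j) * (4 * (K ^+ 3 * (e * (a i * Rr w)))) + 2 * (K ^+ 4 * (e * (a i * Rr w))) by ring.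
have e1 : 2 * K * (4 * (K ^+ 3 * (e * (a i * Rr w)))) = 8 * (K ^+ 4 * (e * (a i * Rr w))) by ring.
rewrite e1 in h1; exact: absorb_ten h1 h4 h5 M4.
Qed.

Lemma iso_b : Qdiff D p X <= K ^+ 4 * (e * bt).
Proof.
have aux (c c' u : CC) : c - u - (c' - u) = c - c' by ring.
by rewrite /Qdiff /= aux cabsBC [K ^+ 4 * _]mulrA; apply: kill_beta.
Qed.

Lemma iso_Q12 : cabs (mQ1 D p X) + cabs (mQ2 D p X) <= bt.
Proof.
have h1 : cabs (mQ1 D p X) <= 1 * y i * x j.
  by apply: le_cabsM => //; apply: le_cabsM => //; rewrite cabsN cabs_offd.
have h2 : cabs (mQ2 D p X) <= y j * x i by apply: le_cabsM; rewrite ?cabsN.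
by apply: le_trans (lerD h1 h2) _; rewrite mul1r /bt /pbeta lerDl !mulr_ge0.
Qed.

Lemma iso_dQ12 : cabs (mQ1 D p Xk - mQ1 D p X) + cabs (mQ2 D p Xk - mQ2 D p X) <=
  2 * (K ^+ 4 * (e * (L v * Rr w))).
Proof.
have k1 : cabs (Gq Xk z v (ev i) - G v (ev i)) <= K ^+ 3 * e * L v by exact: kill_coli.
have k2 : cabs (Gq Xk z v (ev j) - G v (ev j)) <= K ^+ 3 * e * L v by exact: kill_colj.
have r1 : cabs (Gq Xk z (ev i) w - G (ev i) w) <= K ^+ 3 * e * Rr w by exact: kill_rowi.
have r2 : cabs (Gq Xk z (ev j) w - G (ev j) w) <= K ^+ 3 * e * Rr w by exact: kill_rowj.
have q1 : cabs (Gq Xk z (ev i) w) <= 2 * Rr w.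
  by apply: (@kill_rowi_le _ _ X z p hX zn K e) => //.
have q2 : cabs (Gq Xk z (ev j) w) <= 2 * Rr w.
  by apply: (@kill_rowj_le _ _ X z p hX zn K e) => //.
have l1 : cabs (G v (ev i)) <= L v by rewrite lerDl cabs_ge0.
have l2 : cabs (G v (ev j)) <= L v by rewrite lerDr cabs_ge0.
have p1 := le_cabsM (@cabs_offd R N p) (prod_diff k1 q2 l1 r2).
have p2 := prod_diff k2 q1 l2 r1.
have aux (o' a' b' c' d' : CC) : - o' * a' * b' - - o' * c' * d' = - (o' * (a' * b' - c' * d')) by ring.
have aux' (a' b' c' d' : CC) : - a' * b' - - c' * d' = - (a' * b' - c' * d') by ring.
rewrite /= aux aux'.
rewrite !cabsN; apply: le_trans (lerD p1 p2) _.
have M0 : 0 <= e * (L v * Rr w) by rewrite !mulr_ge0.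
have h3 := Kpow 3 M0; have M3 : 0 <= K ^+ 3 * (e * (L v * Rr w)) by rewrite !mulr_ge0 ?exprn_ge0.
have -> : 1 * (K ^+ 3 * e * L v * (2 * Rr w) + L v * (K ^+ 3 * e * Rr w)) +
  (K ^+ 3 * e * L v * (2 * Rr w) + L v * (K ^+ 3 * e * Rr w)) =
  6 * (K ^+ 3 * (e * (L v * Rr w))) by ring.
exact: absorb_six h3 M3.
Qed.

Lemma iso_Qerr : Qerr D p X <= K ^+ 5 * (e ^+ 2 * (L v * Rr w)).
Proof.
have aux (c c' u : CC) : c - u - (c' - u) = c - c' by ring.
by rewrite /Qerr /= aux [K ^+ 5 * _]mulrA; apply: kill_taylor.
Qed.

Let CNle : C / N%:R <= K * e ^+ 2.
Proof.
have -> : e ^+ 2 = N%:R^-1.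
  by apply: (mulIf (lt0r_neq0 Np)); rewrite mulVf ?gt_eqF // Nsq -exprMn eN expr1n.
by rewrite ler_pM2r ?invr_gt0.
Qed.

Let aR0 : 0 <= a i * Rr w. Proof. exact: mulr_ge0. Qed.
Let t0 : 0 <= a i * (x j + e * (x i + x j)).
Proof. by rewrite mulr_ge0 // addr_ge0 ?cabs_ge0 // mulr_ge0 // addr_ge0 ?cabs_ge0. Qed.

(** In the bounds for a single pair only the powers of e and the surviving resolvent factors matter.
    The powers of K are generous, a spare one absorbing numerical constants. *)
Lemma iso_E1 : E1term (C / N%:R) D p X <= K ^+ 9 * (e ^+ 3 * (a i * (x i + x j))).
Proof.
have p1 := ler_pM (cabs_ge0 _) (cabs_ge0 _) (hent p) iso_cerr.
have d0 := addr_ge0 (cabs_ge0 (mc1 D p Xk - mc1 D p X)) (cabs_ge0 (mc2 D p Xk - mc2 D p X)).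
have p2 := ler_pM cN0 d0 CNle iso_dc12.
apply: le_trans (lerD p1 p2) _.
have M0 : 0 <= e ^+ 3 * (a i * Rr w) by rewrite mulr_ge0 ?exprn_ge0.
have -> : K * e * (K ^+ 7 * (e ^+ 2 * (a i * Rr w))) + K * e ^+ 2 * (K ^+ 6 * (e * (a i * Rr w))) =
  K ^+ 8 * (e ^+ 3 * (a i * Rr w)) + K ^+ 7 * (e ^+ 3 * (a i * Rr w)) by ring.
have h7 := Kpow 7 M0; have h8 := Kpow 8 M0.
have M8 : 0 <= K ^+ 8 * (e ^+ 3 * (a i * Rr w)) by rewrite mulr_ge0 ?exprn_ge0.
rewrite -[x i + x j]/(Rr w); lra.
Qed.

Lemma iso_E2 : E2term (C / N%:R) D p X <= K ^+ 10 * (e ^+ 3 * (a i * (x i + x j) * bt +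
   a i * (x j + e * (x i + x j)) * ((y i + y j) * (x i + x j)))).
Proof.
have c0 := @cabs_ge0 R.
have b0 : 0 <= Qdiff D p X by exact: c0.
have p1 := ler_pM (mulr_ge0 (c0 _) (c0 _)) b0 (ler_pM (c0 _) (c0 _) (hent p) iso_dc) iso_b.
have p2 := ler_pM (mulr_ge0 (c0 _) (c0 _)) (c0 _) (ler_pM (c0 _) (c0 _) (hent p) iso_ck) iso_Qerr.
have dc' : cabs (mc D p Xk - mc D p X) <= K ^+ 3 * (e * (a i * Rr w)) by rewrite cabsBC iso_dc.
have q0 := addr_ge0 (c0 (mQ1 D p X)) (c0 (mQ2 D p X)).
have dq0 := addr_ge0 (c0 (mQ1 D p Xk - mQ1 D p X)) (c0 (mQ2 D p Xk - mQ2 D p X)).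
have cc0 := addr_ge0 (c0 (mc1 D p X)) (c0 (mc2 D p X)).
have p31 := ler_pM (c0 _) q0 dc' iso_Q12.
have p32 := ler_pM (c0 _) dq0 iso_ck iso_dQ12.
have p3 := ler_pM cN0 (addr_ge0 (mulr_ge0 (c0 _) q0) (mulr_ge0 (c0 _) dq0)) CNle (lerD p31 p32).
have p4 := ler_pM (mulr_ge0 cN0 cc0) b0 (ler_pM cN0 cc0 CNle iso_c12) iso_b.
apply: le_trans (lerD (lerD (lerD p1 p2) p3) p4) _.
set M1 := e ^+ 3 * (a i * Rr w * bt).
set M2 := e ^+ 3 * (a i * (x j + e * (x i + x j)) * (L v * Rr w)).
have M10 : 0 <= M1 by rewrite mulr_ge0 ?exprn_ge0 // mulr_ge0.
have M20 : 0 <= M2 by rewrite mulr_ge0 ?exprn_ge0 // mulr_ge0 // mulr_ge0.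
have -> : K * e * (K ^+ 3 * (e * (a i * Rr w))) * (K ^+ 4 * (e * bt)) +
  K * e * (K ^+ 3 * (a i * (x j + e * (x i + x j)))) * (K ^+ 5 * (e ^+ 2 * (L v * Rr w))) +
  K * e ^+ 2 * (K ^+ 3 * (e * (a i * Rr w)) * bt +
    K ^+ 3 * (a i * (x j + e * (x i + x j))) * (2 * (K ^+ 4 * (e * (L v * Rr w))))) +
  K * e ^+ 2 * (2 * (K * (a i * Rr w))) * (K ^+ 4 * (e * bt)) =
  K ^+ 8 * M1 + K ^+ 9 * M2 + K ^+ 4 * M1 + 2 * (K ^+ 8 * M2) + 2 * (K ^+ 6 * M1).
  by rewrite /M1 /M2; ring.
have -> : K ^+ 10 * (e ^+ 3 * (a i * (x i + x j) * bt +
   a i * (x j + e * (x i + x j)) * ((y i + y j) * (x i + x j)))) = K ^+ 10 * M1 + K ^+ 10 * M2.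
  by rewrite -mulrDr /M1 /M2 -mulrDr.
have z1 n : 0 <= K ^+ n * M1 by rewrite mulr_ge0 ?exprn_ge0.
have z2 n : 0 <= K ^+ n * M2 by rewrite mulr_ge0 ?exprn_ge0.
have a4 := Kpow 4 M10; have a5 := Kpow 5 M10; have a6 := Kpow 6 M10; have a7 := Kpow 7 M10.
have a8 := Kpow 8 M10; have a9 := Kpow 9 M10; have b8 := Kpow 8 M20; have b9 := Kpow 9 M20.
have z15 := z1 5; have z16 := z1 6; have z17 := z1 7; have z18 := z1 8; have z19 := z1 9.
have z1t := z1 10; have z29 := z2 9; have z2t := z2 10.
exact: (iso_E2_aux a4 a5 a6 a7 a8 a9 b8 b9 z15 z16 z17 z18 z19 z1t z29 z2t).
Qed.

Lemma iso_E3 : E3term (C / N%:R) D p X <=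
  K ^+ 13 * (e ^+ 3 * (a i * (x j + e * (x i + x j)) * bt ^+ 2)).
Proof.
have c0 := @cabs_ge0 R.
have b0 : 0 <= Qdiff D p X by exact: c0.
have b2 : Qdiff D p X ^+ 2 <= (K ^+ 4 * (e * bt)) ^+ 2.
  by apply: lerXn2r; rewrite ?nnegrE ?mulr_ge0 ?exprn_ge0 // iso_b.
have p1 := ler_pM (mulr_ge0 (c0 _) (c0 _)) (sqr_ge0 _) (ler_pM (c0 _) (c0 _) (hent p) iso_ck) b2.
have q0 := addr_ge0 (c0 (mQ1 D p X)) (c0 (mQ2 D p X)).
have c1 : cabs (mc D p X) <= a i * (x j + e * (x i + x j)).
  apply: le_trans iso_c _; rewrite ler_wpM2l // lerDl mulr_ge0 // addr_ge0 ?cabs_ge0 //.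
have p2 := ler_pM (mulr_ge0 (mulr_ge0 cN0 (c0 _)) q0) b0
  (ler_pM (mulr_ge0 cN0 (c0 _)) q0 (ler_pM cN0 (c0 _) CNle c1) iso_Q12) iso_b.
apply: le_trans (lerD p1 p2) _.
set M := e ^+ 3 * _.
have M0 : 0 <= M by rewrite mulr_ge0 ?exprn_ge0 // mulr_ge0 ?exprn_ge0.
have -> : K * e * (K ^+ 3 * (a i * (x j + e * (x i + x j)))) * (K ^+ 4 * (e * bt)) ^+ 2 +
  K * e ^+ 2 * (a i * (x j + e * (x i + x j))) * bt * (K ^+ 4 * (e * bt)) =
  K ^+ 12 * M + K ^+ 5 * M by rewrite /M; ring.
have h1 : K ^+ 5 * M <= K ^+ 12 * M by rewrite ler_wpM2r // ler_weXn2l.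
have h2 := Kpow 12 M0; have h3 : 0 <= K ^+ 12 * M by rewrite mulr_ge0 ?exprn_ge0.
exact: absorb_sum h1 h2 h3.
Qed.

End Pair.

(** The pair sums give psi, psi^2 and psi^3 for the three error groups, as [good] demands. In the
    group of order k the exponent of K stays below 10 k: it is 10, 14 and 21. *)
Theorem iso_good : good S T (C / N%:R) (K ^+ 10 * (psi + phi)) D X.
Proof.
set A := psi + phi.
have A0 : 0 <= A by rewrite addr_ge0.
have pA : psi <= A by rewrite lerDl.
have K10 n m' : (n <= m')%N -> K ^+ n <= K ^+ m' by move=> nm; rewrite ler_weXn2l.
have pA2 n : psi ^+ n <= A ^+ n by apply: lerXn2r; rewrite ?nnegrE.
have bnd (B : R) n k : (n <= 10 * k)%N -> B <= K ^+ n * psi ^+ k -> B <= (K ^+ 10 * A) ^+ k.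
  move=> nk hB; apply: (le_trans hB); rewrite exprMn -exprM; apply: ler_pM;
  rewrite ?exprn_ge0 //; exact: K10.
split.
- apply: le_trans iso_M0 _; rewrite ler_wpM2r //; exact: K10.
- apply: (bnd _ 3 2) => //; apply: le_trans iso_M1 _.
  rewrite [K ^+ 3]exprSr -[leRHS]mulrA ler_wpM2l ?exprn_ge0 // ler_wpM2r ?exprn_ge0 //.
  by move: K4; lra.
- apply: (bnd _ 3 2) => //; apply: le_trans iso_M2 _.
  rewrite [K ^+ 3]exprSr -[leRHS]mulrA ler_wpM2l ?exprn_ge0 // ler_wpM2r ?exprn_ge0 //.
  by move: K4; lra.
- move=> p; rewrite -[leRHS]expr1; apply: (bnd _ 8 1) => //; rewrite expr1.
  apply: le_trans (iso_b p) _.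
  have hb : pbeta X z p e v w <= K ^+ 4.
    by apply: pbeta_le_aux; rewrite ?e0 ?(e_le1 sN1 eN) ?x0K ?y0K.
  have -> : K ^+ 8 * psi = K ^+ 4 * (psi * K ^+ 4) by ring.
  rewrite ler_wpM2l ?exprn_ge0 //; apply: ler_pM => //; exact: pbeta_ge0.
- rewrite -[leRHS]expr1; apply: (bnd _ 10 1) => //; rewrite expr1.
  apply: le_trans (ler_sum _ (fun p _ => iso_E1 p)) _; rewrite -mulr_sumr [K ^+ 10]exprSr -mulrA.
  rewrite ler_wpM2l ?exprn_ge0 //.
  apply: le_trans (iso_sum1 sN1 eN epsi cardI a01 x0K hv hx) _.
  by rewrite ler_wpM2r //; move: K4; lra.
- apply: (bnd _ 14 2) => //.
  apply: le_trans (ler_sum _ (fun p _ => iso_E2 p)) _; rewrite -mulr_sumr (exprD K 10 4) -mulrA.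
  rewrite ler_wpM2l ?exprn_ge0 //.
  exact: (iso_sum2 K4 sN1 eN epsi cardI a01 x0K y0K hv hx hy).
- apply: (bnd _ 21 3) => //.
  apply: le_trans (ler_sum _ (fun p _ => iso_E3 p)) _; rewrite -mulr_sumr (exprD K 13 8) -mulrA.
  rewrite ler_wpM2l ?exprn_ge0 //.
  exact: (iso_sum3 K4 sN1 eN epsi cardI a01 x0K y0K hv hx hy).
Qed.

End IsotropicGood.

(** * The diagonal equation *)

#[global] Opaque Gq.

Section PairCalculus.
Context {R : realType}.

(** For v = e_a only the pairs in row a count: N of them instead of N^2. *)
Lemma sum_row_weight (N : nat) (f : 'I_N * 'I_N -> R) (a : 'I_N) :
  \sum_p cabs ((ev a : 'cV[R[i]]_N) p.1 0) * f p = \sum_j f (a, j).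
Proof.
transitivity (\sum_i \sum_j cabs ((ev a : 'cV[R[i]]_N) i 0) * f (i, j)).
  by rewrite pair_bigA; apply: eq_bigr => -[].
rewrite (bigD1 a) //= [X in _ + X]big1 ?addr0 => [|i ia].
  by apply: eq_bigr => j _; rewrite /ev mxE !eqxx cabs1 mul1r.
by apply: big1 => j _; rewrite /ev mxE (negbTE ia) cabs0 mul0r.
Qed.

Variables (K : R).
Hypothesis K4 : 4 <= K.
Let K0 : 0 <= K. Proof. exact: le_trans K4. Qed.

Lemma Kmono n m (M : R) : (n <= m)%N -> 0 <= M -> K ^+ n * M <= K ^+ m * M.
Proof. by move=> nm M0; rewrite ler_wpM2r // ler_weXn2l //; move: K4; lra. Qed.

Lemma Kmono4 n m (M : R) : (n < m)%N -> 0 <= M -> 4 * (K ^+ n * M) <= K ^+ m * M.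
Proof.
move=> nm M0; apply: le_trans (Kmono nm M0).
by rewrite exprS -mulrA ler_wpM2r // mulr_ge0 ?exprn_ge0.
Qed.

Lemma Kmono16 n m (M : R) : (n.+1 < m)%N -> 0 <= M -> 16 * (K ^+ n * M) <= K ^+ m * M.
Proof.
move=> nm M0; apply: le_trans (Kmono nm M0).
have -> : 16 * (K ^+ n * M) = 4 * (4 * (K ^+ n * M)) by ring.
rewrite exprS -mulrA; apply: ler_pM => //; rewrite ?mulr_ge0 ?exprn_ge0 //.
exact: Kmono4.
Qed.

Variables (e xi xj yi yj q : R).
Hypotheses (e01 : 0 <= e <= 1) (xi01 : 0 <= xi <= K) (yi01 : 0 <= yi <= K)
  (xj01 : 0 <= xj <= K) (yj01 : 0 <= yj <= K) (q01 : 0 <= q <= K ^+ 2).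

Let bt := yi * xj + yj * xi + e * (yi + yj) * (xi + xj).
Let t := xj + e * (xi + xj).
Let B := xj + yj + e + q.

Lemma diag_point_bt : bt + q <= K ^+ 3 * B.
Proof.
move: e01 xi01 xj01 yi01 yj01 q01 => /andP[e0 e1] /andP[xi0 xiK] /andP[xj0 xjK] /andP[yi0 yiK]
  /andP[yj0 yjK] /andP[q0 qK].
have h1 : yi * xj <= K * xj by rewrite ler_wpM2r.
have h2 : yj * xi <= K * yj by rewrite mulrC ler_wpM2r.
have h3 : (yi + yj) * (xi + xj) <= (K + K) * (K + K).
  by apply: ler_pM; rewrite ?addr_ge0 // lerD.
have h4 : e * (yi + yj) * (xi + xj) <= 4 * (K ^+ 2 * e).
  rewrite -mulrA; apply: le_trans (ler_wpM2l e0 h3) _.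
  by rewrite le_eqVlt; apply/orP; left; apply/eqP; ring.
have h5 := Kmono4 (isT : (2 < 3)%N) e0.
have h6 : 1 * q <= K ^+ 3 * q by rewrite ler_wpM2r // exprn_ege1 //; move: K4; lra.
have h7 := Kmono (isT : (1 <= 3)%N) xj0; have h8 := Kmono (isT : (1 <= 3)%N) yj0.
rewrite !expr1 in h7 h8.
have -> : K ^+ 3 * B = K ^+ 3 * xj + K ^+ 3 * yj + K ^+ 3 * e + K ^+ 3 * q by rewrite /B; ring.
rewrite /bt; move: h1 h2 h4 h5 h6 h7 h8; move: (yi * xj) (yj * xi) (e * (yi + yj) * (xi + xj)) => *; lra.
Qed.

Lemma diag_point_t : t <= K ^+ 2 * B.
Proof.
move: e01 xi01 xj01 yi01 yj01 q01 => /andP[e0 e1] /andP[xi0 xiK] /andP[xj0 xjK] /andP[yi0 yiK]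
  /andP[yj0 yjK] /andP[q0 qK].
have h1 : e * (xi + xj) <= e * (K + K) by rewrite ler_wpM2l // lerD.
have h2 : 1 * xj <= K ^+ 2 * xj by rewrite ler_wpM2r // exprn_ege1 //; move: K4; lra.
have h3 := Kmono4 (isT : (1 < 2)%N) e0.
have h4 : 0 <= K ^+ 2 * yj by rewrite mulr_ge0 ?exprn_ge0.
have h5 : 0 <= K ^+ 2 * q by rewrite mulr_ge0 ?exprn_ge0.
have h6 : 0 <= K * e by rewrite mulr_ge0.
rewrite /t /B !mulrDr expr1 in h1 h2 h3 *; move: h1 h2 h3 h4 h5 h6.
move: (e * xi) (e * xj) (K ^+ 2) => *; lra.
Qed.

Lemma diag_point_B : 0 <= B <= K ^+ 3.
Proof.
move: e01 xi01 xj01 yi01 yj01 q01 => /andP[e0 e1] /andP[xi0 xiK] /andP[xj0 xjK] /andP[yi0 yiK]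
  /andP[yj0 yjK] /andP[q0 qK].
apply/andP; split; first by rewrite /B !addr_ge0.
have := Kmono4 (isT : (2 < 3)%N) ler01; have := Kmono4 (isT : (1 < 2)%N) ler01.
by rewrite !mulr1 expr1 /B; move: K4; lra.
Qed.

Lemma diag_point_sq : B ^+ 2 <= 4 * (xj ^+ 2 + yj ^+ 2 + e ^+ 2 + q ^+ 2).
Proof.
have := sqr_ge0 (xj - yj); have := sqr_ge0 (xj - e); have := sqr_ge0 (xj - q).
by have := sqr_ge0 (yj - e); have := sqr_ge0 (yj - q); have := sqr_ge0 (e - q); rewrite /B; lra.
Qed.

(** Both t and bt + q are at most a power of K times B, and the sum of B^2 over j is of order N
    psi^2 by the Ward identity. *)
Lemma diag_point2 : t * (bt + q) <= K ^+ 5 * B ^+ 2.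
Proof.
move: e01 xi01 xj01 yi01 yj01 q01 => /andP[e0 e1] /andP[xi0 xiK] /andP[xj0 xjK] /andP[yi0 yiK]
  /andP[yj0 yjK] /andP[q0 qK].
have -> : K ^+ 5 * B ^+ 2 = K ^+ 2 * B * (K ^+ 3 * B) by ring.
apply: ler_pM; rewrite ?diag_point_t ?diag_point_bt ?addr_ge0 ?mulr_ge0 ?addr_ge0 //.
Qed.

Lemma diag_point3 : t * (bt + q) ^+ 2 <= K ^+ 11 * B ^+ 2.
Proof.
have /andP[B0 B1] := diag_point_B.
move: e01 xi01 xj01 yi01 yj01 q01 => /andP[e0 e1] /andP[xi0 xiK] /andP[xj0 xjK] /andP[yi0 yiK]
  /andP[yj0 yjK] /andP[q0 qK].
have b0 : 0 <= bt + q by rewrite ?addr_ge0 ?mulr_ge0 ?addr_ge0.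
have t0 : 0 <= t by rewrite ?addr_ge0 ?mulr_ge0 ?addr_ge0.
have h1 : t <= K ^+ 5.
  apply: le_trans diag_point_t _; rewrite (exprD K 2 3); apply: ler_wpM2l => //.
  by rewrite exprn_ge0.
have -> : K ^+ 11 * B ^+ 2 = K ^+ 5 * (K ^+ 3 * B) ^+ 2 by ring.
apply: ler_pM => //; rewrite ?exprn_ge0 //.
by apply: lerXn2r; rewrite ?nnegrE ?mulr_ge0 ?exprn_ge0 // diag_point_bt.
Qed.

End PairCalculus.

Section DiagonalData.
Context {R : realType} {N : nat}.
Local Notation CC := R[i].
Variables (z : CC) (S : 'I_N * 'I_N -> R) (a : 'I_N).
Implicit Types (X : 'M[CC]_N).

Definition gdiag X i : CC := Gq X z (ev i) (ev i).
Definition Sdiag X i : CC := \sum_k (S (i, k))%:C%C * gdiag X k.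

(* The coefficients of the isotropic expansion at [v = w = e_a] with [-1] in place
   of [m]; the derivative of [mQ] is treated as an error. *)
Definition diag_data : @mmdata R N := {|
  mQ := fun X => 1 + z * gdiag X a + Sdiag X a * gdiag X a;
  mq := fun X => Sdiag X a * gdiag X a;
  mc := mc (iso_data z (-1) (ev a) (ev a));
  mc1 := mc1 (iso_data z (-1) (ev a) (ev a));
  mc2 := mc2 (iso_data z (-1) (ev a) (ev a));
  mQ1 := fun _ _ => 0;
  mQ2 := fun _ _ => 0 |}.

Hypotheses (S0 : forall p, 0 <= S p) (Srow : forall i, \sum_j S (i, j) = 1).

Lemma Sdiag_le X i (n : R) : (forall k, cabs (gdiag X k) <= n) -> cabs (Sdiag X i) <= n.
Proof.
move=> h; apply: le_trans (cabs_sum _ _ _) _.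
apply: (@le_trans _ _ (\sum_k S (i, k) * n)); last by rewrite -mulr_suml Srow mul1r.
apply: ler_sum => k _; rewrite cabsM cabs_real ger0_norm //.
by rewrite ler_wpM2l.
Qed.

Lemma diag_admissible (n : R) : 3 <= n -> 0 < complex.Im z -> 1 <= n * complex.Im z ->
  cabs z <= n -> admissible diag_data (n ^+ 3).
Proof.
move=> n3 z0 nz zn.
have zi : complex.Im z != 0 by rewrite gt_eqF.
have n1 : 1 <= n by move: n3; lra.
have n0 : 0 <= n by move: n3; lra.
have e1 i : nsq (@ev R N i) <= 1 by rewrite nsq_ev.
have G X u u' : hermx X -> nsq u <= 1 -> nsq u' <= 1 -> cabs (Gq X z u u') <= n.
  by move=> *; exact: Gq_le_N.
have gd X k : hermx X -> cabs (gdiag X k) <= n by move=> hX; exact: G.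
have sd X k : hermx X -> cabs (Sdiag X k) <= n by move=> hX; apply: Sdiag_le => ?; exact: gd.
have mG u u' : mxmeas (fun X : 'M[CC]_N => Gq X z u u') by exact: mxmeas_Gq.
have mZ b (g : 'M[CC]_N -> CC) : mxmeas g -> mxmeas (fun X => b * g X).
  by move=> mg; apply: mxmeasM => //; exact: mxmeas_cst.
have mS i : mxmeas (fun X => Sdiag X i).
  by apply: mxmeas_sum => k; apply: mZ; exact: mG.
have nX k : (k <= 3)%N -> n ^+ k <= n ^+ 3 by move=> k3; rewrite ler_weXn2l.
have vb1 p : cabs (((ev a : 'cV[CC]_N) p.1 0)^*)%C <= 1 by rewrite cabsJ nsq_entry.
have mvb p : cabs (-1 * (((ev a : 'cV[CC]_N) p.1 0)^*)%C) <= 1.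
  by rewrite mulN1r cabsN.
have mvbN p : cabs (- -1 * (((ev a : 'cV[CC]_N) p.1 0)^*)%C) <= 1.
  by rewrite opprK mul1r.
have qb X : hermx X -> cabs (Sdiag X a * gdiag X a) <= n ^+ 2.
  by move=> hX; rewrite expr2; apply: le_cabsM; [exact: sd|exact: gd].
split=> /=.
- apply: mxmeasD; last by apply: mxmeasM => //; exact: mG.
  by apply: mxmeasD; [exact: mxmeas_cst|apply: mZ; exact: mG].
- by apply: mxmeasM => //; exact: mG.
- by move=> p; exact: mZ.
- by move=> p; apply: (mZ); apply: mxmeasM => //; exact: mZ.
- by move=> p; apply: mZ; exact: mxmeasM.
- by move=> p; exact: mxmeas_cst.
- by move=> p; exact: mxmeas_cst.
- exact: exprn_ege1.
- move=> X hX; apply: (@le_trans _ _ (1 + n * n + n ^+ 2)).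
    apply: le_cabsD; last exact: qb.
    apply: le_cabsD; first by rewrite cabs1.
    by apply: le_cabsM => //; exact: gd.
  have h := mulr_ge0 (sqr_ge0 n) (_ : 0 <= n - 3); rewrite subr_ge0 in h.
  have := h n3; have : 1 <= n ^+ 2 by rewrite exprn_ege1.
  by rewrite [n ^+ 3]exprSr -expr2; lra.
- by move=> X hX; apply: le_trans (qb _ hX) _; exact: nX.
- move=> p X hX; apply: (@le_trans _ _ (1 * n)); last by rewrite mul1r -[leLHS]expr1 nX.
  by apply: le_cabsM => //; exact: G.
- move=> p X hX; apply: (@le_trans _ _ (1 * (1 * n * n))).
    apply: le_cabsM => //; apply: le_cabsM; last exact: G.
    by apply: le_cabsM; [exact: cabs_offd|exact: G].
  by rewrite !mul1r -expr2 nX.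
- move=> p X hX; apply: (@le_trans _ _ (1 * (n * n))).
    by apply: le_cabsM => //; apply: le_cabsM; exact: G.
  by rewrite mul1r -expr2 nX.
- by move=> p X hX; rewrite cabs0 exprn_ge0.
- by move=> p X hX; rewrite cabs0 exprn_ge0.
- move=> X hX; congr (_ + _).
  transitivity (cdot (ev a) (X *m (green X z *m ev a))).
    rewrite green_eq // cdotDr cdotZr cdot_nsq nsq_ev; congr (_ + _ * _).
    by rewrite /gdiag GqE.
  rewrite cdot_mulmx; apply: eq_bigr => p _.
  by rewrite Gq_evl; ring.
Qed.

End DiagonalData.

(** * Error terms of the diagonal equation *)

Section DiagonalGood.
Context {R : realType} {N : nat}.
Local Notation CC := R[i].
Variables (z : CC) (a : 'I_N) (X : 'M[CC]_N) (hX : hermx X).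
Variables (S : 'I_N * 'I_N -> R) (T : 'I_N * 'I_N -> CC) (C : R).
Hypotheses (z0 : 0 < complex.Im z) (C0 : 0 < C).
Hypotheses (S0 : forall p, 0 <= S p) (SC : forall p, S p <= C / N%:R)
  (TS : forall p, cabs (T p) <= S p) (Srow : forall i, \sum_j S (i, j) = 1).
Variables (K e psi sN : R).
Hypotheses (K4 : 4 <= K) (CK : C <= K) (sN1 : 1 <= sN) (eN : e * sN = 1) (Nsq : N%:R = sN ^+ 2)
  (epsi : e <= psi) (psiK : psi <= K) (Ke : 4 * K ^+ 2 * e <= 1) (zK : cabs z <= K).
Hypothesis hent : forall p, cabs (X p.1 p.2) <= K * e.
Local Notation fam := (fam (ev a) (ev a) S T C).
Hypothesis hG : forall x y, fam x -> fam y -> cabs (Gq X z x y) <= K.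
Hypothesis hIm : forall x, fam x -> complex.Im (Gq X z x x) <= complex.Im z * (sN * psi) ^+ 2.

Local Notation G := (Gq X z).
Let D := diag_data z S a.
Let D' := iso_data z (-1) (ev a) (ev a).

Let zn : complex.Im z != 0. Proof. by rewrite gt_eqF. Qed.
Let K0 : 0 <= K. Proof. exact: le_trans K4. Qed.
Let K1 : 1 <= K. Proof. by move: K4; lra. Qed.
Let e0 : 0 <= e. Proof. exact: ltW (e_gt0 sN1 eN). Qed.
Let e1 : e <= 1. Proof. exact: e_le1 sN1 eN. Qed.
Let e01 : 0 <= e <= 1. Proof. by apply/andP; split. Qed.
Let psi0 : 0 <= psi. Proof. exact: le_trans e0 epsi. Qed.
Let sN0 : 0 <= sN. Proof. exact: le_trans ler01 sN1. Qed.
Let Np : 0 < N%:R :> R.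
Proof. by rewrite Nsq exprn_gt0 // (lt_le_trans ltr01). Qed.
Let cN0 : 0 <= C / N%:R. Proof. by rewrite divr_ge0 ?ltW. Qed.
Let m1 : cabs (-1 : CC) <= 1. Proof. by rewrite cabsN cabs1. Qed.
Let sp0 : 0 <= sN * psi. Proof. exact: mulr_ge0. Qed.
Let hGev i j : cabs (G (ev i) (ev j)) <= K.
Proof. by apply: hG; exact: fam_ev. Qed.
Let CNle : C / N%:R <= K * e ^+ 2.
Proof.
have -> : e ^+ 2 = N%:R^-1.
  by apply: (mulIf (lt0r_neq0 Np)); rewrite mulVf ?gt_eqF // Nsq -exprMn eN expr1n.
by rewrite ler_pM2r ?invr_gt0.
Qed.

Let x i := cabs (G (ev i) (ev a)).
Let y i := cabs (G (ev a) (ev i)).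
Let w i := cabs ((ev a : 'cV[CC]_N) i 0).

Let hr i : \sum_k cabs (G (ev k) (ev i)) ^+ 2 <= (sN * psi) ^+ 2.
Proof. by rewrite ward_r // ler_pdivrMr // mulrC hIm //; exact: fam_ev. Qed.
Let hc i : \sum_k cabs (G (ev i) (ev k)) ^+ 2 <= (sN * psi) ^+ 2.
Proof. by rewrite ward_l // ler_pdivrMr // mulrC hIm //; exact: fam_ev. Qed.

(** The weights are of order 1/N, and the products in [pbeta] are summed over k by Cauchy-Schwarz
    and the Ward identity; the average therefore gains psi^2. *)
Lemma Sdiag_diff p i : cabs (Sdiag z S X i - Sdiag z S (kill p X) i) <= K ^+ 7 * (e * psi ^+ 2).
Proof.
rewrite /Sdiag -sumrB; apply: le_trans (cabs_sum _ _ _) _.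
have h k : cabs ((S (i, k))%:C%C * gdiag z X k - (S (i, k))%:C%C * gdiag z (kill p X) k) <=
  (K * e ^+ 2) * (K ^+ 4 * e * pbeta X z p e (ev k) (ev k)).
  rewrite -mulrBr; apply: le_cabsM.
    by rewrite cabs_real ger0_norm // (le_trans (SC _)).
  by rewrite cabsBC; apply: kill_beta => //; exact: hGev.
apply: le_trans (ler_sum _ (fun k _ => h k)) _; rewrite -mulr_sumr -mulr_sumr.
have cs i1 i2 := cauchy_schwarz sp0 sp0 (hr i1) (hc i2).
have cs1 i1 i2 := cauchy_schwarz sp0 sp0 (hr i1) (hr i2).
have hb : \sum_k pbeta X z p e (ev k) (ev k) <= 6 * (sN * psi) ^+ 2.
  rewrite /pbeta /pL /pR.
  have -> : \sum_k (cabs (G (ev k) (ev p.1)) * cabs (G (ev p.2) (ev k)) +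
     cabs (G (ev k) (ev p.2)) * cabs (G (ev p.1) (ev k)) +
     e * (cabs (G (ev k) (ev p.1)) + cabs (G (ev k) (ev p.2))) *
     (cabs (G (ev p.1) (ev k)) + cabs (G (ev p.2) (ev k)))) =
    (\sum_k cabs (G (ev k) (ev p.1)) * cabs (G (ev p.2) (ev k)) +
     \sum_k cabs (G (ev k) (ev p.2)) * cabs (G (ev p.1) (ev k))) + e *
    ((\sum_k cabs (G (ev k) (ev p.1)) * cabs (G (ev p.1) (ev k)) +
     \sum_k cabs (G (ev k) (ev p.1)) * cabs (G (ev p.2) (ev k))) +
    (\sum_k cabs (G (ev k) (ev p.2)) * cabs (G (ev p.1) (ev k)) +
     \sum_k cabs (G (ev k) (ev p.2)) * cabs (G (ev p.2) (ev k)))).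
    rewrite -!big_split mulr_sumr -big_split /=; apply: eq_bigr => k _.
    have aux (b1 b2 b3 b4 : R) : b1 * b4 + b2 * b3 + e * (b1 + b2) * (b3 + b4) =
      (b1 * b4 + b2 * b3) + e * ((b1 * b3 + b1 * b4) + (b2 * b3 + b2 * b4)) by ring.
    by rewrite aux; congr (_ + _); rewrite mulrDr.
  have h4 := lerD (lerD (cs p.1 p.1) (cs p.1 p.2)) (lerD (cs p.2 p.1) (cs p.2 p.2)).
  apply: le_trans (lerD (lerD (cs p.1 p.2) (cs p.2 p.1)) (ler_wpM2l e0 h4)) _.
  have s0 : 0 <= sN * psi * (sN * psi) by rewrite mulr_ge0.
  have := mulr_ge0 s0 (_ : 0 <= 1 - e); rewrite subr_ge0 => /(_ e1).
  by rewrite expr2; lra.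
have c0 : 0 <= K ^+ 4 * e by rewrite mulr_ge0 ?exprn_ge0.
have c1 : 0 <= K * e ^+ 2 by rewrite mulr_ge0 ?exprn_ge0.
apply: le_trans (ler_wpM2l c1 (ler_wpM2l c0 hb)) _.
have -> : K * e ^+ 2 * (K ^+ 4 * e * (6 * (sN * psi) ^+ 2)) =
  6 * ((e * sN) ^+ 2 * (K ^+ 5 * (e * psi ^+ 2))) by ring.
rewrite eN expr1n mul1r.
have M0 : 0 <= e * psi ^+ 2 by rewrite mulr_ge0 ?exprn_ge0.
have := Kmono16 K4 (isT : (6 < 7)%N) M0.
by have : 0 <= K ^+ 5 * (e * psi ^+ 2) by [rewrite mulr_ge0 ?exprn_ge0]; lra.
Qed.

Section Pair.
Variable p : 'I_N * 'I_N.
Local Notation i := p.1.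
Local Notation j := p.2.
Local Notation h := (X p.1 p.2).
Local Notation Xk := (kill p X).
Let bt := pbeta X z p e (ev a) (ev a).
Let t := x j + e * (x i + x j).
Let ex := e * (bt + psi ^+ 2).

Let x01 k : 0 <= x k <= K. Proof. by rewrite cabs_ge0 hGev. Qed.
Let y01 k : 0 <= y k <= K. Proof. by rewrite cabs_ge0 hGev. Qed.
Let bt0 : 0 <= bt. Proof. exact: pbeta_ge0. Qed.
Let bt4 : bt <= K ^+ 4.
Proof. exact: (pbeta_le_aux K4 e01 (x01 i) (x01 j) (y01 i) (y01 j)). Qed.
Let ex0 : 0 <= ex. Proof. by apply: mulr_ge0 => //; apply: addr_ge0 => //; exact: exprn_ge0. Qed.
Let w0 : 0 <= w i. Proof. exact: cabs_ge0. Qed.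
Let R0 : 0 <= x i + x j. Proof. by rewrite addr_ge0 ?cabs_ge0. Qed.
Let t0 : 0 <= t. Proof. by rewrite addr_ge0 ?cabs_ge0 // mulr_ge0. Qed.
Let wt0 : 0 <= w i * t. Proof. exact: mulr_ge0. Qed.
Let eRt : e * (w i * (x i + x j)) <= w i * t.
Proof.
have -> : e * (w i * (x i + x j)) = w i * (e * (x i + x j)) by ring.
by rewrite ler_wpM2l // lerDr cabs_ge0.
Qed.

Lemma diag_b : Qdiff D p X <= K ^+ 16 * ex.
Proof.
have hd : cabs (gdiag z X a - gdiag z Xk a) <= K ^+ 4 * ex.
  rewrite cabsBC; apply: le_trans (kill_beta hX zn K4 e0 Ke (hent p) (hGev _ _) (hGev _ _)
    (hGev _ _) (hGev _ _) (ev a) (ev a)) _.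
  rewrite -mulrA ler_wpM2l ?exprn_ge0 // ler_wpM2l // lerDl exprn_ge0 //.
have hs : cabs (Sdiag z S X a - Sdiag z S Xk a) <= K ^+ 7 * ex.
  apply: le_trans (Sdiag_diff p a) _.
  by rewrite ler_wpM2l ?exprn_ge0 // ler_wpM2l // lerDr.
have hd8 : cabs (gdiag z X a - gdiag z Xk a) <= K ^+ 4 * K ^+ 4.
  rewrite cabsBC; apply: le_trans (kill_beta hX zn K4 e0 Ke (hent p) (hGev _ _) (hGev _ _)
    (hGev _ _) (hGev _ _) (ev a) (ev a)) _.
  rewrite -mulrA ler_wpM2l ?exprn_ge0 //; apply: le_trans bt4.
  by rewrite ler_piMl.
have hgk : cabs (gdiag z Xk a) <= K + K ^+ 4 * K ^+ 4.
  have -> : gdiag z Xk a = gdiag z X a - (gdiag z X a - gdiag z Xk a) by ring.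
  by apply: le_cabsB => //; exact: hGev.
have hS : cabs (Sdiag z S X a) <= K by apply: Sdiag_le => // k; exact: hGev.
have aux (g g' s s' : CC) : 1 + z * g + s * g - (1 + z * g' + s' * g') =
  z * (g - g') + (s * (g - g') + (s - s') * g') by ring.
rewrite /Qdiff /= aux.
apply: le_trans (le_cabsD (le_cabsM zK hd) (le_cabsD (le_cabsM hS hd) (le_cabsM hs hgk))) _.
have -> : K * (K ^+ 4 * ex) + (K * (K ^+ 4 * ex) + K ^+ 7 * ex * (K + K ^+ 4 * K ^+ 4)) =
  2 * (K ^+ 5 * ex) + K ^+ 8 * ex + K ^+ 15 * ex by ring.
have h1 := Kmono4 K4 (isT : (5 < 16)%N) ex0; have h2 := Kmono4 K4 (isT : (8 < 16)%N) ex0.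
have h3 := Kmono4 K4 (isT : (15 < 16)%N) ex0.
have h5 : 0 <= K ^+ 5 * ex by rewrite mulr_ge0 ?exprn_ge0.
by move: h1 h2 h3 h5; clearbody ex; lra.
Qed.

Let hck := iso_ck (m := -1) (v := ev a) (w := ev a) hX z0 K4 sN1 eN Ke hent hG m1 p.
Let hdc := iso_dc (m := -1) (v := ev a) (w := ev a) hX z0 K4 sN1 eN Ke hent hG m1 p.
Let hc12 := iso_c12 (m := -1) (v := ev a) (w := ev a) (X := X) hG m1 p.

(** With the derivative of Q set to zero, the Taylor error of Q is only as small as its increment.
    Two powers of e suffice nevertheless, as the weight w leaves just one row of pairs. *)
Lemma diag_E2 : E2term (C / N%:R) D p X <= K ^+ 22 * (e ^+ 2 * (w i * (t * (bt + psi ^+ 2)))).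
Proof.
have c0 := @cabs_ge0 R.
have b0 : 0 <= Qdiff D p X by exact: c0.
have dcl : cabs (mc D p X - mc D p Xk) <= K ^+ 3 * (w i * t).
  by apply: (le_trans hdc); rewrite ler_wpM2l ?exprn_ge0.
have p1 := ler_pM (mulr_ge0 (c0 _) (c0 _)) b0 (ler_pM (c0 _) (c0 _) (hent p) dcl) diag_b.
have qe : Qerr D p X <= K ^+ 16 * ex.
  by rewrite /Qerr /= !mulr0 !subr0; exact: diag_b.
have p2 := ler_pM (mulr_ge0 (c0 _) (c0 _)) (c0 _) (ler_pM (c0 _) (c0 _) (hent p) hck) qe.
have cc0 := addr_ge0 (c0 (mc1 D p X)) (c0 (mc2 D p X)).
have p4 := ler_pM (mulr_ge0 cN0 cc0) b0 (ler_pM cN0 cc0 CNle hc12) diag_b.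
have -> : E2term (C / N%:R) D p X =
  cabs h * cabs (mc D p X - mc D p Xk) * Qdiff D p X +
  cabs h * cabs (mc D p Xk) * Qerr D p X +
  C / N%:R * (cabs (mc1 D p X) + cabs (mc2 D p X)) * Qdiff D p X.
  by rewrite /E2term /= !subr0 !cabs0 !addr0 !mulr0 !addr0 mulr0 addr0.
apply: le_trans (lerD (lerD p1 p2) p4) _.
set M := e ^+ 2 * (w i * (t * (bt + psi ^+ 2))).
have M0 : 0 <= M.
  by apply: mulr_ge0; rewrite ?exprn_ge0 // mulr_ge0 // mulr_ge0 // addr_ge0 // exprn_ge0.
have -> : K * e * (K ^+ 3 * (w i * t)) * (K ^+ 16 * ex) = K ^+ 20 * M by rewrite /M /ex; ring.
have -> : K * e ^+ 2 * (2 * (K * (w i * pR X z p (ev a)))) * (K ^+ 16 * ex) =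
   2 * K ^+ 18 * (e * (w i * (x i + x j))) * e * ex by rewrite /pR -/(x i) -/(x j); ring.
have h1 : 2 * K ^+ 18 * (e * (w i * (x i + x j))) * e * ex <= 2 * (K ^+ 18 * M).
  have -> : 2 * (K ^+ 18 * M) = 2 * K ^+ 18 * (w i * t) * e * ex by rewrite /M /ex; ring.
  by rewrite ler_wpM2r // ler_wpM2r // ler_wpM2l // mulr_ge0 // exprn_ge0.
have h2 := Kmono4 K4 (isT : (20 < 22)%N) M0; have h3 := Kmono4 K4 (isT : (18 < 22)%N) M0.
have h5 : 0 <= K ^+ 20 * M by rewrite mulr_ge0 ?exprn_ge0.
have h6 : 0 <= K ^+ 18 * M by rewrite mulr_ge0 ?exprn_ge0.
move: (2 * K ^+ 18 * (e * (w i * (x i + x j))) * e * ex) h1 => q; clearbody M.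
move: (K ^+ 20 * M) (K ^+ 18 * M) (K ^+ 22 * M) h2 h3 h5 h6 => q1 q2 q3; lra.
Qed.

Lemma diag_E3 : E3term (C / N%:R) D p X <= K ^+ 36 * (e ^+ 3 * (w i * (t * (bt + psi ^+ 2) ^+ 2))).
Proof.
have c0 := @cabs_ge0 R.
have b0 : 0 <= Qdiff D p X by exact: c0.
have b2 : Qdiff D p X ^+ 2 <= (K ^+ 16 * ex) ^+ 2.
  have r0 : 0 <= K ^+ 16 * ex by rewrite mulr_ge0 ?exprn_ge0.
  by apply: lerXn2r; [exact: b0|exact: r0|exact: diag_b].
have p1 := ler_pM (mulr_ge0 (c0 _) (c0 _)) (sqr_ge0 _) (ler_pM (c0 _) (c0 _) (hent p) hck) b2.
have -> : E3term (C / N%:R) D p X = cabs h * cabs (mc D p Xk) * Qdiff D p X ^+ 2.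
  have aux (a' b' c' d' x' y' f' : R) : x' = 0 -> y' = 0 -> a' * b' * c' + d' * (x' + y') * f' = a' * b' * c'.
    by move=> -> ->; rewrite addr0 mulr0 mul0r addr0.
  by apply: aux; exact: cabs0.
have -> : K ^+ 36 * (e ^+ 3 * (w i * (t * (bt + psi ^+ 2) ^+ 2))) =
  K * e * (K ^+ 3 * (w i * t)) * (K ^+ 16 * ex) ^+ 2 by rewrite /ex; ring.
exact: p1.
Qed.

End Pair.

Let Bj j := x j + y j + e + psi ^+ 2.
Let p201 : 0 <= psi ^+ 2 <= K ^+ 2.
Proof. by rewrite exprn_ge0 //= lerXn2r ?nnegrE. Qed.
Let x01 k : 0 <= x k <= K. Proof. by rewrite cabs_ge0 hGev. Qed.
Let y01 k : 0 <= y k <= K. Proof. by rewrite cabs_ge0 hGev. Qed.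
Let cardI : #|'I_N|%:R = sN ^+ 2. Proof. by rewrite card_ord. Qed.

Lemma diag_sumB : e ^+ 2 * \sum_j Bj j ^+ 2 <= K ^+ 5 * psi ^+ 2.
Proof.
have e20 : 0 <= e ^+ 2 by rewrite exprn_ge0.
have h1 : \sum_j Bj j ^+ 2 <= 4 * (\sum_j x j ^+ 2 + \sum_j y j ^+ 2 +
   \sum_(j : 'I_N) (e ^+ 2 + (psi ^+ 2) ^+ 2)).
  rewrite -!big_split mulr_sumr /=; apply: ler_sum => j _.
  by apply: le_trans (diag_point_sq _ _ _ _) _; rewrite addrA.
have h2 : \sum_(j : 'I_N) (e ^+ 2 + (psi ^+ 2) ^+ 2) <= sN ^+ 2 * (e ^+ 2 + (psi ^+ 2) ^+ 2).
  by rewrite -cardI; exact: sum_le_card.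
have E4 : 0 <= 4 :> R by [].
apply: le_trans (ler_wpM2l e20 (le_trans h1 (ler_wpM2l E4 (lerD (lerD (hr a) (hc a)) h2)))) _.
have -> : e ^+ 2 * (4 * ((sN * psi) ^+ 2 + (sN * psi) ^+ 2 + sN ^+ 2 * (e ^+ 2 + (psi ^+ 2) ^+ 2))) =
  (e * sN) ^+ 2 * (4 * (2 * psi ^+ 2 + (e ^+ 2 + psi ^+ 2 * psi ^+ 2))) by ring.
rewrite eN expr1n mul1r.
have /andP[q0 q1] := p201.
have h3 : e ^+ 2 <= psi ^+ 2 by rewrite lerXn2r ?nnegrE.
have h4 := ler_wpM2r q0 q1.
have h5 := Kmono16 K4 (isT : (3 < 5)%N) q0; have h6 := Kmono4 K4 (isT : (2 < 3)%N) q0.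
have h7 : 0 <= K ^+ 3 * psi ^+ 2 by rewrite mulr_ge0 ?exprn_ge0.
have h8 := Kmono K4 (isT : (0 <= 2)%N) q0; rewrite expr0 mul1r in h8.
by move: h3 h4 h5 h6 h7 h8; move: (psi ^+ 2) (e ^+ 2) => *; lra.
Qed.

(** The variance terms cancel [mq] exactly, because (SG)_a is kept in the equation instead of an
    approximation. The pseudo-variances leave squares of G_ja, summed by the Ward identity. *)
Lemma diag_M0 : cabs (mq D X + \sum_p (T p * mc1 D p X + (S p)%:C%C * mc2 D p X)) <= K ^+ 2 * psi.
Proof.
have -> : mq D X + \sum_p (T p * mc1 D p X + (S p)%:C%C * mc2 D p X) =
  \sum_j T (a, j) * (- (offd (a, j) * G (ev j) (ev a) * G (ev j) (ev a))).
  rewrite /=.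
  transitivity (Sdiag z S X a * gdiag z X a + \sum_i \sum_j (((ev a : 'cV[CC]_N) i 0)^*)%C *
    (T (i, j) * - (offd (i, j) * G (ev j) (ev i) * G (ev j) (ev a)) -
     (S (i, j))%:C%C * (G (ev j) (ev j) * G (ev i) (ev a)))).
    have aux (t s v' o' a' b c d : CC) : t * (-1 * v' * (o' * a' * b)) + s * (-1 * v' * (c * d)) =
      v' * (t * - (o' * a' * b) - s * (c * d)) by ring.
    by congr (_ + _); rewrite pair_bigA; apply: eq_bigr => -[i j] _; exact: aux.
  rewrite (bigD1 a) //= [X in _ + (_ + X)]big1 => [|i ia]; last first.
    by apply: big1 => j _; rewrite /ev mxE (negbTE ia) conjc0 mul0r.
  rewrite addr0 /Sdiag mulr_suml -big_split /=; apply: eq_bigr => j _.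
  by rewrite /gdiag {1}/ev mxE !eqxx conjc1 mul1r; ring.
apply: le_trans (cabs_sum _ _ _) _.
have hT j : cabs (T (a, j) * (- (offd (a, j) * G (ev j) (ev a) * G (ev j) (ev a)))) <=
  K * e ^+ 2 * x j ^+ 2.
  apply: le_cabsM; first exact: le_trans (TS _) (le_trans (SC _) CNle).
  rewrite cabsN -[x j ^+ 2]mul1r expr2 mulrA; apply: le_cabsM => //; apply: le_cabsM => //.
  exact: cabs_offd.
apply: le_trans (ler_sum _ (fun j _ => hT j)) _; rewrite -mulr_sumr.
have c1 : 0 <= K * e ^+ 2 by rewrite mulr_ge0 ?exprn_ge0.
apply: le_trans (ler_wpM2l c1 (hr a)) _.
have -> : K * e ^+ 2 * (sN * psi) ^+ 2 = K * psi * psi * (e * sN) ^+ 2 by ring.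
rewrite eN expr1n mulr1 -mulrA expr2 -mulrA ler_wpM2l // ler_wpM2r //.
Qed.

Theorem diag_good : good S T (C / N%:R) (K ^+ 30 * psi) D X.
Proof.
have bnd (B : R) n k : (n <= 30 * k)%N -> B <= K ^+ n * psi ^+ k -> B <= (K ^+ 30 * psi) ^+ k.
  move=> nk hB; apply: (le_trans hB); rewrite exprMn -exprM; apply: Kmono => //.
  exact: exprn_ge0.
have A0 n : 0 <= (K ^+ 30 * psi) ^+ n by rewrite exprn_ge0 ?mulr_ge0 ?exprn_ge0.
have S2 (f : 'I_N * 'I_N -> R) n k : (forall j, f (a, j) <= K ^+ k * Bj j ^+ 2) ->
    \sum_p K ^+ n * (e ^+ 2 * (w p.1 * f p)) <= K ^+ (n + k + 5) * psi ^+ 2.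
  move=> hf; rewrite -mulr_sumr -mulr_sumr sum_row_weight.
  have e20 : 0 <= e ^+ 2 by rewrite exprn_ge0.
  have Kn : 0 <= K ^+ n by rewrite exprn_ge0.
  have Kk : 0 <= K ^+ k by rewrite exprn_ge0.
  apply: le_trans (ler_wpM2l Kn (ler_wpM2l e20 (ler_sum _ (fun j _ => hf j)))) _.
  rewrite -mulr_sumr (exprD K (n + k)) (exprD K n) -(mulrA (K ^+ n * _)) -(mulrA (K ^+ n)).
  apply: ler_wpM2l => //.
  by rewrite mulrCA; apply: ler_wpM2l => //; exact: diag_sumB.
split.
- by rewrite -[leRHS]expr1; apply: (bnd _ 2 1) => //; rewrite expr1; exact: diag_M0.
- by rewrite big1 ?cabs0 // => p _ /=; rewrite !mulr0 addr0.
- rewrite big1 ?cabs0 // => p _.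
  by rewrite [mQ1 _ _ _]/(0 : CC) [mQ2 _ _ _]/(0 : CC) conjc0 !mulr0 addr0.
- move=> p; rewrite -[leRHS]expr1; apply: (bnd _ 21 1) => //; rewrite expr1.
  apply: le_trans (diag_b p) _.
  have -> : K ^+ 21 * psi = K ^+ 16 * (psi * K ^+ 5) by ring.
  rewrite ler_wpM2l ?exprn_ge0 //; apply: ler_pM => //.
    by rewrite addr_ge0 ?pbeta_ge0 ?exprn_ge0.
  have h1 : pbeta X z p e (ev a) (ev a) <= K ^+ 4.
    exact: (pbeta_le_aux K4 e01 (x01 p.1) (x01 p.2) (y01 p.1) (y01 p.2)).
  have /andP[_ h2] := p201.
  have h3 := Kmono4 K4 (isT : (4 < 5)%N) ler01; have h4 := Kmono4 K4 (isT : (2 < 5)%N) ler01.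
  apply: le_trans (lerD h1 h2) _; rewrite !mulr1 in h3 h4.
  have h5 : 0 <= K ^+ 4 by rewrite exprn_ge0.
  by move: (K ^+ 4) (K ^+ 2) (K ^+ 5) h3 h4 h5 => q1 q2 q3; clear h2; lra.
- rewrite -[leRHS]expr1; apply: (bnd _ 10 1) => //; rewrite expr1.
  have hE p := iso_E1 (m := -1) (v := ev a) (w := ev a) hX z0 C0 K4 CK sN1 eN Nsq Ke hent hG m1 p.
  apply: le_trans (ler_sum _ (fun p _ => hE p)) _; rewrite -mulr_sumr [K ^+ 10]exprSr -mulrA.
  rewrite ler_wpM2l ?exprn_ge0 //.
  have hv : nsq (ev a : 'cV[CC]_N) <= 1 by rewrite nsq_ev.
  have a01 k : 0 <= w k <= 1 by rewrite cabs_ge0 nsq_entry.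
  apply: le_trans (iso_sum1 sN1 eN epsi cardI a01 x01 hv (hr a)) _.
  by rewrite ler_wpM2r //; move: K4; lra.
- apply: (bnd _ (22 + 5 + 5)%N 2) => //.
  apply: le_trans (ler_sum _ (fun p _ => diag_E2 p)) _.
  apply: (S2 (fun p => (x p.2 + e * (x p.1 + x p.2)) * (pbeta X z p e (ev a) (ev a) + psi ^+ 2))) => j.
  exact: (diag_point2 K4 e01 (x01 a) (y01 a) (x01 j) (y01 j) p201).
- apply: (bnd _ (36 + 11 + 5)%N 3) => //.
  have hE3 p : E3term (C / N%:R) D p X <= e * (K ^+ 36 * (e ^+ 2 * (w p.1 *
     ((x p.2 + e * (x p.1 + x p.2)) * (pbeta X z p e (ev a) (ev a) + psi ^+ 2) ^+ 2)))).
    by apply: le_trans (diag_E3 p) _; rewrite le_eqVlt; apply/orP; left; apply/eqP; ring.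
  apply: le_trans (ler_sum _ (fun p _ => hE3 p)) _; rewrite -mulr_sumr.
  have -> : K ^+ (36 + 11 + 5) * psi ^+ 3 = psi * (K ^+ (36 + 11 + 5) * psi ^+ 2).
    by rewrite [psi ^+ 3]exprS; ring.
  apply: ler_pM => //.
    apply: sumr_ge0 => p _; rewrite mulr_ge0 ?exprn_ge0 // mulr_ge0 ?exprn_ge0 // mulr_ge0 ?cabs_ge0 //.
    by rewrite mulr_ge0 ?exprn_ge0 // ?addr_ge0 ?mulr_ge0 ?addr_ge0 ?pbeta_ge0 ?exprn_ge0 ?cabs_ge0.
  apply: (S2 (fun p => (x p.2 + e * (x p.1 + x p.2)) * (pbeta X z p e (ev a) (ev a) + psi ^+ 2) ^+ 2)) => j.
  exact: (diag_point3 K4 e01 (x01 a) (y01 a) (x01 j) (y01 j) p201).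
Qed.

End DiagonalGood.

(** * The averaged equation *)

#[global] Opaque ev.

(** * Finer bounds for the entries at the removed position *)

Section KillFirstOrder.
Context {R : realType} {N : nat}.
Local Notation CC := R[i].
Variables (X : 'M[CC]_N) (z : CC) (p : 'I_N * 'I_N).
Hypotheses (hX : hermx X) (z0 : complex.Im z != 0).
Local Notation i := p.1.
Local Notation j := p.2.
Local Notation h := (X p.1 p.2).
Local Notation g a b := (Gq X z (ev a) (ev b)).
Local Notation gk a b := (Gq (kill p X) z (ev a) (ev b)).
Variables (K e : R).
Hypotheses (K4 : 4 <= K) (e0 : 0 <= e) (Ke : 4 * K ^+ 2 * e <= 1).
Hypothesis he : cabs h <= K * e.
Hypothesis hii : cabs (g i i) <= K.
Hypothesis hij : cabs (g i j) <= K.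
Hypothesis hji : cabs (g j i) <= K.
Hypothesis hjj : cabs (g j j) <= K.

Let K0 : 0 <= K. Proof. exact: le_trans K4. Qed.
Let K1 : 1 <= K. Proof. by move: K4; lra. Qed.
Let doh : cabs (offd p * h) <= K * e. Proof. exact: cabs_dh. Qed.
Let dhJ : cabs (h^*)%C <= K * e. Proof. by rewrite cabsJ. Qed.
Let k4 : 0 <= K ^+ 4 * e. Proof. by rewrite mulr_ge0 ?exprn_ge0. Qed.

(** In contrast to [kill_taylor], the first-order term is taken at the original matrix, so that
    summing it over v = w = e_k produces entries of G^2. *)
Lemma kill_first v w : cabs (Gq (kill p X) z v w - Gq X z v w -
    (offd p * h * (Gq X z v (ev i) * Gq X z (ev j) w) + (h^*)%C * (Gq X z v (ev j) * Gq X z (ev i) w)))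
  <= K ^+ 4 * e ^+ 2 * (pL X z p v * pR X z p w).
Proof.
have aux (gk0 g0 a b d f d' f' x y : CC) : gk0 = g0 + x * a * d' + y * b * f' ->
   gk0 - g0 - (x * (a * d) + y * (b * f)) = x * (a * (d' - d)) + y * (b * (f' - f)).
  by move=> ->; ring.
rewrite (aux _ _ _ _ _ _ _ _ _ _ (kill_expandl _ hX z0 v w)).
apply: le_trans (le_cabsD (le_cabsM doh (le_cabsM (lexx _) (kill_rowj hX z0 K4 e0 Ke he hii hij hji hjj w)))
  (le_cabsM dhJ (le_cabsM (lexx _) (kill_rowi hX z0 K4 e0 Ke he hii hij hji hjj w)))) _.
have aux2 (a b r : R) : K * e * (a * (K ^+ 3 * e * r)) + K * e * (b * (K ^+ 3 * e * r)) =
  K ^+ 4 * e ^+ 2 * ((a + b) * r) by ring.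
by rewrite aux2 /pL.
Qed.

Let o := cabs (g i j) + cabs (g j i) + e.
Let o0 : 0 <= o. Proof. by rewrite addr_ge0 // addr_ge0 // cabs_ge0. Qed.

Lemma pbeta_real (a b d : R) : 0 <= a -> 0 <= b -> 0 <= d -> a <= K -> b <= K -> d <= K ->
  b * d + d * a + e * (b + d) * (a + d) <= K ^+ 3 * (a + b + e).
Proof.
move=> a0 b0 d0 aK bK dK.
have h1 : b * d <= K * b by rewrite mulrC ler_wpM2r.
have h2 : d * a <= K * a by rewrite ler_wpM2r.
have h3 : (b + d) * (a + d) <= (K + K) * (K + K).
  by apply: ler_pM; rewrite ?addr_ge0 // lerD.
have h4 := ler_wpM2l e0 h3.
have h5 := Kmono K4 (isT : (1 <= 3)%N) a0; have h6 := Kmono K4 (isT : (1 <= 3)%N) b0.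
have h7 := Kmono4 K4 (isT : (2 < 3)%N) e0.
rewrite !expr1 in h5 h6.
have -> : K ^+ 3 * (a + b + e) = K ^+ 3 * a + K ^+ 3 * b + K ^+ 3 * e by ring.
have E : e * ((K + K) * (K + K)) = 4 * (K ^+ 2 * e) by ring.
rewrite E [X in X <= _]mulrA in h4.
by move: h1 h2 h4 h5 h6 h7; move: (b * d) (d * a) (e * (b + d) * (a + d)) => *; lra.
Qed.

(** To first order the change is G_ii times G_ij or G_ji, so besides e there is an off-diagonal
    factor, collected in [o]. *)
Lemma kill_dii : cabs (gk i i - g i i) <= K ^+ 7 * (e * o).
Proof.
apply: le_trans (kill_beta hX z0 K4 e0 Ke he hii hij hji hjj _ _) _.
have -> : K ^+ 7 * (e * o) = K ^+ 4 * e * (K ^+ 3 * o) by ring.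
rewrite ler_wpM2l // /pbeta /pL /pR.
have aux (a b d : R) : d * a + b * d + e * (d + b) * (d + a) =
  b * d + d * a + e * (b + d) * (a + d) by ring.
rewrite aux /o [cabs (g i j) + cabs (g j i)]addrC.
exact: (pbeta_real (cabs_ge0 _) (cabs_ge0 _) (cabs_ge0 _) hji hij hii).
Qed.

Lemma kill_djj : cabs (gk j j - g j j) <= K ^+ 7 * (e * o).
Proof.
apply: le_trans (kill_beta hX z0 K4 e0 Ke he hii hij hji hjj _ _) _.
have -> : K ^+ 7 * (e * o) = K ^+ 4 * e * (K ^+ 3 * o) by ring.
rewrite ler_wpM2l // /pbeta /pL /pR.
exact: (pbeta_real (cabs_ge0 _) (cabs_ge0 _) (cabs_ge0 _) hij hji hjj).
Qed.

(** Here the first-order change contains G_jj G_ii, so nothing is gained beyond e. *)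
Lemma kill_dji : cabs (gk j i - g j i) <= K ^+ 8 * e.
Proof.
apply: le_trans (kill_beta hX z0 K4 e0 Ke he hii hij hji hjj _ _) _.
have -> : K ^+ 8 * e = K ^+ 4 * e * K ^+ 4 by ring.
rewrite ler_wpM2l //.
have e01 : 0 <= e <= 1.
  rewrite e0 /=; apply: le_trans Ke; rewrite ler_peMl //.
  have := exprn_ege1 2 K1; lra.
exact: (@pbeta_le_aux R K e (cabs (g i i)) (cabs (g j i)) (cabs (g j i)) (cabs (g j j)) K4 e01
  (introT andP (conj (cabs_ge0 _) hii)) (introT andP (conj (cabs_ge0 _) hji))
  (introT andP (conj (cabs_ge0 _) hji)) (introT andP (conj (cabs_ge0 _) hjj))).
Qed.

Lemma kill_ji : cabs (gk j i) <= K ^+ 9 * o.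
Proof.
have -> : gk j i = g j i + (gk j i - g j i) by rewrite addrC subrK.
have q : cabs (g j i) <= o by rewrite /o addrAC lerDr addr_ge0 // cabs_ge0.
have oe : e <= o by rewrite /o lerDr addr_ge0 ?cabs_ge0.
apply: le_trans (le_cabsD q kill_dji) _.
have h1 := Kmono4 K4 (isT : (0 < 9)%N) o0; have h2 := Kmono4 K4 (isT : (8 < 9)%N) o0.
have h3 := ler_wpM2l (exprn_ge0 8 K0) oe; rewrite expr0 mul1r in h1.
have h4 : 0 <= K ^+ 9 * o by rewrite mulr_ge0 ?exprn_ge0.
by move: h1 h2 h3 h4; move: (K ^+ 9 * o) (K ^+ 8 * o) (K ^+ 8 * e) o => *; lra.
Qed.

Let gK2 (x : R) : x <= 2 * (K + K) -> x <= K ^+ 2.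
Proof.
move/le_trans; apply; have -> : 2 * (K + K) = 4 * K by ring.
by rewrite expr2 ler_wpM2r.
Qed.

Lemma kill_jj : cabs (gk j j) <= K ^+ 2.
Proof.
have h1 : cabs (gk j j) <= 2 * pR X z p (ev j).
  by apply: (@kill_rowj_le _ _ X z p hX z0 K e).
apply/gK2/(le_trans h1); apply: (ler_wpM2l (ler0n R 2)); exact: lerD hij hjj.
Qed.

Lemma kill_ii : cabs (gk i i) <= K ^+ 2.
Proof.
have h1 : cabs (gk i i) <= 2 * pR X z p (ev i).
  by apply: (@kill_rowi_le _ _ X z p hX z0 K e).
apply/gK2/(le_trans h1); apply: (ler_wpM2l (ler0n R 2)); exact: lerD hii hji.
Qed.

Lemma kill_taylor_ji :
  cabs (g j i - gk j i - h * (- offd p * gk j i * gk j i) - (h^*)%C * (- gk j j * gk i i)) <=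
  K ^+ 19 * (e ^+ 2 * o).
Proof.
have aux (g0 gk0 a b d f d' f' o' x y : CC) : gk0 = g0 + o' * x * a * d + y * b * f ->
    g0 - gk0 - x * (- o' * a * d') - y * (- b * f') = o' * x * (a * (d' - d)) + y * (b * (f' - f)).
  by move=> ->; ring.
rewrite (aux _ _ _ _ _ _ _ _ _ _ _ (kill_expandr _ hX z0 (ev j) (ev i))).
apply: le_trans (le_cabsD (le_cabsM doh (le_cabsM kill_ji kill_dji))
  (le_cabsM dhJ (le_cabsM kill_jj kill_dii))) _.
have M0 : 0 <= e ^+ 2 * o by rewrite mulr_ge0 ?exprn_ge0.
have -> : K * e * (K ^+ 9 * o * (K ^+ 8 * e)) + K * e * (K ^+ 2 * (K ^+ 7 * (e * o))) =
  K ^+ 18 * (e ^+ 2 * o) + K ^+ 10 * (e ^+ 2 * o) by ring.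
have h1 := Kmono4 K4 (isT : (18 < 19)%N) M0; have h2 := Kmono4 K4 (isT : (10 < 19)%N) M0.
have h3 : 0 <= K ^+ 19 * (e ^+ 2 * o) by rewrite mulr_ge0 ?exprn_ge0.
move: (K ^+ 19 * (e ^+ 2 * o)) (K ^+ 18 * (e ^+ 2 * o)) (K ^+ 10 * (e ^+ 2 * o)) h1 h2 h3 => *; lra.
Qed.

Lemma kill_dji2 : cabs (gk j i * gk j i - g j i * g j i) <= K ^+ 18 * (e * o).
Proof.
have aux (a b : CC) : a * a - b * b = (a - b) * (a + b) by ring.
rewrite aux.
have q : cabs (g j i) <= o by rewrite /o addrAC lerDr addr_ge0 // cabs_ge0.
apply: le_trans (le_cabsM kill_dji (le_cabsD kill_ji q)) _.
have M0 : 0 <= e * o by rewrite mulr_ge0.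
have -> : K ^+ 8 * e * (K ^+ 9 * o + o) = K ^+ 17 * (e * o) + K ^+ 8 * (e * o) by ring.
have h1 := Kmono4 K4 (isT : (17 < 18)%N) M0; have h2 := Kmono4 K4 (isT : (8 < 18)%N) M0.
have h3 : 0 <= K ^+ 18 * (e * o) by rewrite mulr_ge0 ?exprn_ge0.
move: (K ^+ 18 * (e * o)) (K ^+ 17 * (e * o)) (K ^+ 8 * (e * o)) h1 h2 h3 => *; lra.
Qed.

Lemma kill_diijj : cabs (gk j j * gk i i - g j j * g i i) <= K ^+ 10 * (e * o).
Proof.
apply: le_trans (prod_diff kill_djj kill_ii hjj kill_dii) _.
have M0 : 0 <= e * o by rewrite mulr_ge0.
have -> : K ^+ 7 * (e * o) * K ^+ 2 + K * (K ^+ 7 * (e * o)) = K ^+ 9 * (e * o) + K ^+ 8 * (e * o) by ring.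
have h1 := Kmono4 K4 (isT : (9 < 10)%N) M0; have h2 := Kmono4 K4 (isT : (8 < 10)%N) M0.
have h3 : 0 <= K ^+ 10 * (e * o) by rewrite mulr_ge0 ?exprn_ge0.
move: (K ^+ 10 * (e * o)) (K ^+ 9 * (e * o)) (K ^+ 8 * (e * o)) h1 h2 h3 => *; lra.
Qed.

End KillFirstOrder.

Section AverageData.
Context {R : realType} {N : nat}.
Local Notation CC := R[i].
Variables (z : CC).
Implicit Types (X : 'M[CC]_N).
Let r : CC := ((N%:R)^-1)%:C%C.

Definition avg X : CC := r * \sum_k gdiag z X k.
Definition G2 X a b : CC := \sum_k Gq X z (ev a) (ev k) * Gq X z (ev k) (ev b).

(** The derivative of u in an entry is an entry of -G^2 / N; for 1 + z u + u^2 it acquires the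
    factor z + 2 u, close to 2 m + z. That factor is small near the edges, exactly where stability
    is weak. *)
Definition avg_data : @mmdata R N := {|
  mQ := fun X => 1 + z * avg X + avg X ^+ 2;
  mq := fun X => avg X ^+ 2;
  mc := fun p X => r * Gq X z (ev p.2) (ev p.1);
  mc1 := fun p X => - r * (offd p * (Gq X z (ev p.2) (ev p.1) * Gq X z (ev p.2) (ev p.1)));
  mc2 := fun p X => - r * (Gq X z (ev p.2) (ev p.2) * Gq X z (ev p.1) (ev p.1));
  mQ1 := fun p X => - (z + 2 * avg X) * (r * (offd p * G2 X p.2 p.1));
  mQ2 := fun p X => - (z + 2 * avg X) * (r * G2 X p.1 p.2) |}.

Hypothesis N0 : (0 < N)%N.
Let Np : 0 < N%:R :> R. Proof. by rewrite ltr0n. Qed.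

Lemma r_sum_le (F : 'I_N -> CC) (n : R) : (forall k, cabs (F k) <= n) -> cabs (r * \sum_k F k) <= n.
Proof.
move=> h; rewrite cabsM cabs_real ger0_norm ?invr_ge0 ?(ltW Np) //.
rewrite mulrC ler_pdivrMr //; apply: le_trans (cabs_sum _ _ _) _.
by rewrite [leRHS]mulrC -[N in N%:R]card_ord; apply: sum_le_card.
Qed.

Lemma avg_admissible (n : R) : 3 <= n -> 0 < complex.Im z -> 1 <= n * complex.Im z ->
  cabs z <= n -> admissible avg_data (n ^+ 4).
Proof.
move=> n3 z0 nz zn.
have zi : complex.Im z != 0 by rewrite gt_eqF.
have n1 : 1 <= n by move: n3; lra.
have n0 : 0 <= n by move: n3; lra.
have G X a b : hermx X -> cabs (Gq X z (ev a) (ev b)) <= n.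
  by move=> hX; apply: Gq_le_N => //; rewrite nsq_ev.
have hr : cabs r <= 1.
  rewrite cabs_real ger0_norm ?invr_ge0 ?(ltW Np) // invf_le1 //; by rewrite ler1n.
have av X : hermx X -> cabs (avg X) <= n by move=> hX; apply: r_sum_le => k; exact: G.
have g2 X a b : hermx X -> cabs (r * G2 X a b) <= n * n.
  by move=> hX; apply: r_sum_le => k; apply: le_cabsM; exact: G.
have mG u u' : mxmeas (fun X : 'M[CC]_N => Gq X z u u') by exact: mxmeas_Gq.
have mZ b (g : 'M[CC]_N -> CC) : mxmeas g -> mxmeas (fun X => b * g X).
  by move=> mg; apply: mxmeasM => //; exact: mxmeas_cst.
have mA : mxmeas avg by apply: mZ; apply: mxmeas_sum => k; exact: mG.
have mG2 a b : mxmeas (fun X => G2 X a b).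
  by apply: mxmeas_sum => k; exact: mxmeasM.
have mzA : mxmeas (fun X => - (z + 2 * avg X)).
  by apply: mxmeasN; apply: mxmeasD; [exact: mxmeas_cst|exact: mZ].
have nX k : (k <= 4)%N -> n ^+ k <= n ^+ 4 by move=> k3; rewrite ler_weXn2l.
have hz X : hermx X -> cabs (- (z + 2 * avg X)) <= n + 2 * n.
  move=> hX; rewrite cabsN; apply: le_cabsD => //; apply: le_cabsM; last exact: av.
  by rewrite cabs_nat.
have n34 : 3 * n ^+ 3 <= n ^+ 4 by rewrite [n ^+ 4]exprS ler_wpM2r // exprn_ge0.
have nn : (n + 2 * n) * (n * n) = 3 * n ^+ 3 by ring.
split=> /=.
- by apply: mxmeasD; [apply: mxmeasD; [exact: mxmeas_cst|exact: mZ]|exact: mxmeasX].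
- exact: mxmeasX.
- by move=> p; exact: mZ.
- by move=> p; apply: (mZ); apply: mZ; exact: mxmeasM.
- by move=> p; apply: mZ; exact: mxmeasM.
- by move=> p; apply: mxmeasM => //; apply: (mZ); exact: mZ.
- by move=> p; apply: mxmeasM => //; exact: mZ.
- exact: exprn_ege1.
- move=> X hX; apply: (@le_trans _ _ (1 + n * n + n ^+ 2)).
    apply: le_cabsD.
      by apply: le_cabsD; [rewrite cabs1|apply: le_cabsM => //; exact: av].
    by rewrite expr2 expr2; apply: le_cabsM; exact: av.
  apply: le_trans n34.
  have h := mulr_ge0 (sqr_ge0 n) (_ : 0 <= n - 3); rewrite subr_ge0 in h.
  have := h n3; have : 1 <= n ^+ 2 by rewrite exprn_ege1.
  by rewrite [n ^+ 3]exprSr -expr2; lra.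
- by move=> X hX; apply: (@le_trans _ _ (n ^+ 2)); rewrite ?nX // !expr2; apply: le_cabsM; exact: av.
- move=> p X hX; apply: (@le_trans _ _ (1 * n)); last by rewrite mul1r -[leLHS]expr1 nX.
  by apply: le_cabsM => //; exact: G.
- move=> p X hX; apply: (@le_trans _ _ (1 * (1 * (n * n)))).
    apply: le_cabsM; first by rewrite cabsN.
    apply: le_cabsM; first exact: cabs_offd.
    by apply: le_cabsM; exact: G.
  by rewrite !mul1r -expr2 nX.
- move=> p X hX; apply: (@le_trans _ _ (1 * (n * n))).
    by apply: le_cabsM; [rewrite cabsN|apply: le_cabsM; exact: G].
  by rewrite mul1r -expr2 nX.
- move=> p X hX; apply: le_trans n34; rewrite -nn; apply: le_cabsM; first exact: hz.
  rewrite mulrCA -[leRHS]mul1r; apply: le_cabsM; [exact: cabs_offd|exact: g2].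
- by move=> p X hX; apply: le_trans n34; rewrite -nn; apply: le_cabsM; [exact: hz|exact: g2].
- move=> X hX; congr (_ + _).
  transitivity (r * \sum_a cdot (ev a) (X *m (green X z *m ev a))).
    under eq_bigr => a _ do rewrite green_eq // cdotDr cdotZr cdot_nsq nsq_ev -GqE.
    rewrite big_split /= -mulr_sumr sumr_const card_ord mulrDr /avg mulrCA; congr (_ + _).
    rewrite -(rmorph_nat (real_complex R)) /r -(rmorphM (real_complex R)) /=.
    by rewrite mulVf ?gt_eqF.
  rewrite mulr_sumr.
  transitivity (\sum_a \sum_b X a b * (r * Gq X z (ev b) (ev a))).
    apply: eq_bigr => a _; rewrite cdot_evl mxE mulr_sumr; apply: eq_bigr => b _.
    by rewrite Gq_evl mulrCA.
  by rewrite pair_bigA.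
Qed.

End AverageData.

Lemma sqr3_le (R : realType) (a b c : R) : (a + b + c) ^+ 2 <= 3 * (a ^+ 2 + b ^+ 2 + c ^+ 2).
Proof. by have := sqr_ge0 (a - b); have := sqr_ge0 (a - c); have := sqr_ge0 (b - c); lra. Qed.

Lemma Kpoly2 (R : realType) (K M : R) a b n : 4 <= K -> (a < n)%N -> (b < n)%N -> 0 <= M ->
  K ^+ a * M + 2 * (K ^+ b * M) <= K ^+ n * M.
Proof.
move=> K4 an bn M0; have h1 := Kmono4 K4 an M0; have h2 := Kmono4 K4 bn M0.
have h3 : 0 <= K ^+ n * M by rewrite mulr_ge0 ?exprn_ge0 // (le_trans _ K4).
by move: (K ^+ a * M) (K ^+ b * M) (K ^+ n * M) h1 h2 h3 => *; lra.
Qed.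

Lemma absorb_two {R : realType} (x y : R) : 0 <= x -> 4 * x <= y -> 2 * x <= y.
Proof. by lra. Qed.

Lemma absorb_five {R : realType} (x1 x2 x3 x y u1 u2 u : R) :
  x1 + 2 * x2 <= x -> 4 * x <= y -> 4 * x3 <= y -> 4 * u1 <= u -> 4 * u2 <= u ->
  0 <= x -> 0 <= y -> 0 <= u -> x1 + 2 * x2 + x3 + (u1 + u2) <= y + u.
Proof. by lra. Qed.

(** * Error terms of the averaged equation *)

Section AverageGood.
Context {R : realType} {N : nat}.
Local Notation CC := R[i].
Variables (z : CC) (X : 'M[CC]_N) (hX : hermx X).
Variables (S : 'I_N * 'I_N -> R) (T : 'I_N * 'I_N -> CC) (C : R).
Hypotheses (z0 : 0 < complex.Im z) (C0 : 0 < C).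
Hypotheses (S0 : forall p, 0 <= S p) (SC : forall p, S p <= C / N%:R)
  (TS : forall p, cabs (T p) <= S p) (Srow : forall i, \sum_j S (i, j) = 1)
  (Ssym : forall i j, S (j, i) = S (i, j)).
Variables (K e psi sN La rho : R).
Hypotheses (K4 : 4 <= K) (CK : C <= K) (sN1 : 1 <= sN) (eN : e * sN = 1) (Nsq : N%:R = sN ^+ 2)
  (epsi : e <= psi) (Ke : 4 * K ^+ 2 * e <= 1).
Hypotheses (La0 : 0 <= La) (LaK : La <= K) (rhoE : rho * (sN ^+ 2 * complex.Im z) = 1)
  (rho1 : rho <= 1) (psiL : psi ^+ 2 <= K * (La * rho)).
Local Notation g a b := (Gq X z (ev a) (ev b)).
Local Notation u := (avg z X).
Hypothesis hent : forall p, cabs (X p.1 p.2) <= K * e.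
Hypothesis hG : forall a b, cabs (g a b) <= K.
Hypothesis hIm : forall a, complex.Im (g a a) <= complex.Im z * (sN * psi) ^+ 2.
Hypothesis hd : forall a, cabs (g a a - u) <= K * psi.
Hypothesis hzu : cabs (z + 2 * u) <= K * La.

Let D := avg_data (N := N) z.
Let r : CC := ((N%:R)^-1)%:C%C.

Let zn : complex.Im z != 0. Proof. by rewrite gt_eqF. Qed.
Let K0 : 0 <= K. Proof. exact: le_trans K4. Qed.
Let K1 : 1 <= K. Proof. by move: K4; lra. Qed.
Let e0 : 0 <= e. Proof. exact: ltW (e_gt0 sN1 eN). Qed.
Let e1 : e <= 1. Proof. exact: e_le1 sN1 eN. Qed.
Let psi0 : 0 <= psi. Proof. exact: le_trans e0 epsi. Qed.
Let sN0 : 0 < sN. Proof. exact: lt_le_trans ltr01 sN1. Qed.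
Let Np : 0 < N%:R :> R. Proof. by rewrite Nsq exprn_gt0. Qed.
Let cN0 : 0 <= C / N%:R. Proof. by rewrite divr_ge0 ?ltW. Qed.
Let sp0 : 0 <= sN * psi. Proof. by rewrite mulr_ge0 // ltW. Qed.
Let cardI : #|'I_N|%:R = sN ^+ 2. Proof. by rewrite card_ord. Qed.
Let rho0 : 0 < rho.
Proof.
have h : 0 < sN ^+ 2 * complex.Im z by rewrite mulr_gt0 ?exprn_gt0.
by rewrite -(pmulr_lgt0 _ h) rhoE.
Qed.
Let Lr0 : 0 <= La * rho. Proof. by rewrite mulr_ge0 // ltW. Qed.
Let e2E : e ^+ 2 = N%:R^-1.
Proof.
by apply: (mulIf (lt0r_neq0 Np)); rewrite mulVf ?gt_eqF // Nsq -exprMn eN expr1n.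
Qed.
Let rE : cabs r = e ^+ 2. Proof. by rewrite cabs_real ger0_norm ?invr_ge0 ?(ltW Np) // e2E. Qed.
Let CNle : C / N%:R <= K * e ^+ 2. Proof. by rewrite e2E ler_pM2r ?invr_gt0. Qed.
Let N0 : (0 < N)%N. Proof. by rewrite -(ltr0n R). Qed.

Let hr i : \sum_k cabs (g k i) ^+ 2 <= (sN * psi) ^+ 2.
Proof. by rewrite ward_r // ler_pdivrMr // mulrC hIm. Qed.
Let hc i : \sum_k cabs (g i k) ^+ 2 <= (sN * psi) ^+ 2.
Proof. by rewrite ward_l // ler_pdivrMr // mulrC hIm. Qed.

Lemma G2_le a b : e ^+ 2 * cabs (G2 z X a b) <= psi ^+ 2.
Proof.
have h : cabs (G2 z X a b) <= (sN * psi) * (sN * psi).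
  apply: le_trans (cabs_sum _ _ _) _; under eq_bigr do rewrite cabsM.
  exact: cauchy_schwarz sp0 sp0 (hc a) (hr b).
apply: le_trans (ler_wpM2l (exprn_ge0 2 e0) h) _.
have -> : e ^+ 2 * (sN * psi * (sN * psi)) = (e * sN) ^+ 2 * psi ^+ 2 by ring.
by rewrite eN expr1n mul1r.
Qed.

Lemma sum_pLR p : \sum_k pL X z p (ev k) * pR X z p (ev k) <= 4 * (sN * psi) ^+ 2.
Proof.
have cs i1 i2 := cauchy_schwarz sp0 sp0 (hr i1) (hc i2).
apply: le_trans (_ : (\sum_k cabs (g k p.1) * cabs (g p.1 k) +
  \sum_k cabs (g k p.1) * cabs (g p.2 k)) +
  (\sum_k cabs (g k p.2) * cabs (g p.1 k) + \sum_k cabs (g k p.2) * cabs (g p.2 k)) <= _).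
  rewrite -!big_split /=; apply: ler_sum => k _; rewrite /pL /pR.
  have aux (a b c d : R) : (a + b) * (c + d) <= a * c + a * d + (b * c + b * d) by rewrite mulrDl !mulrDr.
  exact: aux.
apply: le_trans (lerD (lerD (cs p.1 p.1) (cs p.1 p.2)) (lerD (cs p.2 p.1) (cs p.2 p.2))) _.
by rewrite le_eqVlt; apply/orP; left; apply/eqP; ring.
Qed.

(** The norm bound 1 / Im z on one factor of G^2 and the Ward identity on the other give G^2 / N the
    size psi rho in mean square over pairs, whereas [G2_le] gives psi^2 for each single pair. *)
Lemma sum_G2 : \sum_p (e ^+ 2 * cabs (G2 z X p.1 p.2)) ^+ 2 <= (sN ^+ 2 * (psi * rho)) ^+ 2.
Proof.
have h b : \sum_a cabs (G2 z X a b) ^+ 2 <= (sN * psi) ^+ 2 / complex.Im z ^+ 2.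
  have E a : G2 z X a b = (green X z *m (green X z *m ev b)) a 0.
    by rewrite mxE; apply: eq_bigr => k _; rewrite Gq_evl [Gq X z (ev k) _]Gq_evl -colE mxE.
  under eq_bigr do rewrite E.
  have h1 := sqrt_nsq_green (green X z *m ev b) hX z0.
  have h2 : nsq (green X z *m ev b) <= (sN * psi) ^+ 2.
    by rewrite /nsq; apply: le_trans (hr b); apply: ler_sum => k _; rewrite Gq_evl.
  rewrite -/(nsq _) -(nsq_sqrt (green X z *m (green X z *m ev b))).
  have h3 : Num.sqrt (nsq (green X z *m ev b)) ^+ 2 <= (sN * psi) ^+ 2 by rewrite nsq_sqrt.
  have h4 := lerXn2r 2 (_ : Num.sqrt _ \in Num.nneg) (_ : _ \in Num.nneg) h1.
  rewrite !nnegrE in h4; apply: le_trans (h4 _ _) _; rewrite ?sqrtr_ge0 //.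
    by rewrite divr_ge0 ?sqrtr_ge0 // ltW.
  by rewrite expr_div_n ler_wpM2r // invr_ge0 exprn_ge0 // ltW.
have -> : \sum_p (e ^+ 2 * cabs (G2 z X p.1 p.2)) ^+ 2 =
  e ^+ 4 * \sum_b \sum_a cabs (G2 z X a b) ^+ 2.
  rewrite exchange_big pair_bigA mulr_sumr /=; apply: eq_bigr => p _.
  by rewrite [in LHS]exprMn -exprM.
have e40 : 0 <= e ^+ 4 by rewrite exprn_ge0.
apply: le_trans (ler_wpM2l e40 (sum_le_card h)) _; rewrite cardI.
have -> : complex.Im z = (rho * sN ^+ 2)^-1.
  apply: (mulfI (lt0r_neq0 (mulr_gt0 rho0 (exprn_gt0 2 sN0)))).
  by rewrite -mulrA rhoE divff // mulf_neq0 ?gt_eqF // exprn_gt0.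
rewrite -exprVn invrK.
have -> : e ^+ 4 * (sN ^+ 2 * ((sN * psi) ^+ 2 * (rho * sN ^+ 2) ^+ 2)) =
  (e * sN) ^+ 4 * (sN ^+ 2 * (psi * rho)) ^+ 2 by ring.
by rewrite eN expr1n mul1r.
Qed.

(** Up to powers of K, [o] bounds the off-diagonal entries at p and [e * f] the change of u when p
    is removed. Their mean squares over all pairs are of order psi and psi rho. *)
Let o p := cabs (g p.1 p.2) + cabs (g p.2 p.1) + e.
Let o2 p := e ^+ 2 * cabs (G2 z X p.1 p.2) + e ^+ 2 * cabs (G2 z X p.2 p.1).
Let f p := o2 p + e * psi ^+ 2.
Let o0 p : 0 <= o p. Proof. by rewrite addr_ge0 // addr_ge0 // cabs_ge0. Qed.
Let g20 a b : 0 <= e ^+ 2 * cabs (G2 z X a b).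
Proof. by apply: mulr_ge0; rewrite ?exprn_ge0 // cabs_ge0. Qed.
Let o20 p : 0 <= o2 p. Proof. by rewrite addr_ge0. Qed.
Let ep0 : 0 <= e * psi ^+ 2. Proof. by rewrite mulr_ge0 ?exprn_ge0. Qed.
Let f0 p : 0 <= f p. Proof. by rewrite addr_ge0. Qed.
Let o2f p : o2 p <= f p. Proof. by rewrite lerDl. Qed.
Let f_le p : f p <= 3 * psi ^+ 2.
Proof.
have h1 := G2_le p.1 p.2; have h2 := G2_le p.2 p.1.
have h3 : e * psi ^+ 2 <= 1 * psi ^+ 2 by rewrite ler_wpM2r ?exprn_ge0.
apply: le_trans (lerD (lerD h1 h2) h3) _.
by have -> : psi ^+ 2 + psi ^+ 2 + 1 * psi ^+ 2 = 3 * psi ^+ 2 by ring.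
Qed.

Lemma sum_swap (F : 'I_N * 'I_N -> R) : \sum_p F (p.2, p.1) = \sum_p F p.
Proof.
rewrite -(pair_bigA _ (fun i j => F (j, i))) exchange_big pair_bigA /=.
by apply: eq_bigr => -[].
Qed.

Lemma avg_sum_o2 : \sum_p o p ^+ 2 <= (3 * (sN ^+ 2 * psi)) ^+ 2.
Proof.
have h1 : \sum_p cabs (g p.1 p.2) ^+ 2 <= sN ^+ 2 * (sN * psi) ^+ 2.
  rewrite -(pair_bigA _ (fun i j => cabs (g i j) ^+ 2)) -cardI /=.
  exact: sum_le_card.
have h2 : \sum_(p : 'I_N * 'I_N) cabs (g p.2 p.1) ^+ 2 <= sN ^+ 2 * (sN * psi) ^+ 2.
  by rewrite (sum_swap (fun p => cabs (g p.1 p.2) ^+ 2)).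
have h3 : \sum_(p : 'I_N * 'I_N) e ^+ 2 <= sN ^+ 2 * sN ^+ 2 * psi ^+ 2.
  rewrite sumr_const card_prod card_ord -[leLHS]mulr_natl natrM Nsq.
  by rewrite ler_wpM2l ?mulr_ge0 ?exprn_ge0 ?(ltW sN0) // lerXn2r ?nnegrE.
apply: (@le_trans _ _ (3 * (\sum_p cabs (g p.1 p.2) ^+ 2 + \sum_(p : 'I_N * 'I_N) cabs (g p.2 p.1) ^+ 2 +
   \sum_(p : 'I_N * 'I_N) e ^+ 2))).
  rewrite -!big_split mulr_sumr /=; apply: ler_sum => p _; rewrite /o.
  exact: sqr3_le.
have -> : (3 * (sN ^+ 2 * psi)) ^+ 2 = 3 * (sN ^+ 2 * (sN * psi) ^+ 2 + sN ^+ 2 * (sN * psi) ^+ 2 +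
  sN ^+ 2 * sN ^+ 2 * psi ^+ 2) by ring.
exact: (ler_wpM2l (ler0n R 3) (lerD (lerD h1 h2) h3)).
Qed.

Let epsi_rho : e * psi <= K ^+ 2 * rho.
Proof.
apply: (@le_trans _ _ (psi ^+ 2)); first by rewrite expr2 ler_wpM2r.
apply: (le_trans psiL); rewrite expr2 -mulrA ler_wpM2l // ler_wpM2r // ltW //.
Qed.

Lemma avg_sum_f2 : \sum_p f p ^+ 2 <= (K ^+ 3 * (sN ^+ 2 * (psi * rho))) ^+ 2.
Proof.
set B := sN ^+ 2 * (psi * rho).
have B0 : 0 <= B by rewrite !mulr_ge0 ?exprn_ge0 ?(ltW sN0) ?(ltW rho0).
have h2 : \sum_(p : 'I_N * 'I_N) (e ^+ 2 * cabs (G2 z X p.2 p.1)) ^+ 2 <= B ^+ 2.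
  by rewrite (sum_swap (fun p => (e ^+ 2 * cabs (G2 z X p.1 p.2)) ^+ 2)) sum_G2.
have h3 : \sum_(p : 'I_N * 'I_N) (e * psi ^+ 2) ^+ 2 <= (K ^+ 2 * B) ^+ 2.
  rewrite sumr_const card_prod card_ord -[leLHS]mulr_natl natrM Nsq.
  have -> : sN ^+ 2 * sN ^+ 2 * (e * psi ^+ 2) ^+ 2 = (sN ^+ 2 * psi * (e * psi)) ^+ 2 by ring.
  have -> : K ^+ 2 * B = sN ^+ 2 * psi * (K ^+ 2 * rho) by rewrite /B; ring.
  have s0 : 0 <= sN ^+ 2 * psi by rewrite mulr_ge0 ?exprn_ge0 ?(ltW sN0).
  apply: lerXn2r; rewrite ?nnegrE; [|  |exact: ler_wpM2l].
  - by rewrite mulr_ge0 // mulr_ge0.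
  - by rewrite mulr_ge0 // mulr_ge0 ?exprn_ge0 ?(ltW rho0).
apply: (@le_trans _ _ (3 * (\sum_p (e ^+ 2 * cabs (G2 z X p.1 p.2)) ^+ 2 +
   \sum_(p : 'I_N * 'I_N) (e ^+ 2 * cabs (G2 z X p.2 p.1)) ^+ 2 +
   \sum_(p : 'I_N * 'I_N) (e * psi ^+ 2) ^+ 2))).
  rewrite -!big_split mulr_sumr /=; apply: ler_sum => p _; rewrite /f /o2.
  exact: sqr3_le.
have E3 : 0 <= 3 :> R by [].
apply: le_trans (ler_wpM2l E3 (lerD (lerD sum_G2 h2) h3)) _; rewrite -/B.
have B20 : 0 <= B ^+ 2 by exact: sqr_ge0.
have k1 := Kmono4 K4 (isT : (4 < 6)%N) B20; have k2 := Kmono16 K4 (isT : (0.+1 < 5)%N) B20.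
have k3 := Kmono K4 (isT : (5 <= 6)%N) B20.
have k4 : 0 <= K ^+ 4 * B ^+ 2 by rewrite mulr_ge0 ?exprn_ge0.
have -> : (K ^+ 3 * B) ^+ 2 = K ^+ 6 * B ^+ 2 by ring.
have -> : (K ^+ 2 * B) ^+ 2 = K ^+ 4 * B ^+ 2 by ring.
have k5 := Kmono4 K4 (isT : (5 < 6)%N) B20; have k6 := Kmono4 K4 (isT : (4 < 5)%N) B20.
rewrite expr0 mul1r in k2.
move: (B ^+ 2) (K ^+ 4 * B ^+ 2) (K ^+ 5 * B ^+ 2) (K ^+ 6 * B ^+ 2) k1 k2 k3 k4 k5 k6 B20 => *; lra.
Qed.

Let sum1 : \sum_(p : 'I_N * 'I_N) 1 ^+ 2 <= (sN ^+ 2) ^+ 2.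
Proof.
by rewrite expr1n sumr_const card_prod card_ord natrM Nsq -expr2.
Qed.
Let s20 : 0 <= sN ^+ 2. Proof. by rewrite exprn_ge0 // ltW. Qed.
Let Bo0 : 0 <= 3 * (sN ^+ 2 * psi). Proof. by rewrite mulr_ge0 // mulr_ge0. Qed.
Let Bf0 : 0 <= K ^+ 3 * (sN ^+ 2 * (psi * rho)).
Proof. by rewrite mulr_ge0 ?exprn_ge0 // mulr_ge0 // mulr_ge0 // ltW. Qed.

Lemma avg_sum_o : e ^+ 4 * \sum_p o p <= 3 * psi.
Proof.
have h := cauchy_schwarz (b := fun=> 1) Bo0 s20 avg_sum_o2 sum1.
have h1 : \sum_p o p <= 3 * (sN ^+ 2 * psi) * sN ^+ 2 by move: h; under eq_bigr do rewrite mulr1.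
apply: le_trans (ler_wpM2l (exprn_ge0 4 e0) h1) _.
have -> : e ^+ 4 * (3 * (sN ^+ 2 * psi) * sN ^+ 2) = (e * sN) ^+ 4 * (3 * psi) by ring.
by rewrite eN expr1n mul1r.
Qed.

Lemma avg_sum_f : e ^+ 4 * \sum_p f p <= K ^+ 3 * (psi * rho).
Proof.
have h := cauchy_schwarz (b := fun=> 1) Bf0 s20 avg_sum_f2 sum1.
have h1 : \sum_p f p <= K ^+ 3 * (sN ^+ 2 * (psi * rho)) * sN ^+ 2 by move: h; under eq_bigr do rewrite mulr1.
apply: le_trans (ler_wpM2l (exprn_ge0 4 e0) h1) _.
have -> : e ^+ 4 * (K ^+ 3 * (sN ^+ 2 * (psi * rho)) * sN ^+ 2) = (e * sN) ^+ 4 * (K ^+ 3 * (psi * rho)) by ring.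
by rewrite eN expr1n mul1r.
Qed.

Lemma avg_sum_of : e ^+ 4 * \sum_p o p * f p <= K ^+ 4 * (psi ^+ 2 * rho).
Proof.
have h := cauchy_schwarz Bo0 Bf0 avg_sum_o2 avg_sum_f2.
apply: le_trans (ler_wpM2l (exprn_ge0 4 e0) h) _.
have -> : e ^+ 4 * (3 * (sN ^+ 2 * psi) * (K ^+ 3 * (sN ^+ 2 * (psi * rho)))) =
  (e * sN) ^+ 4 * (3 * (K ^+ 3 * (psi ^+ 2 * rho))) by ring.
rewrite eN expr1n mul1r.
have M0 : 0 <= psi ^+ 2 * rho by rewrite mulr_ge0 ?exprn_ge0 // ltW.
have := Kmono4 K4 (isT : (3 < 4)%N) M0.
have : 0 <= K ^+ 3 * (psi ^+ 2 * rho) by rewrite mulr_ge0 ?exprn_ge0.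
move: (K ^+ 3 * (psi ^+ 2 * rho)) (K ^+ 4 * (psi ^+ 2 * rho)) => *; lra.
Qed.

Section Pair.
Variable p : 'I_N * 'I_N.
Local Notation i := p.1.
Local Notation j := p.2.
Local Notation h := (X p.1 p.2).
Local Notation Xk := (kill p X).
Local Notation gk a b := (Gq Xk z (ev a) (ev b)).
Let du := u - avg z Xk.
Let op0 : 0 <= o p. Proof. exact: o0. Qed.
Let eo0 n : 0 <= e ^+ n * o p. Proof. by rewrite mulr_ge0 ?exprn_ge0. Qed.
Let Kn n : 0 <= K ^+ n. Proof. by rewrite exprn_ge0. Qed.
Let doh : cabs (offd p * h) <= K * e. Proof. exact: cabs_dh. Qed.
Let psi20 : 0 <= psi ^+ 2. Proof. exact: sqr_ge0. Qed.

Lemma avg_du : cabs du <= K ^+ 6 * (e * f p).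
Proof.
have -> : du = - (r * (\sum_k (gk k k - g k k - (offd p * h * (g k i * g j k) + (h^*)%C * (g k j * g i k)))) +
   (offd p * h * (r * G2 z X j i) + (h^*)%C * (r * G2 z X i j))).
  rewrite /du /avg -/r !sumrB big_split /= -!mulr_sumr.
  have E1 : \sum_k g k i * g j k = G2 z X j i by apply: eq_bigr => k _; exact: mulrC.
  have E2 : \sum_k g k j * g i k = G2 z X i j by apply: eq_bigr => k _; exact: mulrC.
  have aux (s a b x y c d c' d' : CC) : c = c' -> d = d' ->
      s * a - s * b = - (s * (b - a - (x * c + y * d)) + (x * (s * c') + y * (s * d'))).
    by move=> <- <-; ring.
  exact: aux E1 E2.
rewrite cabsN.
have hk k := kill_first hX zn K4 e0 Ke (hent p) (hG _ _) (hG _ _) (hG _ _) (hG _ _) (ev k) (ev k).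
have hs : cabs (r * (\sum_k (gk k k - g k k - (offd p * h * (g k i * g j k) + (h^*)%C * (g k j * g i k))))) <=
   e ^+ 2 * (K ^+ 4 * e ^+ 2 * (4 * (sN * psi) ^+ 2)).
  apply: le_cabsM; first by rewrite rE.
  apply: le_trans (cabs_sum _ _ _) _; apply: le_trans (ler_sum _ (fun k _ => hk k)) _.
  by rewrite -mulr_sumr ler_wpM2l ?sum_pLR // mulr_ge0 ?exprn_ge0.
have hg2 a b : cabs (r * G2 z X a b) <= e ^+ 2 * cabs (G2 z X a b) by rewrite cabsM rE.
apply: le_trans (le_cabsD hs (le_cabsD (le_cabsM doh (hg2 j i)) (le_cabsM (le_cabsJ (hent p)) (hg2 i j)))) _.
have -> : e ^+ 2 * (K ^+ 4 * e ^+ 2 * (4 * (sN * psi) ^+ 2)) =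
   4 * (K ^+ 4 * (e * (e * psi ^+ 2))) * (e * sN) ^+ 2 by ring.
have aux (x y : R) : K * e * x + K * e * y = K * (e * (y + x)) by ring.
rewrite eN expr1n mulr1 aux -/(o2 p).
have M0 : 0 <= e * (e * psi ^+ 2) by rewrite mulr_ge0.
have h1 := Kmono4 K4 (isT : (4 < 6)%N) M0.
have h2 : K * (e * o2 p) <= K ^+ 6 * (e * o2 p).
  by rewrite -[X in X * _ <= _]expr1; apply: Kmono => //; rewrite mulr_ge0.
by have -> : K ^+ 6 * (e * f p) = K ^+ 6 * (e * (e * psi ^+ 2)) + K ^+ 6 * (e * o2 p)
  by [rewrite /f; ring]; exact: lerD.
Qed.

Let psiLK : psi ^+ 2 <= K * La.
Proof.
apply: (le_trans psiL); rewrite ler_wpM2l // -[leRHS]mulr1 ler_wpM2l //.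
Qed.

Lemma avg_du' : cabs du <= K ^+ 7 * (e * psi ^+ 2).
Proof.
apply: le_trans avg_du _.
have -> : K ^+ 7 * (e * psi ^+ 2) = K ^+ 6 * (e * (K * psi ^+ 2)) by ring.
rewrite ler_wpM2l // ler_wpM2l //; apply: le_trans (f_le p) _.
by rewrite ler_wpM2r //; move: K4; lra.
Qed.

Lemma avg_du2 : cabs du <= K ^+ 8 * (La * e).
Proof.
apply: le_trans avg_du' _.
have -> : K ^+ 8 * (La * e) = K ^+ 7 * (e * (K * La)) by ring.
by rewrite ler_wpM2l // ler_wpM2l.
Qed.

Lemma avg_du3 : cabs du <= K ^+ 8 * La.
Proof.
apply: le_trans avg_du2 _; rewrite ler_wpM2l // -[leRHS]mulr1 ler_wpM2l //.
Qed.

Lemma avg_zuk : cabs (z + 2 * avg z Xk) <= K ^+ 9 * La.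
Proof.
have aux (y a b : CC) : y + 2 * b = (y + 2 * a) - 2 * (a - b) by ring.
rewrite (aux z u).
have h2 : cabs (2 : CC) <= 2 by rewrite cabs_nat.
apply: le_trans (le_cabsB hzu (le_cabsM h2 avg_du3)) _.
by have := @Kpoly2 R K La 1 8 9 K4 isT isT La0; rewrite expr1.
Qed.

(** The increment of 1 + z u + u^2 factors as du (z + 2 u - du). The second factor is of order La,
    because du itself is at most of that order. *)
Lemma avg_b : Qdiff D p X <= K ^+ 15 * (La * (e * f p)).
Proof.
have -> : Qdiff D p X = cabs (du * ((z + 2 * u) - du)).
  rewrite /Qdiff /=; congr cabs; rewrite /du.
  have aux (a b : CC) : 1 + z * a + a ^+ 2 - (1 + z * b + b ^+ 2) = (a - b) * (z + 2 * a - (a - b)) by ring.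
  exact: aux.
apply: le_trans (le_cabsM avg_du (le_cabsB hzu avg_du3)) _.
have -> : K ^+ 15 * (La * (e * f p)) = K ^+ 6 * (e * f p) * (K ^+ 9 * La) by ring.
rewrite ler_wpM2l ?mulr_ge0 //.
have := @Kpoly2 R K La 1 8 9 K4 isT isT La0; rewrite expr1; apply: le_trans.
by rewrite lerD2l mulr_natl mulr2n lerDl mulr_ge0.
Qed.

Lemma avg_Qerr : Qerr D p X <= K ^+ 17 * (La * (e ^+ 2 * psi ^+ 2)).
Proof.
have hk k := kill_taylor hX zn K4 e0 Ke (hent p) (hG _ _) (hG _ _) (hG _ _) (hG _ _) (ev k) (ev k).
pose rem := r * \sum_k (g k k - gk k k - h * (- offd p * gk k i * gk j k) - (h^*)%C * (- gk k j * gk i k)).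
have hs : cabs rem <= e ^+ 2 * (K ^+ 5 * e ^+ 2 * (4 * (sN * psi) ^+ 2)).
  apply: le_cabsM; first by rewrite rE.
  apply: le_trans (cabs_sum _ _ _) _; apply: le_trans (ler_sum _ (fun k _ => hk k)) _.
  by rewrite -mulr_sumr ler_wpM2l ?sum_pLR // mulr_ge0 ?exprn_ge0.
have E : rem = du + h * (r * (offd p * G2 z Xk j i)) + (h^*)%C * (r * G2 z Xk i j).
  rewrite /rem /du /avg -/r !sumrB /G2 /gdiag.
  have -> : \sum_k h * (- offd p * gk k i * gk j k) = - h * (offd p * \sum_k gk j k * gk k i).
    have a1 (x o' a b : CC) : x * (- o' * a * b) = - x * (o' * (b * a)) by ring.
    by rewrite !mulr_sumr; apply: eq_bigr => k _; exact: a1.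
  have -> : \sum_k (h^*)%C * (- gk k j * gk i k) = - (h^*)%C * \sum_k gk i k * gk k j.
    have a1 (x a b : CC) : x * (- a * b) = - x * (b * a) by ring.
    by rewrite !mulr_sumr; apply: eq_bigr => k _; exact: a1.
  have aux (s a b x y c d : CC) : s * (a - b - - x * c - - y * d) = s * a - s * b + x * (s * c) + y * (s * d) by ring.
  exact: aux.
(* Q is quadratic in u, so its Taylor error is z + 2 u at the killed matrix times the Taylor error
   of u, plus du^2. *)
have -> : Qerr D p X = cabs ((z + 2 * avg z Xk) * rem + du ^+ 2).
  rewrite E /Qerr /=; congr cabs; rewrite /du.
  have aux (a b x y c d : CC) : 1 + z * a + a ^+ 2 - (1 + z * b + b ^+ 2) - x * (- (z + 2 * b) * c) - y * (- (z + 2 * b) * d)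
    = (z + 2 * b) * (a - b + x * c + y * d) + (a - b) ^+ 2 by ring.
  exact: aux.
have hd2 : cabs (du ^+ 2) <= K ^+ 15 * (La * (e ^+ 2 * psi ^+ 2)).
  have -> : K ^+ 15 * (La * (e ^+ 2 * psi ^+ 2)) = (K ^+ 8 * (La * e)) * (K ^+ 7 * (e * psi ^+ 2)) by ring.
  by rewrite expr2; apply: le_cabsM; [exact: avg_du2|exact: avg_du'].
apply: le_trans (le_cabsD (le_cabsM avg_zuk hs) hd2) _.
have -> : K ^+ 9 * La * (e ^+ 2 * (K ^+ 5 * e ^+ 2 * (4 * (sN * psi) ^+ 2))) =
  4 * (K ^+ 14 * (La * (e ^+ 2 * psi ^+ 2))) * (e * sN) ^+ 2 by ring.
rewrite eN expr1n mulr1.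
have M0 : 0 <= La * (e ^+ 2 * psi ^+ 2) by rewrite mulr_ge0 // mulr_ge0 // exprn_ge0.
have h1 := Kmono4 K4 (isT : (14 < 15)%N) M0; have h2 := Kmono4 K4 (isT : (15 < 17)%N) M0.
have h3 : 0 <= K ^+ 15 * (La * (e ^+ 2 * psi ^+ 2)) by rewrite mulr_ge0.
move: (K ^+ 14 * (La * (e ^+ 2 * psi ^+ 2))) (K ^+ 15 * (La * (e ^+ 2 * psi ^+ 2)))
  (K ^+ 17 * (La * (e ^+ 2 * psi ^+ 2))) h1 h2 h3 => *; lra.
Qed.

Let rG2 a b : cabs (r * G2 z X a b) <= psi ^+ 2.
Proof. by rewrite cabsM rE G2_le. Qed.

Lemma avg_Q12 : cabs (mQ1 D p X) + cabs (mQ2 D p X) <= K * (La * f p).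
Proof.
have hg2 a b : cabs (r * G2 z X a b) <= e ^+ 2 * cabs (G2 z X a b) by rewrite cabsM rE.
have h1 : cabs (mQ1 D p X) <= K * La * (1 * (e ^+ 2 * cabs (G2 z X j i))).
  rewrite /=; apply: le_cabsM; rewrite ?cabsN // mulrCA.
  by apply: le_cabsM; [exact: cabs_offd|exact: hg2].
have h2 : cabs (mQ2 D p X) <= K * La * (e ^+ 2 * cabs (G2 z X i j)).
  by rewrite /=; apply: le_cabsM; rewrite ?cabsN.
apply: le_trans (lerD h1 h2) _.
have aux (x y : R) : K * La * (1 * x) + K * La * y = K * (La * (y + x)) by ring.
rewrite aux -/(o2 p).
by rewrite ler_wpM2l // ler_wpM2l.
Qed.

Lemma G2_diff a b : (a = j /\ b = i) \/ (a = i /\ b = j) ->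
  cabs (r * (G2 z Xk a b - G2 z X a b)) <= K ^+ 5 * (e * psi ^+ 2).
Proof.
move=> ab; rewrite /G2 -sumrB.
have hrow k : cabs (gk a k - g a k) <= K ^+ 3 * e * pR X z p (ev k).
  by case: ab => [[-> _]|[-> _]]; [apply: kill_rowj|apply: kill_rowi] => //; exact: hG.
have hcol k : cabs (gk k b - g k b) <= K ^+ 3 * e * pL X z p (ev k).
  by case: ab => [[_ ->]|[_ ->]]; [apply: kill_coli|apply: kill_colj] => //; exact: hG.
have hrk k : cabs (gk k b) <= 2 * pL X z p (ev k).
  by case: ab => [[_ ->]|[_ ->]]; [apply: (@kill_coli_le _ _ X z p hX zn K e)|
    apply: (@kill_colj_le _ _ X z p hX zn K e)] => //; exact: hG.
have hr0 k : cabs (g a k) <= pR X z p (ev k).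
  by case: ab => [[-> _]|[-> _]]; rewrite /pR; [rewrite lerDr|rewrite lerDl]; exact: cabs_ge0.
have hk k : cabs (gk a k * gk k b - g a k * g k b) <= 3 * (K ^+ 3 * e) * (pL X z p (ev k) * pR X z p (ev k)).
  apply: le_trans (prod_diff (hrow k) (hrk k) (hr0 k) (hcol k)) _.
  have aux (x y c : R) : c * y * (2 * x) + y * (c * x) = 3 * c * (x * y) by ring.
  by rewrite aux.
apply: le_trans (_ : e ^+ 2 * (3 * (K ^+ 3 * e) * (4 * (sN * psi) ^+ 2)) <= _).
  apply: le_cabsM; first by rewrite rE.
  apply: le_trans (cabs_sum _ _ _) _; apply: le_trans (ler_sum _ (fun k _ => hk k)) _.
  by rewrite -mulr_sumr ler_wpM2l ?sum_pLR // !mulr_ge0.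
have -> : e ^+ 2 * (3 * (K ^+ 3 * e) * (4 * (sN * psi) ^+ 2)) =
  12 * (K ^+ 3 * (e * psi ^+ 2)) * (e * sN) ^+ 2 by ring.
rewrite eN expr1n mulr1.
have h1 := Kmono16 K4 (isT : (3.+1 < 5)%N) ep0.
have h3 : 0 <= K ^+ 3 * (e * psi ^+ 2) by rewrite mulr_ge0.
move: (K ^+ 3 * (e * psi ^+ 2)) (K ^+ 5 * (e * psi ^+ 2)) h1 h3 => *; lra.
Qed.

Lemma avg_dQ12 : cabs (mQ1 D p Xk - mQ1 D p X) + cabs (mQ2 D p Xk - mQ2 D p X) <=
  K ^+ 16 * (La * (e * psi ^+ 2)).
Proof.
have h2 : cabs (2 : CC) <= 2 by rewrite cabs_nat.
have hab a b : (a = j /\ b = i) \/ (a = i /\ b = j) ->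
   cabs ((z + 2 * avg z Xk) * (r * (G2 z Xk a b - G2 z X a b)) - 2 * du * (r * G2 z X a b)) <=
   K ^+ 15 * (La * (e * psi ^+ 2)).
  move=> ab; apply: le_trans (le_cabsB (le_cabsM avg_zuk (G2_diff ab))
    (le_cabsM (le_cabsM h2 avg_du2) (rG2 a b))) _.
  have M0 : 0 <= La * (e * psi ^+ 2) by rewrite mulr_ge0.
  have -> : K ^+ 9 * La * (K ^+ 5 * (e * psi ^+ 2)) + 2 * (K ^+ 8 * (La * e)) * psi ^+ 2 =
    K ^+ 14 * (La * (e * psi ^+ 2)) + 2 * (K ^+ 8 * (La * (e * psi ^+ 2))) by ring.
  exact: Kpoly2.
have -> : mQ1 D p Xk - mQ1 D p X = - (offd p * ((z + 2 * avg z Xk) * (r * (G2 z Xk j i - G2 z X j i)) -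
   2 * du * (r * G2 z X j i))).
  rewrite /= /du.
  have aux (s a b o' x y : CC) : - (z + 2 * b) * (s * (o' * y)) - - (z + 2 * a) * (s * (o' * x)) =
    - (o' * ((z + 2 * b) * (s * (y - x)) - 2 * (a - b) * (s * x))) by ring.
  exact: aux.
have -> : mQ2 D p Xk - mQ2 D p X = - ((z + 2 * avg z Xk) * (r * (G2 z Xk i j - G2 z X i j)) -
   2 * du * (r * G2 z X i j)).
  rewrite /= /du.
  have aux (s a b x y : CC) : - (z + 2 * b) * (s * y) - - (z + 2 * a) * (s * x) =
    - ((z + 2 * b) * (s * (y - x)) - 2 * (a - b) * (s * x)) by ring.
  exact: aux.
rewrite !cabsN.
have h3 := le_cabsM (@cabs_offd R N p) (hab j i (or_introl (conj erefl erefl))); rewrite mul1r in h3.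
apply: le_trans (lerD h3 (hab i j (or_intror (conj erefl erefl)))) _.
have M0 : 0 <= La * (e * psi ^+ 2) by rewrite mulr_ge0.
have h4 := Kmono4 K4 (isT : (15 < 16)%N) M0.
have h5 : 0 <= K ^+ 15 * (La * (e * psi ^+ 2)) by rewrite mulr_ge0.
move: (K ^+ 15 * (La * (e * psi ^+ 2))) (K ^+ 16 * (La * (e * psi ^+ 2))) h4 h5 => *; lra.
Qed.

Let hii : cabs (g i i) <= K. Proof. exact: hG. Qed.
Let hij : cabs (g i j) <= K. Proof. exact: hG. Qed.
Let hji : cabs (g j i) <= K. Proof. exact: hG. Qed.
Let hjj : cabs (g j j) <= K. Proof. exact: hG. Qed.

Lemma avg_c : cabs (mc D p X) <= e ^+ 2 * o p.
Proof.
rewrite /=; apply: le_cabsM; first by rewrite rE.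
by rewrite /o addrAC lerDr addr_ge0 // cabs_ge0.
Qed.

Lemma avg_ck : cabs (mc D p Xk) <= K ^+ 9 * (e ^+ 2 * o p).
Proof.
have -> : K ^+ 9 * (e ^+ 2 * o p) = e ^+ 2 * (K ^+ 9 * o p) by ring.
rewrite /=; apply: le_cabsM; first by rewrite rE.
exact: (kill_ji hX zn K4 e0 Ke (hent p) hii hij hji hjj).
Qed.

Lemma avg_dc : cabs (mc D p X - mc D p Xk) <= K ^+ 8 * e ^+ 3.
Proof.
have -> : K ^+ 8 * e ^+ 3 = e ^+ 2 * (K ^+ 8 * e) by ring.
rewrite /= -mulrBr; apply: le_cabsM; first by rewrite rE.
by rewrite cabsBC; apply: kill_dji.
Qed.

Lemma avg_cerr : cerr D p X <= K ^+ 19 * (e ^+ 4 * o p).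
Proof.
have -> : K ^+ 19 * (e ^+ 4 * o p) = e ^+ 2 * (K ^+ 19 * (e ^+ 2 * o p)) by ring.
have -> : cerr D p X = cabs (r * (g j i - gk j i - h * (- offd p * gk j i * gk j i) - (h^*)%C * (- gk j j * gk i i))).
  rewrite /cerr /=; congr cabs.
  have aux (s a b o' x y c d : CC) : s * a - s * b - x * (- s * (o' * (b * b))) - y * (- s * (c * d)) =
    s * (a - b - x * (- o' * b * b) - y * (- c * d)) by ring.
  exact: aux.
apply: le_cabsM; first by rewrite rE.
exact: (kill_taylor_ji hX zn K4 e0 Ke (hent p) hii hij hji hjj).
Qed.

Lemma avg_c12 : cabs (mc1 D p X) + cabs (mc2 D p X) <= 2 * (K ^+ 2 * e ^+ 2).
Proof.
have h1 : cabs (mc1 D p X) <= e ^+ 2 * (1 * (K * K)).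
  rewrite /=; apply: le_cabsM; first by rewrite cabsN rE.
  by apply: le_cabsM; [exact: cabs_offd|exact: le_cabsM].
have h2 : cabs (mc2 D p X) <= e ^+ 2 * (K * K).
  by rewrite /=; apply: le_cabsM; [rewrite cabsN rE|exact: le_cabsM].
by apply: le_trans (lerD h1 h2) _; rewrite le_eqVlt; apply/orP; left; apply/eqP; ring.
Qed.

Lemma avg_dc12 : cabs (mc1 D p Xk - mc1 D p X) + cabs (mc2 D p Xk - mc2 D p X) <=
  K ^+ 19 * (e ^+ 3 * o p).
Proof.
have h1 : cabs (mc1 D p Xk - mc1 D p X) <= e ^+ 2 * (1 * (K ^+ 18 * (e * o p))).
  rewrite /= -mulrBr -mulrBr; apply: le_cabsM; first by rewrite cabsN rE.
  apply: le_cabsM; first exact: cabs_offd.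
  exact: (kill_dji2 hX zn K4 e0 Ke (hent p) hii hij hji hjj).
have h2 : cabs (mc2 D p Xk - mc2 D p X) <= e ^+ 2 * (K ^+ 10 * (e * o p)).
  rewrite /= -mulrBr; apply: le_cabsM; first by rewrite cabsN rE.
  exact: (kill_diijj hX zn K4 e0 Ke (hent p) hii hij hji hjj).
apply: le_trans (lerD h1 h2) _.
have -> : e ^+ 2 * (1 * (K ^+ 18 * (e * o p))) + e ^+ 2 * (K ^+ 10 * (e * o p)) =
  K ^+ 18 * (e ^+ 3 * o p) + K ^+ 10 * (e ^+ 3 * o p) by ring.
apply: le_trans (_ : K ^+ 18 * (e ^+ 3 * o p) + 2 * (K ^+ 10 * (e ^+ 3 * o p)) <= _).
  by rewrite lerD2l mulr_natl mulr2n lerDl mulr_ge0.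
exact: Kpoly2.
Qed.

Lemma avg_E1 : E1term (C / N%:R) D p X <= K ^+ 21 * (e * (e ^+ 4 * o p)).
Proof.
have p1 := ler_pM (cabs_ge0 _) (cabs_ge0 _) (hent p) avg_cerr.
have d0 := addr_ge0 (cabs_ge0 (mc1 D p Xk - mc1 D p X)) (cabs_ge0 (mc2 D p Xk - mc2 D p X)).
have p2 := ler_pM cN0 d0 CNle avg_dc12.
apply: le_trans (lerD p1 p2) _.
have M0 : 0 <= e * (e ^+ 4 * o p) by rewrite mulr_ge0.
have -> : K * e * (K ^+ 19 * (e ^+ 4 * o p)) + K * e ^+ 2 * (K ^+ 19 * (e ^+ 3 * o p)) =
  2 * (K ^+ 20 * (e * (e ^+ 4 * o p))) by ring.
have := Kmono4 K4 (isT : (20 < 21)%N) M0.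
have : 0 <= K ^+ 20 * (e * (e ^+ 4 * o p)) by rewrite mulr_ge0.
exact: absorb_two.
Qed.

Lemma avg_E2 : E2term (C / N%:R) D p X <=
  K ^+ 28 * (La * e * (e ^+ 4 * f p)) + K ^+ 28 * (La * e * psi ^+ 2 * (e ^+ 4 * o p)).
Proof.
have c0 := @cabs_ge0 R.
have b0 : 0 <= Qdiff D p X by exact: c0.
have p1 := ler_pM (mulr_ge0 (c0 _) (c0 _)) b0 (ler_pM (c0 _) (c0 _) (hent p) avg_dc) avg_b.
have p2 := ler_pM (mulr_ge0 (c0 _) (c0 _)) (c0 _) (ler_pM (c0 _) (c0 _) (hent p) avg_ck) avg_Qerr.
have dc' : cabs (mc D p Xk - mc D p X) <= K ^+ 8 * e ^+ 3 by rewrite cabsBC avg_dc.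
have q0 := addr_ge0 (c0 (mQ1 D p X)) (c0 (mQ2 D p X)).
have dq0 := addr_ge0 (c0 (mQ1 D p Xk - mQ1 D p X)) (c0 (mQ2 D p Xk - mQ2 D p X)).
have cc0 := addr_ge0 (c0 (mc1 D p X)) (c0 (mc2 D p X)).
have p31 := ler_pM (c0 _) q0 dc' avg_Q12.
have p32 := ler_pM (c0 _) dq0 avg_ck avg_dQ12.
have p3 := ler_pM cN0 (addr_ge0 (mulr_ge0 (c0 _) q0) (mulr_ge0 (c0 _) dq0)) CNle (lerD p31 p32).
have p4 := ler_pM (mulr_ge0 cN0 cc0) b0 (ler_pM cN0 cc0 CNle avg_c12) avg_b.
apply: le_trans (lerD (lerD (lerD p1 p2) p3) p4) _.
set M1 := La * e * (e ^+ 4 * f p).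
set M2 := La * e * psi ^+ 2 * (e ^+ 4 * o p).
have M10 : 0 <= M1 by rewrite mulr_ge0 // mulr_ge0 ?exprn_ge0.
have M20 : 0 <= M2 by rewrite mulr_ge0 // mulr_ge0 // mulr_ge0.
have -> : K * e * (K ^+ 8 * e ^+ 3) * (K ^+ 15 * (La * (e * f p))) +
  K * e * (K ^+ 9 * (e ^+ 2 * o p)) * (K ^+ 17 * (La * (e ^+ 2 * psi ^+ 2))) +
  K * e ^+ 2 * (K ^+ 8 * e ^+ 3 * (K * (La * f p)) +
    K ^+ 9 * (e ^+ 2 * o p) * (K ^+ 16 * (La * (e * psi ^+ 2)))) +
  K * e ^+ 2 * (2 * (K ^+ 2 * e ^+ 2)) * (K ^+ 15 * (La * (e * f p))) =
  K ^+ 24 * M1 + 2 * (K ^+ 18 * M1) + K ^+ 10 * M1 + (K ^+ 27 * M2 + K ^+ 26 * M2).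
  by rewrite /M1 /M2; ring.
have h1 := Kpoly2 K4 (isT : (24 < 26)%N) (isT : (18 < 26)%N) M10.
have h2 := Kmono4 K4 (isT : (26 < 28)%N) M10.
have h3 := Kmono4 K4 (isT : (10 < 28)%N) M10.
have h4 := Kmono4 K4 (isT : (27 < 28)%N) M20; have h5 := Kmono4 K4 (isT : (26 < 28)%N) M20.
have h6 : 0 <= K ^+ 26 * M1 by rewrite mulr_ge0.
have h7 : 0 <= K ^+ 28 * M1 by rewrite mulr_ge0.
have h8 : 0 <= K ^+ 28 * M2 by rewrite mulr_ge0.
clearbody M1 M2.
move: (K ^+ 24 * M1) (K ^+ 18 * M1) (K ^+ 10 * M1) (K ^+ 26 * M1) (K ^+ 28 * M1)
  (K ^+ 27 * M2) (K ^+ 26 * M2) (K ^+ 28 * M2) h1 h2 h3 h4 h5 h6 h7 h8.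
exact: absorb_five.
Qed.

Lemma avg_E3 : E3term (C / N%:R) D p X <=
  K ^+ 42 * (La ^+ 2 * e * psi ^+ 2 * (e ^+ 4 * (o p * f p))).
Proof.
have c0 := @cabs_ge0 R.
have b0 : 0 <= Qdiff D p X by exact: c0.
have b2 : Qdiff D p X ^+ 2 <= (K ^+ 15 * (La * (e * f p))) ^+ 2.
  have r0 : 0 <= K ^+ 15 * (La * (e * f p)) by rewrite mulr_ge0 // mulr_ge0 // mulr_ge0.
  by apply: lerXn2r; [exact: b0|exact: r0|exact: avg_b].
have p1 := ler_pM (mulr_ge0 (c0 _) (c0 _)) (sqr_ge0 _) (ler_pM (c0 _) (c0 _) (hent p) avg_ck) b2.
have q0 := addr_ge0 (c0 (mQ1 D p X)) (c0 (mQ2 D p X)).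
have p2 := ler_pM (mulr_ge0 (mulr_ge0 cN0 (c0 _)) q0) b0
  (ler_pM (mulr_ge0 cN0 (c0 _)) q0 (ler_pM cN0 (c0 _) CNle avg_c) avg_Q12) avg_b.
apply: le_trans (lerD p1 p2) _.
set M := La ^+ 2 * e * (e ^+ 4 * (o p * f p)).
have M0 : 0 <= M by rewrite mulr_ge0 ?mulr_ge0 ?exprn_ge0.
have -> : K * e * (K ^+ 9 * (e ^+ 2 * o p)) * (K ^+ 15 * (La * (e * f p))) ^+ 2 +
  K * e ^+ 2 * (e ^+ 2 * o p) * (K * (La * f p)) * (K ^+ 15 * (La * (e * f p))) =
  f p * (K ^+ 40 * M + K ^+ 17 * M) by rewrite /M; ring.
have h1 : K ^+ 40 * M + K ^+ 17 * M <= K ^+ 41 * M.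
  apply: le_trans (_ : K ^+ 40 * M + 2 * (K ^+ 17 * M) <= _); last exact: Kpoly2.
  by rewrite lerD2l mulr_natl mulr2n lerDl mulr_ge0.
apply: le_trans (ler_pM (f0 p) _ (f_le p) h1) _; first by rewrite addr_ge0 ?mulr_ge0.
have -> : K ^+ 42 * (La ^+ 2 * e * psi ^+ 2 * (e ^+ 4 * (o p * f p))) =
  K * psi ^+ 2 * (K ^+ 41 * M) by rewrite /M; ring.
rewrite ler_wpM2r ?mulr_ge0 // ler_wpM2r //.
by apply: le_trans K4; rewrite ler_nat.
Qed.

End Pair.

(** The deviations G_aa - u sum to zero and S has unit row and column sums, so all terms linear in
    them cancel. The remaining quadratic form is of order psi^2 <= K La rho: this is the gain from
    averaging. *)
Lemma avg_M0 : cabs (mq D X + \sum_p (T p * mc1 D p X + (S p)%:C%C * mc2 D p X)) <= K ^+ 4 * (La * rho).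
Proof.
have hsum : \sum_a (g a a - u) = 0.
  rewrite sumrB sumr_const card_ord /avg -/r /gdiag -mulr_natl mulrA.
  rewrite -(rmorph_nat (real_complex R)) /r -(rmorphM (real_complex R)) /= mulfV ?gt_eqF //.
  by rewrite (rmorph1 (real_complex R)) mul1r subrr.
have Srow' i : \sum_j (S (i, j))%:C%C = 1 :> CC.
  by rewrite -(rmorph_sum (real_complex R)) Srow (rmorph1 (real_complex R)).
have E : mq D X + \sum_p (T p * mc1 D p X + (S p)%:C%C * mc2 D p X) =
  - (r * \sum_a ((g a a - u) * \sum_b (S (a, b))%:C%C * (g b b - u))) -
  r * \sum_p T p * (offd p * (g p.2 p.1 * g p.2 p.1)).
  have -> : \sum_p (T p * mc1 D p X + (S p)%:C%C * mc2 D p X) =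
    - (r * \sum_p T p * (offd p * (g p.2 p.1 * g p.2 p.1))) -
    r * \sum_p (S p)%:C%C * (g p.2 p.2 * g p.1 p.1).
    rewrite !mulr_sumr -!sumrN -big_split /=; apply: eq_bigr => p _; ring.
  have -> : \sum_p (S p)%:C%C * (g p.2 p.2 * g p.1 p.1) =
     \sum_a ((g a a - u) * \sum_b (S (a, b))%:C%C * (g b b - u)) + N%:R * u ^+ 2.
    transitivity (\sum_a \sum_b (S (a, b))%:C%C * (g b b * g a a)).
      by rewrite pair_bigA; apply: eq_bigr => -[].
    have eSrow a : \sum_b (S (a, b))%:C%C * (g b b * g a a) =
       (g a a - u) * (\sum_b (S (a, b))%:C%C * (g b b - u)) +
       (u * (g a a - u) + \sum_b (S (a, b))%:C%C * (u * (g b b - u)) + u ^+ 2).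
      rewrite -[X in u * (_ - _) + _ + X]mul1r -[X in (_ - _) * _ + (X + _ + _)]mul1r -(Srow' a).
      rewrite mulr_sumr !mulr_suml -!big_split /=; apply: eq_bigr => b _.
      have aux (s x y v : CC) : s * (y * x) = (x - v) * (s * (y - v)) + (s * (v * (x - v)) + s * (v * (y - v)) + s * v ^+ 2) by ring.
      exact: aux.
    under eq_bigr do rewrite eSrow; rewrite big_split /=; congr (_ + _).
    rewrite !big_split /= -mulr_sumr hsum mulr0 add0r sumr_const card_ord mulr_natl.
    rewrite exchange_big [X in X + _](_ : _ = u * \sum_b (g b b - u)) /=.
      by rewrite hsum mulr0 add0r.
    rewrite mulr_sumr; apply: eq_bigr => b _; rewrite -mulr_suml.
    have -> : \sum_a (S (a, b))%:C%C = 1 :> CC.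
      by rewrite -(Srow' b); apply: eq_bigr => a _; rewrite Ssym.
    by rewrite mul1r.
  rewrite /= [X in X + _](_ : _ = r * (N%:R * u ^+ 2)); last first.
    rewrite mulrA -(rmorph_nat (real_complex R)) /r -(rmorphM (real_complex R)) /= mulVf ?gt_eqF //.
    by rewrite (rmorph1 (real_complex R)) mul1r.
  have aux (s v t1 t2 : CC) : s * v + (- (s * t1) - s * (t2 + v)) = - (s * t2) - s * t1 by ring.
  exact: aux.
rewrite E.
have b1 : cabs (r * \sum_a ((g a a - u) * \sum_b (S (a, b))%:C%C * (g b b - u))) <= K * psi * (K * psi).
  apply: r_sum_le => // a; apply: le_cabsM => //.
  apply: le_trans (cabs_sum _ _ _) _.
  apply: (@le_trans _ _ (\sum_b S (a, b) * (K * psi))); last by rewrite -mulr_suml Srow mul1r.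
  by apply: ler_sum => b _; apply: le_cabsM; rewrite ?cabs_real ?ger0_norm.
have b2 : cabs (r * \sum_p T p * (offd p * (g p.2 p.1 * g p.2 p.1))) <=
  e ^+ 2 * (K * e ^+ 2 * (sN ^+ 2 * (sN * psi) ^+ 2)).
  apply: le_cabsM; first by rewrite rE.
  apply: le_trans (cabs_sum _ _ _) _.
  apply: (@le_trans _ _ (\sum_(p : 'I_N * 'I_N) K * e ^+ 2 * cabs (g p.2 p.1) ^+ 2)).
    apply: ler_sum => p _; apply: le_cabsM; first exact: le_trans (TS _) (le_trans (SC _) CNle).
    by rewrite -[leRHS]mul1r expr2; apply: le_cabsM; [exact: cabs_offd|exact: le_cabsM].
  rewrite -mulr_sumr ler_wpM2l ?mulr_ge0 ?exprn_ge0 //.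
  rewrite (sum_swap (fun p => cabs (g p.1 p.2) ^+ 2)).
  rewrite -(pair_bigA _ (fun i j => cabs (g i j) ^+ 2)) -cardI /=.
  exact: sum_le_card.
rewrite -cabsN in b1.
apply: le_trans (le_cabsB b1 b2) _.
have -> : e ^+ 2 * (K * e ^+ 2 * (sN ^+ 2 * (sN * psi) ^+ 2)) = K * psi ^+ 2 * (e * sN) ^+ 4 by ring.
rewrite eN expr1n mulr1.
apply: le_trans (_ : K ^+ 3 * psi ^+ 2 <= _); last first.
  by rewrite [K ^+ 4]exprSr -mulrA ler_wpM2l ?exprn_ge0.
have p20 : 0 <= psi ^+ 2 by exact: sqr_ge0.
have -> : K * psi * (K * psi) = K ^+ 2 * psi ^+ 2 by ring.
have := @Kpoly2 R K (psi ^+ 2) 2 1 3 K4 isT isT p20; rewrite expr1; apply: le_trans.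
by rewrite lerD2l mulr_natl mulr2n lerDl mulr_ge0.
Qed.

(** One bound for both derivatives of the cofactor. The products of [o] and [f] are summed by
    Cauchy-Schwarz from their mean squares, and psi^2 <= K La rho makes the result quadratic in La
    rho. *)
Lemma avg_M12 (q1 q2 : 'I_N * 'I_N -> CC) : (forall p, cabs (q1 p) + cabs (q2 p) <= K * (La * f p)) ->
  cabs (\sum_p (T p * (mc D p X * q1 p) + (S p)%:C%C * (mc D p X * q2 p))) <= K ^+ 7 * (La * rho) ^+ 2.
Proof.
move=> hq; apply: le_trans (cabs_sum _ _ _) _.
apply: (@le_trans _ _ (\sum_p K ^+ 2 * La * (e ^+ 4 * (o p * f p)))).
  apply: ler_sum => p _.
  have hT : cabs (T p) <= K * e ^+ 2 by exact: le_trans (TS _) (le_trans (SC _) CNle).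
  have hS : cabs ((S p)%:C%C : CC) <= K * e ^+ 2.
    by rewrite cabs_real ger0_norm // (le_trans (SC _) CNle).
  have hp := avg_c p.
  apply: le_trans (le_cabsD (le_cabsM hT (le_cabsM hp (lexx _))) (le_cabsM hS (le_cabsM hp (lexx _)))) _.
  rewrite -!mulrDr.
  have ke0 : 0 <= K * e ^+ 2 by rewrite mulr_ge0 ?exprn_ge0.
  have eo : 0 <= e ^+ 2 * o p by rewrite mulr_ge0 ?exprn_ge0.
  apply: le_trans (ler_wpM2l ke0 (ler_wpM2l eo (hq p))) _.
  by rewrite le_eqVlt; apply/orP; left; apply/eqP; ring.
rewrite -mulr_sumr -mulr_sumr.
have kl : 0 <= K ^+ 2 * La by rewrite mulr_ge0 ?exprn_ge0.
apply: le_trans (ler_wpM2l kl avg_sum_of) _.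
have -> : K ^+ 2 * La * (K ^+ 4 * (psi ^+ 2 * rho)) = (K ^+ 6 * (La * rho)) * psi ^+ 2 by ring.
have -> : K ^+ 7 * (La * rho) ^+ 2 = (K ^+ 6 * (La * rho)) * (K * (La * rho)) by ring.
by rewrite ler_wpM2l ?mulr_ge0 ?exprn_ge0 // ltW.
Qed.

Theorem avg_good : good S T (C / N%:R) (K ^+ 30 * (La * rho)) D X.
Proof.
have bnd (B : R) n k : (n <= 30 * k)%N -> B <= K ^+ n * (La * rho) ^+ k -> B <= (K ^+ 30 * (La * rho)) ^+ k.
  move=> nk hB; apply: (le_trans hB); rewrite [leRHS]exprMn -exprM; apply: Kmono => //.
  exact: exprn_ge0.
have Kn n : 0 <= K ^+ n by rewrite exprn_ge0.
have epsi2 : e * psi <= K * (La * rho).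
  by apply: le_trans psiL; rewrite expr2 ler_wpM2r.
have rho0' := ltW rho0.
split.
- by rewrite -[leRHS]expr1; apply: (bnd _ 4 1) => //; rewrite expr1; exact: avg_M0.
- apply: (bnd _ 7 2) => //; exact: avg_M12 avg_Q12.
- apply: (bnd _ 7 2) => //; apply: avg_M12 => p; rewrite !cabsJ addrC; exact: avg_Q12.
- move=> p; rewrite -[leRHS]expr1; apply: (bnd _ 18 1) => //; rewrite expr1.
  apply: le_trans (avg_b p) _.
  have -> : K ^+ 18 * (La * rho) = K ^+ 15 * (K * (K * (K * (La * rho)))) by ring.
  rewrite ler_wpM2l // ; apply: ler_pM => //; rewrite ?mulr_ge0 //.
  apply: (@le_trans _ _ (1 * (3 * psi ^+ 2))); first by apply: ler_pM.
  rewrite mul1r; apply: ler_pM => //; rewrite ?exprn_ge0 //; move: K4; lra.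
- rewrite -[leRHS]expr1; apply: (bnd _ 23 1) => //; rewrite expr1.
  apply: le_trans (ler_sum _ (fun p _ => avg_E1 p)) _; rewrite -mulr_sumr -mulr_sumr -mulr_sumr.
  apply: le_trans (ler_wpM2l (Kn 21%N) (ler_wpM2l e0 avg_sum_o)) _.
  have -> : K ^+ 21 * (e * (3 * psi)) = K ^+ 21 * (3 * (e * psi)) by ring.
  have -> : K ^+ 23 * (La * rho) = K ^+ 21 * (K * (K * (La * rho))) by ring.
  rewrite ler_wpM2l //; apply: ler_pM => //; rewrite ?mulr_ge0 //; move: K4; lra.
- apply: (bnd _ 36 2) => //.
  apply: le_trans (ler_sum _ (fun p _ => avg_E2 p)) _.
  rewrite big_split /= -!mulr_sumr.
  have k1 : 0 <= La * e by rewrite mulr_ge0.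
  have k2 : 0 <= La * e * psi ^+ 2 by rewrite mulr_ge0 ?exprn_ge0.
  apply: le_trans (lerD (ler_wpM2l (Kn 28%N) (ler_wpM2l k1 avg_sum_f))
    (ler_wpM2l (Kn 28%N) (ler_wpM2l k2 avg_sum_o))) _.
  have -> : K ^+ 28 * (La * e * (K ^+ 3 * (psi * rho))) = K ^+ 31 * (La * rho) * (e * psi) by ring.
  have -> : K ^+ 28 * (La * e * psi ^+ 2 * (3 * psi)) = 3 * K ^+ 28 * La * (e * psi) * psi ^+ 2 by ring.
  have l0 : 0 <= K ^+ 31 * (La * rho) by rewrite mulr_ge0.
  have l1 : 0 <= 3 * K ^+ 28 * La by rewrite mulr_ge0 // mulr_ge0.
  have t1 := ler_wpM2l l0 epsi2.
  have ep0' : 0 <= e * psi by rewrite mulr_ge0.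
  have t2 := ler_pM (mulr_ge0 l1 ep0') (sqr_ge0 psi) (ler_wpM2l l1 epsi2) psiL.
  apply: le_trans (lerD t1 t2) _.
  have M0 : 0 <= (La * rho) ^+ 2 by exact: sqr_ge0.
  have -> : K ^+ 31 * (La * rho) * (K * (La * rho)) = K ^+ 32 * (La * rho) ^+ 2 by ring.
  have -> : 3 * K ^+ 28 * La * (K * (La * rho)) * (K * (La * rho)) =
    3 * La * (K ^+ 30 * (La * rho) ^+ 2) by ring.
  have h1 : 3 * La * (K ^+ 30 * (La * rho) ^+ 2) <= 4 * K * (K ^+ 30 * (La * rho) ^+ 2).
    rewrite ler_wpM2r ?mulr_ge0 //; move: La0 LaK; lra.
  have h2 : 4 * K * (K ^+ 30 * (La * rho) ^+ 2) = 4 * (K ^+ 31 * (La * rho) ^+ 2) by ring.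
  have h3 := Kmono4 K4 (isT : (31 < 35)%N) M0; have h4 := Kmono4 K4 (isT : (32 < 36)%N) M0.
  have h5 := Kmono4 K4 (isT : (35 < 36)%N) M0.
  have h6 : 0 <= K ^+ 35 * (La * rho) ^+ 2 by rewrite mulr_ge0.
  rewrite h2 in h1.
  move: (3 * La * (K ^+ 30 * (La * rho) ^+ 2)) (K ^+ 31 * (La * rho) ^+ 2) (K ^+ 32 * (La * rho) ^+ 2)
    (K ^+ 35 * (La * rho) ^+ 2) (K ^+ 36 * (La * rho) ^+ 2) h1 h3 h4 h5 h6 => *; lra.
- apply: (bnd _ 49 3) => //.
  apply: le_trans (ler_sum _ (fun p _ => avg_E3 p)) _; rewrite -!mulr_sumr.
  have k2 : 0 <= La ^+ 2 * e * psi ^+ 2 by rewrite mulr_ge0 ?exprn_ge0 // mulr_ge0 ?exprn_ge0.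
  apply: le_trans (ler_wpM2l (Kn 42%N) (ler_wpM2l k2 avg_sum_of)) _.
  have -> : K ^+ 42 * (La ^+ 2 * e * psi ^+ 2 * (K ^+ 4 * (psi ^+ 2 * rho))) =
    e * (K ^+ 46 * (La ^+ 2 * rho)) * (psi ^+ 2 * psi ^+ 2) by ring.
  have -> : K ^+ 49 * (La * rho) ^+ 3 =
    1 * (K ^+ 46 * (La ^+ 2 * rho)) * ((K * (La * rho)) * (K * (K * rho))) by ring.
  have l2 : 0 <= La ^+ 2 * rho by rewrite mulr_ge0 ?exprn_ge0.
  have ps2 : 0 <= psi ^+ 2 by exact: sqr_ge0.
  apply: ler_pM; rewrite ?mulr_ge0 //; first by rewrite ler_wpM2r // mulr_ge0.
  apply: ler_pM => //; apply: (le_trans psiL).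
  by rewrite ler_wpM2l // ler_wpM2r.
Qed.

End AverageGood.

(** * Stieltjes transform of the semicircle law *)

Section UniformAngle.
Context {R : realType}.
  Import numFieldNormedType.Exports.
Local Notation CC := R[i].
Local Notation mu := (@lebesgue_measure R).
Local Notation U := (uniform_prob (@pi_gt0 R)).

Lemma continuous_integrable_itv (a b : R) (f : R -> R) : continuous f ->
  mu.-integrable `[a, b] (EFin \o f).
Proof.
move=> cf; apply: continuous_compact_integrable; first exact: segment_compact.
exact: continuous_subspaceT.
Qed.

Lemma mu_0pi : fine (mu `[0, pi]%classic) = pi :> R.
Proof. by rewrite lebesgue_measure_itv /= lte_fin pi_gt0 sube0. Qed.

Lemma uniform_Rintegral (f : R -> R) (b : R) : continuous f -> (forall t, `|f t| <= b) ->
  Rintegral U setT f = pi^-1 * Rintegral mu `[0, pi] f.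
Proof.
move=> cf hb.
have mf : measurable_fun setT f by exact: continuous_measurable_fun.
have iU : U.-integrable setT (EFin \o f) by exact: (@bounded_integrable _ _ _ U f b).
(* The shift by b makes the integrand nonnegative, which is the form [integral_uniform] takes. *)
have h1 : Rintegral U setT (fun t => f t + b) = Rintegral U setT f + b.
  rewrite RintegralD //; last exact: finite_measure_integrable_cst.
  congr (_ + _); rewrite (Rintegral_cst U measurableT b).
  by have -> : fine (U setT) = 1 :> R by [rewrite probability_setT]; rewrite mulr1.
have h2 : Rintegral mu `[0, pi] (fun t => f t + b) = Rintegral mu `[0, pi] f + b * pi.
  rewrite RintegralD //; [|exact: continuous_integrable_itv|].
    by congr (_ + _); rewrite Rintegral_cst // mu_0pi.
  by apply: continuous_integrable_itv => t; exact: cvg_cst.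
have h3 : Rintegral U setT (fun t => f t + b) = pi^-1 * Rintegral mu `[0, pi] (fun t => f t + b).
  rewrite /Rintegral integral_uniform.
  - rewrite subr0 fineM //.
    have : mu.-integrable `[0, pi] (EFin \o (fun t => f t + b)).
      apply: continuous_integrable_itv => t; apply: cvgD; [exact: cf|exact: cvg_cst].
    by move/integrable_fin_num => /(_ (measurable_itv _)).
  - by apply/measurable_EFinP; apply: measurable_funD => //; exact: measurable_cst.
  - by move=> t; rewrite lee_fin; have := hb t; rewrite ler_norml => /andP[]; lra.
move: h3; rewrite h1 h2 mulrDr mulrCA mulVf ?mulr1; last by rewrite gt_eqF ?pi_gt0.
by move=> h; apply: (addIr b).
Qed.

Lemma continuous_natcos (n : nat) : continuous (fun t : R => cos (n%:R * t)).
Proof.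
rewrite (_ : (fun t => _) = (@cos R) \o (fun t : R => n%:R * t)) // => t.
apply: continuous_comp; last exact: continuous_cos.
by apply: cvgM; [exact: cvg_cst|exact: cvg_id].
Qed.

Lemma sin_natpi (n : nat) : sin (n%:R * pi) = 0 :> R.
Proof.
elim: n => [|n IH]; first by rewrite mul0r sin0.
by rewrite -natr1 mulrDl mul1r sinDpi IH oppr0.
Qed.

Lemma uniform_cos (n : nat) : Rintegral U setT (fun t => cos (n%:R * t)) = (n == 0%N)%:R.
Proof.
rewrite (@uniform_Rintegral _ 1); [|exact: continuous_natcos|by move=> t; exact: cos_max].
case: n => [|n].
  under eq_Rintegral do rewrite mul0r cos0.
  by rewrite Rintegral_cst // mu_0pi mul1r mulVf // gt_eqF // pi_gt0.
pose F := fun t : R => (n.+1%:R)^-1 * sin (n.+1%:R * t).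
have dF (t : R) : is_derive t 1 F (cos (n.+1%:R * t)).
  have h1 : is_derive t 1 (fun t : R => n.+1%:R * t) n.+1%:R.
    have h := is_deriveZ n.+1%:R (is_derive_id t (1 : R)).
    by apply: (is_derive_eq h); rewrite /GRing.scale /= mulr1.
  have h2 : is_derive t 1 (@sin R \o (fun t : R => n.+1%:R * t)) (n.+1%:R * cos (n.+1%:R * t)).
    by apply: (is_derive_eq (is_derive1_comp _ h1)); rewrite mulrC.
  have h3 := is_deriveZ (n.+1%:R)^-1 h2.
  by apply: (is_derive_eq h3); rewrite /GRing.scale /= mulrA mulVf ?mul1r.
have cF : continuous F.
  by move=> t; apply: differentiable_continuous; apply/derivable1_diffP; exact: ex_derive.
rewrite /Rintegral (@continuous_FTC2 _ _ F) ?pi_gt0 //.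
- by rewrite /F sin_natpi !mulr0 sin0 mulr0 sube0 /= mulr0.
- exact/continuous_subspaceT/continuous_natcos.
- split => [t _||]; first exact: ex_derive.
  + exact: cvg_at_right_filter (cF 0).
  + exact: cvg_at_left_filter (cF pi).
- by move=> t _; rewrite derive1E; exact: derive_val.
Qed.

Lemma continuous_sc_density : continuous (@sc_density R).
Proof.
have h : continuous (@Num.sqrt R \o (fun x : R => Num.max (4 - x ^+ 2) 0)).
  move=> x; apply: continuous_comp; last exact: sqrt_continuous.
  apply: continuous_max; last exact: cvg_cst.
  apply: cvgB; first exact: cvg_cst.
  exact: exprn_continuous.
by move=> x; apply: cvgM; [exact: cvg_cst|exact: h].
Qed.

Lemma sc_density_outside (x : R) : x \notin `[(- 2 : R), 2]%R -> sc_density x = 0.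
Proof.
move=> hx; rewrite /sc_density max_r ?sqrtr0 ?mulr0 // subr_le0.
move: hx; rewrite in_itv /= negb_and -!ltNge => /orP[h|h].
  by have := mulr_ge0 (_ : 0 <= -2 - x) (_ : 0 <= - x); nra.
by nra.
Qed.

(** Substitution x = 2 cos t: the semicircle law is the image under 2 cos of the density 2 sin^2
    with respect to the uniform law on [0, pi]. *)
Lemma sc_integral (g : R -> R) (b : R) : continuous g -> (forall x, `|g x| <= b) ->
  Rintegral mu setT (fun x => sc_density x * g x) =
  Rintegral U setT (fun t => 2 * sin t ^+ 2 * g (2 * cos t)).
Proof.
move=> cg gb.
have csg : continuous (fun x => sc_density x * g x).
  by move=> x; apply: cvgM; [exact: continuous_sc_density|exact: cg].
have c2 : continuous (fun t : R => 2 * cos t).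
  by move=> t; apply: cvgM; [exact: cvg_cst|exact: continuous_cos].
have cs : continuous (fun t : R => 2 * sin t ^+ 2 * g (2 * cos t)).
  move=> t; apply: cvgM.
    apply: cvgM; first exact: cvg_cst.
    by rewrite expr2; apply: cvgM; exact: continuous_sin.
  have : continuous (g \o (fun t : R => 2 * cos t)).
    by move=> t'; apply: continuous_comp; [exact: c2|exact: cg].
  exact.
have -> : Rintegral mu setT (fun x => sc_density x * g x) =
   Rintegral mu `[(2 * cos pi)%R, (2 * cos 0)%R] (fun x => sc_density x * g x).
  rewrite cospi cos0 mulr1 mulrN1 [RHS]Rintegral_mkcond; apply: eq_Rintegral => x _.
  rewrite patchE; case: ifPn => // hx; rewrite sc_density_outside ?mul0r //.
  by apply/negP => h; move/negP: hx; apply; rewrite inE.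
have dF (t : R) : is_derive t 1 (fun t : R => 2 * cos t) (- (2 * sin t)).
  have h := is_deriveZ (2 : R) (is_derive_cos t).
  by apply: (is_derive_eq h); rewrite /GRing.scale /= mulrN.
have F'E : (fun t : R => 2 * cos t)^`() = (fun t => - (2 * sin t)).
  by apply/funext => t; rewrite derive1E; exact: derive_val.
have cF' : continuous (fun t : R => - (2 * sin t)).
  by move=> t; apply: cvgN; apply: cvgM; [exact: cvg_cst|exact: continuous_sin].
have i2 : mu.-integrable `[0, pi] (EFin \o (fun t : R => 2 * sin t ^+ 2 * g (2 * cos t))).
  exact: continuous_integrable_itv.
rewrite (@uniform_Rintegral _ (2 * 1 * b)); last 2 first.
- exact: cs.
- move=> t; rewrite !normrM; apply: ler_pM => //; rewrite ?mulr_ge0 //.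
  apply: ler_pM => //; rewrite ?normr_nat // -[1]mulr1; apply: ler_pM => //; exact: sin_max.
rewrite -RintegralZl //.
rewrite /Rintegral (@integration_by_substitution_decreasing _ (fun t : R => 2 * cos t)); last 7 first.
- exact: pi_ge0.
- move=> s t hs ht st; rewrite ltr_pM2l //; move: st; rewrite ltr_cos //.
- by rewrite F'E => t _; exact: cF'.
- by rewrite F'E; apply/cvg_ex; eexists; exact: cvg_at_right_filter (cF' 0).
- by rewrite F'E; apply/cvg_ex; eexists; exact: cvg_at_left_filter (cF' pi).
- split => [t _||]; first exact: ex_derive.
  + exact: cvg_at_right_filter (c2 0).
  + exact: cvg_at_left_filter (c2 pi).
- exact: continuous_subspaceT.
congr fine; apply: eq_integral => t; rewrite inE /= in_itv /= => /andP[t0 tp]; congr EFin.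
rewrite F'E /= fctE /= opprK /sc_density.
have s0 : 0 <= sin t by apply: sin_ge0_pi; rewrite t0 tp.
have -> : 4 - (2 * cos t) ^+ 2 = (2 * sin t) ^+ 2.
  by rewrite !exprMn sin2cos2; ring.
rewrite max_l ?sqr_ge0 // sqrtr_sqr ger0_norm ?mulr_ge0 //.
by rewrite invfM; move: (pi^-1) => q; field.
Qed.

End UniformAngle.

(** * The quadratic equation for m *)

Section SemicircleTransform.
Context {R : realType}.
  Import numFieldNormedType.Exports.
Local Notation CC := R[i].
Local Notation mu := (@lebesgue_measure R).
Local Notation U := (uniform_prob (@pi_gt0 R)).

(** The two roots have product 1 and sum z. If neither lies inside the unit circle, both lie on it
    and are conjugate, which would make z real. *)
Lemma quadratic_root (z : CC) : complex.Im z != 0 ->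
  exists q : CC, q ^+ 2 - z * q + 1 = 0 /\ cabs q < 1.
Proof.
move=> z0.
pose s := sqrtc (z ^+ 2 - 4).
have hs : s ^+ 2 = z ^+ 2 - 4 by rewrite sqr_sqrtc.
pose q1 := (z + s) / 2; pose q2 := (z - s) / 2.
have two0 : (2 : CC) != 0 by rewrite pnatr_eq0.
have e1 : q1 ^+ 2 - z * q1 + 1 = 0.
  have -> : q1 ^+ 2 - z * q1 + 1 = (s ^+ 2 - (z ^+ 2 - 4)) / 4 by rewrite /q1; field.
  by rewrite hs subrr mul0r.
have e2 : q2 ^+ 2 - z * q2 + 1 = 0.
  have -> : q2 ^+ 2 - z * q2 + 1 = (s ^+ 2 - (z ^+ 2 - 4)) / 4 by rewrite /q2; field.
  by rewrite hs subrr mul0r.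
have e12 : q1 * q2 = 1.
  have -> : q1 * q2 = (z ^+ 2 - s ^+ 2) / 4 by rewrite /q1 /q2; field.
  by rewrite hs opprB addrC subrK divff // pnatr_eq0.
have es : q1 + q2 = z by rewrite /q1 /q2; field.
have ec : cabs q1 * cabs q2 = 1 by rewrite -cabsM e12 cabs1.
case: (ltP (cabs q1) 1) => h1; first by exists q1.
case: (ltP (cabs q2) 1) => h2; first by exists q2.
have c1 : cabs q1 = 1.
  apply/eqP; rewrite eq_le h1 andbT -ec ler_peMr ?cabs_ge0 //.
have q10 : q1 != 0 by apply/eqP => q10; move: c1; rewrite q10 cabs0 => /eqP; rewrite eq_sym oner_eq0.
have q2E : q2 = (q1^*)%C.
  apply: (mulIf q10); rewrite mulrC e12 cabs_conjM c1 expr1n.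
  by rewrite (rmorph1 (real_complex R)).
by move: z0; rewrite -es q2E cImD cImJ subrr eqxx.
Qed.

Variable z : CC.
Hypothesis z0 : 0 < complex.Im z.
Local Notation E := (complex.Re z).
Local Notation eta := (complex.Im z).

Let den (x : R) := (x - E) ^+ 2 + eta ^+ 2.
Let den0 x : 0 < den x.
Proof. by rewrite ltr_wpDl ?sqr_ge0 // exprn_gt0. Qed.

Definition cauchy_kernel (x : R) : CC := Complex ((x - E) / den x) (eta / den x).

Lemma cauchy_kernelK (x : R) : (x%:C%C - z) * cauchy_kernel x = 1.
Proof.
have d0 := lt0r_neq0 (den0 x).
apply: complex_eq; rewrite !(cReM, cImM, cReD, cImD, cReN, cImN) /=.
  have -> : (x - E) * ((x - E) / den x) - (0 - eta) * (eta / den x) = den x / den x.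
    by rewrite /den; ring.
  by rewrite divff.
by ring.
Qed.

Lemma cauchy_kernel_le (x : R) : cabs (cauchy_kernel x) <= eta^-1.
Proof.
have h : cabs (x%:C%C - z) * cabs (cauchy_kernel x) = 1 by rewrite -cabsM cauchy_kernelK cabs1.
have h2 : eta <= cabs (x%:C%C - z).
  apply: le_trans (Im_le_cabs _); rewrite cImD cImN /= sub0r normrN ger0_norm // ltW //.
rewrite -[eta^-1]mul1r ler_pdivlMr // -h mulrC ler_wpM2r //; exact: cabs_ge0.
Qed.

Let continuous_den : continuous den.
Proof.
move=> x; apply: cvgD; last exact: cvg_cst.
rewrite expr2; apply: cvgM; apply: cvgB; by [exact: cvg_id|exact: cvg_cst].
Qed.

Lemma continuous_kernelRe : continuous (fun x => complex.Re (cauchy_kernel x)).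
Proof.
move=> x /=; apply: cvgM; first by apply: cvgB; [exact: cvg_id|exact: cvg_cst].
by apply: cvgV; [exact: lt0r_neq0|exact: continuous_den].
Qed.

Lemma continuous_kernelIm : continuous (fun x => complex.Im (cauchy_kernel x)).
Proof.
move=> x /=; apply: cvgM; first exact: cvg_cst.
by apply: cvgV; [exact: lt0r_neq0|exact: continuous_den].
Qed.

(** For k >= 1, [J k] integrates the Cauchy kernel against the semicircle law times the Chebyshev
    polynomial of the second kind of degree k - 1; in particular [J 1] is [msc z]. *)
Let W (k : nat) (t : R) : CC := (2 * (sin t * sin (k%:R * t)))%:C%C * cauchy_kernel (2 * cos t).
Let J k := Ex U (W k).

Let cmeas_W k : cmeas (W k).
Proof.
have ms (n : nat) : measurable_fun setT (fun t : R => sin (n%:R * t)).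
  apply: continuous_measurable_fun.
  rewrite (_ : (fun t => _) = (@sin R) \o (fun t : R => n%:R * t)) // => t.
  apply: continuous_comp; last exact: continuous_sin.
  by apply: cvgM; [exact: cvg_cst|exact: cvg_id].
have m1 : measurable_fun setT (@sin R) by apply: continuous_measurable_fun; exact: continuous_sin.
have mc : measurable_fun setT (fun t : R => 2 * cos t).
  apply: continuous_measurable_fun => t; apply: cvgM; [exact: cvg_cst|exact: continuous_cos].
apply: cmeasM.
  apply: cmeas_real; apply: measurable_funM; first exact: measurable_cst.
  by apply: measurable_funM.
by split; apply: (@measurableT_comp _ _ _ _ _ _ (fun x => _ (cauchy_kernel x))) => //;
  apply: continuous_measurable_fun; [exact: continuous_kernelRe|exact: continuous_kernelIm].
Qed.

Let W_le k t : cabs (W k t) <= 2 * eta^-1.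
Proof.
rewrite /W cabsM; apply: ler_pM; rewrite ?cabs_ge0 ?cauchy_kernel_le //.
rewrite cabs_real normrM normr_nat ler_piMr // normrM -[1]mulr1.
by apply: ler_pM; rewrite ?normr_ge0 ?sin_max.
Qed.

Let Cint_W k : Cint U (W k).
Proof. by apply: (@Cint_bounded _ _ _ _ _ (2 * eta^-1)) => //; exact: cmeas_W. Qed.

Lemma msc_J : msc z = J 1.
Proof.
have b1 x : `|complex.Re (cauchy_kernel x)| <= eta^-1 := le_trans (Re_le_cabs _) (cauchy_kernel_le x).
have b2 x : `|complex.Im (cauchy_kernel x)| <= eta^-1 := le_trans (Im_le_cabs _) (cauchy_kernel_le x).
apply: complex_eq => /=.
- have := sc_integral continuous_kernelRe b1; rewrite /= => h.
  transitivity (Rintegral mu setT (fun x => sc_density x * ((x - E) / den x))).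
    by apply: eq_Rintegral => x _; rewrite mulrA.
  rewrite h; apply: eq_Rintegral => t _.
  by rewrite mul1r mul0r subr0 expr2.
- have := sc_integral continuous_kernelIm b2; rewrite /= => h.
  transitivity (Rintegral mu setT (fun x => sc_density x * (eta / den x))).
    by apply: eq_Rintegral => x _; rewrite mulrA.
  rewrite h; apply: eq_Rintegral => t _.
  by rewrite mul1r mul0r addr0 expr2.
Qed.

Let two_cos (k : nat) (t : R) :
  sin (k.+2%:R * t) + sin (k%:R * t) = 2 * cos t * sin (k.+1%:R * t).
Proof.
have -> : k.+2%:R * t = k.+1%:R * t + t by rewrite -(natr1 k.+1) mulrDl mul1r.
have -> : k%:R * t = k.+1%:R * t - t by rewrite -natr1 mulrDl mul1r addrK.
by rewrite sinD sinB; ring.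
Qed.

(** The sines obey the Chebyshev recursion with factor 2 cos t. Writing 2 cos t = z + (2 cos t - z)
    cancels the kernel in the second part and leaves a difference of cosines, whose mean is 1 for k
    = 0 and 0 otherwise. *)
Lemma J_rec k : J k.+2 + J k = z * J k.+1 + (k == 0%N)%:R.
Proof.
pose c (t : R) : CC := (cos (k%:R * t) - cos (k.+2%:R * t))%:C%C.
have mcos (n : nat) : measurable_fun setT (fun t : R => cos (n%:R * t)).
  by apply: continuous_measurable_fun; exact: continuous_natcos.
have bc t : cabs (c t) <= 2.
  rewrite cabs_real; apply: le_trans (ler_normB _ _) _.
  by apply: le_trans (lerD (cos_max _) (cos_max _)) _; lra.
have mcc : cmeas c by apply: cmeas_real; apply: measurable_funB.
have ic : Cint U c by exact: (@Cint_bounded _ _ _ _ _ 2).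
have -> : J k.+2 + J k = Ex U (fun t => z * W k.+1 t + c t).
  rewrite -ExD //; apply: eq_Ex => t; rewrite /W -mulrDl.
  have -> : (2 * (sin t * sin (k.+2%:R * t)))%:C%C + (2 * (sin t * sin (k%:R * t)))%:C%C =
    (2 * cos t)%:C%C * (2 * (sin t * sin (k.+1%:R * t)))%:C%C :> CC.
    rewrite -(rmorphM (real_complex R)) -(rmorphD (real_complex R)) /=; congr (_%:C%C).
    transitivity (2 * sin t * (sin (k.+2%:R * t) + sin (k%:R * t))); first by ring.
    by rewrite two_cos; ring.
  have -> : c t = (2 * (sin t * sin (k.+1%:R * t)))%:C%C * ((2 * cos t)%:C%C - z) * cauchy_kernel (2 * cos t).
    rewrite -mulrA cauchy_kernelK mulr1; congr (_%:C%C).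
    have -> : k.+2%:R * t = k.+1%:R * t + t by rewrite -(natr1 k.+1) mulrDl mul1r.
    have -> : k%:R * t = k.+1%:R * t - t by rewrite -natr1 mulrDl mul1r addrK.
    by rewrite cosB cosD; ring.
  by ring.
rewrite ExD //; last exact: CintZ.
rewrite ExZ //; congr (_ + _).
apply: complex_eq; rewrite /Ex /=.
  rewrite RintegralB //; last 2 first.
  - by apply: (@bounded_integrable _ _ _ U _ 1 (mcos _)) => t; exact: cos_max.
  - by apply: (@bounded_integrable _ _ _ U _ 1 (mcos _)) => t; exact: cos_max.
  rewrite !uniform_cos subr0; by case: (k == 0%N).
by rewrite (Rintegral_cst U measurableT 0) mul0r; case: (k == 0%N).
Qed.

Lemma J0 : J 0 = 0.
Proof.
rewrite -[RHS](Ex_cst U); apply: eq_Ex => t.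
by rewrite /W mul0r sin0 !mulr0 (rmorph0 (real_complex R)) mul0r.
Qed.

Lemma J_le k : cabs (J k) <= 4 / eta.
Proof.
have h (f : R -> R) (b : R) : measurable_fun setT f -> (forall t, `|f t| <= b) -> `|Rintegral U setT f| <= b.
  move=> mf hb; have i1 : U.-integrable setT (EFin \o f) by exact: (@bounded_integrable _ _ _ U f b).
  have i2 c : U.-integrable setT (EFin \o (fun=> c)) by exact: finite_measure_integrable_cst.
  have ec c : Rintegral U setT (fun=> c) = c.
    rewrite (Rintegral_cst U measurableT c).
    by have -> : fine (U setT) = 1 :> R by [rewrite probability_setT]; rewrite mulr1.
  rewrite ler_norml -[X in X <= _](ec) -[X in _ && (_ <= X)]ec; apply/andP; split.
    by apply: le_Rintegral => // t _; have := hb t; rewrite ler_norml => /andP[].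
  by apply: le_Rintegral => // t _; have := hb t; rewrite ler_norml => /andP[].
have [m1 m2] := cmeas_W k.
apply: le_trans (cabs_le_ReIm _) _.
have -> : 4 / eta = 2 * eta^-1 + 2 * eta^-1 by ring.
by apply: lerD; apply: h => // t; [apply: le_trans (Re_le_cabs _) _|apply: le_trans (Im_le_cabs _) _].
Qed.

(** J is a bounded solution of a recursion with characteristic roots q and 1/q, where |q| < 1.
    Boundedness excludes the growing root: [Dk 0 = q ^+ n * Dk n] tends to zero. Hence J 2 = q J 1,
    and the inhomogeneous equation at k = 0 gives J 1 = -q. *)
Theorem msc_quadratic : msc z ^+ 2 + z * msc z + 1 = 0.
Proof.
have zn : complex.Im z != 0 by rewrite gt_eqF.
have [q [hq q1]] := quadratic_root zn.
have q0 : q != 0.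
  by apply/eqP => q0; move: hq; rewrite q0 expr0n mulr0 subr0 add0r => /eqP; rewrite oner_eq0.
pose Dk k := J k.+2 - q * J k.+1.
have hD k : Dk k = q * Dk k.+1.
  rewrite /Dk; have := J_rec k.+1; rewrite addr0 => h.
  have -> : J k.+3 = z * J k.+2 - J k.+1 by rewrite -h addrK.
  apply/eqP; rewrite -subr_eq0; apply/eqP.
  transitivity ((q ^+ 2 - z * q + 1) * J k.+2); first by ring.
  by rewrite hq mul0r.
have hDn n : cabs (Dk 0) <= cabs q ^+ n * (8 / eta).
  have -> : Dk 0 = q ^+ n * Dk n.
    by elim: n => [|n ->]; [rewrite expr0 mul1r|rewrite hD exprSr mulrA].
  rewrite cabsM cabsX ler_wpM2l ?exprn_ge0 ?cabs_ge0 //.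
  have -> : 8 / eta = 4 / eta + 1 * (4 / eta) by ring.
  by apply: le_cabsB; [exact: J_le|apply: le_cabsM; [exact: ltW|exact: J_le]].
have D0 : Dk 0 = 0.
  apply: cabs_eq0; apply/eqP; rewrite eq_le cabs_ge0 andbT.
  have hl : (cabs q ^+ n * (8 / eta)) @[n --> \oo] --> 0 * (8 / eta).
    apply: cvgM; last exact: cvg_cst.
    by apply: cvg_expr; rewrite ger0_norm ?cabs_ge0.
  rewrite -(mul0r (8 / eta)) -(cvg_lim _ hl) //; apply: limr_ge; first exact: cvgP hl.
  by apply: nearW => n; exact: hDn.
have h0 := J_rec 0; rewrite J0 addr0 eqxx in h0.
have hJ : J 1 = - q.
  have e1 : J 2 = q * J 1 by apply/eqP; rewrite -subr_eq0; apply/eqP.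
  rewrite e1 in h0.
  have hqz : q * (q - z) = -1.
    by apply/eqP; rewrite -subr_eq0 opprK; apply/eqP; rewrite -hq; ring.
  have hz : (q - z) * J 1 = 1 by rewrite mulrBl h0 addrAC subrr add0r.
  have -> : J 1 = - (q * (q - z) * J 1) by rewrite hqz mulN1r opprK.
  by rewrite -mulrA hz mulr1.
rewrite msc_J hJ.
by rewrite -[RHS]hq; ring.
Qed.

Theorem msc_Im_ge0 : 0 <= complex.Im (msc z).
Proof.
apply: Rintegral_ge0 => x _ /=.
rewrite divr_ge0 ?(ltW (den0 x)) // mulr_ge0 ?(ltW z0) // mulr_ge0 ?sqrtr_ge0 //.
by rewrite invr_ge0 mulr_ge0 // pi_ge0.
Qed.

End SemicircleTransform.

(** * Stability *)

Section MscFacts.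
Context {R : realType}.
Local Notation CC := R[i].
Variable z : CC.
Hypothesis z0 : 0 < complex.Im z.
Local Notation m := (msc z).
Local Notation eta := (complex.Im z).

Lemma msc_neq0 : m != 0.
Proof.
apply/eqP => m0; have := msc_quadratic z0.
by rewrite m0 expr0n mulr0 !add0r => /eqP; rewrite oner_eq0.
Qed.

Lemma msc_Im : eta * cabs m ^+ 2 = complex.Im m * (1 - cabs m ^+ 2).
Proof.
have h : z * (cabs m ^+ 2)%:C%C = - (m * (cabs m ^+ 2)%:C%C) - (m^*)%C.
  rewrite -cabs_conjM.
  have -> : z * ((m^*)%C * m) = (m^*)%C * (z * m) by ring.
  have -> : z * m = - m ^+ 2 - 1.
    by apply/eqP; rewrite -subr_eq0 -(msc_quadratic z0); apply/eqP; ring.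
  by ring.
have := congr1 (@complex.Im R) h.
rewrite cImM cImD !cImN cImM cImJ /= => h2.
by move: h2; rewrite !mulr0 !add0r; lra.
Qed.

Lemma msc_cabs_gt0 : 0 < cabs m. Proof. exact: cabs_gt0 msc_neq0. Qed.

Lemma msc_Im_gt0 : 0 < complex.Im m.
Proof.
rewrite lt_neqAle msc_Im_ge0 // andbT; apply/eqP => m0; have := msc_Im.
by rewrite -m0 mul0r => /eqP; rewrite gt_eqF // mulr_gt0 // exprn_gt0 // msc_cabs_gt0.
Qed.

Lemma msc_le1 : cabs m <= 1.
Proof.
have h : 0 < complex.Im m * (1 - cabs m ^+ 2).
  by rewrite -msc_Im mulr_gt0 // exprn_gt0 // msc_cabs_gt0.
rewrite pmulr_rgt0 ?msc_Im_gt0 // subr_gt0 in h.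
by rewrite -(@ler_pXn2r _ 2) ?nnegrE ?cabs_ge0 // expr1n ltW.
Qed.

Lemma msc_shift : cabs (z + m) * cabs m = 1.
Proof.
rewrite -cabsM; have -> : (z + m) * m = -1.
  by apply/eqP; rewrite -subr_eq0 -(msc_quadratic z0); apply/eqP; ring.
by rewrite cabsN cabs1.
Qed.

Lemma msc_shift_ge1 : 1 <= cabs (z + m).
Proof. by rewrite -msc_shift ler_piMr ?cabs_ge0 // msc_le1. Qed.

Lemma msc_ge : 1 <= (cabs z + 1) * cabs m.
Proof.
rewrite -{1}msc_shift ler_wpM2r ?cabs_ge0 //.
by apply: le_trans (ler_cabsD _ _) _; rewrite lerD2l msc_le1.
Qed.

Lemma msc_gap : eta * cabs m <= 1 - cabs m ^+ 2.
Proof.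
have m1 : 0 <= 1 - cabs m ^+ 2 by rewrite subr_ge0 exprn_ile1 ?cabs_ge0 ?msc_le1.
rewrite -(ler_pM2r msc_cabs_gt0) -mulrA -expr2 msc_Im mulrC ler_wpM2l //.
by apply: le_trans (Im_le_cabs _); rewrite ler_norm.
Qed.

Lemma msc_le_eta : cabs m * eta <= 1.
Proof. by rewrite mulrC; apply: le_trans msc_gap _; rewrite gerBl sqr_ge0. Qed.

Lemma msc_Im_ge : eta <= (cabs z + 1) ^+ 2 * complex.Im m.
Proof.
have h : eta * cabs m ^+ 2 <= complex.Im m.
  by rewrite msc_Im ler_piMr ?msc_Im_ge0 // gerBl sqr_ge0.
have h2 : 1 <= (cabs z + 1) ^+ 2 * cabs m ^+ 2.
  by rewrite -exprMn exprn_ege1 // msc_ge.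
apply: (@le_trans _ _ (eta * ((cabs z + 1) ^+ 2 * cabs m ^+ 2))).
  by rewrite ler_peMr // ltW.
by rewrite mulrCA ler_wpM2l // sqr_ge0.
Qed.

(* [|2 m + z| = |z ^ 2 - 4| ^ (1/2)] measures the distance between the two roots. *)
Definition gap : R := cabs (2 * m + z).

Lemma gap_sqr : gap ^+ 4 = ((complex.Re z - 2) ^+ 2 + eta ^+ 2) * ((complex.Re z + 2) ^+ 2 + eta ^+ 2).
Proof.
have h : (2 * m + z) ^+ 2 = (z - 2) * (z + 2).
  have -> : (2 * m + z) ^+ 2 = 4 * (m ^+ 2 + z * m + 1) + (z - 2) * (z + 2) by ring.
  by rewrite msc_quadratic // mulr0 add0r.
have h2 (a : R) : cabs (z + (a%:C)%C) ^+ 2 = (complex.Re z + a) ^+ 2 + eta ^+ 2.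
  by rewrite cabs_sqr cReD cImD /= addr0.
have -> : gap ^+ 4 = cabs ((2 * m + z) ^+ 2) ^+ 2 by rewrite /gap cabsX -exprM.
rewrite h cabsM exprMn.
have e2 : (2 : CC) = (2 : R)%:C%C by rewrite -(rmorph_nat (real_complex R)).
have e3 : - (2 : CC) = (- 2 : R)%:C%C by apply: complex_eq; rewrite /= ?addr0 ?oppr0.
have -> : z + 2 = z + (2 : R)%:C%C by rewrite -e2.
by rewrite e3 !h2.
Qed.

Lemma gap_ge_Im : 2 * complex.Im m + eta <= gap.
Proof.
apply: le_trans (Im_le_cabs _); apply: le_trans (ler_norm _).
rewrite cImD cImM.
have -> : complex.Re (2 : CC) = 2 by [].
have -> : complex.Im (2 : CC) = 0 by rewrite /= addr0.
by rewrite mul0r addr0.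
Qed.

Lemma gap_le : gap <= cabs z + 2.
Proof.
apply: le_trans (ler_cabsD _ _) _; rewrite addrC lerD2l cabsM cabs_nat.
by rewrite ler_piMr // msc_le1.
Qed.

End MscFacts.

Section GapMonotone.
Context {R : realType}.
Local Notation CC := R[i].
Variables (z z' : CC).
Hypotheses (z0 : 0 < complex.Im z) (zz : complex.Im z <= complex.Im z')
  (zE : complex.Re z = complex.Re z').

Let z0' : 0 < complex.Im z'. Proof. exact: lt_le_trans zz. Qed.
Let gap0 (x : CC) : 0 <= gap x. Proof. exact: cabs_ge0. Qed.
Let sq : complex.Im z ^+ 2 <= complex.Im z' ^+ 2.
Proof. by apply: lerXn2r zz; rewrite nnegrE ltW. Qed.

Lemma gap_mono : gap z <= gap z'.
Proof.
rewrite -(@ler_pXn2r _ 4) ?nnegrE ?gap0 // !gap_sqr // zE.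
by apply: ler_pM; rewrite ?addr_ge0 ?sqr_ge0 // lerD2l.
Qed.

(** Through [gap_sqr] this reduces to (a^2 + t) / t decreasing in t. It makes gap times rho
    nonincreasing in Im z, as the error bound along the vertical path has to be. *)
Lemma gap_div_anti : gap z' * complex.Im z <= gap z * complex.Im z'.
Proof.
rewrite -(@ler_pXn2r _ 4) ?nnegrE ?mulr_ge0 ?gap0 ?(ltW z0) ?(ltW z0') //.
rewrite !exprMn !gap_sqr // zE.
have h (a : R) : (a ^+ 2 + complex.Im z' ^+ 2) * complex.Im z ^+ 2 <=
    (a ^+ 2 + complex.Im z ^+ 2) * complex.Im z' ^+ 2.
  rewrite !mulrDl [X in _ + X <= _]mulrC lerD2r ler_wpM2l ?sqr_ge0 //.
have e4 (x : R) : x ^+ 4 = x ^+ 2 * x ^+ 2 by ring.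
have aux (a b t : R) : a * b * (t * t) = (a * t) * (b * t) by ring.
rewrite (e4 (complex.Im z)) (e4 (complex.Im z')) !aux.
by apply: ler_pM; rewrite ?h // mulr_ge0 ?addr_ge0 ?sqr_ge0.
Qed.

End GapMonotone.

(** Subtracting multiples of the two quadratic equations gives (m - m') (1 - m m') = m m' (z - z'),
    and 1 - |m m'| is at least half of Im z |m|. *)
Lemma msc_lip {R : realType} (z z' : R[i]) : 0 < complex.Im z -> 0 < complex.Im z' ->
  cabs (msc z - msc z') * complex.Im z <= 2 * (cabs z + 1) * cabs (z - z').
Proof.
move=> z0 z0'; set m := msc z; set m' := msc z'.
have h : (m - m') * (1 - m * m') = m * m' * (z - z').
  apply/eqP; rewrite -subr_eq0; apply/eqP.
  transitivity (m * (m' ^+ 2 + z' * m' + 1) - m' * (m ^+ 2 + z * m + 1)); first by ring.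
  by rewrite !msc_quadratic // !mulr0 subrr.
have a1 := msc_le1 z0; have a1' := msc_le1 z0'; rewrite -/m -/m' in a1 a1'.
have a0 := cabs_ge0 m; have a0' := cabs_ge0 m'.
have h1 : cabs (m - m') * (1 - cabs m * cabs m') <= cabs (z - z').
  apply: (@le_trans _ _ (cabs (m - m') * cabs (1 - m * m'))).
    rewrite ler_wpM2l ?cabs_ge0 //; have := ler_cabsD (1 - m * m') (m * m').
    by rewrite subrK cabs1 cabsM; lra.
  rewrite -cabsM h cabsM ler_piMl ?cabs_ge0 // cabsM.
  by rewrite -[1]mulr1; apply: ler_pM.
have h2 : complex.Im z * cabs m <= 2 * (1 - cabs m * cabs m').
  have := msc_gap z0; rewrite -/m => g1.
  have := sqr_ge0 (cabs m - cabs m'); have : cabs m' ^+ 2 <= 1 by rewrite exprn_ile1.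
  by move: g1; lra.
have h3 := msc_ge z0; rewrite -/m in h3.
have d0 := cabs_ge0 (m - m').
apply: (@le_trans _ _ (cabs (m - m') * complex.Im z * ((cabs z + 1) * cabs m))).
  by rewrite ler_peMr // mulr_ge0 // ltW.
have -> : cabs (m - m') * complex.Im z * ((cabs z + 1) * cabs m) =
  (cabs z + 1) * (cabs (m - m') * (complex.Im z * cabs m)) by ring.
have -> : 2 * (cabs z + 1) * cabs (z - z') = (cabs z + 1) * (2 * cabs (z - z')) by ring.
rewrite ler_wpM2l ?addr_ge0 ?cabs_ge0 //.
apply: le_trans (ler_wpM2l d0 h2) _; rewrite mulrCA.
by rewrite ler_wpM2l.
Qed.

(** * Selecting a root of a quadratic along a discrete path *)

Section RootPath.
Context {R : realType}.
Local Notation CC := R[i].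
Variables (n : nat) (x b : nat -> CC) (del : nat -> R) (zeta : R) (P : nat -> Prop).

(** The bound |x (x + b)| <= del allows x near 0 or near -b. For |b| > 10 sqrt(del) the two are
    apart and the claim selects 0; otherwise either case yields |x| <= 11 sqrt(del). *)
Definition root_claim k := cabs (x k) <= 11 * Num.sqrt (del k) /\
  (100 * del k < cabs (b k) ^+ 2 -> cabs (x k) * cabs (b k) <= 2 * del k).

Hypothesis (del0 : forall k, (k <= n)%N -> 0 <= del k).
Hypothesis hP : forall k, (k <= n)%N -> P k -> cabs (x k * (x k + b k)) <= del k.
Hypothesis hstep : forall k, (k < n)%N -> P k.+1 -> root_claim k.+1 -> P k.
Hypothesis hx : forall k, (k < n)%N -> cabs (x k - x k.+1) <= zeta.
Hypothesis hz : forall k, (k < n)%N -> zeta <= Num.sqrt (del k).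
Hypothesis hdel : forall k, (k < n)%N -> del k.+1 <= del k.
Hypothesis hb : forall k, (k < n)%N -> cabs (b k) <= cabs (b k.+1).
Hypotheses (Pn : P n) (hn : cabs (x n) * 2 <= cabs (b n)).

(** |x| <= |b| / 2 gives |x + b| >= |b| / 2, hence the bound on |x b|. If |b| <= 10 sqrt(del), then
    |x| > 11 sqrt(del) would force |x + b| >= sqrt(del), and the product would be too large. *)
Lemma root_claim_small k : (k <= n)%N -> P k -> (100 * del k < cabs (b k) ^+ 2 -> cabs (x k) * 2 <= cabs (b k)) ->
  root_claim k.
Proof.
move=> kn Pk hs; have d0 := del0 kn; have h := hP kn Pk; rewrite cabsM in h.
set s := Num.sqrt (del k).
have s0 : 0 <= s by exact: sqrtr_ge0.
have ss : s ^+ 2 = del k by rewrite sqr_sqrtr.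
have x0 := cabs_ge0 (x k); have b0 := cabs_ge0 (b k).
have tri : cabs (b k) <= cabs (x k + b k) + cabs (x k).
  have e : b k = (x k + b k) - x k by rewrite addrAC subrr add0r.
  by rewrite {1}e; exact: ler_cabsB.
have tri2 : cabs (x k) <= cabs (x k + b k) + cabs (b k).
  have e : x k = (x k + b k) - b k by rewrite addrK.
  by rewrite {1}e; exact: ler_cabsB.
rewrite -ss in h hs *.
rewrite /root_claim -ss -/s sqrtr_sqr (ger0_norm s0).
move: (cabs (x k)) (cabs (b k)) (cabs (x k + b k)) x0 b0 tri tri2 h hs => X B Y X0 B0 tri tri2 h hs.
have [hB|hB] := ltP (100 * s ^+ 2) (B ^+ 2).
  have h2 := hs hB.
  have XB : X * B <= 2 * s ^+ 2.
    have : X * (B - X) <= s ^+ 2 by apply: le_trans h; rewrite ler_wpM2l //; lra.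
    have : 0 <= X * (B - X * 2) by rewrite mulr_ge0 //; lra.
    by rewrite !mulrBr mulrA; lra.
  split=> //.
  have : 10 * s <= B.
    by rewrite -(@ler_pXn2r _ 2) ?nnegrE ?mulr_ge0 // exprMn -natrX ltW.
  move=> h10; rewrite leNgt; apply/negP => hX.
  have : 11 * s * (10 * s) <= X * B by apply: ler_pM; rewrite ?mulr_ge0 // ltW.
  move=> hh; have s2 := sqr_ge0 s; have : s ^+ 2 = 0 by lra.
  move/eqP; rewrite sqrf_eq0 => /eqP s00.
  by move: XB hX hB; rewrite s00; nra.
split=> //.
have h10 : B <= 10 * s.
  by rewrite -(@ler_pXn2r _ 2) ?nnegrE ?mulr_ge0 // exprMn -natrX.
rewrite leNgt; apply/negP => hX.
have hY : s <= Y by lra.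
have : X * Y <= s ^+ 2 by [].
have : X * s <= X * Y by rewrite ler_wpM2l.
have : 0 <= (X - 11 * s) * s by rewrite mulr_ge0 // subr_ge0 ltW.
have : 0 <= s ^+ 2 by exact: sqr_ge0.
rewrite mulrBl expr2 => q1 q2 q3 q4.
have s20 : s * s = 0 by lra.
have s00 : s = 0 by move/eqP: s20; rewrite mulf_eq0 orbb => /eqP.
have B00 : B = 0 by move: h10; rewrite s00; lra.
have : X * X <= 0.
  apply: (@le_trans _ _ (X * Y)); first by rewrite ler_wpM2l //; lra.
  by apply: (le_trans h); rewrite s00 expr0n.
by move: hX; rewrite s00; nra.
Qed.

(** Index n is the start and 0 the target. P is an a priori smallness under which the product bound
    is available, and it is inherited from k + 1 together with the claim. Roots apart at k are also
    apart at k + 1, since |b| grows and del shrinks with the index, and a step of at most sqrt(del)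
    cannot reach the other root. *)
Theorem root_path : forall k, (k <= n)%N -> P k /\ root_claim k.
Proof.
suff h j : (j <= n)%N -> P (n - j)%N /\ root_claim (n - j)%N.
  by move=> k kn; have := h (n - k)%N (leq_subr _ _); rewrite subKn.
elim: j => [_|j IH jn].
  by rewrite subn0; split=> //; apply: root_claim_small.
have [P1 [c1 c2]] := IH (ltnW jn).
set k := (n - j.+1)%N; have ek : (n - j)%N = k.+1 by rewrite /k subnS prednK // subn_gt0.
rewrite ek in P1 c1 c2.
have kn : (k < n)%N by rewrite /k -subn_gt0 subKn.
have Pk : P k by apply: hstep.
split=> //; apply: root_claim_small => //; first exact: ltnW.
move=> hB; have d0 := del0 (ltnW kn); have d1 := del0 kn; have dd := hdel kn; have bb := hb kn.
have b0 := cabs_ge0 (b k).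
have s0 : 0 <= Num.sqrt (del k) by exact: sqrtr_ge0.
have ss : Num.sqrt (del k) ^+ 2 = del k by rewrite sqr_sqrtr.
have h10 : 10 * Num.sqrt (del k) <= cabs (b k).
  by rewrite -(@ler_pXn2r _ 2) ?nnegrE ?mulr_ge0 // exprMn -natrX ss ltW.
have hb1 : 100 * del k.+1 < cabs (b k.+1) ^+ 2.
  apply: le_lt_trans (_ : 100 * del k.+1 <= 100 * del k) _; first by rewrite ler_pM2l.
  apply: (lt_le_trans hB); apply: lerXn2r bb; by rewrite nnegrE cabs_ge0.
have h2 := c2 hb1.
(* From |x| |b| <= 2 del at k + 1 and |b| >= 10 sqrt(del). Adding the step zeta keeps x at k below
   |b| / 2. *)
have x1 : cabs (x k.+1) * 5 <= Num.sqrt (del k).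
  have [s00|sn0] := eqVneq (Num.sqrt (del k)) 0.
    have dk0 : del k = 0 by rewrite -ss s00 expr0n.
    have dk1 : del k.+1 = 0 by apply/eqP; rewrite eq_le d1 -dk0 dd.
    have b1p : 0 < cabs (b k.+1).
      have : 0 < cabs (b k.+1) ^+ 2 by move: hb1; rewrite dk1 mulr0.
      by rewrite lt0r sqrf_eq0 => /andP[h _]; rewrite lt0r h cabs_ge0.
    have : cabs (x k.+1) * cabs (b k.+1) <= 0 by move: h2; rewrite dk1 mulr0.
    rewrite pmulr_lle0 // => h; rewrite s00; lra.
  have sp : 0 < Num.sqrt (del k) by rewrite lt0r sn0.
  rewrite -(ler_pM2r sp) -expr2 ss.
  have : cabs (x k.+1) * (10 * Num.sqrt (del k)) <= cabs (x k.+1) * cabs (b k.+1).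
    by rewrite ler_wpM2l ?cabs_ge0 // (le_trans h10).
  have -> : cabs (x k.+1) * (10 * Num.sqrt (del k)) = 2 * (cabs (x k.+1) * 5 * Num.sqrt (del k)) by ring.
  by move=> q; lra.
have := hx kn; have := hz kn => hzk hxk.
have tri : cabs (x k) <= cabs (x k - x k.+1) + cabs (x k.+1).
  by rewrite -{1}[x k](subrK (x k.+1)); exact: ler_cabsD.
by move: tri hxk hzk x1 h10; lra.
Qed.

End RootPath.

Lemma diag_stability_real (R : realType) (c del eps q : R) : 0 <= eps -> 0 <= c * c * del ->
  q <= eps + eps + del ^+ 2 + del ^+ 2 + (1 + c / 16) * ((1 - c) * del) ->
  (1 - c / 16) * del <= q -> del ^+ 2 <= c / 8 * del -> c * del <= 4 * eps.
Proof. by move=> *; lra. Qed.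

(** * Stability of the diagonal equation from the spectral gap of S *)

Section DiagonalStability.
Context {R : realType} {N : nat}.
Local Notation CC := R[i].
Variables (z : CC) (X : 'M[CC]_N) (S : 'I_N * 'I_N -> R) (C : R).
Hypotheses (N0 : (0 < N)%N) (C1 : 1 <= C).
Hypotheses (Slow : forall p, (C * N%:R)^-1 <= S p) (Srow : forall i, \sum_j S (i, j) = 1)
  (Ssym : forall i j, S (j, i) = S (i, j)).
Let r : CC := ((N%:R)^-1)%:C%C.
Local Notation g a := (gdiag z X a).
Local Notation u := (avg z X).
Let d a := g a - u.
Let Sd a := \sum_b (S (a, b))%:C%C * d b.
Let c := C^-1.

Let Np : 0 < N%:R :> R. Proof. by rewrite ltr0n. Qed.
Let C0 : 0 < C. Proof. exact: lt_le_trans C1. Qed.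
Let c0 : 0 < c. Proof. by rewrite invr_gt0. Qed.
Let c1 : c <= 1. Proof. by rewrite invf_le1. Qed.
Let rN : r * N%:R = 1.
Proof.
rewrite -(rmorph_nat (real_complex R)) /r -(rmorphM (real_complex R)) /= mulVf ?gt_eqF //.
Qed.

Lemma sum_deviation : \sum_a d a = 0.
Proof.
rewrite sumrB sumr_const card_ord /avg -/r -mulr_natl mulrA [N%:R * r]mulrC rN mul1r.
by rewrite subrr.
Qed.

Let Srow' i : \sum_j (S (i, j))%:C%C = 1 :> CC.
Proof. by rewrite -(rmorph_sum (real_complex R)) Srow (rmorph1 (real_complex R)). Qed.

Lemma SdiagE a : Sdiag z S X a = u + Sd a.
Proof.
rewrite /Sdiag /Sd -[X in X + _]mul1r -(Srow' a) mulr_suml -big_split /=.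
by apply: eq_bigr => b _; rewrite /d -mulrDr addrC subrK.
Qed.

Lemma sum_Sd : \sum_a Sd a = 0.
Proof.
rewrite exchange_big /= -[RHS]sum_deviation; apply: eq_bigr => b _.
rewrite -mulr_suml (eq_bigr (fun a => (S (b, a))%:C%C)) ?Srow' ?mul1r // => a _.
by rewrite Ssym.
Qed.

(** The deviations sum to zero, so the constant 1/(C N) may be subtracted from all entries of S;
    what is left is nonnegative with row sums 1 - 1/C. *)
Lemma Sd_le (del : R) a : (forall b, cabs (d b) <= del) -> cabs (Sd a) <= (1 - c) * del.
Proof.
move=> h; pose s := (C * N%:R)^-1.
have -> : Sd a = \sum_b (S (a, b) - s)%:C%C * d b.
  under [RHS]eq_bigr do rewrite (rmorphB (real_complex R)) mulrBl.
  by rewrite sumrB -mulr_sumr sum_deviation mulr0 subr0.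
apply: le_trans (cabs_sum _ _ _) _.
apply: (@le_trans _ _ (\sum_b (S (a, b) - s) * del)).
  apply: ler_sum => b _; apply: le_cabsM => //.
  by rewrite cabs_real ger0_norm // subr_ge0.
rewrite -mulr_suml sumrB Srow sumr_const card_ord -[s *+ N]mulr_natr.
have -> : s * N%:R = c by rewrite /s /c; field; rewrite !gt_eqF.
by [].
Qed.

Variables (eps : R).
Hypothesis hPi : forall a, cabs (1 + z * g a + Sdiag z S X a * g a) <= eps.

Let e0 : 0 <= eps.
Proof. by apply: le_trans (hPi (Ordinal N0)); exact: cabs_ge0. Qed.
Let Pa := r * \sum_a (1 + z * g a + Sdiag z S X a * g a).
Let dSd := r * \sum_a d a * Sd a.

Let PaE : Pa = 1 + z * u + u ^+ 2 + dSd.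
Proof.
rewrite /Pa /dSd; under eq_bigr do rewrite SdiagE.
have E a : 1 + z * g a + (u + Sd a) * g a = (1 + z * u + u ^+ 2) + (z * d a + u * d a + u * Sd a) + d a * Sd a.
  by rewrite /d; ring.
have aux (v w : CC) (d' s' : 'I_N -> CC) :
    \sum_a (v + (z * d' a + w * d' a + w * s' a) + d' a * s' a) =
    N%:R * v + (z * \sum_a d' a + w * \sum_a d' a + w * \sum_a s' a) + \sum_a d' a * s' a.
  by rewrite !big_split /= -!mulr_sumr sumr_const card_ord mulr_natl.
by rewrite (eq_bigr _ (fun a _ => E a)) aux sum_deviation sum_Sd !mulr0 !addr0 mulrDr mulrA rN mul1r.
Qed.

Let Pa_le : cabs Pa <= eps. Proof. exact: r_sum_le. Qed.

(** In the average over a the terms linear in the deviations drop out, and only a quadratic form in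
    them remains. *)
Lemma avg_equation del : (forall b, cabs (d b) <= del) -> cabs (1 + z * u + u ^+ 2) <= eps + del ^+ 2.
Proof.
move=> h; have d0 : 0 <= del by apply: le_trans (h (Ordinal N0)); exact: cabs_ge0.
have -> : 1 + z * u + u ^+ 2 = Pa - dSd by rewrite PaE addrK.
apply: le_cabsB => //; apply: r_sum_le => // a; rewrite expr2; apply: le_cabsM => //.
by apply: le_trans (Sd_le a h) _; rewrite ler_piMl // gerBl ltW.
Qed.

(** At the index of maximal deviation, (z + u) d = -u S d up to eps and quadratic terms. Here |z +
    u| is almost at least 1 and |u| almost at most 1, so the contraction 1 - c of S on deviations
    leaves a margin of order c, part of which absorbs the quadratic terms. *)
Lemma diag_stability (a : 'I_N) : 1 - c / 16 <= cabs (z + u) -> cabs u <= 1 + c / 16 ->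
  (forall b, cabs (d b) <= c / 8) -> cabs (d a) <= 4 * C * eps.
Proof.
move=> hz hu hd.
pose i0 := [arg max_(i > a) cabs (d i)]%O.
have hmax b : cabs (d b) <= cabs (d i0).
  by rewrite /i0; case: Order.TotalTheory.arg_maxP => [//|i _ h]; exact: (h b isT).
apply: le_trans (hmax a) _; set del := cabs (d i0).
have del0 : 0 <= del := cabs_ge0 _.
have hS b := Sd_le b hmax; rewrite -/del in hS hmax.
have hdd : cabs dSd <= del ^+ 2.
  apply: r_sum_le => // b; rewrite expr2; apply: le_cabsM => //.
  by apply: le_trans (hS b) _; rewrite ler_piMl // gerBl ltW.
have hdS : cabs (d i0 * Sd i0) <= del ^+ 2.
  rewrite expr2; apply: le_cabsM => //.
  by apply: le_trans (hS _) _; rewrite ler_piMl // gerBl ltW.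
have E : (z + u) * d i0 = (1 + z * g i0 + Sdiag z S X i0 * g i0) - Pa - d i0 * Sd i0 + dSd - u * Sd i0.
  by rewrite PaE SdiagE /d; ring.
have h1 : cabs ((z + u) * d i0) <= eps + eps + del ^+ 2 + del ^+ 2 + (1 + c / 16) * ((1 - c) * del).
  rewrite E; apply: le_cabsB; last by apply: le_cabsM => //; exact: hS.
  apply: le_cabsD => //; apply: le_cabsB => //; apply: le_cabsB => //; exact: hPi.
rewrite cabsM -/del in h1.
have h2 : (1 - c / 16) * del <= cabs (z + u) * del by rewrite ler_wpM2r.
have h3 : del ^+ 2 <= c / 8 * del by rewrite expr2 ler_wpM2r // hd.
have h5 : c * del <= 4 * eps.
  have cd0 : 0 <= c * c * del by rewrite mulr_ge0 // mulr_ge0 // ltW.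
  exact: diag_stability_real e0 cd0 h1 h2 h3.
have -> : del = C * (c * del) by rewrite mulrA /c divff ?mul1r // gt_eqF.
have -> : 4 * C * eps = C * (4 * eps) by ring.
by rewrite ler_wpM2l // ltW.
Qed.

End DiagonalStability.

Section GoodMonotone.
Context {R : realType} {N : nat}.

Lemma good_le S T (s A A' : R) (D : @mmdata R N) X : 0 <= A -> A <= A' -> good S T s A D X -> good S T s A' D X.
Proof.
move=> A0 AA [h1 h2 h3 h4 h5 h6 h7].
have h n : A ^+ n <= A' ^+ n by apply: lerXn2r; rewrite ?nnegrE // (le_trans A0).
split.
- exact: le_trans h1 AA.
- exact: le_trans h2 (h 2).
- exact: le_trans h3 (h 2).
- by move=> p; exact: le_trans (h4 p) AA.
- exact: le_trans h5 AA.
- exact: le_trans h6 (h 2).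
- exact: le_trans h7 (h 3).
Qed.

(** The family [fam] indexed by a finite type, as the union bound requires. *)
Definition famv (v w : 'cV[R[i]]_N) S T (C : R) (j : (('I_N + 'I_N) + ('I_N + 'I_N)) + bool) : 'cV[R[i]]_N :=
  match j with
  | inl (inl (inl j)) => ev j
  | inl (inl (inr j)) => vS v S C j
  | inl (inr (inl j)) => vT v T C j
  | inl (inr (inr j)) => vTo v T C j
  | inr b => if b then v else w
  end.

Lemma fam_famv v w S T C x : fam v w S T C x -> exists j, x = famv v w S T C j.
Proof.
case=> [j|||j|j|j].
- by exists (inl (inl (inl j))).
- by exists (inr true).
- by exists (inr false).
- by exists (inl (inl (inr j))).
- by exists (inl (inr (inl j))).
- by exists (inl (inr (inr j))).
Qed.

Lemma nsq_scaled (v x : 'cV[R[i]]_N) : (forall i, cabs (x i 0) <= cabs (v i 0)) -> nsq v <= 1 -> nsq x <= 1.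
Proof.
move=> h hv; apply: le_trans hv; apply: ler_sum => i _.
by apply: lerXn2r; rewrite ?nnegrE ?cabs_ge0.
Qed.

Lemma nsq_famv v w S T C j : (0 < N)%N -> 0 < C -> (forall p, S p <= C / N%:R) ->
  (forall p, 0 <= S p) -> (forall p, cabs (T p) <= S p) ->
  nsq v <= 1 -> nsq w <= 1 -> nsq (famv v w S T C j) <= 1.
Proof.
move=> N0 C0 SC S0 TS hv hw; have Np : 0 < N%:R :> R by rewrite ltr0n.
have nc : 0 <= N%:R / C by rewrite divr_ge0 ?ltW.
have sc p : N%:R / C * S p <= 1.
  apply: le_trans (ler_wpM2l nc (SC p)) _.
  by rewrite mulrA divfK ?gt_eqF // divff // gt_eqF.
have tc p : N%:R / C * cabs (T p) <= 1.
  by apply: le_trans (sc p); rewrite ler_wpM2l.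
case: j => [[[j|j]|[j|j]]|[]] //=; first by rewrite nsq_ev.
- apply: (nsq_scaled _ hv) => i; rewrite mxE cabsM cabs_real ger0_norm ?(mulr_ge0 nc) //.
  by rewrite ler_piMl ?cabs_ge0.
- apply: (nsq_scaled _ hv) => i; rewrite mxE !cabsM cabs_real ger0_norm // cabsJ.
  by rewrite ler_piMl ?cabs_ge0.
- apply: (nsq_scaled _ hv) => i; rewrite mxE !cabsM cabs_real ger0_norm // cabsJ.
  rewrite ler_piMl ?cabs_ge0 //; apply: le_trans (tc (i, j)); rewrite ler_wpM2l //.
  by rewrite ler_piMl ?cabs_ge0 // cabs_offd.
Qed.

End GoodMonotone.

(** * The three equations with high probability *)

Section Steps.
Context {R : realType} {C : R} {Cp : nat -> R}.
Local Notation CC := R[i].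
Local Notation model := (@model R C Cp).
Hypothesis C0 : 0 < C.

Lemma model_S (N : nat) (M : model N) : (0 < N)%N ->
  let S := Sv (mP M) (mH (m := M)) in
  [/\ 1 <= C, forall p, (C * N%:R)^-1 <= S p <= C / N%:R, forall p, 0 <= S p,
      forall i, \sum_j S (i, j) = 1 & forall i j, S (j, i) = S (i, j)].
Proof.
move=> N0 S; have Np : 0 < N%:R :> R by rewrite ltr0n.
have hS p : (C * N%:R)^-1 <= S p <= C / N%:R.
  have /andP[h1 h2] := Sv_bounds (mW M) p.
  rewrite ler_pdivlMr // [S p * _]mulrC h2 andbT invfM ler_pdivrMr //.
  by rewrite [S p * _]mulrC.
split=> //.
- have := Sv_row (mW M) (Ordinal N0); rewrite -/S => h.
  have : (C * N%:R)^-1 * N%:R <= 1.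
    rewrite -[leRHS]h; apply: (@le_trans _ _ (\sum_(j < N) (C * N%:R)^-1)).
      by rewrite sumr_const card_ord mulr_natr.
    by apply: ler_sum => j _; have /andP[] := hS (Ordinal N0, j).
  rewrite invfM -mulrA mulVf ?gt_eqF // mulr1 invf_le1 //.
- by move=> p; exact: Sv_ge0.
- by move=> i; exact: (Sv_row (mW M) i).
- by move=> i j; exact: (Sv_sym (mW M) j i).
Qed.

Variables (V : nat -> CC -> Prop) (Om : nat -> CC -> R) (c0 : R) (N1 : nat) (tau : R).
Hypotheses (tau0 : 0 < tau) (tau1 : tau <= 10^-1) (c00 : 0 <= c0).
Hypothesis HV : forall N z, (N1 <= N)%N -> V N z ->
  [/\ 0 < complex.Im z, 1 <= N%:R * complex.Im z, cabs z <= c0, complex.Im z <= Om N z & Om N z <= c0].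

Local Notation K N := ((N%:R : R) `^ tau).
Let rho (N : nat) (z : CC) : R := (N%:R * complex.Im z)^-1.
Let Psi0 N z := Num.sqrt (Om N z * rho N z).
Let sN (N : nat) : R := Num.sqrt N%:R.
Let e N := (sN N)^-1.
Let psi N z := Num.sqrt (K N * (Om N z * rho N z)).

Lemma large_N : exists N0 : nat, forall N, (N0 <= N)%N ->
  [/\ (N1 <= N)%N, (6 <= N)%N, 4 <= K N, C <= K N & c0 <= K N] /\
  [/\ 4 * K N ^+ 2 * e N <= 1, 1 <= sN N, e N * sN N = 1, N%:R = sN N ^+ 2 & c0 <= N%:R].
Proof.
have [n1 h1] := powR_ge_const (Num.max 4 (Num.max C c0)) tau0.
(* 1 / (K^2 e) is N to the power 1/2 - 2 tau, which must exceed 4 for large N. *)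
have t2 : 0 < 2^-1 - tau * 2%:R by move: tau1; lra.
have [n2 h2] := powR_ge_const 4 t2.
have [n3 h3] := powR_ge_const c0 (@ltr01 R).
exists (maxn (maxn (maxn n1 n2) (maxn n3 N1)) 6) => N.
rewrite !geq_max => /andP[/andP[/andP[k1 k2] /andP[k3 k4]] k5].
have Np : 0 < N%:R :> R by rewrite ltr0n (leq_trans _ k5).
have sp : 0 < sN N by rewrite sqrtr_gt0.
have := h1 N k1; rewrite !ge_max => /andP[g1 /andP[g2 g3]].
have := h3 N k3; rewrite powRr1 ?ler0n // => g4.
split; split=> //.
- rewrite /e ler_pdivrMr // mul1r powR_natX /sN -powR12_sqrt ?ler0n //.
  have -> : N%:R `^ 2^-1 = N%:R `^ (2^-1 - tau * 2%:R) * N%:R `^ (tau * 2%:R) :> R.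
    by rewrite -powRD ?subrK // (gt_eqF Np) implybT.
  by rewrite ler_wpM2r ?powR_ge0 // h2.
- by rewrite -sqrtr1 ler_wsqrtr // ler1n (leq_trans _ k5).
- by rewrite mulVf // gt_eqF.
- by rewrite sqr_sqrtr // ler0n.
Qed.

(** [psi] has the factor K under the root because Im G is only known to be at most K Om. The last
    equation of the first list is the form in which the Ward identity consumes this bound. *)
Lemma psi_facts N z : (6 <= N)%N -> (N1 <= N)%N -> V N z -> c0 <= K N -> 1 <= sN N -> 4 <= K N ->
  [/\ 0 <= psi N z, e N <= psi N z, psi N z <= K N, psi N z ^+ 2 = K N * (Om N z * rho N z) &
      complex.Im z * (sN N * psi N z) ^+ 2 = K N * Om N z] /\
  [/\ psi N z <= K N * Psi0 N z, 0 <= Psi0 N z <= psi N z, N%:R^-1 <= Psi0 N z,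
     rho N z * (sN N ^+ 2 * complex.Im z) = 1 & 0 < rho N z <= 1].
Proof.
move=> N6 n1 Vz cK s1 K4.
have [z0 Nz zc eOm Omc] := HV n1 Vz.
have Np : 0 < N%:R :> R by rewrite ltr0n (leq_trans _ N6).
have K0 : 0 <= K N by exact: powR_ge0.
have K1 : 1 <= K N by move: K4; lra.
have Nz0 : 0 < N%:R * complex.Im z by rewrite mulr_gt0.
have rp : 0 < rho N z by rewrite invr_gt0.
have r1 : rho N z <= 1 by rewrite invf_le1.
have Om0 : 0 < Om N z by exact: lt_le_trans eOm.
have Or : N%:R^-1 <= Om N z * rho N z.
  rewrite /rho invfM mulrCA -[leLHS]mulr1 ler_wpM2l ?invr_ge0 ?(ltW Np) //.
  by rewrite ler_pdivlMr // mul1r.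
have Or0 : 0 <= Om N z * rho N z by rewrite mulr_ge0 // ltW.
have p0 : 0 <= psi N z by exact: sqrtr_ge0.
have KO : 0 <= K N * (Om N z * rho N z) by rewrite mulr_ge0.
have psq : psi N z ^+ 2 = K N * (Om N z * rho N z) by rewrite sqr_sqrtr.
have s2 : sN N ^+ 2 = N%:R by rewrite sqr_sqrtr // ler0n.
have sp : 0 < sN N by exact: lt_le_trans s1.
have P0 : 0 <= Psi0 N z by exact: sqrtr_ge0.
have le_sq (a b : R) : 0 <= a -> 0 <= b -> a ^+ 2 <= b ^+ 2 -> a <= b.
  by move=> a0 b0; rewrite ler_pXn2r.
have Psq : Psi0 N z ^+ 2 = Om N z * rho N z by rewrite sqr_sqrtr.
split; split=> //.
- apply: le_sq => //; first by rewrite invr_ge0 ltW.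
  rewrite psq exprVn s2; apply: (le_trans Or); rewrite ler_peMl //.
- apply: le_sq => //; rewrite psq [leRHS]expr2 ler_wpM2l //.
  apply: le_trans cK; apply: le_trans Omc; rewrite ler_piMr // ltW //.
- rewrite exprMn psq s2 /rho; field; by rewrite !gt_eqF.
- apply: le_sq => //; first by rewrite mulr_ge0.
  rewrite psq exprMn Psq ler_wpM2r // expr2 ler_peMl //.
- rewrite P0 /=; apply: le_sq => //; rewrite psq Psq ler_peMl //.
- apply: le_sq => //.
  rewrite Psq; apply: le_trans Or; rewrite exprVn lef_pV2 ?posrE ?exprn_gt0 //.
  by rewrite expr2 ler_peMl ?(ltW Np) // ler1n (leq_trans _ N6).
- by rewrite s2 /rho mulVf // gt_eqF.
- by rewrite rp r1.
Qed.

Hypothesis hG : whp (C := C) (Cp := Cp) (I := fun N => (CC * ('cV[CC]_N * 'cV[CC]_N))%type)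
  (fun N M i w => V N i.1 -> nsq i.2.1 <= 1 -> nsq i.2.2 <= 1 ->
     cabs (Gq (mH w) i.1 i.2.1 i.2.2) <= K N).
Hypothesis hIm : whp (C := C) (Cp := Cp) (I := fun N => (CC * 'cV[CC]_N)%type)
  (fun N M i w => V N i.1 -> nsq i.2 <= 1 ->
     complex.Im (Gq (mH w) i.1 i.2 i.2) <= K N * Om N i.1).

Local Notation Smod M := (Sv (mP M) (mH (m := M))).
Local Notation Tmod M := (Tv (mP M) (mH (m := M))).
Local Notation famM M v w := (fam v w (Smod M) (Tmod M) C).

(** A union bound over the entries, the test vectors and their pairs; the test vectors have norm at
    most one by [nsq_famv]. *)
Lemma whp_regular : whp (C := C) (Cp := Cp) (I := fun N => (CC * ('cV[CC]_N * 'cV[CC]_N))%type)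
  (fun N M i w => V N i.1 -> nsq i.2.1 <= 1 -> nsq i.2.2 <= 1 ->
    [/\ forall p, cabs (mH w p.1 p.2) <= K N * e N,
        forall x y, famM M i.2.1 i.2.2 x -> famM M i.2.1 i.2.2 y -> cabs (Gq (mH w) i.1 x y) <= K N &
        forall x, famM M i.2.1 i.2.2 x -> complex.Im (Gq (mH w) i.1 x x) <= K N * Om N i.1]).
Proof.
pose J N := ((('I_N + 'I_N) + ('I_N + 'I_N)) + bool)%type : finType.
have cardJ N : (6 <= N)%N -> #|J N|%:R <= N%:R ^+ 2 :> R.
  move=> N6; rewrite !card_sum !card_ord card_bool -natrX ler_nat.
  have : (6 * N <= N * N)%N by rewrite leq_mul2r N6 orbT.
  rewrite expnS expn1; apply: leq_trans.
  rewrite !mulSn mul0n addn0 -!addnA !leq_add2l (leq_trans _ (leq_addr _ _)) //.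
  exact: leq_trans N6.
pose fv N (M : model N) (i : CC * ('cV[CC]_N * 'cV[CC]_N)) (j : J N) := famv i.2.1 i.2.2 (Smod M) (Tmod M) C j.
have nf N (M : model N) i j : (6 <= N)%N -> nsq i.2.1 <= 1 -> nsq i.2.2 <= 1 -> nsq (fv N M i j) <= 1.
  move=> N6 h1 h2; have N0 : (0 < N)%N by exact: leq_trans N6.
  have [_ hS S0 _ _] := model_S M N0.
  by apply: nsq_famv => // p; [have /andP[] := hS p|exact: Tv_le (mW M) p].
have h1 := whp_sub (fun N (M : model N) (ij : (CC * ('cV[CC]_N * 'cV[CC]_N)) * (J N * J N)) =>
  (ij.1.1, (fv N M ij.1 ij.2.1, fv N M ij.1 ij.2.2))) hG.
have h2 := whp_all (I := fun N => (CC * ('cV[CC]_N * 'cV[CC]_N))%type) (J := fun N => (J N * J N)%type : finType)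
  (l := 4) (N1 := 6) _ h1.
have h3 := whp_sub (fun N (M : model N) (ij : (CC * ('cV[CC]_N * 'cV[CC]_N)) * J N) =>
  (ij.1.1, fv N M ij.1 ij.2)) hIm.
have h4 := whp_all (I := fun N => (CC * ('cV[CC]_N * 'cV[CC]_N))%type) (J := J) (l := 2) (N1 := 6) cardJ h3.
have h5 := whp_sub (fun N (M : model N) (ij : (CC * ('cV[CC]_N * 'cV[CC]_N)) * ('I_N * 'I_N)) => ij.2)
  (whp_entry (C := C) (Cp := Cp) tau0).
have h6 := whp_all (I := fun N => (CC * ('cV[CC]_N * 'cV[CC]_N))%type) (J := fun N => ('I_N * 'I_N)%type : finType)
  (l := 2) (N1 := 0) _ h5.
have c2 N : (6 <= N)%N -> #|(J N * J N)%type : finType|%:R <= N%:R ^+ 4 :> R.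
  move=> N6; rewrite card_prod natrM (exprD _ 2 2); apply: ler_pM; rewrite ?ler0n ?cardJ //.
have c6 N : (0 <= N)%N -> #|('I_N * 'I_N)%type : finType|%:R <= N%:R ^+ 2 :> R.
  by move=> _; rewrite card_prod card_ord natrM expr2.
apply: whp_mono (whp_and (h6 c6) (whp_and (h2 c2) h4)) => N N6 M i w [g1 [g2 g3]] Vz hv hw.
have nn j := nf N M i j N6 hv hw.
split.
- by move=> p; exact: g1.
- move=> x y /fam_famv[j ->] /fam_famv[k ->]; exact: (g2 (j, k) Vz (nn j) (nn k)).
- by move=> x /fam_famv[j ->]; exact: (g3 j Vz (nn j)).
Qed.

(** The exponent is 30 from [diag_good], one for psi <= K Psi0 and one for the loss N^tau in
    [moment_method]. *)
Theorem diag_step : whp (C := C) (Cp := Cp) (I := fun=> CC) (fun N M z w => V N z ->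
  forall a, cabs (1 + z * gdiag z (mH w) a + Sdiag z (Smod M) (mH w) a * gdiag z (mH w) a) <=
    K N ^+ 32 * Psi0 N z).
Proof.
have [N0 hN0] := large_N.
pose Vd N (M : model N) (i : CC * 'I_N) := V N i.1.
pose D N (M : model N) (i : CC * 'I_N) := diag_data i.1 (Smod M) i.2.
pose A N (M : model N) (i : CC * 'I_N) := K N ^+ 31 * Psi0 N i.1.
have hadm N : (N0 <= N)%N -> forall M (i : CC * 'I_N), Vd N M i ->
     admissible (D N M i) (N%:R ^+ 3) /\ N%:R ^- 1 <= A N M i.
  move=> n0 M [z a] Vz; have [[n1 N6 K4 CK cK] [Ke s1 eN sE cN]] := hN0 N n0.
  have [z0 Nz zc _ _] := HV n1 Vz.
  have [_ S0 S1 S2 _] := model_S M (leq_trans (isT : (0 < 6)%N) N6).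
  have [_ [_ /andP[P0 _] P1 _ _]] := psi_facts N6 n1 Vz cK s1 K4.
  split.
    apply: diag_admissible => //; last exact: le_trans cN.
    by rewrite ler_nat (leq_trans _ N6).
  rewrite expr1; apply: (le_trans P1); rewrite ler_peMl // exprn_ege1 //.
  by apply: le_trans K4; lra.
have hgood t : 0 < t -> whp (fun N M (i : CC * 'I_N) w => Vd N M i ->
     good (Smod M) (Tmod M) (C / N%:R) (N%:R `^ t * A N M i) (D N M i) (mH w)).
  move=> t0.
  have hr := whp_sub (fun N (M : model N) (i : CC * 'I_N) => (i.1, (ev i.2 : 'cV[CC]_N, ev i.2 : 'cV[CC]_N))) whp_regular.
  apply: (whp_mono (N1 := N0)) hr => N n0 M [z a] w /= reg Vz.
  have [[n1 N6 K4 CK cK] [Ke s1 eN sE cN]] := hN0 N n0.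
  have [z0 Nz zc _ _] := HV n1 Vz.
  have N0' : (0 < N)%N by exact: leq_trans N6.
  have [_ S0 S1 S2 _] := model_S M N0'.
  have [[p0 ep pK psq pIm] [pP /andP[P0 _] P1 _ _]] := psi_facts N6 n1 Vz cK s1 K4.
  have e1 : nsq (ev a : 'cV[CC]_N) <= 1 by rewrite nsq_ev.
  have [r1 r2 r3] := reg Vz e1 e1.
  have K0 : 0 <= K N by exact: powR_ge0.
  have hI x : famM M (ev a) (ev a) x -> complex.Im (Gq (mH w) z x x) <= complex.Im z * (sN N * psi N z) ^+ 2.
    by move=> fx; rewrite pIm; exact: r3.
  have SC p : Smod M p <= C / N%:R by have /andP[] := S0 p.
  have := diag_good (wigner_herm (mW M) w) z0 C0 S1 SC (Tv_le (mW M)) S2 K4 CK s1 eN sE ep pK Ke (le_trans zc cK)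
    r1 r2 hI.
  apply: good_le; first by rewrite mulr_ge0 ?exprn_ge0.
  apply: (@le_trans _ _ (A N M (z, a))).
    by rewrite /A /= [K N ^+ 31]exprSr -mulrA ler_wpM2l ?exprn_ge0.
  rewrite ler_peMl ?powR_nat_ge ?(ltW t0) //; rewrite /A mulr_ge0 ?exprn_ge0 //.
have hm := moment_method hadm hgood tau0.
have ha := whp_all (I := fun=> CC) (J := fun N => 'I_N : finType) (l := 1) (N1 := 0) _ hm.
have c1 N : (0 <= N)%N -> #|('I_N : finType)|%:R <= N%:R ^+ 1 :> R by rewrite card_ord expr1.
apply: (whp_mono (N1 := 0)) (ha c1) => N _ M z w h Vz a.
by apply: le_trans (h a Vz) _; rewrite /A /= [K N ^+ 32]exprS mulrA.
Qed.

(** phi is whatever is already known about G_aa - m, so the same step serves the weak and the strong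
    law. The exponent is composed as in [diag_step], from 10. *)
Theorem iso_step (phi : nat -> CC -> R) :
  (forall N z, 0 <= phi N z) ->
  whp (C := C) (Cp := Cp) (I := fun=> CC) (fun N M z w => V N z ->
     forall a, cabs (gdiag z (mH w) a - msc z) <= phi N z) ->
  whp (C := C) (Cp := Cp) (I := fun N => (CC * ('cV[CC]_N * 'cV[CC]_N))%type)
  (fun N M i w => V N i.1 -> nsq i.2.1 <= 1 -> nsq i.2.2 <= 1 ->
     cabs (Gq (mH w) i.1 i.2.1 i.2.2 - msc i.1 * cdot i.2.1 i.2.2) <= K N ^+ 12 * (Psi0 N i.1 + phi N i.1)).
Proof.
move=> phi0 hphi.
have [N0 hN0] := large_N.
pose Vd N (M : model N) (i : CC * ('cV[CC]_N * 'cV[CC]_N)) := [/\ V N i.1, nsq i.2.1 <= 1 & nsq i.2.2 <= 1].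
pose D N (M : model N) (i : CC * ('cV[CC]_N * 'cV[CC]_N)) := iso_data i.1 (msc i.1) i.2.1 i.2.2.
pose A N (M : model N) (i : CC * ('cV[CC]_N * 'cV[CC]_N)) := K N ^+ 11 * (Psi0 N i.1 + phi N i.1).
have hadm N : (N0 <= N)%N -> forall M i, Vd N M i ->
     admissible (D N M i) (N%:R ^+ 3) /\ N%:R ^- 1 <= A N M i.
  move=> n0 M [z [v w]] [/= Vz hv hw]; have [[n1 N6 K4 CK cK] [Ke s1 eN sE cN]] := hN0 N n0.
  have [z0 Nz zc _ _] := HV n1 Vz.
  have [_ [_ /andP[P0 _] P1 _ _]] := psi_facts N6 n1 Vz cK s1 K4.
  split.
    apply: iso_admissible => //; [by rewrite ler_nat (leq_trans _ N6)|exact: msc_quadratic|exact: msc_le1].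
  rewrite expr1; apply: (le_trans P1); apply: (@le_trans _ _ (Psi0 N z + phi N z)); first by rewrite lerDl.
  rewrite ler_peMl ?addr_ge0 // exprn_ege1 //.
  by apply: le_trans K4; lra.
have hgood t : 0 < t -> whp (fun N M i w => Vd N M i ->
     good (Smod M) (Tmod M) (C / N%:R) (N%:R `^ t * A N M i) (D N M i) (mH w)).
  move=> t0.
  have hp2 := whp_sub (fun N (M : model N) (i : CC * ('cV[CC]_N * 'cV[CC]_N)) => i.1) hphi.
  apply: (whp_mono (N1 := N0)) (whp_and whp_regular hp2) => N n0 M [z [v v']] w /= [reg hph] [/= Vz hv hw].
  have [[n1 N6 K4 CK cK] [Ke s1 eN sE cN]] := hN0 N n0.
  have [z0 Nz zc _ _] := HV n1 Vz.
  have N0' : (0 < N)%N by exact: leq_trans N6.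
  have [_ S0 S1 S2 _] := model_S M N0'.
  have [[p0 ep pK psq pIm] [pP /andP[P0 _] P1 _ _]] := psi_facts N6 n1 Vz cK s1 K4.
  have [r1 r2 r3] := reg Vz hv hw.
  have K0 : 0 <= K N by exact: powR_ge0.
  have K1 : 1 <= K N by apply: le_trans K4; rewrite ler1n.
  have hI x : famM M v v' x -> complex.Im (Gq (mH w) z x x) <= complex.Im z * (sN N * psi N z) ^+ 2.
    by move=> fx; rewrite pIm; exact: r3.
  have SC p : Smod M p <= C / N%:R by have /andP[] := S0 p.
  have := iso_good (phi := phi N z) (wigner_herm (mW M) w) z0 C0 S1 SC S2 K4 CK s1 eN sE ep Ke (phi0 N z)
    r1 r2 hI (msc_le1 z0) hv (hph Vz).
  apply: good_le; first by rewrite mulr_ge0 ?exprn_ge0 // addr_ge0.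
  have P00 : 0 <= Psi0 N z + phi N z by rewrite addr_ge0.
  apply: (@le_trans _ _ (A N M (z, (v, v')))).
    rewrite /A /= [K N ^+ 11]exprSr -mulrA ler_wpM2l ?exprn_ge0 // mulrDr lerD //.
    by rewrite ler_peMl.
  by rewrite ler_peMl ?powR_nat_ge ?(ltW t0) // /A mulr_ge0 ?exprn_ge0.
have hm := moment_method hadm hgood tau0.
apply: (whp_mono (N1 := 0)) hm => N _ M i w h Vz hv hw.
have V' : Vd N M i by split.
by apply: le_trans (h V') _; rewrite /A /= [K N ^+ 12]exprS mulrA.
Qed.

(** La bounds Om and, up to K, also |z + 2 u|. In the strong law it is of the order |2 m + z| +
    r. *)
Theorem avg_step (La : nat -> CC -> R) :
  (forall N z, (N1 <= N)%N -> V N z -> Om N z <= La N z <= c0) ->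
  whp (C := C) (Cp := Cp) (I := fun=> CC) (fun N M z w => V N z ->
     (forall a, cabs (gdiag z (mH w) a - avg z (mH w)) <= K N * Psi0 N z) /\
     cabs (z + 2 * avg z (mH w)) <= K N * La N z) ->
  whp (C := C) (Cp := Cp) (I := fun=> CC) (fun N M z w => V N z ->
    cabs (1 + z * avg z (mH w) + avg z (mH w) ^+ 2) <= K N ^+ 31 * (La N z * rho N z)).
Proof.
move=> hLa hd.
have [N0 hN0] := large_N.
pose Vd N (M : model N) (z : CC) := V N z.
pose D N (M : model N) (z : CC) := avg_data (N := N) z.
pose A N (M : model N) (z : CC) := K N ^+ 30 * (La N z * rho N z).
have hOm N z : (N1 <= N)%N -> (0 < N)%N -> V N z -> N%:R^-1 <= La N z * rho N z.
  move=> n1 N0' Vz; have [z0 Nz zc Oe _] := HV n1 Vz; have /andP[h1 h2] := hLa N z n1 Vz.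
  have Np : 0 < N%:R :> R by rewrite ltr0n.
  rewrite /rho invfM mulrCA -[leLHS]mulr1 ler_wpM2l ?invr_ge0 ?(ltW Np) //.
  by rewrite ler_pdivlMr // mul1r (le_trans Oe).
have hadm N : (N0 <= N)%N -> forall M (i : CC), Vd N M i ->
     admissible (D N M i) (N%:R ^+ 4) /\ N%:R ^- 1 <= A N M i.
  move=> n0 M z Vz; have [[n1 N6 K4 CK cK] [Ke s1 eN sE cN]] := hN0 N n0.
  have [z0 Nz zc _ _] := HV n1 Vz.
  have N0' : (0 < N)%N by exact: leq_trans N6.
  split.
    apply: avg_admissible => //; last exact: le_trans cN.
    by rewrite ler_nat (leq_trans _ N6).
  rewrite expr1; apply: (le_trans (hOm N z n1 N0' Vz)); rewrite ler_peMl //.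
    by apply: le_trans (hOm N z n1 N0' Vz); rewrite invr_ge0 ler0n.
  by rewrite exprn_ege1 //; apply: le_trans K4; lra.
have hgood t : 0 < t -> whp (fun N M (i : CC) w => Vd N M i ->
     good (Smod M) (Tmod M) (C / N%:R) (N%:R `^ t * A N M i) (D N M i) (mH w)).
  move=> t0.
  have h1 := whp_sub (fun N (M : model N) (ij : CC * ('I_N * 'I_N)) =>
     (ij.1, (ev ij.2.1 : 'cV[CC]_N, ev ij.2.2 : 'cV[CC]_N))) hG.
  have h2 := whp_sub (fun N (M : model N) (ij : CC * ('I_N * 'I_N)) =>
     (ij.1, ev ij.2.1 : 'cV[CC]_N)) hIm.
  have h3 := whp_sub (fun N (M : model N) (ij : CC * ('I_N * 'I_N)) => ij.2)
    (whp_entry (C := C) (Cp := Cp) tau0).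
  have c6 N : (0 <= N)%N -> #|('I_N * 'I_N)%type : finType|%:R <= N%:R ^+ 2 :> R.
    by move=> _; rewrite card_prod card_ord natrM expr2.
  have h4 := whp_all (I := fun=> CC) (J := fun N => ('I_N * 'I_N)%type : finType)
    c6 (whp_and h3 (whp_and h1 h2)).
  apply: (whp_mono (N1 := N0)) (whp_and h4 hd) => N n0 M z w /= [reg hdz] Vz.
  have [[n1 N6 K4 CK cK] [Ke s1 eN sE cN]] := hN0 N n0.
  have [z0 Nz zc Oe Oc] := HV n1 Vz.
  have N0' : (0 < N)%N by exact: leq_trans N6.
  have [_ S0 S1 S2 S3] := model_S M N0'.
  have [[p0 ep pK psq pIm] [pP /andP[P0 PP] P1 rE /andP[r0 r1]]] := psi_facts N6 n1 Vz cK s1 K4.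
  have K0 : 0 <= K N by exact: powR_ge0.
  have K1 : 1 <= K N by apply: le_trans K4; rewrite ler1n.
  have ne a : nsq (ev a : 'cV[CC]_N) <= 1 by rewrite nsq_ev.
  have g1 p : cabs (mH w p.1 p.2) <= K N * e N by have [] := reg p.
  have g2 a b : cabs (Gq (mH w) z (ev a) (ev b)) <= K N.
    by have [_ [h _]] := reg (a, b); exact: h Vz (ne a) (ne b).
  have g3 a : complex.Im (Gq (mH w) z (ev a) (ev a)) <= complex.Im z * (sN N * psi N z) ^+ 2.
    by have [_ [_ h]] := reg (a, a); rewrite pIm; exact: h Vz (ne a).
  have [hd1 hd2] := hdz Vz.
  have SC p : Smod M p <= C / N%:R by have /andP[] := S0 p.
  have /andP[l1 l2] := hLa N z n1 Vz.
  have La0 : 0 <= La N z by apply: le_trans l1; apply: le_trans Oe; exact: ltW.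
  have psiL : psi N z ^+ 2 <= K N * (La N z * rho N z).
    by rewrite psq ler_wpM2l // ler_wpM2r // ltW.
  have hd1' a : cabs (Gq (mH w) z (ev a) (ev a) - avg z (mH w)) <= K N * psi N z.
    by apply: le_trans (hd1 a) _; rewrite ler_wpM2l.
  have := avg_good (wigner_herm (mW M) w) z0 C0 S1 SC (Tv_le (mW M)) S2 S3 K4 CK s1 eN sE ep Ke La0 (le_trans l2 cK)
    rE r1 psiL g1 g2 g3 hd1' hd2.
  apply: good_le; first by rewrite mulr_ge0 ?exprn_ge0 // mulr_ge0 // ltW.
  by rewrite ler_peMl ?powR_nat_ge ?(ltW t0) // mulr_ge0 ?exprn_ge0 // mulr_ge0 // ltW.
have hm := moment_method hadm hgood tau0.
apply: (whp_mono (N1 := 0)) hm => N _ M z w h Vz.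
by apply: le_trans (h Vz) _; rewrite /A /= [K N ^+ 31]exprS mulrA.
Qed.

End Steps.

(** * The vertical path to a large imaginary part *)

Section SpectralPath.
Context {R : realType}.
Local Notation CC := R[i].
Variables (Mx c0 : R).

(** N^6 steps: while Im z >= 1/N a resolvent entry has derivative at most N^2, so each step changes
    it by less than N^(-3). *)
Definition path_pt (N : nat) (z : CC) (k : nat) : CC :=
  Complex (complex.Re z) (complex.Im z + (Mx - complex.Im z) * (k%:R / (N ^ 6)%:R)).

Variables (N : nat) (z : CC) (X : 'M[CC]_N) (hX : hermx X).
Hypotheses (N0 : (0 < N)%N) (hN : 8 * (c0 + 1) * Mx <= N%:R) (c00 : 0 <= c0).
Hypotheses (eN : 1 <= N%:R * complex.Im z) (eM : complex.Im z <= Mx).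
Local Notation p := (path_pt N z).
Hypothesis pc : forall k, (k <= N ^ 6)%N -> cabs (p k) <= c0.

Let Np : 0 < N%:R :> R. Proof. by rewrite ltr0n. Qed.
Let n6 : 0 < (N ^ 6)%:R :> R. Proof. by rewrite ltr0n expn_gt0 N0. Qed.
Let e0 : 0 < complex.Im z.
Proof. by have : 0 < N%:R * complex.Im z := lt_le_trans ltr01 eN; rewrite pmulr_rgt0. Qed.
Let M0 : 0 < Mx. Proof. exact: lt_le_trans eM. Qed.
Let d0 : 0 <= Mx - complex.Im z. Proof. by rewrite subr_ge0. Qed.

Lemma path_Im_le k l : (k <= l)%N -> complex.Im (p k) <= complex.Im (p l).
Proof.
by move=> kl; rewrite /= lerD2l ler_wpM2l // ler_pM2r ?invr_gt0 // ler_nat.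
Qed.

Lemma path0 : p 0 = z.
Proof. by rewrite /path_pt mul0r mulr0 addr0; case: z. Qed.

Lemma path_end : complex.Im (p (N ^ 6)) = Mx.
Proof. by rewrite /= divff ?gt_eqF // mulr1 addrC subrK. Qed.

Lemma path_ge k : complex.Im z <= complex.Im (p k).
Proof. by rewrite -{1}path0; exact: path_Im_le. Qed.

Lemma path_Im_max k : (k <= N ^ 6)%N -> complex.Im (p k) <= Mx.
Proof. by move=> kn; rewrite -path_end; exact: path_Im_le. Qed.

Lemma path_gt0 k : 0 < complex.Im (p k).
Proof. exact: lt_le_trans (path_ge k). Qed.

Lemma path_N k : 1 <= N%:R * complex.Im (p k).
Proof. by apply: le_trans eN _; rewrite ler_wpM2l ?path_ge ?ltW. Qed.

Lemma path_step k : cabs (p k - p k.+1) <= Mx * N%:R ^- 6.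
Proof.
have -> : p k - p k.+1 = Complex 0 (- ((Mx - complex.Im z) * ((N ^ 6)%:R)^-1)).
  apply: complex_eq; rewrite ?cReD ?cReN ?cImD ?cImN /=; first by rewrite subrr.
  by rewrite -natr1; ring.
have -> : Complex 0 (- ((Mx - complex.Im z) * ((N ^ 6)%:R)^-1)) =
  'i%C * (- ((Mx - complex.Im z) * ((N ^ 6)%:R)^-1))%:C%C.
  by apply: complex_eq; rewrite ?cReM ?cImM /=; ring.
have ci : cabs ('i%C : CC) = 1.
  by apply: (pexpIrn (n := 2)); rewrite ?nnegrE ?cabs_ge0 // cabs_sqr /=; ring.
rewrite cabsM ci mul1r cabs_real normrN ger0_norm ?mulr_ge0 ?invr_ge0 ?(ltW n6) //.
by rewrite natrX ler_wpM2r ?invr_ge0 ?exprn_ge0 ?(ltW Np) // gerBl ltW.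
Qed.

Let path_inv k : (complex.Im (p k))^-1 <= N%:R.
Proof. by rewrite -[leLHS]mul1r ler_pdivrMr ?path_gt0 // path_N. Qed.

Let Gq_inv v k : nsq v <= 1 -> Num.sqrt (complex.Im (Gq X (p k) v v) / complex.Im (p k)) <= N%:R.
Proof.
move=> hv; have h : complex.Im (Gq X (p k) v v) <= N%:R.
  apply: le_trans (ler_norm _) _; apply: le_trans (Im_le_cabs _) _.
  by apply: Gq_le_N => //; [exact: path_gt0|exact: path_N].
rewrite -[leRHS]ger0_norm ?(ltW Np) // -sqrtr_sqr ler_wsqrtr // expr2.
have h0 : 0 <= complex.Im (Gq X (p k) v v).
  rewrite Im_Gq //; last by rewrite gt_eqF // path_gt0.
  by rewrite mulr_ge0 ?nsq_ge0 // ltW // path_gt0.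
by apply: ler_pM; rewrite ?invr_ge0 ?(ltW (path_gt0 k)) ?path_inv.
Qed.

Let small_step (A : R) : 0 <= A -> A <= 2 * (c0 + 1) -> A * Mx * N%:R ^- 4 <= 4^-1 * N%:R ^- 3.
Proof.
move=> A0 h; have -> : N%:R ^- 3 = N%:R * N%:R ^- 4 :> R by field; rewrite gt_eqF.
rewrite mulrA ler_wpM2r ?invr_ge0 ?exprn_ge0 ?(ltW Np) //.
have : A * Mx <= 2 * (c0 + 1) * Mx by rewrite ler_wpM2r // ltW.
by move: hN; lra.
Qed.

Lemma path_Gq v w k : nsq v <= 1 -> nsq w <= 1 ->
  cabs (Gq X (p k) v w - Gq X (p k.+1) v w) <= 4^-1 * N%:R ^- 3.
Proof.
move=> hv hw; apply: le_trans (Gq_diff_le v w hX (path_gt0 k) (path_gt0 k.+1)) _.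
apply: (@le_trans _ _ (Mx * N%:R ^- 6 * (N%:R * N%:R))).
  by apply: ler_pM; rewrite ?cabs_ge0 ?mulr_ge0 ?sqrtr_ge0 ?path_step //; apply: ler_pM; rewrite ?sqrtr_ge0 ?Gq_inv.
have -> : Mx * N%:R ^- 6 * (N%:R * N%:R) = 1 * Mx * N%:R ^- 4 by field; rewrite gt_eqF.
by apply: small_step => //; move: c00; lra.
Qed.

Lemma path_msc k : (k <= N ^ 6)%N -> cabs (msc (p k) - msc (p k.+1)) <= 4^-1 * N%:R ^- 3.
Proof.
move=> kn; have h := msc_lip (path_gt0 k) (path_gt0 k.+1).
have h2 : cabs (msc (p k) - msc (p k.+1)) <= 2 * (cabs (p k) + 1) * cabs (p k - p k.+1) / complex.Im (p k).
  by rewrite ler_pdivlMr // path_gt0.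
apply: (le_trans h2).
apply: (@le_trans _ _ (2 * (c0 + 1) * (Mx * N%:R ^- 6) * N%:R)).
  apply: ler_pM; rewrite ?invr_ge0 ?(ltW (path_gt0 k)) ?path_inv //.
    by rewrite !mulr_ge0 ?addr_ge0 ?cabs_ge0.
  apply: ler_pM; rewrite ?mulr_ge0 ?addr_ge0 ?cabs_ge0 ?path_step //.
  by rewrite ler_wpM2l // lerD2r pc.
have -> : 2 * (c0 + 1) * (Mx * N%:R ^- 6) * N%:R = 2 * (c0 + 1) * Mx * N%:R ^- 5 by field; rewrite gt_eqF.
have c2 : 0 <= 2 * (c0 + 1) by rewrite mulr_ge0 // addr_ge0.
apply: le_trans (small_step c2 (lexx _)); rewrite ler_wpM2l ?(mulr_ge0 c2 (ltW M0)) //.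
rewrite lef_pV2 ?posrE ?exprn_gt0 // ler_weXn2l // ler1n //.
Qed.

Lemma path_avg k : cabs (avg (p k) X - avg (p k.+1) X) <= 4^-1 * N%:R ^- 3.
Proof.
rewrite /avg -mulrBr -sumrB; apply: r_sum_le => // a.
by apply: path_Gq; rewrite nsq_ev.
Qed.

Let two_steps (a b a' b' : CC) : cabs (a - a') <= 4^-1 * N%:R ^- 3 -> cabs (b - b') <= 4^-1 * N%:R ^- 3 ->
  cabs (a - b - (a' - b')) <= N%:R ^- 3.
Proof.
move=> h1 h2; have -> : a - b - (a' - b') = (a - a') - (b - b') by ring.
apply: le_trans (le_cabsB h1 h2) _.
have : 0 <= N%:R ^- 3 :> R by rewrite invr_ge0 exprn_ge0 // ltW.
by lra.
Qed.

Lemma path_x k : (k <= N ^ 6)%N ->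
  cabs (avg (p k) X - msc (p k) - (avg (p k.+1) X - msc (p k.+1))) <= N%:R ^- 3.
Proof. by move=> kn; apply: two_steps; [exact: path_avg|exact: path_msc]. Qed.

Lemma path_d k a : cabs (gdiag (p k) X a - avg (p k) X) <=
  cabs (gdiag (p k.+1) X a - avg (p k.+1) X) + N%:R ^- 3.
Proof.
rewrite -[gdiag (p k) X a - _](subrK (gdiag (p k.+1) X a - avg (p k.+1) X)) addrC.
apply: le_cabsD => //; apply: two_steps; last exact: path_avg.
by apply: path_Gq; rewrite nsq_ev.
Qed.

Lemma path_gap k : gap (p k) <= gap (p k.+1).
Proof. by apply: gap_mono; rewrite ?path_gt0 ?path_Im_le. Qed.

Lemma path_end_Gq v w : nsq v <= 1 -> nsq w <= 1 -> cabs (Gq X (p (N ^ 6)) v w) <= Mx^-1.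
Proof.
move=> hv hw; apply: le_trans (Gq_le_eta v w hX (path_gt0 _)) _.
rewrite path_end ler_pdivrMr // mulVf ?gt_eqF //.
by rewrite -[1]mulr1; apply: ler_pM; rewrite ?sqrtr_ge0 ?sqrt_nsq_le1.
Qed.

Lemma path_end_avg : cabs (avg (p (N ^ 6)) X) <= Mx^-1.
Proof. by apply: r_sum_le => // a; apply: path_end_Gq; rewrite nsq_ev. Qed.

Lemma path_end_msc : cabs (msc (p (N ^ 6))) <= Mx^-1.
Proof.
have h := msc_le_eta (path_gt0 (N ^ 6)); rewrite path_end in h.
by rewrite -[leRHS]mul1r ler_pdivlMr.
Qed.

Lemma root_identity (y u m : CC) : m ^+ 2 + y * m + 1 = 0 ->
  (u - m) * (u - m + (2 * m + y)) = 1 + y * u + u ^+ 2.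
Proof.
move=> h; have -> : 1 + y * u + u ^+ 2 = 1 + y * u + u ^+ 2 - (m ^+ 2 + y * m + 1) by rewrite h subr0.
ring.
Qed.

Variables (S : 'I_N * 'I_N -> R) (C E : R).
Hypotheses (C1 : 1 <= C).
Hypotheses (Slow : forall q, (C * N%:R)^-1 <= S q) (Srow : forall i, \sum_j S (i, j) = 1)
  (Ssym : forall i j, S (j, i) = S (i, j)).
Hypotheses (hM : 32 * C + 4 <= Mx) (E0 : 0 < E) (EC : 16 * C ^+ 2 * E <= 1)
  (ES : 11 * Num.sqrt (2 * E) + N%:R ^- 3 <= C^-1 / 16) (EC2 : 4 * C * E + N%:R ^- 3 <= C^-1 / 8)
  (EN : N%:R ^- 3 <= Num.sqrt (2 * E)).
Hypothesis hPi : forall k, (k <= N ^ 6)%N -> forall a,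
  cabs (1 + p k * gdiag (p k) X a + Sdiag (p k) S X a * gdiag (p k) X a) <= E.

Let Cp : 0 < C. Proof. exact: lt_le_trans C1. Qed.
Let x k := avg (p k) X - msc (p k).
(** The smallness under which [diag_stability] applies; one step of the path changes these
    quantities by at most N^(-3). *)
Let Psm k := cabs (x k) <= C^-1 / 16 /\ forall b, cabs (gdiag (p k) X b - avg (p k) X) <= C^-1 / 8.

Let Psm_d k : (k <= N ^ 6)%N -> Psm k -> forall a, cabs (gdiag (p k) X a - avg (p k) X) <= 4 * C * E.
Proof.
move=> kn [h1 h2] a.
apply: (diag_stability N0 C1 Slow Srow Ssym (hPi kn)) => //.
- have h := msc_shift_ge1 (path_gt0 k).
  have e : p k + msc (p k) = (p k + avg (p k) X) - x k by rewrite /x; ring.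
  have := ler_cabsB (p k + avg (p k) X) (x k); rewrite -e; move: h h1; lra.
- have e : avg (p k) X = msc (p k) + x k by rewrite /x; ring.
  by rewrite e; apply: le_cabsD => //; exact: msc_le1 (path_gt0 k).
Qed.

(** At the top the resolvent entries and m are at most 1 / Mx, and Mx >= 32 C + 4 yields [Psm]
    there. Further down, the bounds from [root_claim] and [diag_stability] are stronger than [Psm]
    by more than one step, so [Psm] persists. *)
Theorem weak_stability : cabs (avg z X - msc z) <= 11 * Num.sqrt (2 * E) /\
  forall a, cabs (gdiag z X a - avg z X) <= 4 * C * E.
Proof.
have Mi : Mx^-1 + Mx^-1 <= C^-1 / 16.
  have h : Mx^-1 <= (32 * C)^-1 by rewrite lef_pV2 ?posrE ?mulr_gt0 //; move: hM; lra.
  have e : C^-1 / 16 = (32 * C)^-1 + (32 * C)^-1 by field; rewrite gt_eqF.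
  by rewrite e lerD.
have C0i : 0 < C^-1 by rewrite invr_gt0.
have [] := @root_path R (N ^ 6)%N x (fun k => 2 * msc (p k) + p k) (fun=> 2 * E) (N%:R ^- 3) Psm
  _ _ _ _ _ _ _ _ _ 0%N (leq0n _).
- by move=> *; rewrite mulr_ge0 // ltW.
- move=> k kn Pk; rewrite /x root_identity; last exact: msc_quadratic (path_gt0 k).
  apply: le_trans (avg_equation N0 C1 Slow Srow Ssym (hPi kn) (Psm_d kn Pk)) _.
  have : (4 * C * E) ^+ 2 <= E.
    have -> : (4 * C * E) ^+ 2 = 16 * C ^+ 2 * E * E by ring.
    by rewrite ler_piMl // ltW.
  lra.
- move=> k kn Pk [c1 _]; split.
    have e : x k = (x k - x k.+1) + x k.+1 by rewrite subrK.
    rewrite e; apply: le_trans (le_cabsD (path_x (ltnW kn)) c1) _.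
    by rewrite addrC.
  move=> b; apply: le_trans (path_d k b) _; apply: le_trans EC2; rewrite lerD2r.
  exact: Psm_d.
- by move=> k kn; apply: path_x; exact: ltnW.
- by [].
- by [].
- by move=> k kn; exact: path_gap.
- split.
    by apply: le_trans (le_cabsB path_end_avg path_end_msc) Mi.
  move=> b; apply: le_trans (le_cabsB _ path_end_avg) (le_trans Mi _).
    by apply: path_end_Gq; rewrite nsq_ev.
  by move: C0i; lra.
- have h := gap_ge_Im (p (N ^ 6)); rewrite path_end in h.
  have h2 := le_cabsB path_end_avg path_end_msc.
  have h3 := msc_Im_ge0 (path_gt0 (N ^ 6)).
  apply: (@le_trans _ _ Mx); last first.
    by apply: le_trans h; rewrite lerDr mulr_ge0.
  apply: (@le_trans _ _ ((C^-1 / 16) * 2)); first by rewrite ler_wpM2r // (le_trans h2).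
  have : C^-1 <= 1 by rewrite invf_le1.
  by move: hM Cp; lra.
- move=> P0 [c1 _]; rewrite /x path0 in c1 *; split=> // a.
  by have := Psm_d (leq0n _) P0 a; rewrite path0.
Qed.

End SpectralPath.

(** * Weak law *)

(** Later y is a negative power of K and n3 is N^(-3). Thanks to 400 C <= K, one power of K absorbs
    all constants. *)
Lemma weak_numerics {R : realType} (C K y n3 : R) : 1 <= C -> 20 * 20 * C <= K -> 0 < y -> y * K <= 1 ->
  n3 <= y -> let E := y ^+ 2 in
  [/\ 16 * C ^+ 2 * E <= 1, 11 * Num.sqrt (2 * E) + n3 <= C^-1 / 16,
     4 * C * E + n3 <= C^-1 / 8, n3 <= Num.sqrt (2 * E) & 11 * Num.sqrt (2 * E) + 4 * C * E <= y * K].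
Proof.
move=> C1 CK y0 yK n3y E.
have C0 : 0 < C by exact: lt_le_trans C1.
have s0 : 0 <= Num.sqrt (2 * E) by exact: sqrtr_ge0.
have E0 : 0 <= E by exact: sqr_ge0.
have ss : Num.sqrt (2 * E) ^+ 2 = 2 * E by rewrite sqr_sqrtr // mulr_ge0.
have s1 : Num.sqrt (2 * E) <= 2 * y.
  by rewrite -(@ler_pXn2r _ 2) ?nnegrE ?mulr_ge0 ?(ltW y0) // ss exprMn /E; move: E0; rewrite /E; lra.
have s2 : y <= Num.sqrt (2 * E).
  by rewrite -(@ler_pXn2r _ 2) ?nnegrE ?(ltW y0) // ss -/E; move: E0; lra.
have Cy : 20 * (20 * (C * y)) <= 1.
  apply: le_trans yK; rewrite [y * K]mulrC; apply: le_trans (ler_wpM2r (ltW y0) CK).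
  by rewrite !mulrA.
have Cy0 : 0 <= C * y by rewrite mulr_ge0 // ltW.
have yC : 20 * (20 * y) <= C^-1.
  rewrite -[leRHS]mul1r ler_pdivlMr //; apply: le_trans Cy.
  by rewrite -[leLHS]mulrA -[20 * y * C]mulrA [y * C]mulrC.
have CE : 20 * (20 * (C * E)) <= y.
  have -> : 20 * (20 * (C * E)) = 20 * (20 * (C * y)) * y by rewrite /E; ring.
  by rewrite ler_piMl // ltW.
have yK4 : 20 * (20 * y) <= y * K.
  rewrite mulrA mulrC ler_wpM2l ?(ltW y0) //; apply: le_trans CK.
  by rewrite -[leLHS]mulr1 ler_wpM2l // mulr_ge0.
split.
- have -> : 16 * C ^+ 2 * E = 16 * (C * y) ^+ 2 by rewrite /E; ring.
  have : (C * y) ^+ 2 <= (4^-1) ^+ 2.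
    by apply: lerXn2r; rewrite ?nnegrE //; move: Cy Cy0; clear; lra.
  clear; lra.
- by move: s1 n3y yC; lra.
- have : 0 < C^-1 by rewrite invr_gt0.
  by move: CE n3y yC y0; lra.
- exact: le_trans s2.
- by move: s1 CE yK4 y0; lra.
Qed.

Section WeakLaw.
Context {R : realType} {C : R} {Cp : nat -> R}.
Local Notation CC := R[i].
Local Notation model := (@model R C Cp).
Variable om : R.
Hypotheses (C0 : 0 < C) (om0 : 0 < om) (om1 : om < 1).

(** Above the whole range of Im z in the claim, and high enough for [weak_stability] to start at the
    top. *)
Definition Mx : R := om^-1 + 32 * C + 4.
Definition c0 : R := om^-1 + Mx.
Definition dom (N : nat) (z : CC) : Prop :=
  [/\ `|complex.Re z| <= om^-1, N%:R `^ (-1 + om) <= complex.Im z & complex.Im z <= Mx].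
(** With this exponent rho <= K^(-200) on the domain, which outweighs every power of K lost in the
    weak law. *)
Definition wexp : R := om / 200.
Local Notation K N := ((N%:R : R) `^ wexp).
Let rho (N : nat) (z : CC) : R := (N%:R * complex.Im z)^-1.

Let oi : 1 <= om^-1. Proof. by rewrite invf_ge1 // ltW. Qed.
Let Mx1 : 5 <= Mx. Proof. by rewrite /Mx; move: oi C0; lra. Qed.
Let c01 : 6 <= c0. Proof. by rewrite /c0; move: oi Mx1; lra. Qed.
Let t0 : 0 < wexp. Proof. by rewrite divr_gt0. Qed.
Let t1 : wexp <= 10^-1. Proof. by rewrite /wexp; move: om1; lra. Qed.

Lemma powR_om N : N%:R `^ om = K N ^+ 200.
Proof. by rewrite powR_natX /wexp divfK. Qed.

Lemma dom_facts N z : (0 < N)%N -> dom N z ->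
  [/\ 0 < complex.Im z, 1 <= N%:R * complex.Im z, cabs z <= c0, complex.Im z <= c0 & rho N z * K N ^+ 200 <= 1].
Proof.
move=> N0 [d1 d2 d3]; have Np : 0 < N%:R :> R by rewrite ltr0n.
have e0 : 0 < complex.Im z by apply: lt_le_trans d2; rewrite powR_gt0.
have h : K N ^+ 200 <= N%:R * complex.Im z.
  rewrite -powR_om; apply: (@le_trans _ _ (N%:R * N%:R `^ (-1 + om))).
    rewrite -{2}[N%:R]powRr1 ?ler0n // -powRD ?(gt_eqF Np) ?implybT //.
    by rewrite addrA subrr add0r.
  by rewrite ler_pM2l.
have NI : 0 < N%:R * complex.Im z by rewrite mulr_gt0.
split=> //.
- by apply: le_trans h; rewrite exprn_ege1 // powR_nat_ge // ltW.
- apply: le_trans (cabs_le_ReIm _) _; rewrite (ger0_norm (ltW e0)); exact: lerD.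
- by apply: (le_trans d3); rewrite /c0; move: oi; lra.
- by rewrite /rho mulrC ler_pdivrMr // mul1r.
Qed.

Lemma dom_path N z k : (0 < N)%N -> dom N z -> (k <= N ^ 6)%N -> dom N (path_pt Mx N z k).
Proof.
move=> N0 dz kn; have [d1 d2 d3] := dz.
have [_ eN _ _ _] := dom_facts N0 dz.
have h := path_Im_max N0 d3 kn.
split; [exact: d1| |exact: h].
by apply: (le_trans d2); apply: path_ge.
Qed.

Lemma whp_path (Phi : forall N (M : model N), CC -> msp M -> Prop) :
  whp (I := fun=> CC) Phi ->
  whp (I := fun=> CC) (fun N M z w => forall k, (k <= N ^ 6)%N -> Phi N M (path_pt Mx N z k) w).
Proof.
move=> h.
have h1 := whp_sub (fun N (M : model N) (ij : CC * 'I_(N ^ 6).+1) => path_pt Mx N ij.1 ij.2) h.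
have hc N : (2 <= N)%N -> #|('I_(N ^ 6).+1 : finType)|%:R <= N%:R ^+ 7 :> R.
  move=> N2; rewrite card_ord -natrX ler_nat expnS.
  apply: (@leq_trans (2 * N ^ 6)); last by rewrite leq_mul2r N2 orbT.
  by rewrite mul2n -addnn -addn1 leq_add2l expn_gt0 (leq_trans _ N2).
have h2 := whp_all (I := fun=> CC) (J := fun N => 'I_(N ^ 6).+1 : finType) hc h1.
apply: (whp_mono (N1 := 0)) h2 => N _ M z w hk k kn.
by have := hk (Ordinal (kn : (k < (N ^ 6).+1)%N)).
Qed.

Definition close (e : nat -> R) (V : nat -> CC -> Prop) :=
  whp (C := C) (Cp := Cp) (I := fun N => (CC * ('cV[CC]_N * 'cV[CC]_N))%type)
  (fun N M i w => V N i.1 -> nsq i.2.1 <= 1 -> nsq i.2.2 <= 1 ->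
     cabs (Gq (mH w) i.1 i.2.1 i.2.2 - msc i.1 * cdot i.2.1 i.2.2) <= e N).

Definition bounded (b : nat -> R) (V : nat -> CC -> Prop) :=
  whp (C := C) (Cp := Cp) (I := fun N => (CC * ('cV[CC]_N * 'cV[CC]_N))%type)
  (fun N M i w => V N i.1 -> nsq i.2.1 <= 1 -> nsq i.2.2 <= 1 ->
     cabs (Gq (mH w) i.1 i.2.1 i.2.2) <= b N).

Lemma large_K : exists N0 : nat, forall N, (N0 <= N)%N ->
  [/\ (0 < N)%N, 20 * 20 * C <= K N, c0 <= K N, 20 <= K N & 8 * (c0 + 1) * Mx <= N%:R /\ K N ^+ 200 <= N%:R].
Proof.
have [n1 h1] := powR_ge_const (Num.max (20 * 20 * C) (Num.max c0 20)) t0.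
have [n2 h2] := powR_ge_const (8 * (c0 + 1) * Mx) (@ltr01 R).
exists (maxn (maxn n1 n2) 1) => N.
rewrite !geq_max => /andP[/andP[k1 k2] k3].
have := h1 N k1; rewrite !ge_max => /andP[g1 /andP[g2 g3]].
have := h2 N k2; rewrite powRr1 ?ler0n // => g4.
split=> //; split=> //; rewrite -powR_om -{2}[N%:R]powRr1 ?ler0n //.
by rewrite ler_powR ?ler1n // ltW.
Qed.

Lemma rho_small N z : (0 < N)%N -> dom N z -> c0 <= K N -> 1 <= K N ->
  Num.sqrt (c0 * rho N z) * K N ^+ 99 <= 1.
Proof.
move=> N0 dz cK K1; have [e0 _ _ _ h] := dom_facts N0 dz.
have Np : 0 < N%:R :> R by rewrite ltr0n.
have r0 : 0 <= rho N z by rewrite invr_ge0 mulr_ge0 ?(ltW Np) ?(ltW e0).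
have c00 : 0 <= c0 by move: c01; lra.
rewrite -(@ler_pXn2r _ 2) ?nnegrE ?mulr_ge0 ?exprn_ge0 ?powR_ge0 ?sqrtr_ge0 // expr1n.
rewrite exprMn sqr_sqrtr ?mulr_ge0 // -exprM.
apply: le_trans h; rewrite -mulrA mulrCA ler_wpM2l //.
rewrite [K N ^+ 200](exprD _ 2 198) ler_wpM2r ?exprn_ge0 ?powR_ge0 //.
by apply: (le_trans cK); rewrite expr2 ler_peMl // powR_ge0.
Qed.

(** V contains the path above each of its points because the stability argument starts at the top.
    Im G is bounded crudely here, by the constant choice [Om = c0]. *)
Theorem close_of_bounded (V : nat -> CC -> Prop) :
  (forall N z, V N z -> dom N z) ->
  (forall N z k, (0 < N)%N -> V N z -> (k <= N ^ 6)%N -> V N (path_pt Mx N z k)) ->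
  bounded (fun N => K N) V -> close (fun N => K N ^- 10) V.
Proof.
move=> Vd Vp hG; have [N0 hN0] := large_K.
have HV N z : (N0 <= N)%N -> V N z ->
    [/\ 0 < complex.Im z, 1 <= N%:R * complex.Im z, cabs z <= c0, complex.Im z <= c0 & c0 <= c0].
  move=> n0 Vz; have [N0' _ _ _ _] := hN0 N n0.
  by have [? ? ? ? _] := dom_facts N0' (Vd _ _ Vz).
have hIm : whp (C := C) (Cp := Cp) (I := fun N => (CC * 'cV[CC]_N)%type)
    (fun N M i w => V N i.1 -> nsq i.2 <= 1 -> complex.Im (Gq (mH w) i.1 i.2 i.2) <= K N * c0).
  have h := whp_sub (fun N (M : model N) (i : CC * 'cV[CC]_N) => (i.1, (i.2, i.2))) hG.
  apply: (whp_mono (N1 := 0)) h => N _ M [z v] w /= h Vz hv.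
  apply: le_trans (ler_norm _) _; apply: le_trans (Im_le_cabs _) _; apply: le_trans (h Vz hv hv) _.
  by rewrite ler_peMr ?powR_ge0 //; move: c01; lra.
have c00 : 0 <= c0 by move: c01; lra.
have hd := whp_path (diag_step C0 t0 t1 HV hG hIm).
have hg : whp (C := C) (Cp := Cp) (I := fun=> CC) (fun N M z w => V N z ->
     forall a, cabs (gdiag z (mH w) a - msc z) <= K N ^- 24).
  apply: (whp_mono (N1 := N0)) hd => N n0 M z w h Vz a.
  have [N0' CK cK K4 [hN KN]] := hN0 N n0.
  have K1 : 1 <= K N by move: K4; lra.
  have K0 : 0 < K N by exact: lt_le_trans K1.
  have [C1 S0 S1 S2 S3] := model_S C0 M N0'.
  have [e0 eN _ _ _] := dom_facts N0' (Vd _ _ Vz).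
  have [_ _ eM] := Vd _ _ Vz.
  have Np : 0 < N%:R :> R by rewrite ltr0n.
  (* The diagonal equation holds up to K^(32 - 99) <= y^2. Stability takes a square root and one K
     absorbs constants; K^(-24) then beats the K^12 of [iso_step]. *)
  pose y := K N ^- 25.
  have y0 : 0 < y by rewrite invr_gt0 exprn_gt0.
  have yK : y * K N = K N ^- 24 by rewrite /y exprSr invfM -mulrA mulVf ?mulr1 // gt_eqF.
  have yK1 : y * K N <= 1 by rewrite yK invf_le1 ?exprn_gt0 // exprn_ege1.
  have n3y : N%:R ^- 3 <= y.
    rewrite lef_pV2 ?posrE ?exprn_gt0 //; apply: (@le_trans _ _ N%:R).
      by apply: le_trans KN; rewrite ler_weXn2l.
    by rewrite -{1}[N%:R]expr1 ler_weXn2l // ler1n.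
  have [q1 q2 q3 q4 q5] := weak_numerics C1 CK y0 yK1 n3y.
  have pc k : (k <= N ^ 6)%N -> cabs (path_pt Mx N z k) <= c0.
    by move=> kn; have [] := dom_facts N0' (Vd _ _ (Vp _ _ _ N0' Vz kn)).
  have MxC : 32 * C + 4 <= Mx by rewrite /Mx; move: oi; lra.
  have Slow q : (C * N%:R)^-1 <= Sv (mP M) (mH (m := M)) q by have /andP[] := S0 q.
  have hPi k : (k <= N ^ 6)%N -> forall a, cabs (1 + path_pt Mx N z k * gdiag (path_pt Mx N z k) (mH w) a +
      Sdiag (path_pt Mx N z k) (Sv (mP M) (mH (m := M))) (mH w) a * gdiag (path_pt Mx N z k) (mH w) a) <= y ^+ 2.
    move=> kn b; have Vk := Vp _ _ _ N0' Vz kn.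
    apply: le_trans (h k kn Vk b) _.
    have := rho_small N0' (Vd _ _ Vk) cK K1; set s := Num.sqrt _ => hs.
    rewrite /y -exprVn -exprM exprVn -[leRHS]mul1r ler_pdivlMr ?exprn_gt0 //.
    apply: le_trans hs; rewrite mulrAC -exprD mulrC ler_wpM2l ?sqrtr_ge0 //.
    by rewrite ler_weXn2l.
  have [w1 w2] := weak_stability (wigner_herm (mW M) w) N0' hN c00 eN eM pc C1 Slow S2 S3 MxC
    (exprn_gt0 2 y0) q1 q2 q3 q4 hPi.
  rewrite -yK; apply: le_trans q5.
  have e : gdiag z (mH w) a - msc z = (gdiag z (mH w) a - avg z (mH w)) + (avg z (mH w) - msc z).
    by rewrite addrA subrK.
  rewrite e addrC; exact: le_cabsD.
have hi := iso_step C0 t0 t1 HV hG hIm (phi := fun N _ => K N ^- 24) (fun N z => _) hg.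
apply: (whp_mono (N1 := N0)) (hi _) => [|N z]; last by rewrite invr_ge0 exprn_ge0 // powR_ge0.
move=> N n0 M [z [v v']] w /= h Vz hv hv'.
have [N0' CK cK K4 [hN KN]] := hN0 N n0.
have K1 : 1 <= K N by move: K4; lra.
have K0 : 0 < K N by exact: lt_le_trans K1.
apply: le_trans (h Vz hv hv') _.
have := rho_small N0' (Vd _ _ Vz) cK K1; set s := Num.sqrt _ => hs.
have s24 : s <= K N ^- 24.
  rewrite -[leRHS]mul1r ler_pdivlMr ?exprn_gt0 //; apply: le_trans hs.
  by rewrite ler_wpM2l ?sqrtr_ge0 // ler_weXn2l.
apply: (@le_trans _ _ (K N ^+ 12 * (2 * K N ^- 24))).
  by rewrite ler_wpM2l ?exprn_ge0 ?(ltW K0) //; move: s24; lra.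
have -> : K N ^+ 12 * (2 * K N ^- 24) = 2 * K N ^- 12 by field; rewrite gt_eqF.
have -> : K N ^- 10 = K N ^+ 2 * K N ^- 12 by field; rewrite gt_eqF.
rewrite ler_wpM2r ?invr_ge0 ?exprn_ge0 ?(ltW K0) // expr2.
by apply: (@le_trans _ _ (K N)); [move: K4; lra|rewrite ler_peMl // ltW].
Qed.

Let tau' : R := wexp / 2.
Let Vs s N z := dom N z /\ N%:R `^ (- (tau' * s%:R)) <= complex.Im z.

(** Lowering Im z by the factor L = N^tau' turns the bound 2 into at most 2 L <= L^2 = K, by
    [Im_Gq_mono] and [Gq_diff_le]; [close_of_bounded] then restores the bound 2. So nothing
    deteriorates from scale to scale. *)
Lemma bounded_scale (s : nat) : bounded (fun=> 2) (Vs s).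
Proof.
have t'0 : 0 < tau' by rewrite divr_gt0.
have [N0 hN0] := large_K.
elim: s => [|s IH].
  apply: (whp_det (N1 := 1)) => N N1 M [z [v v']] w /= [dz]; rewrite mulr0 oppr0 powRr0 => z1 hv hv'.
  have [e0 _ _ _ _] := dom_facts N1 dz.
  apply: le_trans (Gq_le_eta v v' (wigner_herm (mW M) w) e0) _.
  rewrite ler_pdivrMr //; apply: (@le_trans _ _ (1 * 1)); last by move: z1; lra.
  by apply: ler_pM; rewrite ?sqrtr_ge0 ?sqrt_nsq_le1.
(* One scale up, but not beyond the top of the domain. *)
pose up N (z : CC) := Complex (complex.Re z) (Num.min Mx (N%:R `^ tau' * complex.Im z)).
have hup : bounded (fun N => K N) (Vs s.+1).
  have h1 := whp_sub (fun N (M : model N) (i : CC * ('cV[CC]_N * 'cV[CC]_N)) => (up N i.1, (i.2.1, i.2.1))) IH.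
  have h2 := whp_sub (fun N (M : model N) (i : CC * ('cV[CC]_N * 'cV[CC]_N)) => (up N i.1, (i.2.2, i.2.2))) IH.
  have h3 := whp_sub (fun N (M : model N) (i : CC * ('cV[CC]_N * 'cV[CC]_N)) => (up N i.1, i.2)) IH.
  apply: (whp_mono (N1 := N0)) (whp_and h1 (whp_and h2 h3)) => N n0 M [z [v v']] w /= [g1 [g2 g3]] [dz zs] hv hv'.
  have [N0' CK cK K4 [hN KN]] := hN0 N n0.
  have [e0 eN _ _ _] := dom_facts N0' dz.
  have [d1 d2 d3] := dz.
  set L := N%:R `^ tau'.
  have L0 : 0 <= L by exact: powR_ge0.
  have LK : L ^+ 2 = K N by rewrite powR_natX /tau' divfK.
  have L2 : 2 <= L.
    by rewrite -(@ler_pXn2r _ 2) ?nnegrE // LK; move: K4; lra.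
  have L1 : 1 <= L by move: L2; lra.
  set e' := Num.min Mx (L * complex.Im z).
  have ee : complex.Im z <= e' by rewrite le_min d3 ler_peMl // ltW.
  have eL : e' <= L * complex.Im z by rewrite ge_min lexx orbT.
  have Vu : Vs s N (up N z).
    split; first by split=> //=; [exact: le_trans ee|rewrite ge_min lexx].
    rewrite /= le_min; apply/andP; split.
      apply: (@le_trans _ _ 1); last by apply: le_trans Mx1; rewrite ler1n.
      have h0 : - (tau' * s%:R) <= 0 by rewrite oppr_le0 mulr_ge0 // ltW.
      have : N%:R `^ (- (tau' * s%:R)) <= N%:R `^ 0 :> R by rewrite ler_powR // ler1n.
      by rewrite powRr0.
    apply: le_trans (_ : L * N%:R `^ (- (tau' * s.+1%:R)) <= _); last by rewrite ler_wpM2l.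
    rewrite /L -powRD; last by rewrite pnatr_eq0 -lt0n N0' implybT.
    rewrite ler_powR ?ler1n // -natr1; lra.
  have e'0 : 0 < e' by exact: lt_le_trans ee.
  have hX := wigner_herm (mW M) w.
  have hz : z = Complex (complex.Re z) (complex.Im z) by case: (z).
  have b2 : complex.Im (Gq (mH w) (up N z) v' v') <= 2.
    by apply: le_trans (ler_norm _) _; apply: le_trans (Im_le_cabs _) _; exact: g2.
  have b1 : complex.Im z * complex.Im (Gq (mH w) z v v) <= e' * 2.
    rewrite {2}hz; apply: le_trans (Im_Gq_mono (complex.Re z) v hX e0 ee) _.
    rewrite ler_wpM2l ?(ltW e'0) //.
    by apply: le_trans (ler_norm _) _; apply: le_trans (Im_le_cabs _) _; exact: g1.
  have hd := Gq_diff_le v v' hX e0 (e'0 : 0 < complex.Im (up N z)).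
  have dz' : cabs (z - up N z) = e' - complex.Im z.
    have -> : z - up N z = 'i%C * (- (e' - complex.Im z))%:C%C.
      by apply: complex_eq; rewrite ?cReD ?cReN ?cImD ?cImN ?cReM ?cImM /= -/L -/e'; ring.
    have ci : cabs ('i%C : CC) = 1.
      by apply: (pexpIrn (n := 2)); rewrite ?nnegrE ?cabs_ge0 // cabs_sqr /=; ring.
    by rewrite cabsM ci mul1r cabs_real normrN ger0_norm // subr_ge0.
  rewrite dz' /= in hd.
  have I1 : 0 <= complex.Im (Gq (mH w) z v v) / complex.Im z.
    by rewrite divr_ge0 ?(ltW e0) // Im_Gq ?gt_eqF // mulr_ge0 ?nsq_ge0 // ltW.
  have hs : Num.sqrt (complex.Im (Gq (mH w) z v v) / complex.Im z) *
      Num.sqrt (complex.Im (Gq (mH w) (up N z) v' v') / e') <= 2 / complex.Im z.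
    rewrite -sqrtrM //.
    have -> : 2 / complex.Im z = Num.sqrt ((2 / complex.Im z) ^+ 2).
      by rewrite sqrtr_sqr ger0_norm // divr_ge0 // ltW.
    apply: ler_wsqrtr.
    apply: (@le_trans _ _ ((e' * 2) / complex.Im z ^+ 2 * (2 / e'))).
      apply: ler_pM => //.
      - by rewrite divr_ge0 ?(ltW e'0) // Im_Gq ?gt_eqF // mulr_ge0 ?nsq_ge0 // ltW.
      - by rewrite ler_pdivlMr ?exprn_gt0 // expr2 mulrA divfK ?gt_eqF // mulrC.
      - by rewrite ler_pM2r ?invr_gt0.
    rewrite le_eqVlt; apply/orP; left; apply/eqP; field; by rewrite !gt_eqF.
  have hb := g3 Vu hv hv'.
  rewrite -[Gq (mH w) z v v'](subrK (Gq (mH w) (up N z) v v')).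
  apply: le_trans (le_cabsD hd hb) _.
  apply: (@le_trans _ _ ((L - 1) * complex.Im z * (2 / complex.Im z) + 2)).
    rewrite lerD2r; apply: ler_pM; rewrite ?mulr_ge0 ?sqrtr_ge0 ?subr_ge0 //.
    by rewrite mulrBl mul1r lerD2r.
  have -> : (L - 1) * complex.Im z * (2 / complex.Im z) = (L - 1) * 2 by field; rewrite gt_eqF.
  have : 2 * L <= L ^+ 2 by rewrite expr2 ler_wpM2r.
  by rewrite LK mulrBl mul1r subrK mulrC.
have hc : close (fun N => K N ^- 10) (Vs s.+1).
  apply: close_of_bounded hup; first by move=> N z [].
  move=> N z k N0' [dz zs] kn; split; first exact: dom_path.
  by apply: (le_trans zs); apply: path_ge => //; have [] := dz.
apply: (whp_mono (N1 := N0)) hc => N n0 M [z [v v']] w /= h Vz hv hv'.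
have [N0' CK cK K4 [hN KN]] := hN0 N n0.
have [e0 _ _ _ _] := dom_facts N0' (let: conj d _ := Vz in d).
have K1 : 1 <= K N by move: K4; lra.
rewrite -[Gq (mH w) z v v'](subrK (msc z * cdot v v')).
apply: le_trans (le_cabsD (h Vz hv hv') (le_cabsM (msc_le1 e0) (cdot_le v v'))) _.
have : Num.sqrt (nsq v) * Num.sqrt (nsq v') <= 1 * 1.
  by apply: ler_pM; rewrite ?sqrtr_ge0 ?sqrt_nsq_le1.
have : K N ^- 10 <= 1 by rewrite invf_le1 ?exprn_gt0 ?exprn_ege1 // (lt_le_trans ltr01).
by lra.
Qed.

Theorem weak_law : bounded (fun=> 2) dom /\ close (fun N => K N ^- 10) dom.
Proof.
have t'0 : 0 < tau' by rewrite divr_gt0.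
(* Im z >= 1/N on the domain, so s >= 1 / tau' scales cover it, a number independent of N. *)
have [s hs] := exists_nat_ge (tau'^-1 : R).
have hb : bounded (fun=> 2) dom.
  apply: (whp_mono (N1 := 1)) (bounded_scale s) => N N1 M i w h dz; apply: h; split=> //.
  have [_ d2 _] := dz; apply: le_trans d2; rewrite ler_powR ?ler1n //.
  have : 1 <= tau' * s%:R by rewrite mulrC -ler_pdivrMr // mul1r.
  by move: om0; lra.
split=> //; apply: close_of_bounded => //; first by move=> N z k; exact: dom_path.
have [N0 hN0] := large_K.
apply: (whp_mono (N1 := N0)) hb => N n0 M i w h dz hv hv'.
have [_ _ _ K4 _] := hN0 N n0.
by apply: le_trans (h dz hv hv') _; move: K4; lra.
Qed.

End WeakLaw.

(** * Strong law *)

(** If B <= r, then del is of order r rho. If B > r and the roots are apart, 2 del / B is of order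
    rho; if they are not, B^2 <= 100 del forces B and sqrt(del) down to order rho. Finally rho <=
    sqrt(r rho). *)
Lemma root_bound {R : realType} (X B A r rho : R) : 0 <= X -> 0 <= B -> 1 <= A -> 0 < rho -> rho <= r ->
  let del := A * ((B + r) * rho) in
  X <= 11 * Num.sqrt del -> (100 * del < B ^+ 2 -> X * B <= 2 * del) ->
  X <= 20 * (20 * (A * Num.sqrt (r * rho))).
Proof.
move=> X0 B0 A1 rho0 rr del h1 h2.
have A0 : 0 < A by exact: lt_le_trans A1.
have r0 : 0 < r by exact: lt_le_trans rr.
set s := Num.sqrt (r * rho).
have s0 : 0 <= s by exact: sqrtr_ge0.
have ss : s ^+ 2 = r * rho by rewrite sqr_sqrtr // mulr_ge0 // ltW.
have sr : rho <= s.
  by rewrite -(@ler_pXn2r _ 2) ?nnegrE ?(ltW rho0) // ss expr2 ler_pM2r.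
have As : A * rho <= A * s by rewrite ler_pM2l.
have As0 : 0 <= A * s by rewrite mulr_ge0 // ltW.
have As1 : 0 < A * rho by rewrite mulr_gt0.
have sq (y : R) : 0 <= y -> del <= y ^+ 2 -> Num.sqrt del <= y.
  by move=> y0 h; rewrite -(ger0_norm y0) -sqrtr_sqr ler_wsqrtr.
have [Br|Br] := leP B r.
  have : Num.sqrt del <= 2 * (A * s).
    apply: sq; first by rewrite mulr_ge0.
    have -> : (2 * (A * s)) ^+ 2 = A * (4 * A * s ^+ 2) by ring.
    rewrite /del ler_pM2l // ss.
    have : (B + r) * rho <= 2 * (r * rho).
      by rewrite mulrA ler_pM2r //; move: Br; clear; lra.
    have : 1 * (r * rho) <= A * (r * rho) by rewrite ler_pM2r // mulr_gt0.
    move: (mulr_gt0 r0 rho0); clear; nra.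
  by move: h1 As0; clear; lra.
have Bp : 0 < B by exact: lt_trans Br.
have dB : del <= 2 * (A * rho) * B.
  have -> : 2 * (A * rho) * B = A * ((B + B) * rho) by ring.
  by rewrite /del ler_pM2l // ler_pM2r // lerD2l ltW.
have [hB|hB] := ltP (100 * del) (B ^+ 2).
  have : X * B <= 4 * (A * rho) * B by apply: le_trans (h2 hB) _; move: dB; clear; lra.
  by rewrite ler_pM2r // => h; move: h As As0; clear; lra.
have hB2 : B <= 100 * (2 * (A * rho)).
  rewrite -(ler_pM2r Bp) -expr2; apply: (le_trans hB).
  by rewrite -[leRHS]mulrA ler_wpM2l.
have : Num.sqrt del <= 20 * (A * rho).
  apply: sq; first by rewrite mulr_ge0 // ltW.
  apply: (le_trans dB).
  have -> : (20 * (A * rho)) ^+ 2 = 2 * (A * rho) * (100 * (2 * (A * rho))) by ring.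
  by rewrite ler_pM2l ?mulr_gt0.
by move: h1 As As0; clear; lra.
Qed.

Lemma sqrtrD_le {R : realType} (x y : R) : 0 <= x -> 0 <= y -> Num.sqrt (x + y) <= Num.sqrt x + Num.sqrt y.
Proof.
move=> x0 y0; rewrite -(@ler_pXn2r _ 2) ?nnegrE ?addr_ge0 ?sqrtr_ge0 //.
rewrite sqrrD !sqr_sqrtr ?addr_ge0 // lerD2r lerDl.
by rewrite mulrn_wge0 // mulr_ge0 ?sqrtr_ge0.
Qed.

Lemma sqrtrM_le {R : realType} (x y : R) : 0 <= x -> 0 <= y -> Num.sqrt (x * y) <= x + y.
Proof.
move=> x0 y0; have h0 : 0 <= x + y by rewrite addr_ge0.
rewrite -(ger0_norm h0) -sqrtr_sqr ler_wsqrtr // sqrrD.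
have := mulr_ge0 x0 y0; have := sqr_ge0 x; have := sqr_ge0 y; lra.
Qed.

Lemma avg_sub {R : realType} {N : nat} (z m : R[i]) (X : 'M[R[i]]_N) : (0 < N)%N ->
  avg z X - m = ((N%:R : R)^-1)%:C%C * \sum_a (gdiag z X a - m).
Proof.
move=> N0; rewrite sumrB mulrBr /avg sumr_const card_ord -[m *+ N]mulr_natl mulrA.
rewrite -(rmorph_nat (real_complex R)) -(rmorphM (real_complex R)) /= mulVf ?pnatr_eq0 -?lt0n //.
by rewrite (rmorph1 (real_complex R)) mul1r.
Qed.

Section StrongLaw.
Context {R : realType} {C : R} {Cp : nat -> R}.
Local Notation CC := R[i].
Local Notation model := (@model R C Cp).
Variable om : R.
Hypotheses (C0 : 0 < C) (om0 : 0 < om) (om1 : om < 1).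
Local Notation Mx := (@Mx R C om).
Local Notation c0 := (@c0 R C om).
Local Notation dom := (@dom R C om).

Definition rho (N : nat) (z : CC) : R := (N%:R * complex.Im z)^-1.
Definition wave (N : nat) (z : CC) : R := Num.sqrt (complex.Im (msc z) * rho N z).

(** r is the part of the error still to be improved; [wave] has its final form from the
    beginning. *)
Definition isolaw (r : nat -> CC -> R) := forall t : R, 0 < t ->
  whp (C := C) (Cp := Cp) (I := fun N => (CC * ('cV[CC]_N * 'cV[CC]_N))%type)
  (fun N M i w => dom N i.1 -> nsq i.2.1 <= 1 -> nsq i.2.2 <= 1 ->
     cabs (Gq (mH w) i.1 i.2.1 i.2.2 - msc i.1 * cdot i.2.1 i.2.2) <= N%:R `^ t * (wave N i.1 + r N i.1)).

Let oi : 1 <= om^-1. Proof. by rewrite invf_ge1 // ltW. Qed.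
Let Mx5 : 5 <= Mx. Proof. by rewrite /Mx; move: oi C0; lra. Qed.
Let c06 : 6 <= c0. Proof. by rewrite /c0; move: oi Mx5; lra. Qed.
(** The constant of [msc_Im_ge], by which Im z <= c1 Im m on the domain and [Om] dominates Im z. *)
Let c1 : R := (c0 + 1) ^+ 2.
Let c1_ge : 2 <= c1 /\ 1 <= c1.
Proof.
have : 1 <= c0 + 1 by move: c06; lra.
move=> h; have : 1 * (c0 + 1) <= (c0 + 1) * (c0 + 1) by rewrite ler_wpM2r //; move: c06; lra.
by rewrite /c1 expr2; move: c06; split; lra.
Qed.
Let c3 : R := c1 * (c0 + 3).

Lemma rho_facts N z : (0 < N)%N -> dom N z -> 0 < rho N z /\ rho N z <= 1.
Proof.
move=> N0 dz; have [e0 eN _ _ _] := dom_facts om0 om1 N0 dz.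
have h : 0 < N%:R * complex.Im z by exact: lt_le_trans eN.
by rewrite /rho invr_gt0 invf_le1.
Qed.

Lemma rho_anti N (z z' : CC) : (0 < N)%N -> 0 < complex.Im z -> complex.Im z <= complex.Im z' -> rho N z' <= rho N z.
Proof.
move=> N0 e0 ee; have Np : 0 < N%:R :> R by rewrite ltr0n.
by rewrite /rho lef_pV2 ?posrE ?mulr_gt0 ?(lt_le_trans e0 ee) // ler_pM2l.
Qed.

Lemma wave_le N z : (0 < N)%N -> dom N z -> wave N z <= complex.Im (msc z) + rho N z.
Proof.
move=> N0 dz; have [r0 _] := rho_facts N0 dz.
have [e0 _ _ _ _] := dom_facts om0 om1 N0 dz; have m0 := msc_Im_ge0 e0.
apply: sqrtrM_le => //; exact: ltW.
Qed.

Section Step.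
Variable r : nat -> CC -> R.
Hypothesis hr : forall N z, (0 < N)%N -> dom N z -> rho N z <= r N z /\ r N z <= 1.
Hypothesis ra : forall N z z', (0 < N)%N -> dom N z -> dom N z' -> complex.Re z = complex.Re z' ->
  complex.Im z <= complex.Im z' -> r N z' <= r N z.
Hypothesis hJ : isolaw r.

Variable tau : R.
Hypotheses (tau0 : 0 < tau) (tau1 : tau * 33%:R <= 10^-1).
(** [hdev] loses K^33, and N^tau2 = K^33 takes the role of K in [avg_step]; hence the condition on
    33 tau. *)
Let tau2 : R := tau * 33%:R.
Local Notation K N := ((N%:R : R) `^ tau).
Local Notation L N := ((N%:R : R) `^ tau2).
(** The known error r enters twice: in [Om] it bounds Im G through the current law, and in [La] it
    bounds the distance of z + 2 u from 2 m + z. *)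
Let Om N z : R := c1 * (complex.Im (msc z) + r N z).
Let La N z : R := c1 * (gap z + r N z).
Let Psi0 N z := Num.sqrt (Om N z * rho N z).
Let F N z := wave N z + Num.sqrt (r N z * rho N z).

Let tau20 : 0 < tau2. Proof. by rewrite mulr_gt0. Qed.
Let tau11 : tau <= 10^-1.
Proof. by apply: le_trans tau1; rewrite ler_peMr ?(ltW tau0) // ler1n. Qed.
Let KL N : L N = K N ^+ 33. Proof. by rewrite powR_natX. Qed.

Let step_facts N z : (0 < N)%N -> dom N z ->
  [/\ 0 < complex.Im z, 0 <= complex.Im (msc z) & 0 < r N z] /\
  [/\ complex.Im z <= Om N z, Om N z <= La N z, La N z <= c3, cabs z <= c3 & 2 * complex.Im (msc z) <= gap z].
Proof.
move=> N0 dz; have [e0 eN zc _ _] := dom_facts om0 om1 N0 dz.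
have [h1 h2] := hr N0 dz; have [p0 _] := rho_facts N0 dz.
have [c1a c1b] := c1_ge.
have m0 := msc_Im_ge0 e0; have g1 := gap_ge_Im z; have g2 := gap_le e0.
have r0 : 0 < r N z by exact: lt_le_trans h1.
have c10 : 0 <= c1 by move: c1b; lra.
split; split=> //.
- apply: le_trans (msc_Im_ge e0) _; apply: (@le_trans _ _ (c1 * complex.Im (msc z))).
    have a0 : 0 <= cabs z + 1 by rewrite addr_ge0 ?cabs_ge0.
    have b0 : 0 <= c0 + 1 by move: c06; lra.
    by rewrite ler_wpM2r // lerXn2r // lerD2r.
  by rewrite ler_wpM2l // lerDl ltW.
- by rewrite ler_wpM2l // lerD2r; move: g1 e0 m0; lra.
- by rewrite ler_wpM2l //; move: g2 zc h2; lra.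
- apply: (le_trans zc); apply: (@le_trans _ _ (1 * (c0 + 3))); first by move: c06; lra.
  by rewrite ler_wpM2r //; move: c06; lra.
- by move: g1 e0; lra.
Qed.

Let large : exists N0 : nat, forall N, (N0 <= N)%N ->
  [/\ (0 < N)%N, 20 <= K N, 4 * C <= K N, c1 <= K N & 8 * (c0 + 1) * Mx <= N%:R].
Proof.
have [n1 h1] := powR_ge_const (Num.max 20 (Num.max (4 * C) c1)) tau0.
have [n2 h2] := powR_ge_const (8 * (c0 + 1) * Mx) (@ltr01 R).
exists (maxn (maxn n1 n2) 1) => N.
rewrite !geq_max => /andP[/andP[k1 k2] k3].
have := h1 N k1; rewrite !ge_max => /andP[g1 /andP[g2 g3]].
by have := h2 N k2; rewrite powRr1 ?ler0n.
Qed.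

Let HV N z : (1 <= N)%N -> dom N z ->
  [/\ 0 < complex.Im z, 1 <= N%:R * complex.Im z, cabs z <= c3, complex.Im z <= Om N z & Om N z <= c3].
Proof.
move=> N0 dz; have [e0 eN _ _ _] := dom_facts om0 om1 N0 dz.
have [_ [h1 h2 h3 h4 _]] := step_facts N0 dz.
by split=> //; exact: le_trans h3.
Qed.

Let HLa N z : (1 <= N)%N -> dom N z -> Om N z <= La N z <= c3.
Proof. by move=> N0 dz; have [_ [_ h1 h2 _ _]] := step_facts N0 dz; rewrite h1. Qed.

Let hG : whp (C := C) (Cp := Cp) (I := fun N => (CC * ('cV[CC]_N * 'cV[CC]_N))%type)
  (fun N M i w => dom N i.1 -> nsq i.2.1 <= 1 -> nsq i.2.2 <= 1 ->
     cabs (Gq (mH w) i.1 i.2.1 i.2.2) <= K N).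
Proof.
have [hb _] := weak_law (Cp := Cp) C0 om0 om1; have [N0 hN0] := large.
apply: (whp_mono (N1 := N0)) hb => N n0 M i w h dz h1 h2.
have [_ K20 _ _ _] := hN0 N n0.
by apply: le_trans (h dz h1 h2) _; apply: le_trans K20; rewrite ler_nat.
Qed.

(** The law with error r bounds Im G_vv by Im m + r up to K, since [wave] is at most Im m + rho and
    rho <= r. Feeding this back into the Ward identity is what improves r. *)
Let hIm : whp (C := C) (Cp := Cp) (I := fun N => (CC * 'cV[CC]_N)%type)
  (fun N M i w => dom N i.1 -> nsq i.2 <= 1 ->
     complex.Im (Gq (mH w) i.1 i.2 i.2) <= K N * Om N i.1).
Proof.
have [N0 hN0] := large.
have h := whp_sub (fun N (M : model N) (i : CC * 'cV[CC]_N) => (i.1, (i.2, i.2))) (hJ tau0).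
apply: (whp_mono (N1 := N0)) h => N n0 M [z v] w /= h dz hv.
have [N0' K20 _ _ _] := hN0 N n0.
have := h dz hv hv; set X := Gq _ _ _ _ => hX.
have [[e0 m0 r0] _] := step_facts N0' dz.
have -> : X = (X - msc z * cdot v v) + msc z * cdot v v by rewrite subrK.
rewrite cImD cdot_nsq cImM /= mulr0 add0r.
have wl := wave_le N0' dz; have [rl _] := hr N0' dz; have [c1a _] := c1_ge.
have a1 : complex.Im (X - msc z * cdot v v) <= K N * (complex.Im (msc z) + r N z + r N z).
  apply: le_trans (ler_norm _) _; apply: le_trans (Im_le_cabs _) _; apply: (le_trans hX).
  by rewrite ler_wpM2l ?powR_ge0 // lerD2r (le_trans wl) // lerD2l.
have a2 : complex.Im (msc z) * nsq v <= complex.Im (msc z) by rewrite ler_piMr.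
rewrite cdot_nsq in a1; apply: le_trans (lerD a1 a2) _.
have K1 : 1 <= K N by apply: le_trans K20; rewrite ler1n.
apply: (@le_trans _ _ (K N * (2 * (complex.Im (msc z) + r N z)))).
  have : 1 * complex.Im (msc z) <= K N * complex.Im (msc z) by rewrite ler_wpM2r.
  rewrite !mulrDr; lra.
rewrite ler_wpM2l ?powR_ge0 // ler_wpM2r // addr_ge0 // ltW //.
Qed.

(** The weak law provides, at every point of the domain, the smallness that [diag_stability]
    assumes. *)
Let hsmall : whp (C := C) (Cp := Cp) (I := fun=> CC) (fun N M z w => dom N z ->
  forall a, cabs (gdiag z (mH w) a - msc z) <= C^-1 / 16).
Proof.
have [_ hb] := weak_law (Cp := Cp) C0 om0 om1.
have t10 : 0 < wexp om * 10%:R by rewrite mulr_gt0 ?divr_gt0.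
have [N0 hN0] := powR_ge_const (16 * C) t10.
have h := whp_sub (fun N (M : model N) (i : CC * 'I_N) => (i.1, (ev i.2 : 'cV[CC]_N, ev i.2 : 'cV[CC]_N))) hb.
have hc N : (0 <= N)%N -> #|('I_N : finType)|%:R <= N%:R ^+ 1 :> R by rewrite card_ord expr1.
have h1 := whp_all (I := fun=> CC) (J := fun N => 'I_N : finType) hc h.
apply: (whp_mono (N1 := N0.+1)) h1 => N n0 M z w h2 dz a.
have := h2 a dz; rewrite /= !nsq_ev => /(_ (lexx _) (lexx _)).
rewrite cdot_nsq nsq_ev (rmorph1 (real_complex R)) mulr1.
move/le_trans; apply; rewrite powR_natX.
have -> : C^-1 / 16 = (16 * C)^-1 by rewrite invfM mulrC.
have Np : 0 < N%:R :> R by rewrite ltr0n (leq_trans _ n0).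
by rewrite lef_pV2 ?posrE ?powR_gt0 ?mulr_gt0 // hN0 // ltnW.
Qed.

Let hdev : whp (C := C) (Cp := Cp) (I := fun=> CC) (fun N M z w => dom N z ->
  (forall a, cabs (gdiag z (mH w) a - avg z (mH w)) <= L N * Psi0 N z) /\
  cabs (z + 2 * avg z (mH w)) <= L N * La N z).
Proof.
have [N0 hN0] := large.
have hd := diag_step C0 tau0 tau11 HV hG hIm.
have h := whp_sub (fun N (M : model N) (i : CC * 'I_N) => (i.1, (ev i.2 : 'cV[CC]_N, ev i.2 : 'cV[CC]_N))) (hJ tau0).
have hc N : (0 <= N)%N -> #|('I_N : finType)|%:R <= N%:R ^+ 1 :> R by rewrite card_ord expr1.
have h1 := whp_all (I := fun=> CC) (J := fun N => 'I_N : finType) hc h.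
apply: (whp_mono (N1 := N0)) (whp_and hsmall (whp_and hd h1)) => N n0 M z w [g1 [g2 g3]] dz.
have [N0' K20 KC Kc _] := hN0 N n0.
have K1 : 1 <= K N by apply: le_trans K20; rewrite ler1n.
have K0 : 0 < K N by exact: lt_le_trans K1.
have [C1 S0 S1 S2 S3] := model_S C0 M N0'.
have [[e0 m0 r0] [_ _ _ _ gm]] := step_facts N0' dz.
have ci : 0 < C^-1 by rewrite invr_gt0.
have um : cabs (avg z (mH w) - msc z) <= C^-1 / 16.
  rewrite avg_sub //.
  by apply: r_sum_le => // a; exact: g1.
have um2 : cabs (avg z (mH w) - msc z) <= K N * (wave N z + r N z).
  rewrite avg_sub //.
  apply: r_sum_le => // a; have := g3 a dz; rewrite /= !nsq_ev => /(_ (lexx _) (lexx _)).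
  by rewrite cdot_nsq nsq_ev (rmorph1 (real_complex R)) mulr1.
split=> [a|].
  apply: (@le_trans _ _ (4 * C * (K N ^+ 32 * Psi0 N z))).
    apply: (diag_stability N0' C1 _ S2 S3 (g2 dz)).
    - by move=> q; have /andP[] := S0 q.
    - have e : z + msc z = (z + avg z (mH w)) - (avg z (mH w) - msc z) by rewrite opprB [msc z - _]addrC addrA addrK.
      have := ler_cabsB (z + avg z (mH w)) (avg z (mH w) - msc z); rewrite -e.
      by move: (msc_shift_ge1 e0) um; lra.
    - rewrite -[avg z (mH w)](subrK (msc z)) addrC; apply: le_cabsD um; exact: msc_le1.
    - move=> b; have e : gdiag z (mH w) b - avg z (mH w) = (gdiag z (mH w) b - msc z) - (avg z (mH w) - msc z).
        by rewrite opprB addrA subrK.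
      by rewrite e; apply: le_trans (le_cabsB (g1 dz b) um) _; lra.
  by rewrite KL [K N ^+ 33]exprS -[leRHS]mulrA ler_wpM2r // mulr_ge0 ?exprn_ge0 ?sqrtr_ge0 // ltW.
have e : z + 2 * avg z (mH w) = (2 * msc z + z) + 2 * (avg z (mH w) - msc z) by ring.
rewrite e; apply: (@le_trans _ _ (gap z + 2 * (K N * (wave N z + r N z)))).
  by apply: le_cabsD => //; apply: le_cabsM => //; rewrite cabs_nat.
have wl := wave_le N0' dz; have [rl _] := hr N0' dz; have [_ c1b] := c1_ge.
have g0 : 0 <= gap z by exact: cabs_ge0.
apply: (@le_trans _ _ (K N ^+ 2 * (gap z + r N z))).
  have a1 : 1 * gap z <= K N * gap z by rewrite ler_wpM2r.
  have a2 : K N * (wave N z + r N z) <= K N * (gap z + 2 * r N z).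
    by rewrite ler_wpM2l ?(ltW K0) //; move: wl rl gm m0 g0; lra.
  have a3 : 5 * (K N * (gap z + r N z)) <= K N ^+ 2 * (gap z + r N z).
    rewrite expr2 -mulrA ler_wpM2r ?mulr_ge0 ?addr_ge0 ?(ltW K0) ?(ltW r0) //.
    by apply: le_trans K20; rewrite ler_nat.
  have a4 : 0 <= K N * r N z by rewrite mulr_ge0 // ltW.
  have a5 : 0 <= K N * gap z by rewrite mulr_ge0 // ltW.
  move: a1 a2 a3 a4 a5; rewrite !mulrDr; lra.
apply: ler_pM; rewrite ?exprn_ge0 ?addr_ge0 ?(ltW K0) ?(ltW r0) //.
  by rewrite KL ler_weXn2l.
by rewrite ler_peMl // addr_ge0 // ltW.
Qed.

Let KL_le N : 1 <= K N -> K N <= L N.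
Proof. by move=> K1; rewrite KL -[leLHS]expr1 ler_weXn2l. Qed.

Let havg : whp (C := C) (Cp := Cp) (I := fun=> CC) (fun N M z w => dom N z ->
  cabs (1 + z * avg z (mH w) + avg z (mH w) ^+ 2) <= L N ^+ 31 * (La N z * rho N z)).
Proof.
have [N0 hN0] := large.
have KK2 N : (N0 <= N)%N -> K N <= L N.
  by move=> n0; have [_ K20 _ _ _] := hN0 N n0; apply: KL_le; apply: le_trans K20; rewrite ler1n.
have hG2 : whp (C := C) (Cp := Cp) (I := fun N => (CC * ('cV[CC]_N * 'cV[CC]_N))%type)
  (fun N M i w => dom N i.1 -> nsq i.2.1 <= 1 -> nsq i.2.2 <= 1 ->
     cabs (Gq (mH w) i.1 i.2.1 i.2.2) <= L N).
  apply: (whp_mono (N1 := N0)) hG => N n0 M i w h dz h1 h2.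
  exact: le_trans (h dz h1 h2) (KK2 N n0).
have hIm2 : whp (C := C) (Cp := Cp) (I := fun N => (CC * 'cV[CC]_N)%type)
  (fun N M i w => dom N i.1 -> nsq i.2 <= 1 ->
     complex.Im (Gq (mH w) i.1 i.2 i.2) <= L N * Om N i.1).
  apply: (whp_mono (N1 := N0)) hIm => N n0 M i w h dz h1.
  apply: le_trans (h dz h1) _; rewrite ler_wpM2r ?KK2 //.
  have [N0' _ _ _ _] := hN0 N n0; have [[e0 _ _] [h2 _ _ _ _]] := step_facts N0' dz.
  by apply: le_trans h2; exact: ltW.
exact (avg_step C0 tau20 tau1 HV hG2 hIm2 HLa hdev).
Qed.

(** [root_path] with the trivial predicate P, since [havg] gives the product bound at every point of
    the path. At the top the height Mx makes u - m small against the gap. *)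
Let hroot : whp (C := C) (Cp := Cp) (I := fun=> CC) (fun N M z w => dom N z ->
  cabs (avg z (mH w) - msc z) <= L N ^+ 32 * Num.sqrt (r N z * rho N z)).
Proof.
have [N0 hN0] := large.
apply: (whp_mono (N1 := N0)) (whp_path om havg) => N n0 M z w h dz.
have [N0' K20 KC Kc hN] := hN0 N n0.
have K1 : 1 <= K N by apply: le_trans K20; rewrite ler1n.
have K0 : 0 < K N by exact: lt_le_trans K1.
have L1 : 1 <= L N by exact: le_trans (KL_le K1).
have L0 : 0 < L N by exact: lt_le_trans L1.
have Np : 0 < N%:R :> R by rewrite ltr0n.
have [c1a c1b] := c1_ge.
have hX := wigner_herm (mW M) w.
have [_ _ eM] := dz.
have [e0 eN _ _ _] := dom_facts om0 om1 N0' dz.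
have dp k : (k <= N ^ 6)%N -> dom N (path_pt Mx N z k) by move=> kn; apply: dom_path.
have pc k : (k <= N ^ 6)%N -> cabs (path_pt Mx N z k) <= c0.
  by move=> /dp/(dom_facts om0 om1 N0')[].
have c00 : 0 <= c0 by apply: le_trans c06; rewrite ler0n.
pose A := L N ^+ 31 * c1.
have A1 : 1 <= A by rewrite -[1]mulr1; apply: ler_pM => //; rewrite exprn_ege1.
have A0 : 0 < A by exact: lt_le_trans A1.
(* The bound of [havg] with gap and r displayed, as [root_bound] expects it. *)
pose del k := A * ((gap (path_pt Mx N z k) + r N (path_pt Mx N z k)) * rho N (path_pt Mx N z k)).
have delE k : del k = L N ^+ 31 * (La N (path_pt Mx N z k) * rho N (path_pt Mx N z k)).
  have aux (p c x y : R) : p * c * (x * y) = p * (c * x * y) by ring.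
  exact: aux.
(* Since del >= 1/N, a path step of N^(-3) stays below sqrt(del). *)
have delN k : (k <= N ^ 6)%N -> N%:R^-1 <= del k.
  move=> kn; have dk := dp k kn; have [_ [h1 h2 _ _ _]] := step_facts N0' dk.
  have [ek _ _ _ _] := dom_facts om0 om1 N0' dk.
  rewrite delE; apply: (@le_trans _ _ (La N (path_pt Mx N z k) * rho N (path_pt Mx N z k))).
    rewrite /rho invfM mulrCA -[leLHS]mulr1 ler_wpM2l ?invr_ge0 ?(ltW Np) //.
    by rewrite ler_pdivlMr // mul1r (le_trans h1).
  have [p0 _] := rho_facts N0' dk.
  rewrite ler_peMl ?exprn_ege1 //; apply: mulr_ge0; last exact: ltW.
  by apply: le_trans h2; apply: le_trans h1; exact: ltW.
pose x k := avg (path_pt Mx N z k) (mH w) - msc (path_pt Mx N z k).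
pose b k := 2 * msc (path_pt Mx N z k) + path_pt Mx N z k.
have h0 : forall k, (k <= N ^ 6)%N -> 0 <= del k.
  by move=> k kn; apply: le_trans (delN k kn); rewrite invr_ge0 ltW.
have h1 : forall k, (k <= N ^ 6)%N -> True -> cabs (x k * (x k + b k)) <= del k.
  move=> k kn _; have dk := dp k kn; have [ek _ _ _ _] := dom_facts om0 om1 N0' dk.
  by rewrite /x /b root_identity ?delE; [exact: h|exact: msc_quadratic].
have h3 : forall k, (k < N ^ 6)%N -> cabs (x k - x k.+1) <= N%:R ^- 3.
  by move=> k kn; apply: (path_x hX N0' hN c00 eN eM pc (ltnW kn)).
have h4 : forall k, (k < N ^ 6)%N -> N%:R ^- 3 <= Num.sqrt (del k).
  move=> k kn; rewrite -[leLHS]ger0_norm ?invr_ge0 ?exprn_ge0 ?(ltW Np) // -sqrtr_sqr ler_wsqrtr //.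
  apply: le_trans (delN k (ltnW kn)); rewrite exprVn -exprM lef_pV2 ?posrE ?exprn_gt0 //.
  by rewrite -{1}[N%:R]expr1 ler_weXn2l // ler1n.
have h5 : forall k, (k < N ^ 6)%N -> del k.+1 <= del k.
  move=> k kn; have dk := dp k (ltnW kn); have dk1 := dp k.+1 kn.
  have [ek _ _ _ _] := dom_facts om0 om1 N0' dk.
  have kk : complex.Im (path_pt Mx N z k) <= complex.Im (path_pt Mx N z k.+1) by exact: path_Im_le.
  have ek1 := lt_le_trans ek kk.
  (* Neither product increases with Im z: gap times rho by [gap_div_anti], and r times rho because
     both factors are nonincreasing. *)
  rewrite /del ler_pM2l // !mulrDl; apply: lerD.
    have := gap_div_anti ek kk (erefl _); rewrite /rho !invfM => hh.
    rewrite !mulrA [gap _ / _]mulrC [gap (path_pt Mx N z k) / _]mulrC -!mulrA ler_pM2l ?invr_gt0 //.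
    by rewrite ler_pdivrMr // mulrAC ler_pdivlMr.
  have [q1 _] := hr N0' dk1; have [p1 _] := rho_facts N0' dk1.
  apply: ler_pM; rewrite ?(ltW p1) //; [exact: le_trans (ltW p1) q1|exact: ra|exact: rho_anti].
have h6 : forall k, (k < N ^ 6)%N -> cabs (b k) <= cabs (b k.+1).
  by move=> k kn; exact: path_gap.
have h8 : cabs (x (N ^ 6)%N) * 2 <= cabs (b (N ^ 6)%N).
  have hg := gap_ge_Im (path_pt Mx N z (N ^ 6)); rewrite (path_end Mx z N0') in hg.
  have h2 := le_cabsB (path_end_avg hX N0' eN eM) (path_end_msc N0' eN eM).
  have [ek _ _ _ _] := dom_facts om0 om1 N0' (dp _ (leqnn _)).
  have mi0 := msc_Im_ge0 ek.
  apply: (@le_trans _ _ Mx); last first.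
    by apply: le_trans hg; rewrite lerDr mulr_ge0.
  have Mi : Mx^-1 <= 1 by rewrite invf_le1; move: Mx5; lra.
  by move: Mi h2 Mx5; lra.
have [_ rc] := root_path h0 h1 (fun _ _ _ _ => I) h3 h4 h5 h6 I h8 (leq0n _).
move: rc; rewrite /root_claim /x /b /del (path0 Mx N z) => -[b1 b2].
have [p0 _] := rho_facts N0' dz; have [rl _] := hr N0' dz.
apply: le_trans (root_bound (cabs_ge0 _) (cabs_ge0 _) A1 p0 rl b1 b2) _.
have aux (l c s : R) : 20 * (20 * (l * c * s)) = l * (20 * (20 * c)) * s by ring.
rewrite /A aux [L N ^+ 32]exprSr; apply: ler_wpM2r; first exact: sqrtr_ge0.
rewrite ler_pM2l ?exprn_gt0 // KL.
have c10 : 0 <= c1 by apply: le_trans c1b.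
apply: (@le_trans _ _ (K N * (K N * K N))).
  have q := ler_pM (ler0n R 20) c10 K20 Kc.
  exact: ler_pM (ler0n R 20) (mulr_ge0 (ler0n R 20) c10) K20 q.
by rewrite -expr2 -exprS ler_weXn2l.
Qed.

(** The square root in [Psi0] splits into [wave] and sqrt(r rho), and [hroot] contributes only the
    latter. So F is the old error with r replaced by sqrt(r rho). *)
Lemma strong_step : whp (C := C) (Cp := Cp) (I := fun N => (CC * ('cV[CC]_N * 'cV[CC]_N))%type)
  (fun N M i w => dom N i.1 -> nsq i.2.1 <= 1 -> nsq i.2.2 <= 1 ->
     cabs (Gq (mH w) i.1 i.2.1 i.2.2 - msc i.1 * cdot i.2.1 i.2.2) <= L N ^+ 35 * F N i.1).
Proof.
have [N0 hN0] := large.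
have F0 N z : 0 <= F N z by rewrite addr_ge0 ?sqrtr_ge0.
have lN N : (N0 <= N)%N -> [/\ (0 < N)%N, 1 <= K N, K N <= L N, 0 <= L N & c1 <= L N] /\ 2 <= L N.
  move=> n0; have [N0' K20 _ Kc _] := hN0 N n0.
  have K1 : 1 <= K N by apply: le_trans K20; rewrite ler1n.
  have KLN := KL_le K1; split; last by apply: le_trans KLN; apply: le_trans K20; rewrite ler_nat.
  by split=> //; exact: le_trans KLN.
have PF N z : (N0 <= N)%N -> dom N z -> Psi0 N z <= L N * F N z.
  move=> n0 dz; have [[N0' K1 KLN L0 Lc] _] := lN N n0.
  have [[e0 m0 r0] _] := step_facts N0' dz; have [p0 _] := rho_facts N0' dz.
  have [c1a c1b] := c1_ge; have c10 : 0 <= c1 by apply: le_trans c1b.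
  rewrite /Psi0 /Om -mulrA sqrtrM //; apply: ler_pM; rewrite ?sqrtr_ge0 //.
    apply: le_trans Lc; rewrite -[leRHS](ger0_norm c10) -sqrtr_sqr ler_wsqrtr //.
    by rewrite expr2 ler_peMl.
  by rewrite mulrDl; apply: sqrtrD_le; rewrite mulr_ge0 // ltW.
have two (l a b f : R) n : 2 <= l -> 0 <= f -> a <= l ^+ n * f -> b <= l ^+ n * f -> a + b <= l ^+ n.+1 * f.
  move=> l2 f0 h1 h2; apply: le_trans (lerD h1 h2) _.
  have l0 : 0 <= l by apply: le_trans l2.
  rewrite exprS -mulrA -mulr2n -[leLHS]mulr_natl; apply: ler_wpM2r => //.
  by rewrite mulr_ge0 ?exprn_ge0.
pose phi N z := L N ^+ 33 * F N z.
have phi0 N z : 0 <= phi N z by rewrite mulr_ge0 ?exprn_ge0 ?powR_ge0.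
have hphi : whp (C := C) (Cp := Cp) (I := fun=> CC) (fun N M z w => dom N z ->
     forall a, cabs (gdiag z (mH w) a - msc z) <= phi N z).
  apply: (whp_mono (N1 := N0)) (whp_and hdev hroot) => N n0 M z w [g1 g2] dz a.
  have [[N0' K1 KLN L0 Lc] L2] := lN N n0; have L1 := le_trans K1 KLN.
  have [d1 _] := g1 dz; have d2 := g2 dz.
  have e : gdiag z (mH w) a - msc z = (gdiag z (mH w) a - avg z (mH w)) + (avg z (mH w) - msc z).
    by rewrite addrA subrK.
  rewrite e; apply: le_trans (ler_cabsD _ _) _; apply: two => //.
    apply: le_trans (d1 a) _; apply: (@le_trans _ _ (L N ^+ 2 * F N z)).
      by rewrite expr2 -mulrA ler_wpM2l // PF.
    by rewrite ler_wpM2r // ler_weXn2l.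
  by apply: (le_trans d2); rewrite ler_wpM2l ?exprn_ge0 // lerDr sqrtr_ge0.
have hi := iso_step C0 tau0 tau11 HV hG hIm phi0 hphi.
apply: (whp_mono (N1 := N0)) hi => N n0 M i w h dz h1 h2.
have [[N0' K1 KLN L0 Lc] L2] := lN N n0; have L1 := le_trans K1 KLN.
apply: le_trans (h dz h1 h2) _; rewrite [L N ^+ 35]exprS -mulrA.
apply: ler_pM; rewrite ?exprn_ge0 ?addr_ge0 ?sqrtr_ge0 ?powR_ge0 //.
  by rewrite KL ler_weXn2l.
apply: two => //; apply: le_trans (PF N i.1 n0 dz) _.
by rewrite ler_wpM2r // -[leLHS]expr1 ler_weXn2l.
Qed.

End Step.

(** In closed form this is rho^(1 - 2^(-k)). *)
Fixpoint rate (k : nat) (N : nat) (z : CC) : R :=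
  if k is k'.+1 then Num.sqrt (rate k' N z * rho N z) else 1.

Lemma rate_bounds k N z : (0 < N)%N -> dom N z -> rho N z <= rate k N z /\ rate k N z <= 1.
Proof.
move=> N0 dz; have [p0 p1] := rho_facts N0 dz.
elim: k => [//|k [h1 h2]] /=.
have k0 : 0 <= rate k N z by apply: le_trans h1; exact: ltW.
have kr : 0 <= rate k N z * rho N z by rewrite mulr_ge0 // ltW.
split.
  rewrite -(@ler_pXn2r _ 2) ?nnegrE ?sqrtr_ge0 ?(ltW p0) // sqr_sqrtr // expr2.
  by rewrite ler_wpM2r // ltW.
by rewrite -sqrtr1 ler_wsqrtr // -[1]mulr1; apply: ler_pM => //; exact: ltW.
Qed.

Lemma rate_anti k N z z' : (0 < N)%N -> dom N z -> dom N z' -> complex.Re z = complex.Re z' ->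
  complex.Im z <= complex.Im z' -> rate k N z' <= rate k N z.
Proof.
move=> N0 dz dz' _ ee; elim: k => [//|k IH] /=; rewrite ler_wsqrtr //.
have [e0 _ _ _ _] := dom_facts om0 om1 N0 dz.
have [p0 _] := rho_facts N0 dz'; have [h1 _] := rate_bounds k N0 dz'.
apply: ler_pM; rewrite ?(ltW p0) //; [exact: le_trans (ltW p0) h1|exact: rho_anti].
Qed.

(** The initial rate 1 is at most rho N^2 because Im z <= Mx <= N, and each square root halves the
    excess exponent. *)
Lemma rate_le k N z : (0 < N)%N -> dom N z -> Mx <= N%:R -> rate k N z <= rho N z * N%:R `^ (2 / 2 ^+ k).
Proof.
move=> N0 dz MN; have [p0 p1] := rho_facts N0 dz.
have [e0 _ _ _ _] := dom_facts om0 om1 N0 dz; have [_ _ d3] := dz.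
have Np : 0 < N%:R :> R by rewrite ltr0n.
elim: k => [|k IH] /=.
  rewrite expr0 divr1 powR_mulrn ?ler0n // /rho mulrC ler_pdivlMr ?mulr_gt0 // mul1r expr2.
  by rewrite ler_pM2l // (le_trans d3).
have h0 : 0 <= rho N z * N%:R `^ (2 / 2 ^+ k.+1) by rewrite mulr_ge0 ?powR_ge0 // ltW.
rewrite -[leRHS](ger0_norm h0) -sqrtr_sqr ler_wsqrtr // exprMn powR_natX.
have -> : 2 / 2 ^+ k.+1 * 2%:R = 2 / 2 ^+ k :> R by rewrite exprSr; field; rewrite expf_neq0.
by rewrite expr2 mulrC -mulrA ler_wpM2l // ltW.
Qed.

Lemma isolaw_rate k : isolaw (rate k).
Proof.
elim: k => [|k IH] t t0.
  have [_ hb] := weak_law (Cp := Cp) C0 om0 om1.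
  apply: (whp_mono (N1 := 1)) hb => N N1 M i w h dz h1 h2.
  have wp : 0 < wexp om by rewrite divr_gt0.
  apply: le_trans (h dz h1 h2) _; apply: (@le_trans _ _ 1).
    by rewrite invf_le1 ?exprn_gt0 ?powR_gt0 ?ltr0n // exprn_ege1 // powR_nat_ge // ltW.
  rewrite -[leLHS]mulr1; apply: ler_pM => //=; first by rewrite powR_nat_ge // ltW.
  by rewrite lerDr sqrtr_ge0.
(* 33 is the exponent of K in L and 35 that of L in [strong_step], so the total loss is at most N^t;
   the second argument meets the bound on tau required there. *)
pose tau := Num.min (t / 35%:R / 33%:R) (10^-1 / 33%:R).
have tau0 : 0 < tau by rewrite lt_min !divr_gt0.
have tau1 : tau * 33%:R <= 10^-1 by rewrite -ler_pdivlMr // ge_min lexx orbT.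
have tau2 : tau * 33%:R * 35%:R <= t by rewrite -!ler_pdivlMr // ge_min lexx.
have := strong_step (rate_bounds k) (rate_anti k) IH tau0 tau1.
apply: (whp_mono (N1 := 1)) => N N1 M i w h dz h1 h2.
apply: le_trans (h dz h1 h2) _; apply: ler_wpM2r; first by rewrite addr_ge0 ?sqrtr_ge0.
by rewrite powR_natX ler_powR // ler1n.
Qed.

Theorem local_law (eps : R) : 0 < eps ->
  whp (C := C) (Cp := Cp) (I := fun N => (CC * ('cV[CC]_N * 'cV[CC]_N))%type)
  (fun N M i w => dom N i.1 -> nsq i.2.1 <= 1 -> nsq i.2.2 <= 1 ->
     cabs (Gq (mH w) i.1 i.2.1 i.2.2 - msc i.1 * cdot i.2.1 i.2.2) <= N%:R `^ eps * (wave N i.1 + rho N i.1)).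
Proof.
move=> eps0; have e2 : 0 < eps / 2 by rewrite divr_gt0.
(* From 2^k >= k >= 4 / eps the excess exponent 2 / 2^k is at most eps / 2. *)
have [k hk] := exists_nat_ge (2 / (eps / 2)).
have [N1 hN1] := powR_ge_const Mx (@ltr01 R).
apply: (whp_mono (N1 := maxn N1 1)) (isolaw_rate k e2) => N.
rewrite geq_max => /andP[n1 N0] M i w h dz h1 h2.
have MN := hN1 N n1; rewrite powRr1 ?ler0n // in MN.
apply: le_trans (h dz h1 h2) _.
have -> : N%:R `^ eps = N%:R `^ (eps / 2) * N%:R `^ (eps / 2) :> R.
  by rewrite -powRD -?splitr // pnatr_eq0 -lt0n N0 implybT.
rewrite -mulrA ler_wpM2l ?powR_ge0 // mulrDr.
have P1 : 1 <= N%:R `^ (eps / 2) by rewrite powR_nat_ge // ltW.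
apply: lerD; first by rewrite ler_peMl // sqrtr_ge0.
apply: le_trans (rate_le k N0 dz MN) _; rewrite mulrC ler_wpM2r //.
  by have [p0 _] := rho_facts N0 dz; exact: ltW.
rewrite ler_powR ?ler1n // ler_pdivrMr ?exprn_gt0 // mulrC -ler_pdivrMr //.
apply: (le_trans hk); rewrite -natrX ler_nat; exact: ltnW (ltn_expl _ _).
Qed.

End StrongLaw.

Theorem mainTheorem14 (R : realType) (omega C : R) (Cp : nat -> R) :
  0 < omega < 1 -> 0 < C ->
  forall eps D : R, 0 < eps -> 0 < D ->
  exists N0 : nat, forall N : nat, (N0 <= N)%N ->
  forall (d : measure_display) (T : measurableType d) (P : probability T R)
         (H : T -> 'M[R[i]]_N),
  wigner_type C Cp P H ->
  forall (z : R[i]) (v w : 'cV[R[i]]_N),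
  in_SW omega N z -> unit_vector v -> unit_vector w ->
  (P [set x | (N%:R `^ eps * Psi N z <
             cabs (cdot v (green (H x) z *m w) - cdot v w * msc z))%R]
  <= ((N%:R) `^ (- D))%:E)%E.
Proof.
move=> /andP[om0 om1] C0 eps D eps0 D0.
have [k hk] := exists_nat_ge D.
have [N0 hN0] := local_law (Cp := Cp) C0 om0 om1 eps0 k.
exists (maxn N0 1) => N; rewrite geq_max => /andP[n0 n1] d T P H hW z v w [z1 [z2 z3]] hv hw.
have [B [mB PB gB]] := hN0 N n0 (Model hW) (z, (v, w)).
(* The range of z in the claim lies in [dom], whose top Mx is at least 1 / omega. *)
have dz : @dom R C omega N z.
  have h : 0 <= 32 * C + 4 by rewrite addr_ge0 // mulr_ge0 // ltW.
  by split=> //; apply: (le_trans z3); rewrite /Mx -addrA lerDl.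
have e0 : 0 < complex.Im z by have [] := dom_facts om0 om1 n1 dz.
set A := [set x | _].
(* [hp] provides only a measurable set B containing the failure; measurability of the failure set
   itself allows its probability to be compared with that of B. *)
have mA : measurable A.
  have mf : measurable_fun setT (fun x => cabs (Gq (H x) z v w - cdot v w * msc z)).
    apply: measurable_cabs; apply: (mxmeasH hW (phi := fun X => Gq X z v w - cdot v w * msc z)).
    by apply: mxmeasB; [apply: mxmeas_Gq; rewrite gt_eqF|exact: mxmeas_cst].
  have := mf measurableT `]N%:R `^ eps * Psi N z, +oo[%classic (measurable_itv _).
  rewrite setTI; congr measurable; apply/seteqP; split => x /=; rewrite in_itv /= andbT GqE //.
have AB : A `<=` B.
  move=> x hx; rewrite /A /= -GqE in hx; apply: contrapT => nB.
  have := gB x nB dz; rewrite /= /nsq hv hw => /(_ (lexx _) (lexx _)).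
  by rewrite leNgt [_ * msc z]mulrC in hx *; rewrite hx.
apply: (@le_trans _ _ (P B)); first by apply: le_measure; rewrite ?inE.
have fB : P B \is a fin_num by exact: fin_num_measure.
rewrite -(fineK fB) lee_fin; apply: (le_trans PB).
rewrite -powR_mulrn ?ler0n // -powRN ler_powR ?ler1n // lerN2 //.
Qed.
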